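(* Write $$Q_{N,T}=\left[\frac{\lambda_{N,T}}{2\sqrt{NT}}\vee\frac{\mu_{N,T}}{2\sqrt T}\right]+\left[\frac{2\lambda_{N,T}}{\sqrt{NT}\beta_{\min}}\vee\frac{2\mu_{N,T}}{\sqrt Tc_{\min}}\right],$$ and consider the inequalities $$(\mathrm{i})\ \frac{2\sqrt{|J|}}{\phi_{\min}(\Gamma_{J,J})}Q_{N,T}\le\sqrt{NT}\beta_{\min},\qquad(\mathrm{ii})\ \frac{2|J|K_{1,N,T}}{\phi_{\min}(\Gamma_{J,J})}Q_{N,T}+\frac{\lambda_{N,T}}2\le\frac{\lambda_{N,T}}{\|\hat\beta-\beta^*\|},$$ $$(\mathrm{iii})\ \frac{2\sqrt{|J|}}{\phi_{\min}(\Gamma_{J,J})}Q_{N,T}\le\sqrt{T}c_{\min},\qquad(\mathrm{iv})\ \frac{2|J|K_{2,N,T}}{\phi_{\min}(\Gamma_{J,J})}Q_{N,T}+\frac{\mu_{N,T}}2\le\frac{\mu_{N,T}}{\|\hat c-c^*\|}.$$ (1) Let (A1) and (A2a) be satisfied, let $a_{N,T}$ be a positive sequence, $\lambda_{N,T}=4a_{N,T}p^{1/r}(NT)^{1/2}\max_{1\le t\le T}\|\epsilon_{1,t}\|_{L_r}$, $\mu_{N,T}=4a_{N,T}N^{1/r}T^{1/2}\max_{1\le t\le T}\|\epsilon_{1,t}\|_{L_r}$ and $\xi_{N,T}=32a_{N,T}\max_{1\le t\le T}\|\epsilon_{1,t}\|_{L_r}(p^{1/r}\sqrt{s_1}+N^{1/r}\sqrt{s_2})/\kappa^2$.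 Assume $\beta_{\min}\ge2\xi_{N,T}/\sqrt{NT}$ and $c_{\min}\ge2\xi_{N,T}/\sqrt T$. There are constants $C_r,D_r$ depending only on $r$ such that, if (i)-(ii) are valid with $K_{1,N,T}=|J_1^c|^{2/r}|J_1|^{2/r}(NT)^{1/2}a_{N,T}$, then $\mathrm{sign}(\tilde\beta)=\mathrm{sign}(\beta^* )$ with probability at least $$1-2\left(\frac{C_r}{a_{N,T}}\right)^r-D_r\frac{(p^2+Np)(s_1+s_2)^{r/2}\left(\frac pN\vee\frac Np\right)}{\kappa^rN^{r/4}}-\frac2{a_{N,T}^{r/2}}.$$ Similarly, if (iii)-(iv) are valid with $K_{2,N,T}=|J_1|^{1/r}|J_2^c|^{1/r}T^{1/2}a_{N,T}$, then $\mathrm{sign}(\tilde c)=\mathrm{sign}(c^* )$ with probability at least $$1-2\left(\frac{C_r}{a_{N,T}}\right)^r-D_r\frac{(p^2+Np)(s_1+s_2)^{r/2}\left(\frac pN\vee\frac Np\right)}{\kappa^rN^{r/4}}-\frac1{a_{N,T}^{r/2}}.$$ (2) Let (A1) and (A2b) be satisfied, let $a_{N,T}\ge e$, $\lambda_{N,T}=\sqrt{4NT\log(p)^3\log(a_{N,T})^3}$, $\mu_{N,T}=\sqrt{4T\log(N)^3\log(a_{N,T})^3}$ and $\xi_{N,T}=16\log(a_{N,T})^{3/2}[\log(p)^{3/2}\sqrt{s_1}+\log(N)^{3/2}\sqrt{s_2}]/\kappa^2$. Assume $\beta_{\min}\ge2\xi_{N,T}/\sqrt{NT}$ and $c_{\min}\ge2\xi_{N,T}/\sqrt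 T$. Let $t=\kappa^2/\left[(s_1+s_2)\left(\frac{\log p}{\log N}\vee\frac{\log N}{\log p}\right)^3\right]$ and $Nt^2\ge1$. There are absolute constants $A,B>0$ such that, if (i)-(ii) are valid with $K_{1,N,T}=A\log(1+|J_1^c|)\log(e+|J_1|)\sqrt{NT}\log(a_{N,T})$, then $\mathrm{sign}(\tilde\beta)=\mathrm{sign}(\beta^* )$ with probability at least $$1-Ap^{1-B\log(a_{N,T})}-AN^{1-B\log(a_{N,T})}-A(p^2+Np)e^{-B(t^2N)^{1/3}}-\frac4{a_{N,T}}.$$ Similarly, if (iii)-(iv) are valid with $K_{2,N,T}=A\log(1+|J_1|)\log(1+|J_2^c|)\sqrt T\log(a_{N,T})$, then $\mathrm{sign}(\tilde c)=\mathrm{sign}(c^* )$ with probability at least $$1-Ap^{1-B\log(a_{N,T})}-AN^{1-B\log(a_{N,T})}-A(p^2+Np)e^{-B(t^2N)^{1/3}}-\frac2{a_{N,T}}.$$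
   Context: Model: for $i=1,\dots,N$, $t=1,\dots,T$, $y_{i,t}=x_{i,t}'\beta^*+c_i^*+\epsilon_{i,t}$ with random covariates $x_{i,t}=(x_{i,t,1},\dots,x_{i,t,p})'\in\mathbb{R}^p$, unknown deterministic $\beta^*\in\mathbb{R}^p$, $c^*\in\mathbb{R}^N$ and random errors $\epsilon_{i,t}$; in part (2) $p,N\ge e$. Put $X_i=(x_{i,1},\dots,x_{i,T})'$, $X=(X_1',\dots,X_N')'$, $\epsilon_i=(\epsilon_{i,1},\dots,\epsilon_{i,T})'$, $y$ the stacked vector of the $y_{i,t}$, $D=I_N\otimes\iota$ with $\iota$ the $T\times1$ vector of ones. Let $J_1=\{j:\beta_j^*\ne0\}\subseteq\{1,\dots,p\}$, $J_2=\{i:c_i^*\neq0\}\subseteq\{1,\dots,N\}$, $s_1=|J_1|$, $s_2=|J_2|$, $J=J_1\cup(J_2+p)\subseteq\{1,\dots,p+N\}$, $\beta_{\min}=\min\{|\beta_j^*|:j\in J_1\}$, $c_{\min}=\min\{|c_j^*|:j\in J_2\}$; complements are within $\{1,\dots,p\}$, $\{1,\dots,N\}$ respectively. $\|\cdot\|,\|\cdot\|_{\ell_1}$ are the $\ell_2$-, $\ell_1$-norms; $\|U\|_{L_r}=(E|U|^r)^{1/r}$; $a\vee b=\max(a,b)$; $\log$ is natural; $\phi_{\min}$ is the smallest eigenvalue; $M_{J,J}$ is the submatrix with rows and columns in $J$; $v_A$ is the subvector indexed by $A$; $\mathrm{sign}$ acts componentwise. A fraction with zero denominator is $\infty$. First-step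 Lasso: $(\hat\beta,\hat c)$ minimizes $\|y-X\beta-Dc\|^2+2\lambda_{N,T}\|\beta\|_{\ell_1}+2\mu_{N,T}\|c\|_{\ell_1}$. Adaptive Lasso: with $J_1(\hat\beta)=\{j:\hat\beta_j\neq0\}$, $J_2(\hat c)=\{i:\hat c_i\ne0\}$, $(\tilde\beta,\tilde c)$ minimizes $\sum_{i=1}^N\sum_{t=1}^T(y_{i,t}-x_{i,t}'\beta-c_i)^2+2\lambda_{N,T}\sum_{k\in J_1(\hat\beta)}|\beta_k|/|\hat\beta_k|+2\mu_{N,T}\sum_{i\in J_2(\hat c)}|c_i|/|\hat c_i|$ subject to $\beta_k=0$ for $k\notin J_1(\hat\beta)$ and $c_i=0$ for $i\notin J_2(\hat c)$. Let $\Gamma=\mathrm{diag}(E(X'X/(NT)),I_N)$ (block diagonal) and let $\kappa^2$ (with $\kappa=\sqrt{\kappa^2}$) be the minimum of $\delta'\Gamma\delta/\|\delta\|^2$ over all $\delta=({\delta^1}',{\delta^2}')'\in\mathbb{R}^{p+N}\setminus\{0\}$ ($\delta^1\in\mathbb{R}^p$, $\delta^2\in\mathbb{R}^N$) and all $R_1\subseteq\{1,\dots,p\}$, $R_2\subseteq\{1,\dots,N\}$ with $|R_1|\le s_1$, $|R_2|\le s_2$ and $\frac{\lambda_{N,T}}{\sqrt{NT}}\|\delta^1_{R_1^c}\|_{\ell_1}+\frac{\mu_{N,T}}{\sqrt T}\|\delta^2_{R_2^c}\|_{\ell_1}\le 3\frac{\lambda_{N,T}}{\sqrt{NT}}\|\delta^1_{R_1}\|_{\ell_1}+3\frac{\mu_{N,T}}{\sqrt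 T}\|\delta^2_{R_2}\|_{\ell_1}$; $\kappa^2>0$. (A1): (a) $\{(X_i,\epsilon_i)\}_{i=1}^N$ are independent and identically distributed; (b) $X_i$ and $\epsilon_i$ are independent for each $i$; (c) for each $i$, $\{\epsilon_{i,t},\mathcal{F}_{i,t}\}_{t=1}^T$ with $\mathcal{F}_{i,t}=\sigma(\epsilon_{i,1},\dots,\epsilon_{i,t})$ is a martingale difference sequence ($E(\epsilon_{i,t}\mid\mathcal{F}_{i,t-1})=0$, $\mathcal F_{i,0}$ trivial). (A2a): for some $r\ge2$, $E|x_{1,t,k}|^r<\infty$ and $E|\epsilon_{1,t}|^r<\infty$ for all $t,k$, with $\max_{1\le t\le T}E|x_{1,t,k}|^r\le1$ for all $k=1,\dots,p$. (A2b): there are constants $C,K>0$ with $P(|x_{1,t,k}|\ge u)\le\frac12Ke^{-Cu^2}$ and $P(|\epsilon_{1,t}|\ge u)\le\frac12Ke^{-Cu^2}$ for all $u>0$, $1\le t\le T$, $1\le k\le p$. The constants $C,K$ are regarded as fixed; ''absolute constants'' may depend on $C,K$ but on nothing else.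
   Formalization: In part (1) the tuning parameters are additionally assumed positive, λ_{N,T}>0 and μ_{N,T}>0, i.e. the errors ε_{1,t} are not all almost surely zero; with zero errors there is no penalty, minimizers need not be unique, and the claim fails. *)

(* Defs.v *)
(* Indices are 0-based: 'I_N, 'I_T, 'I_p stand for {1..N}, {1..T}, {1..p}.    *)
(* Quantities that can degenerate (a minimum over an empty set, a fraction    *)
(* with zero denominator) live in \bar R, with min of the empty set = +oo.    *)
From HB Require Import structures.
From mathcomp Require Export all_boot all_order all_algebra.
From mathcomp Require Export all_classical all_reals all_analysis.

Set Implicit Arguments.
Unset Strict Implicit.
Unset Printing Implicit Defensive.

Export Order.TTheory GRing.Theory Num.Theory.
Export numFieldNormedType.Exports.

Local Open Scope classical_set_scope.
Local Open Scope ring_scope.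

Section Algebra.
Context {R : realType}.

(* The norm `|_| of the library on matrices is the sup norm. *)
Definition l2norm n (v : 'cV[R]_n) : R := Num.sqrt (\sum_i v i 0 ^+ 2).

Definition l1norm_on n (A : {set 'I_n}) (v : 'cV[R]_n) : R :=
  \sum_(i in A) `|v i 0|.

Definition l1norm n (v : 'cV[R]_n) : R := l1norm_on [set: 'I_n]%SET v.

Definition sgnv n (v : 'cV[R]_n) : 'cV[R]_n := map_mx Num.sg v.

Definition supp n (v : 'cV[R]_n) : {set 'I_n} := [set i | v i 0 != 0]%SET.

Definition absmin n (v : 'cV[R]_n) : \bar R :=
  \big[Order.min/+oo%E]_(i in supp v) (`|v i 0|)%:E.

(* Fraction with the convention x / 0 = +oo, for x = 0 as well. *)
Definition efrac (x y : \bar R) : \bar R :=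
  (if y == 0 then +oo else x / y)%E.

Definition phi_min n (M : 'M[R]_n) : \bar R :=
  ereal_inf [set z%:E | z in [set z : R | eigenvalue M z]].

Definition principal_submx n (M : 'M[R]_n) (A : {set 'I_n}) : 'M[R]_#|A| :=
  mxsub (@enum_val _ (mem A)) (@enum_val _ (mem A)) M.

Definition joint_supp p N (b : 'cV[R]_p) (c : 'cV[R]_N) : {set 'I_(p + N)} :=
  (lshift N @: supp b :|: @rshift p N @: supp c)%SET.

End Algebra.

Section Probability.
Context {d : measure_display} {Omega : measurableType d} {R : realType}.
Variable P : probability Omega R.

Definition rvec n (U : 'I_n -> {RV P >-> R}) (w : Omega) : 'cV[R]_n :=
  \col_i U i w.

Definition mutually_independent d' (E : measurableType d') (I : finType)
    (V : I -> Omega -> E) : Prop :=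
  forall (S : {set I}) (B : I -> set E), (forall i, measurable (B i)) ->
    P (\bigcap_(i in [set` S]) (V i @^-1` B i)) =
    (\prod_(i in S) P (V i @^-1` B i))%E.

Definition identically_distributed d' (E : measurableType d') (I : Type)
    (V : I -> Omega -> E) : Prop :=
  forall (i j : I) (B : set E), measurable B ->
    P (V i @^-1` B) = P (V j @^-1` B).

Definition independent2 d1 d2 (E1 : measurableType d1) (E2 : measurableType d2)
    (U : Omega -> E1) (V : Omega -> E2) : Prop :=
  forall (A : set E1) (B : set E2), measurable A -> measurable B ->
    P (U @^-1` A `&` V @^-1` B) = (P (U @^-1` A) * P (V @^-1` B))%E.

(* Y is a version of E(X | F). *)
Definition is_cond_exp (F : set (set Omega)) (X Y : Omega -> R) : Prop :=
  [/\ P.-integrable setT (EFin \o Y),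
      forall B : set R, measurable B -> F (Y @^-1` B)
    & forall A, F A ->
        (\int[P]_(w in A) (Y w)%:E = \int[P]_(w in A) (X w)%:E)%E].

(* sigma(e_1, ..., e_m); trivial for m = 0. *)
Definition sigma_first T (e : 'I_T -> {RV P >-> R}) (m : nat)
    : set (set Omega) :=
  <<s \bigcup_(s in [set s : 'I_T | (s < m)%N])
        preimage_set_system setT (e s) measurable >>.

(* For the 0-based index t, F_(t-1) is generated by the t errors before t. *)
Definition martingale_difference T (e : 'I_T -> {RV P >-> R}) : Prop :=
  forall t : 'I_T, P.-integrable setT (EFin \o e t) /\
    is_cond_exp (sigma_first e t) (e t) (cst 0).

Definition Lr_norm (r : R) (U : Omega -> R) : R :=
  fine (Lnorm P r%:E (EFin \o U)).

End Probability.

Section Panel.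
Context {d : measure_display} {Omega : measurableType d} {R : realType}.
Variable P : probability Omega R.
Variables N T p : nat.
Implicit Types (x : 'I_N -> 'I_T -> 'I_p -> {RV P >-> R})
  (eps : 'I_N -> 'I_T -> {RV P >-> R}) (b : 'cV[R]_p) (c : 'cV[R]_N).

Definition response x eps b c (i : 'I_N) (t : 'I_T) (w : Omega) : R :=
  ((rvec (x i t) w)^T *m b) 0 0 + c i 0 + eps i t w.

Definition Xblock x (i : 'I_N) (w : Omega) : 'M[R]_(T, p) :=
  \matrix_(t, k) x i t k w.

Definition Xstack x (w : Omega) : 'M[R]_(\sum_(i < N) T, p) :=
  \mxcol_(i < N) Xblock x i w.

Definition ystack (y : 'I_N -> 'I_T -> Omega -> R) (w : Omega)
    : 'cV[R]_(\sum_(i < N) T) :=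
  \mxcol_(i < N) \col_t y i t w.

(* The Kronecker product of I_N and iota: its i-th block of T rows is
   iota *m e_i^T. *)
Definition dummies : 'M[R]_(\sum_(i < N) T, N) :=
  \mxcol_(i < N) ((const_mx 1 : 'cV[R]_T) *m delta_mx 0 i).

Definition lasso_objective (y : 'cV[R]_(\sum_(i < N) T))
    (X : 'M[R]_(\sum_(i < N) T, p)) (lam mu : R) b c : R :=
  l2norm (y - X *m b - dummies *m c) ^+ 2
    + 2 * lam * l1norm b + 2 * mu * l1norm c.

Definition is_lasso (y : 'I_N -> 'I_T -> Omega -> R) x (lam mu : R)
    (bhat : 'I_p -> {RV P >-> R}) (chat : 'I_N -> {RV P >-> R}) : Prop :=
  forall w b c,
    lasso_objective (ystack y w) (Xstack x w) lam mu (rvec bhat w) (rvec chat w)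
    <= lasso_objective (ystack y w) (Xstack x w) lam mu b c.

Definition adaptive_objective (y : 'I_N -> 'I_T -> R)
    (x : 'I_N -> 'I_T -> 'cV[R]_p) (lam mu : R) (bhat : 'cV[R]_p)
    (chat : 'cV[R]_N) b c : R :=
  \sum_i \sum_t (y i t - ((x i t)^T *m b) 0 0 - c i 0) ^+ 2
    + 2 * lam * (\sum_(k in supp bhat) `|b k 0| / `|bhat k 0|)
    + 2 * mu * (\sum_(i in supp chat) `|c i 0| / `|chat i 0|).

Definition adaptive_feasible (bhat : 'cV[R]_p) (chat : 'cV[R]_N) b c : Prop :=
  (forall k, k \notin supp bhat -> b k 0 = 0) /\
  (forall i, i \notin supp chat -> c i 0 = 0).

Definition is_adaptive_lasso (y : 'I_N -> 'I_T -> Omega -> R) x (lam mu : R)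
    (bhat : 'I_p -> {RV P >-> R}) (chat : 'I_N -> {RV P >-> R})
    (btil : 'I_p -> {RV P >-> R}) (ctil : 'I_N -> {RV P >-> R}) : Prop :=
  forall w,
    let obj := adaptive_objective (fun i t => y i t w)
      (fun i t => rvec (x i t) w) lam mu (rvec bhat w) (rvec chat w) in
    let feasible := adaptive_feasible (rvec bhat w) (rvec chat w) in
    feasible (rvec btil w) (rvec ctil w) /\
    forall b c, feasible b c -> obj (rvec btil w) (rvec ctil w) <= obj b c.

Definition Gamma x : 'M[R]_(p + N) :=
  block_mx
    (\matrix_(j, k) fine
       ('E_P[fun w => (((Xstack x w)^T *m Xstack x w) j k / (N * T)%:R)%R])%E)
    0 0 1%:M.

Definition kappa_cone (lam mu : R) (R1 : {set 'I_p}) (R2 : {set 'I_N})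
    (delta : 'cV[R]_(p + N)) : Prop :=
  let d1 := usubmx delta in
  let d2 := dsubmx delta in
  let l := lam / Num.sqrt (N * T)%:R in
  let m := mu / Num.sqrt T%:R in
  l * l1norm_on (~: R1)%SET d1 + m * l1norm_on (~: R2)%SET d2
    <= 3 * l * l1norm_on R1 d1 + 3 * m * l1norm_on R2 d2.

(* The minimum (attained, unless no delta is admissible) as an infimum. *)
Definition kappa2 x (lam mu : R) (s1 s2 : nat) : \bar R :=
  ereal_inf [set z : \bar R |
    exists (delta : 'cV[R]_(p + N)) (R1 : {set 'I_p}) (R2 : {set 'I_N}),
      [/\ delta != 0, (#|R1| <= s1)%N, (#|R2| <= s2)%N,
          kappa_cone lam mu R1 R2 delta
        & z = ((delta^T *m Gamma x *m delta) 0 0 / l2norm delta ^+ 2)%:E]].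

(* X_i and eps_i as random elements of (R^p)^T and R^T. *)
Definition covariates_unit x (i : 'I_N) (w : Omega) : T.-tuple (p.-tuple R) :=
  [tuple [tuple x i t k w | k < p] | t < T].

Definition errors_unit eps (i : 'I_N) (w : Omega) : T.-tuple R :=
  [tuple eps i t w | t < T].

Definition data_unit x eps (i : 'I_N) (w : Omega)
    : (T.-tuple (p.-tuple R) * T.-tuple R)%type :=
  (covariates_unit x i w, errors_unit eps i w).

Definition A1 x eps : Prop :=
  [/\ mutually_independent P (data_unit x eps),
      identically_distributed P (data_unit x eps),
      forall i, independent2 P (covariates_unit x i) (errors_unit eps i)
    & forall i, martingale_difference (eps i)].

Definition A2a (r : R) x eps (i1 : 'I_N) : Prop :=
  [/\ forall t k, ('E_P[fun w => (`|x i1 t k w| `^ r)%R] < +oo)%E,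
      forall t, ('E_P[fun w => (`|eps i1 t w| `^ r)%R] < +oo)%E
    & forall t k, ('E_P[fun w => (`|x i1 t k w| `^ r)%R] <= 1)%E].

Definition A2b (C K : R) x eps (i1 : 'I_N) : Prop :=
  forall u : R, 0 < u ->
    (forall t k, P [set w | (u <= `|x i1 t k w|)%R]
                   <= (2^-1 * K * expR (- (C * u ^+ 2)))%R%:E)%E /\
    (forall t, P [set w | (u <= `|eps i1 t w|)%R]
                   <= (2^-1 * K * expR (- (C * u ^+ 2)))%R%:E)%E.

Definition max_Lr_norm (r : R) (e : 'I_T -> {RV P >-> R}) : R :=
  \big[Num.max/0]_(t < T) Lr_norm P r (e t).

Definition Qterm (lam mu : R) b c : \bar R :=
  (Order.max ((lam / (2 * Num.sqrt (N * T)%:R))%R%:E)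
             ((mu / (2 * Num.sqrt T%:R))%R%:E)
   + Order.max
       (efrac (2 * lam)%R%:E ((Num.sqrt (N * T)%:R)%:E * absmin b))
       (efrac (2 * mu)%R%:E ((Num.sqrt T%:R)%:E * absmin c)))%E.

Definition phi_min_J x b c : \bar R :=
  phi_min (principal_submx (Gamma x) (joint_supp b c)).

(* Inequalities (i) and (iii): [scale] is sqrt(NT), resp. sqrt T, and [vmin]
   is beta_min, resp. c_min. *)
Definition minimal_signal x (lam mu : R) b c (scale : R) (vmin : \bar R)
    : Prop :=
  (efrac (2 * Num.sqrt #|joint_supp b c|%:R)%R%:E (phi_min_J x b c)
     * Qterm lam mu b c <= scale%:E * vmin)%E.

(* Inequalities (ii) and (iv), at one outcome: [tuning] is lambda, resp. mu,
   and [err] is the l2 error of the first-step estimator of beta*, resp. c*. *)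
Definition correlation_bound x (lam mu : R) b c (K tuning err : R) : Prop :=
  (efrac (2 * #|joint_supp b c|%:R * K)%R%:E (phi_min_J x b c)
     * Qterm lam mu b c + (tuning / 2)%R%:E
   <= efrac tuning%:E err%:E)%E.

End Panel.

(* Main.v *)
Require Import Defs.
From mathcomp Require Import ring lra measurable_realfun.
Set Implicit Arguments.
Unset Strict Implicit.
Unset Printing Implicit Defensive.
Local Open Scope classical_set_scope.
Local Open Scope ring_scope.

(** Multiply an error in beta by sqrt(NT) and an error in c by sqrt T.  In these
    coordinates both estimation steps are the same kind of problem: penalised least
    squares in the scaled error h, with design columns x_k / sqrt(NT) and
    dummy / sqrt T.  The Gram matrix Psi of these columns has mean Gamma, and the
    first-step penalty weights are L = lambda / sqrt(NT) and M = mu / sqrt T.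

    The randomness enters through one event: every score (column times error) is at
    most 1/16 of its penalty weight, and every entry of Psi is within tau of Gamma,
    where tau |J| rho^2 = kappa^2 / 200 and rho bounds the ratio of the two weights.
    On this event everything is deterministic.
    - First step ([first_step_l2], [first_step_coordinate]).  The error lies in the
      cone that defines kappa, where tau |h|_1^2 is a small fraction of
      kappa^2 |h|^2, so Psi inherits the compatibility of Gamma and |h| <= xi / 3.
      Hence each active coefficient is estimated with relative error at most 1/6.
      The dummy columns are orthonormal and almost orthogonal to the covariates, so
      the optimality condition of a single dummy coordinate shows that chat has no false positive
      and that |h_i| >= M/2 where chat_i is nonzero.
    - Second step.  The new weights are at most 6/5 omega / min on J, and at least
      L / |betahat - beta*| at a false positive, which is always a covariate.
    - Sign of beta ([sign_beta]).  The correlation inequality makes the weight of a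
      false positive exceed what it can gain through its correlation, at most
      K1 / sqrt(NT), with the error on J.  Shrinking the minimiser towards the truth
      stays in the sublevel set by convexity, so the error on J can be taken small
      enough for this comparison.  False positives therefore vanish, and the
      error is below 2 sqrt|J| Q / phi, which the signal inequality compares with
      beta_min.
    - Sign of c ([sign_dummy]).  The error is again in the cone, tau |h|_1 <= Q / 30,
      and the optimality condition of one dummy coordinate gives |h_i| < Q.  The
      correlation inequality for c is used to bound M by 4 sqrt T, which makes
      |betahat - beta*| at most 1/20.

    The probability of the event is a union bound over moments.  In the order of
    the cells, unit by unit, each score is a sum of martingale differences, and
    E|S_n|^r <= (C sqrt(r n))^r max E|d|^r with C absolute ([martingale_moment]).  The
    explicit dependence on r matters: in the first part r is given, and Gram entries
    use order r/2; in the second part r grows like ln p ln a for the scores and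
    like (t^2 N)^(1/3) for the Gram entries, which turns Markov's inequality into the
    stated exponential tails.  If the order would be below 2, or tau below
    1 / sqrt N, the stated lower bound is at most zero.
    Without active coefficients both estimators vanish as soon as the scores are
    small ([null_truth]). *)

(** * Penalised least squares *)

Lemma sum_mul_sum (R : comNzRingType) (I M : finType) (f g : I -> M -> R) :
  \sum_a \sum_b \sum_m f a m * g b m = \sum_m (\sum_a f a m) * (\sum_b g b m).
Proof.
under [RHS]eq_bigr => m _ do rewrite big_distrlr /=.
rewrite [RHS]exchange_big /=; apply: eq_bigr => a _.
by rewrite [RHS]exchange_big.
Qed.

Lemma cauchy_schwarz_sum (R : realType) (I : finType) (A : {set I}) (f g : I -> R) :
  \sum_(i in A) f i * g i <=
  Num.sqrt (\sum_(i in A) f i ^+ 2) * Num.sqrt (\sum_(i in A) g i ^+ 2).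
Proof.
set F := \sum_(i in A) f i ^+ 2; set G := \sum_(i in A) g i ^+ 2.
have F0 : 0 <= F by apply: sumr_ge0 => i _; exact: sqr_ge0.
have G0 : 0 <= G by apply: sumr_ge0 => i _; exact: sqr_ge0.
rewrite -sqrtrM//; set S := \sum_(i in A) _.
suff S2 : S ^+ 2 <= F * G.
  by apply: (le_trans (ler_norm _)); rewrite -sqrtr_sqr ler_wsqrtr.
have key (x : R) : 0 <= F * x ^+ 2 + 2 * S * x + G.
  have -> : F * x ^+ 2 + 2 * S * x + G = \sum_(i in A) (f i * x + g i) ^+ 2.
    rewrite mulr_suml mulr_sumr mulr_suml -!big_split /=.
    by apply: eq_bigr => i _; ring.
  by apply: sumr_ge0 => i _; exact: sqr_ge0.
have [F00|Fn0] := eqVneq F 0.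
  have := key (- (G + 1) / (2 * S)).
  have [->|Sn0] := eqVneq S 0; first by rewrite expr0n mulr_ge0.
  rewrite F00 mul0r add0r mulrCA divff ?mulf_neq0// mulr1; lra.
have Fp : 0 < F by rewrite lt_neqAle eq_sym Fn0.
have := key (- S / F).
have -> : F * (- S / F) ^+ 2 + 2 * S * (- S / F) + G = (F * G - S ^+ 2) / F.
  by field.
by rewrite pmulr_lge0 ?invr_gt0// subr_ge0.
Qed.

Section PenalizedLeastSquares.
Context {R : realType} {I M : finType}.
Implicit Types (h theta om v : I -> R) (Psi Gam : I -> I -> R).
Variables (Z : I -> M -> R) (e : M -> R).

Definition fit h (m : M) : R := \sum_l h l * Z l m.

Definition gram (a b : I) : R := \sum_m Z a m * Z b m.

Definition score (l : I) : R := \sum_m Z l m * e m.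

Definition qform (Psi : I -> I -> R) h : R := \sum_a \sum_b Psi a b * (h a * h b).

Definition objective om theta h : R :=
  \sum_m (e m - fit h m) ^+ 2 + 2 * \sum_l om l * `|theta l + h l|.

Definition norm1 h : R := \sum_l `|h l|.
Definition norm2 h : R := Num.sqrt (\sum_l h l ^+ 2).

Definition cone om (J : {set I}) h : Prop :=
  \sum_(l in ~: J) om l * `|h l| <= 3 * \sum_(l in J) om l * `|h l|.

Definition supported (A : {set I}) h : Prop := forall l, l \notin A -> h l = 0.

Lemma sum_sqr_fit h : \sum_m fit h m ^+ 2 = qform gram h.
Proof.
rewrite /qform /gram.
under [RHS]eq_bigr => a _ do under eq_bigr => b _ do rewrite mulr_suml.
rewrite (eq_bigr (fun a => \sum_b \sum_m (h a * Z a m) * (h b * Z b m))); last first.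
  move=> a _; apply: eq_bigr => b _; apply: eq_bigr => m _; ring.
rewrite sum_mul_sum; apply: eq_bigr => m _; by rewrite expr2.
Qed.

Lemma sum_fit_mul h (g : M -> R) : \sum_m fit h m * g m = \sum_l h l * \sum_m Z l m * g m.
Proof.
rewrite /fit; under eq_bigr => m _ do rewrite mulr_suml.
rewrite exchange_big /=; apply: eq_bigr => l _; rewrite mulr_sumr.
by apply: eq_bigr => m _; ring.
Qed.

Lemma objectiveE om theta h :
  objective om theta h = \sum_m e m ^+ 2 - 2 * \sum_l h l * score l
     + qform gram h + 2 * \sum_l om l * `|theta l + h l|.
Proof.
rewrite /objective -sum_sqr_fit /score -sum_fit_mul; congr (_ + _).
rewrite mulr_sumr -sumrN -!big_split /=; apply: eq_bigr => m _; ring.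
Qed.

Lemma fitZ s h m : fit (fun l => s * h l) m = s * fit h m.
Proof. by rewrite /fit mulr_sumr; apply: eq_bigr => l _; rewrite mulrA. Qed.

Lemma qform_gram_ge0 h : 0 <= qform gram h.
Proof. by rewrite -sum_sqr_fit; apply: sumr_ge0 => m _; apply: sqr_ge0. Qed.

Lemma norm1_ge0 h : 0 <= norm1 h.
Proof. by apply: sumr_ge0. Qed.

Lemma norm2_ge0 h : 0 <= norm2 h. Proof. exact: sqrtr_ge0. Qed.

Lemma sqr_norm2 h : norm2 h ^+ 2 = \sum_l h l ^+ 2.
Proof. by rewrite sqr_sqrtr// sumr_ge0// => l _; apply: sqr_ge0. Qed.

Lemma abs_le_norm2 h l : `|h l| <= norm2 h.
Proof.
rewrite -sqrtr_sqr ler_wsqrtr// (bigD1 l)//= lerDl sumr_ge0// => i _.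
exact: sqr_ge0.
Qed.

Lemma norm2_eq0 h : norm2 h = 0 -> forall l, h l = 0.
Proof.
by move=> h0 l; apply/eqP; rewrite -normr_eq0 eq_le normr_ge0 andbT -h0 abs_le_norm2.
Qed.

Lemma sum_abs_le_sqrt_card (J : {set I}) h :
  \sum_(l in J) `|h l| <= Num.sqrt #|J|%:R * norm2 h.
Proof.
have := cauchy_schwarz_sum J (fun=> 1) (fun l => `|h l|).
under eq_bigr do rewrite mul1r.
move=> /le_trans; apply; rewrite expr1n sumr_const; apply: ler_wpM2l => //.
apply: ler_wsqrtr; rewrite [leRHS](bigID (mem J)) /=.
under eq_bigr do rewrite real_normK ?num_real//.
by rewrite lerDl sumr_ge0// => i _; apply: sqr_ge0.
Qed.

Lemma sum_setC (J : {set I}) (f : I -> R) :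
  \sum_l f l = \sum_(l in J) f l + \sum_(l in ~: J) f l.
Proof.
rewrite (bigID (mem J)) /=; congr (_ + _).
by apply: eq_bigl => l; rewrite inE.
Qed.

(** The l1-norm appears because an entrywise bound on Psi - Gam is the norm of the
    difference as a bilinear form on l1. *)
Lemma qform_perturb Psi Gam tau h :
  (forall a b, `|Psi a b - Gam a b| <= tau) ->
  qform Gam h - tau * norm1 h ^+ 2 <= qform Psi h.
Proof.
move=> H; rewrite lerBlDr -lerBlDl.
have -> : norm1 h ^+ 2 = \sum_a \sum_b `|h a| * `|h b|.
  by rewrite expr2 /norm1 big_distrlr.
rewrite /qform mulr_sumr -sumrB; apply: ler_sum => a _.
rewrite mulr_sumr -sumrB; apply: ler_sum => b _.
rewrite -mulrBl; apply: (le_trans (ler_norm _)).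
rewrite normrM normrM distrC; apply: ler_wpM2r; last exact: H.
exact: mulr_ge0.
Qed.

(** Off J the truth vanishes, so the penalty pays for all of h there and the score is
    absorbed into it; on J the penalty can only be gained back by the triangle inequality. *)
Lemma basic_inequality om theta (J : {set I}) h :
  (forall l, l \notin J -> theta l = 0) -> (forall l, 0 <= om l) ->
  objective om theta h <= objective om theta (fun=> 0) ->
  qform gram h <= 2 * \sum_(l in J) (`|score l| + om l) * `|h l|
    - 2 * \sum_(l in ~: J) (om l - `|score l|) * `|h l|.
Proof.
move=> theta0 om0; rewrite !objectiveE.
have -> : qform gram (fun=> 0) = 0.
  by rewrite /qform big1// => a _; rewrite big1// => b _; rewrite !mulr0.
rewrite [X in _ - 2 * X + 0](_ : _ = 0); last by rewrite big1// => l _; rewrite mul0r.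
under [X in _ + 0 + 2 * X]eq_bigr do rewrite addr0.
set S := \sum_m _; set q := qform _ _; set P1 := \sum_l om l * `|theta l + h l|.
set P0 := \sum_l om l * `|theta l|; set sc := \sum_l h l * score l => Hobj.
have {Hobj} Hq : q <= 2 * (sc + P0 - P1) by lra.
apply: (le_trans Hq); rewrite -mulrBr ler_pM2l//.
rewrite /sc /P0 /P1 -big_split -sumrB /= (sum_setC J) -sumrN; apply: lerD.
  apply: ler_sum => l _.
  have Hs : h l * score l <= `|score l| * `|h l|.
    by rewrite mulrC -normrM ler_norm.
  have : om l * `|theta l| <= om l * (`|theta l + h l| + `|h l|).
    apply: ler_wpM2l => //; have := ler_normB (theta l + h l) (h l).
    by rewrite addrK.
  by rewrite mulrDl; move: (om l * _) => X; rewrite mulrDr => ?; lra.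
apply: ler_sum => l; rewrite inE => lJ; rewrite theta0// add0r normr0 mulr0 addr0.
have Hs : h l * score l <= `|score l| * `|h l|.
  by rewrite mulrC -normrM ler_norm.
by rewrite mulrBl opprB lerD2r.
Qed.

(** The points between the truth (h = 0) and a point of its sublevel set stay in the
    sublevel set: this lets one shrink a minimiser until its error is as short as desired. *)
Lemma objective_convex om theta h s : (forall l, 0 <= om l) -> 0 <= s <= 1 ->
  objective om theta h <= objective om theta (fun=> 0) ->
  objective om theta (fun l => s * h l) <= objective om theta (fun=> 0).
Proof.
move=> om0 /andP[s0 s1] H.
apply: (@le_trans _ _ (s * objective om theta h + (1 - s) * objective om theta (fun=> 0))); last first.
  have : s * objective om theta h <= s * objective om theta (fun=> 0) by rewrite ler_wpM2l.
  lra.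
rewrite /objective !mulrDr addrACA; apply: lerD.
  rewrite 2!mulr_sumr -big_split; apply: ler_sum => m _ /=.
  rewrite fitZ; have -> : fit (fun=> 0) m = 0 by rewrite /fit big1// => l _; rewrite mul0r.
  set f := fit h m; rewrite subr0 -subr_ge0.
  have -> : s * (e m - f) ^+ 2 + (1 - s) * e m ^+ 2 - (e m - s * f) ^+ 2
     = s * (1 - s) * f ^+ 2 by ring.
  by rewrite mulr_ge0 ?sqr_ge0// mulr_ge0// subr_ge0.
rewrite !(mulrCA _ 2) -mulrDr ler_pM2l// 2!mulr_sumr -big_split; apply: ler_sum => l _ /=.
rewrite addr0 !(mulrCA _ (om l)) -mulrDr ler_wpM2l//.
have -> : theta l + s * h l = s * (theta l + h l) + (1 - s) * theta l by ring.
apply: (le_trans (ler_normD _ _)); rewrite !normrM (ger0_norm s0).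
by rewrite (@ger0_norm _ (1 - s)) ?subr_ge0.
Qed.

End PenalizedLeastSquares.

(** * Optimality conditions and restricted eigenvalues *)

(** The condition on d is the minimality of s for the one-dimensional Lasso with
    residual correlation u, in the form of an increment; testing with d = u -+ w and
    with small d towards 0 gives the three conclusions. *)
Lemma soft_threshold_kkt (R : realFieldType) (w s u : R) : 0 <= w ->
  (forall d, 2 * w * `|s| <= d ^+ 2 - 2 * d * u + 2 * w * `|s + d|) ->
  [/\ `|u| <= w, 0 < s -> u = w & s < 0 -> u = - w].
Proof.
move=> w0 H.
have H' d : 0 <= d ^+ 2 - 2 * d * u + 2 * w * `|d|.
  have := H d; have : w * `|s + d| <= w * (`|s| + `|d|) by rewrite ler_wpM2l// ler_normD.
  lra.
have uw : `|u| <= w.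
  rewrite ler_norml; apply/andP; split; rewrite leNgt; apply/negP => uw.
  - have := H' (u + w); rewrite ltr0_norm; last lra.
    have -> : (u + w) ^+ 2 - 2 * (u + w) * u + 2 * w * - (u + w) = - (u + w) ^+ 2 by ring.
    have : 0 < (u + w) ^+ 2 by rewrite exprn_even_gt0//= lt_eqF//; lra.
    lra.
  - have := H' (u - w); rewrite gtr0_norm; last lra.
    have -> : (u - w) ^+ 2 - 2 * (u - w) * u + 2 * w * (u - w) = - (u - w) ^+ 2 by ring.
    have : 0 < (u - w) ^+ 2 by rewrite exprn_even_gt0//= gt_eqF//; lra.
    lra.
split=> // s0; move: uw; rewrite ler_norml => /andP[u1 u2].
- apply/eqP; rewrite eq_le u2 /= leNgt; apply/negP => uw.
  pose t := Num.min s (w - u); have ts : t <= s by rewrite ge_min lexx.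
  have tw : t <= w - u by rewrite ge_min lexx orbT.
  have t0 : 0 < t by rewrite lt_min s0 subr_gt0.
  have := H (- t); rewrite !ger0_norm; [|lra|lra].
  have : 0 < t * (2 * (w - u) - t) by apply: mulr_gt0 => //; lra.
  lra.
- apply/eqP; rewrite eq_le u1 andbT leNgt; apply/negP => uw.
  pose t := Num.min (- s) (w + u); have ts : t <= - s by rewrite ge_min lexx.
  have tw : t <= w + u by rewrite ge_min lexx orbT.
  have t0 : 0 < t by rewrite lt_min oppr_gt0 s0 /=; lra.
  have := H t; rewrite !ler0_norm; [|lra|lra].
  have : 0 < t * (2 * (w + u) - t) by apply: mulr_gt0 => //; lra.
  lra.
Qed.

Section Lasso.
Context {R : realType} {I M : finType}.
Variables (Z : I -> M -> R) (e : M -> R).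
Implicit Types (h theta om v : I -> R).
Local Notation objective := (objective Z e).
Local Notation gram := (gram Z).
Local Notation score := (score Z e).

Definition shift_coord h (l : I) (d : R) : I -> R :=
  fun k => if k == l then h k + d else h k.

Lemma fit_shift_coord h l d m :
  fit Z (shift_coord h l d) m = fit Z h m + d * Z l m.
Proof.
rewrite /fit (bigD1 l)//= [in RHS](bigD1 l)//= /shift_coord eqxx.
rewrite (eq_bigr (fun k => h k * Z k m)); last by move=> k /negbTE ->.
by rewrite mulrDl; ring.
Qed.

Lemma objective_shift_coord om theta h l d : gram l l = 1 ->
  objective om theta (shift_coord h l d) - objective om theta h =
  d ^+ 2 - 2 * d * (score l - \sum_k gram l k * h k)
  + 2 * om l * (`|theta l + h l + d| - `|theta l + h l|).
Proof.
move=> g1; rewrite /objective opprD addrACA; congr (_ + _); last first.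
  rewrite -mulrBr (bigD1 l)//= [X in _ - X](bigD1 l)//= /shift_coord eqxx.
  rewrite (eq_bigr (fun k => om k * `|theta k + h k|)); last by move=> k /negbTE ->.
  by rewrite addrA; ring.
have -> : d ^+ 2 - 2 * d * (score l - \sum_k gram l k * h k) =
    \sum_m ((d * Z l m) ^+ 2 - 2 * (d * Z l m) * (e m - fit Z h m)).
  rewrite sumrB; congr (_ - _).
    by under eq_bigr do rewrite exprMn expr2 (expr2 (Z l _)); rewrite -mulr_sumr
         -[X in _ * X]/(gram l l) g1 mulr1 -expr2.
  rewrite (eq_bigr (fun m => 2 * d * (Z l m * e m) - 2 * d * (fit Z h m * Z l m))); last first.
    by move=> m _; ring.
  rewrite sumrB -!mulr_sumr sum_fit_mul -mulrBr; congr (_ * (_ - _)).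
  apply: eq_bigr => k _; rewrite mulrC; congr (_ * _).
  by apply: eq_bigr => m _; rewrite mulrC.
rewrite -sumrB; apply: eq_bigr => m _; rewrite fit_shift_coord; ring.
Qed.

(** Along a single coordinate with a unit-norm column the objective is a
    one-dimensional Lasso. *)
Lemma coordinate_kkt om theta h l : 0 <= om l -> gram l l = 1 ->
  (forall d, objective om theta h <= objective om theta (shift_coord h l d)) ->
  let u := score l - \sum_k gram l k * h k in
  [/\ `|u| <= om l, 0 < theta l + h l -> u = om l & theta l + h l < 0 -> u = - om l].
Proof.
move=> w0 g1 H u; apply: soft_threshold_kkt => // d.
by have := H d; rewrite -subr_ge0 objective_shift_coord// -/u; lra.
Qed.

(** For a column almost orthogonal to the others, u + h l is small, so the optimality
    condition on u is a statement about h l itself. *)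
Lemma coordinate_residual h l tau : gram l l = 1 -> 0 <= tau ->
  (forall k, k != l -> `|gram l k| <= tau) ->
  `|score l - \sum_k gram l k * h k + h l| <= `|score l| + tau * norm1 h.
Proof.
move=> g1 tau0 H; rewrite (bigD1 l)//= g1 mul1r.
rewrite [X in `|X|](_ : _ = score l - \sum_(i | i != l) gram l i * h i); last by ring.
apply: (le_trans (ler_normB _ _)); rewrite lerD2l.
apply: (le_trans (ler_norm_sum _ _ _)).
rewrite /norm1 [X in tau * X](bigD1 l)//= mulrDr mulr_sumr.
apply: ler_wpDl; first exact: mulr_ge0.
by apply: ler_sum => k kl; rewrite normrM ler_wpM2r// H.
Qed.

Variables (Gam : I -> I -> R) (tau kap2 rho : R) (J : {set I}) (om : I -> R).
Hypothesis tau_ge0 : 0 <= tau.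
Hypothesis rho_gt0 : 0 < rho.
Hypothesis om_gt0 : forall l, 0 < om l.
Hypothesis om_rho : forall k l, om k <= rho * om l.
Hypothesis J0 : J != finset.set0.
Hypothesis close : forall a b, `|gram a b - Gam a b| <= tau.
Hypothesis compat : forall h, cone om J h -> kap2 * norm2 h ^+ 2 <= qform Gam h.
Hypothesis tau_small : tau * #|J|%:R * rho ^+ 2 <= kap2 / 200.
Local Notation s := (#|J|%:R : R).

Lemma cardJ_ge1 : 1 <= s.
Proof. by rewrite ler1n card_gt0. Qed.

Lemma rho_ge1 : 1 <= rho.
Proof.
have /set0Pn[l _] := J0.
by rewrite -(ler_pM2r (om_gt0 l)) mul1r.
Qed.

(** In the cone the weighted l1-norm is at most 4 times its part on J; replacing all
    weights by the smallest one costs the ratio rho. *)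
Lemma cone_norm1 h : cone om J h -> norm1 h <= 4 * rho * Num.sqrt s * norm2 h.
Proof.
move=> hc; have /set0Pn[l0 _] := J0.
have [l _ Hl] : exists2 l, true & forall k, om l <= om k.
  by exists [arg min_(i < l0) om i]%O => //; case: arg_minP => // i _ H k; apply: H.
have Hs : \sum_k om k * `|h k| <= 4 * \sum_(k in J) om k * `|h k|.
  by rewrite (sum_setC J); move: hc; rewrite /cone; lra.
have H1 : om l * norm1 h <= \sum_k om k * `|h k|.
  by rewrite mulr_sumr; apply: ler_sum => k _; rewrite ler_wpM2r.
have H2 : \sum_(k in J) om k * `|h k| <= rho * om l * \sum_(k in J) `|h k|.
  by rewrite mulr_sumr; apply: ler_sum => k _; rewrite ler_wpM2r.
have H3 := sum_abs_le_sqrt_card J h.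
have rl : 0 <= rho * om l by rewrite mulr_ge0 ?ltW.
have H4 := ler_wpM2l rl H3.
have : om l * norm1 h <= om l * (4 * rho * Num.sqrt s * norm2 h) by lra.
by rewrite ler_pM2l.
Qed.

(** Replacing Gam by the Gram matrix costs tau |h|_1^2 <= 16 tau s rho^2 |h|^2, that is
    at most 16/200 of the energy that compatibility provides. *)
Lemma cone_energy h : cone om J h ->
  23 / 25 * (kap2 * norm2 h ^+ 2) <= qform gram h.
Proof.
move=> hc; apply: le_trans (qform_perturb h close).
have n0 := norm2_ge0 h; have m0 := norm1_ge0 h.
have H1 : norm1 h ^+ 2 <= (4 * rho * Num.sqrt s * norm2 h) ^+ 2.
  by rewrite ler_pXn2r ?nnegrE// ?cone_norm1// !mulr_ge0// ltW.
have H2 := ler_wpM2l tau_ge0 H1.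
have H3 := ler_wpM2r (sqr_ge0 (norm2 h)) tau_small.
have H4 := compat hc.
move: H2; rewrite !exprMn sqr_sqrtr// => H2.
lra.
Qed.

Hypothesis score_small : forall l, `|score l| <= om l / 16.
Variable (theta : I -> R).
Hypothesis theta0 : forall l, l \notin J -> theta l = 0.

Section FirstStep.
Variable h : I -> R.
Hypothesis hmin : objective om theta h <= objective om theta (fun=> 0).

(** The basic inequality with every score at most 1/16 of its weight. *)
Lemma first_step_basic :
  qform gram h <= 2 * (17 / 16) * \sum_(l in J) om l * `|h l|
    - 2 * (15 / 16) * \sum_(l in ~: J) om l * `|h l|.
Proof.
apply: (le_trans (basic_inequality theta0 (fun l => ltW (om_gt0 l)) hmin)).
have H1 : \sum_(l in J) (`|score l| + om l) * `|h l| <=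
          17 / 16 * \sum_(l in J) om l * `|h l|.
  rewrite mulr_sumr; apply: ler_sum => l _; rewrite [leRHS]mulrA ler_wpM2r//.
  have := score_small l; lra.
have H2 : 15 / 16 * \sum_(l in ~: J) om l * `|h l| <=
          \sum_(l in ~: J) (om l - `|score l|) * `|h l|.
  rewrite mulr_sumr; apply: ler_sum => l _; rewrite [leLHS]mulrA ler_wpM2r//.
  have := score_small l; lra.
lra.
Qed.

Lemma first_step_cone : cone om J h.
Proof.
have := first_step_basic; have := qform_gram_ge0 Z h.
have : 0 <= \sum_(l in J) om l * `|h l|.
  by apply: sumr_ge0 => l _; rewrite mulr_ge0// ltW.
rewrite /cone; lra.
Qed.

Lemma first_step_l2 : kap2 * norm2 h <= 5 / 2 * Num.sqrt (\sum_(l in J) om l ^+ 2).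
Proof.
have E := cone_energy first_step_cone; have B := first_step_basic.
have C0 : 0 <= \sum_(l in ~: J) om l * `|h l|.
  by apply: sumr_ge0 => l _; rewrite mulr_ge0// ltW.
have CS := cauchy_schwarz_sum J om (fun l => `|h l|).
have n0 := norm2_ge0 h; set S := Num.sqrt _ in CS *.
have S0 : 0 <= S by apply: sqrtr_ge0.
have CS' : \sum_(l in J) om l * `|h l| <= S * norm2 h.
  apply: (le_trans CS); apply: ler_wpM2l => //; apply: ler_wsqrtr.
  rewrite [leRHS](bigID (mem J)) /=.
  under eq_bigr do rewrite real_normK ?num_real//.
  by rewrite lerDl sumr_ge0// => i _; apply: sqr_ge0.
have [->|nn0] := eqVneq (norm2 h) 0; first by rewrite mulr0; apply: mulr_ge0 => //; lra.
have np : 0 < norm2 h by rewrite lt_neqAle eq_sym nn0.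
rewrite -(ler_pM2r np); have : 0 <= S * norm2 h by apply: mulr_ge0.
move: E; rewrite expr2; lra.
Qed.

Lemma sqrt_weights_le l : Num.sqrt (\sum_(k in J) om k ^+ 2) <= rho * om l * Num.sqrt s.
Proof.
have rl : 0 <= rho * om l by rewrite mulr_ge0 ?ltW.
rewrite -[X in X * _]ger0_norm// -sqrtr_sqr -sqrtrM ?sqr_ge0//.
apply: ler_wsqrtr; rewrite mulr_natr -sumr_const; apply: ler_sum => k _.
by rewrite ler_pXn2r ?nnegrE// ?ltW.
Qed.

(** The perturbation of one optimality condition by the other coordinates is at most
    1/20 of the penalty weight; together with the score, 1/16, this leaves the KKT
    condition decisive in [first_step_coordinate]. *)
Lemma first_step_tau_norm1 l : tau * norm1 h <= om l / 20.
Proof.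
have r1 := rho_ge1; have n0 := norm2_ge0 h.
have H1 := ler_wpM2l tau_ge0 (cone_norm1 first_step_cone).
have H2 := first_step_l2.
have H3 := sqrt_weights_le l.
have sq : Num.sqrt s * Num.sqrt s = s by rewrite -expr2 sqr_sqrtr.
have ss : 0 <= Num.sqrt s by apply: sqrtr_ge0.
apply: (le_trans H1).
have rl : 0 < rho ^+ 2 by rewrite exprn_gt0.
have sg0 : 0 < Num.sqrt s by rewrite sqrtr_gt0 ltr0n card_gt0.
have P0 : 0 < rho * Num.sqrt s by apply: mulr_gt0.
(* The factor rho * sqrt s makes the tolerance tau * s * rho^2 appear. *)
rewrite -(ler_pM2r P0).
have -> : tau * (4 * rho * Num.sqrt s * norm2 h) * (rho * Num.sqrt s) =
  4 * (tau * s * rho ^+ 2) * norm2 h.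
  transitivity (4 * (tau * (Num.sqrt s * Num.sqrt s) * rho ^+ 2) * norm2 h); first ring.
  by rewrite sq.
have H4 := ler_wpM2r n0 tau_small.
have := mulr_ge0 (mulr_ge0 (ltW rho_gt0) (ltW (om_gt0 l))) ss.
lra.
Qed.

(** If theta l + h l is nonzero then |u| = om l, while u + h l is at most 9/80 om l: so
    |h l| is close to om l.  For l outside J a nonzero h l would have the sign of u, and
    |u + h l| would exceed om l; hence there is no false positive at l. *)
Lemma first_step_coordinate l : gram l l = 1 ->
  (forall k, k != l -> `|gram l k| <= tau) ->
  (forall d, objective om theta h <= objective om theta (shift_coord h l d)) ->
  (l \notin J -> h l = 0) /\ (theta l + h l != 0 -> om l / 2 <= `|h l|).
Proof.
move=> g1 gt H; have [_] := coordinate_kkt (ltW (om_gt0 l)) g1 H.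
have := coordinate_residual h g1 tau_ge0 gt; set u := score l - _ => Hr Hp Hn.
have T := first_step_tau_norm1 l; have S := score_small l.
have w0 := om_gt0 l.
have Hr' : `|u + h l| <= om l * (9 / 80) by lra.
move: Hr'; rewrite ler_norml => /andP[Ha Hb]; split.
- move=> lJ; apply/eqP; rewrite eq_le.
  move: Hp Hn; rewrite (theta0 lJ) add0r => Hp Hn.
  apply/andP; split; rewrite leNgt; apply/negP.
  + by move=> /[dup] h0 /Hp; lra.
  + by move=> /[dup] h0 /Hn; lra.
- rewrite neq_lt => /orP[/Hn hu|/Hp hu].
  + by apply: le_trans (ler_norm _); lra.
  + by rewrite -normrN; apply: le_trans (ler_norm _); lra.
Qed.

End FirstStep.

Section SecondStep.
Variables (h : I -> R) (v : I -> R) (A : {set I}) (Q : R).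
Hypothesis hA : supported A h.
Hypothesis v_ge0 : forall l, 0 <= v l.
Hypothesis Q_gt0 : 0 < Q.
Hypothesis vQ : forall l, l \in J -> `|score l| + v l <= 3 / 5 * Q.
Hypothesis hmin : objective v theta h <= objective v theta (fun=> 0).

Lemma sum_offJ (h' f : I -> R) : supported A h' ->
  \sum_(l in ~: J) f l * `|h' l| = \sum_(l in A :\: J) f l * `|h' l|.
Proof.
move=> h'A; rewrite (bigID (mem A)) /= addrC big1 ?add0r; last first.
  by move=> l /andP[_ lA]; rewrite h'A// normr0 mulr0.
by apply: eq_bigl => l; rewrite !inE.
Qed.

Lemma second_step_J_sum (h' : I -> R) :
  2 * \sum_(l in J) (`|score l| + v l) * `|h' l| <= 6 / 5 * Q * \sum_(l in J) `|h' l|.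
Proof.
rewrite !mulr_sumr; apply: ler_sum => l lJ.
rewrite [leLHS]mulrA ler_wpM2r//; have := vQ lJ; lra.
Qed.

Section ConeRegime.
Variable W : R.
Hypothesis W_gt0 : 0 < W.
Hypothesis vJ : forall l, l \in J -> `|score l| + v l <= W * om l.
Hypothesis vA : forall l, l \in A :\: J -> W * om l <= 3 * (v l - `|score l|).

(** The hypotheses say that the adaptive weights, relative to the first-step weights,
    are at most W on J and large compared with W off J: then the basic inequality
    of the second step has the shape of the one of the first step. *)
Lemma second_step_cone : cone om J h.
Proof.
have B := basic_inequality theta0 v_ge0 hmin.
have q0 := qform_gram_ge0 Z h.
rewrite /cone (sum_offJ _ hA) -(ler_pM2l W_gt0).
rewrite (sum_offJ (fun l => v l - `|score l|) hA) in B.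
have H1 : \sum_(l in J) (`|score l| + v l) * `|h l| <= W * \sum_(l in J) om l * `|h l|.
  by rewrite mulr_sumr; apply: ler_sum => l lJ; rewrite [leRHS]mulrA ler_wpM2r ?vJ.
have H2 : W * \sum_(l in A :\: J) om l * `|h l| <=
          3 * \sum_(l in A :\: J) (v l - `|score l|) * `|h l|.
  by rewrite !mulr_sumr; apply: ler_sum => l lJ; rewrite !mulrA ler_wpM2r ?vA.
have vS : \sum_(l in A :\: J) (v l - `|score l|) * `|h l| <=
          \sum_(l in J) (`|score l| + v l) * `|h l| by lra.
lra.
Qed.

Lemma second_step_tau_norm1 : tau * norm1 h <= Q / 30.
Proof.
have hc := second_step_cone.
have E := cone_energy hc; have B := basic_inequality theta0 v_ge0 hmin.
have n0 := norm2_ge0 h; have r1 := rho_ge1.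
have C0 : 0 <= \sum_(l in ~: J) (v l - `|score l|) * `|h l|.
  rewrite (sum_offJ _ hA); apply: sumr_ge0 => l lA; apply: mulr_ge0 => //.
  have := vA lA; have := mulr_gt0 W_gt0 (om_gt0 l); lra.
have B' := second_step_J_sum h.
have S := sum_abs_le_sqrt_card J h.
have S' : Q * \sum_(l in J) `|h l| <= Q * (Num.sqrt s * norm2 h) by rewrite ler_wpM2l// ltW.
have K : kap2 * norm2 h <= 4 / 3 * Q * Num.sqrt s.
  have [->|nn0] := eqVneq (norm2 h) 0.
    by rewrite mulr0 !mulr_ge0// ltW.
  have np : 0 < norm2 h by rewrite lt_neqAle eq_sym nn0.
  rewrite -(ler_pM2r np).
  have : 0 <= Q * (Num.sqrt s * norm2 h) by rewrite !mulr_ge0// ltW.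
  move: E; rewrite expr2; lra.
have H1 := ler_wpM2l tau_ge0 (cone_norm1 hc).
have sq : Num.sqrt s * Num.sqrt s = s by rewrite -expr2 sqr_sqrtr.
have sg0 : 0 < Num.sqrt s by rewrite sqrtr_gt0 ltr0n card_gt0.
apply: (le_trans H1).
have P0 : 0 < rho * Num.sqrt s by apply: mulr_gt0.
rewrite -(ler_pM2r P0).
have -> : tau * (4 * rho * Num.sqrt s * norm2 h) * (rho * Num.sqrt s) =
  4 * (tau * s * rho ^+ 2) * norm2 h.
  transitivity (4 * (tau * (Num.sqrt s * Num.sqrt s) * rho ^+ 2) * norm2 h); first ring.
  by rewrite sq.
have H4 := ler_wpM2r n0 tau_small.
have QS : 0 <= Q * Num.sqrt s by rewrite mulr_ge0// ltW.
have := ler_wpM2l QS r1.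
lra.
Qed.

(** As in the first step, but at an active coordinate, where only |u| <= v l is used. *)
Lemma second_step_coordinate l : l \in J -> gram l l = 1 ->
  (forall k, k != l -> `|gram l k| <= tau) ->
  (forall d, objective v theta h <= objective v theta (shift_coord h l d)) ->
  `|h l| < Q.
Proof.
move=> lJ g1 gt H; have [Hu _ _] := coordinate_kkt (v_ge0 l) g1 H.
have := coordinate_residual h g1 tau_ge0 gt; move: Hu; set u := score l - _ => Hu Hr.
have T := second_step_tau_norm1; have V := vQ lJ.
have -> : h l = (u + h l) - u by ring.
apply: (le_lt_trans (ler_normB _ _)); have := Q_gt0; lra.
Qed.

End ConeRegime.

Section DualFeasibility.
Variables (phi B : R).
Hypothesis phi_gt0 : 0 < phi.
Hypothesis phiP : forall h', supported J h' -> phi * norm2 h' ^+ 2 <= qform Gam h'.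
Hypothesis tau_phi : tau * s <= phi / 200.
Hypothesis B_ge0 : 0 <= B.
Hypothesis gramB : forall k l, k \in A :\: J -> l \in J -> `|gram k l| <= B.
Hypothesis vB : forall k, k \in A :\: J -> B * (2 * s * Q / phi) + `|score k| < v k.

Definition restr (h' : I -> R) : I -> R := fun l => if l \in J then h' l else 0.

Lemma fit_restr (h' : I -> R) m :
  fit Z h' m = fit Z (restr h') m + \sum_(k in ~: J) h' k * Z k m.
Proof.
rewrite /fit (sum_setC J) [in RHS](sum_setC J) -addrA; congr (_ + _).
  by apply: eq_bigr => l lJ; rewrite /restr lJ.
rewrite [X in X + _]big1 ?add0r// => l; rewrite inE => /negbTE lJ.
by rewrite /restr lJ mul0r.
Qed.

Lemma norm1_restr h' : norm1 (restr h') = \sum_(l in J) `|h' l|.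
Proof.
rewrite /norm1 (sum_setC J) [X in _ + X]big1 ?addr0.
  by apply: eq_bigr => l lJ; rewrite /restr lJ.
by move=> l; rewrite inE => /negbTE lJ; rewrite /restr lJ normr0.
Qed.

(** The interaction of the error on J with the false positives is at most B times the
    product of their l1-norms. *)
Lemma cross_term h' : supported A h' ->
  - (B * norm1 (restr h') * \sum_(k in A :\: J) `|h' k|) <=
  \sum_m fit Z (restr h') m * \sum_(k in ~: J) h' k * Z k m.
Proof.
move=> h'A; rewrite lerNl -sumrN.
have -> : \sum_m - (fit Z (restr h') m * (\sum_(k in ~: J) h' k * Z k m)) =
   \sum_(k in ~: J) \sum_(l in J) - (h' k * (h' l * gram k l)).
  under eq_bigr => m _ do rewrite -mulrN -sumrN /fit big_distrlr /=.
  rewrite exchange_big /= (sum_setC J) [X in _ + X]big1 ?addr0; last first.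
    move=> l; rewrite inE => /negbTE lJ; rewrite big1// => m _; rewrite big1// => k _.
    by rewrite /restr lJ !mul0r.
  rewrite [RHS]exchange_big; apply: eq_bigr => l lJ.
  rewrite exchange_big; apply: eq_bigr => k _ /=.
  rewrite /restr lJ /gram !mulr_sumr -sumrN; apply: eq_bigr => m _; ring.
rewrite (bigID (mem A)) /= [X in _ + X]big1 ?addr0; last first.
  by move=> k /andP[_ kA]; rewrite big1// => l _; rewrite h'A// mul0r oppr0.
rewrite norm1_restr mulr_sumr (eq_bigl (fun k => k \in A :\: J)); last by move=> k; rewrite !inE.
apply: ler_sum => k kA; rewrite mulrAC mulr_sumr; apply: ler_sum => l lJ.
apply: (le_trans (ler_norm _)); rewrite normrN !normrM.
rewrite [leRHS](_ : _ = `|h' k| * (`|h' l| * B)); last by ring.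
by rewrite ler_wpM2l// ler_wpM2l// gramB.
Qed.

(** While the l1-norm on J is at most 2 s Q / phi, the weights off J dominate the
    cross term, so the false positives only help; phi then gives an l2-bound which,
    by Cauchy-Schwarz, is strictly better than the assumed l1-bound. *)
Lemma second_step_short h' : supported A h' ->
  objective v theta h' <= objective v theta (fun=> 0) ->
  norm1 (restr h') <= 2 * s * Q / phi ->
  norm2 (restr h') <= 4 / 3 * Num.sqrt s * Q / phi.
Proof.
move=> h'A h'min short.
have Bi := basic_inequality theta0 v_ge0 h'min.
rewrite (sum_offJ (fun l => v l - `|score l|) h'A) in Bi.
have BJ := second_step_J_sum h'.
have Cr := cross_term h'A.
have Eq : qform gram h' = qform gram (restr h') + qform gram (fun k => if k \in J then 0 else h' k)
   + 2 * \sum_m fit Z (restr h') m * \sum_(k in ~: J) h' k * Z k m.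
  rewrite -!sum_sqr_fit mulr_sumr -!big_split; apply: eq_bigr => m _ /=.
  have -> : fit Z (fun k => if k \in J then 0 else h' k) m = \sum_(k in ~: J) h' k * Z k m.
    rewrite /fit (sum_setC J) big1 ?add0r; last by move=> l ->; rewrite mul0r.
    by apply: eq_bigr => l; rewrite inE => /negbTE ->.
  rewrite (fit_restr h'); ring.
have q0 := qform_gram_ge0 Z (fun k => if k \in J then 0 else h' k).
have S : \sum_(l in J) `|h' l| <= Num.sqrt s * norm2 (restr h').
  have := sum_abs_le_sqrt_card J (restr h'); congr (_ <= _).
  by apply: eq_bigr => l lJ; rewrite /restr lJ.
have F : B * norm1 (restr h') * \sum_(k in A :\: J) `|h' k| <=
    \sum_(l in A :\: J) (v l - `|score l|) * `|h' l|.
  rewrite mulr_sumr; apply: ler_sum => k kA; rewrite ler_wpM2r//.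
  have := ler_wpM2l B_ge0 short; have := vB kA; lra.
have sJ : supported J (restr h') by move=> l /negbTE lJ; rewrite /restr lJ.
have E := qform_perturb (restr h') close; have Ph := phiP sJ.
set n := norm2 (restr h') in S Ph E *; have n0 : 0 <= n by apply: norm2_ge0.
have N1 : norm1 (restr h') ^+ 2 <= s * n ^+ 2.
  rewrite -[X in X * _](sqr_sqrtr (ler0n _ _)) -exprMn ler_pXn2r ?nnegrE ?norm1_ge0//.
    by rewrite norm1_restr.
  by rewrite mulr_ge0// sqrtr_ge0.
have T1 := ler_wpM2l tau_ge0 N1.
have T2 := ler_wpM2r (sqr_ge0 n) tau_phi.
have QS : Q * \sum_(l in J) `|h' l| <= Q * (Num.sqrt s * n) by rewrite ler_wpM2l// ltW.
have K : phi * n <= 4 / 3 * Num.sqrt s * Q.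
  have [->|nn0] := eqVneq n 0.
    by rewrite mulr0 !mulr_ge0// ltW.
  have np : 0 < n by rewrite lt_neqAle eq_sym nn0.
  rewrite -(ler_pM2r np).
  have : 0 <= phi * n ^+ 2 by rewrite mulr_ge0 ?sqr_ge0// ltW.
  have : 0 <= Q * (Num.sqrt s * n) by rewrite !mulr_ge0// ltW.
  have -> : phi * n * n = phi * n ^+ 2 by ring.
  have -> : 4 / 3 * Num.sqrt s * Q * n = 4 / 3 * (Q * (Num.sqrt s * n)) by ring.
  lra.
by rewrite ler_pdivlMr// mulrC.
Qed.

Lemma norm1_restrZ (t : R) h' : 0 <= t ->
  norm1 (restr (fun l => t * h' l)) = t * norm1 (restr h').
Proof.
move=> t0; rewrite !norm1_restr mulr_sumr; apply: eq_bigr => l _.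
by rewrite normrM ger0_norm.
Qed.

Lemma norm1_restr_le h' : norm1 (restr h') <= Num.sqrt s * norm2 (restr h').
Proof.
rewrite [leLHS]norm1_restr; have := sum_abs_le_sqrt_card J (restr h'); congr (_ <= _).
by apply: eq_bigr => l lJ; rewrite /restr lJ.
Qed.

(** If the l1-norm on J were larger, shrink h until it equals 2 s Q / phi; by convexity
    [second_step_short] applies to the shrunk point, and improves the bound strictly. *)
Lemma second_step_norm1 : norm1 (restr h) <= 2 * s * Q / phi.
Proof.
rewrite leNgt; apply/negP => big; set m0 := 2 * s * Q / phi in big.
have s0 : 0 < s by rewrite (lt_le_trans ltr01) ?cardJ_ge1.
have m00 : 0 < m0 by rewrite divr_gt0// !mulr_gt0.
have m_gt0 := lt_trans m00 big.
pose t := m0 / norm1 (restr h).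
have t0 : 0 <= t by rewrite divr_ge0 ?ltW.
have t1 : t <= 1 by rewrite ler_pdivrMr// mul1r ltW.
have tm : norm1 (restr (fun l => t * h l)) = m0.
  by rewrite norm1_restrZ// /t divfK// gt_eqF.
have hA' : supported A (fun l => t * h l) by move=> l lA; rewrite hA// mulr0.
have := second_step_short hA' (objective_convex v_ge0 _ hmin).
rewrite t0 t1 => /(_ isT); rewrite tm => /(_ (lexx _)) H.
have := norm1_restr_le (fun l => t * h l); rewrite tm leNgt => /negP; apply.
apply: (le_lt_trans (ler_wpM2l (sqrtr_ge0 _) H)).
have -> : Num.sqrt s * (4 / 3 * Num.sqrt s * Q / phi) = 2 / 3 * m0.
  transitivity (4 / 3 * (Num.sqrt s * Num.sqrt s) * Q / phi); first by ring.
  by rewrite -expr2 sqr_sqrtr// /m0; ring.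
lra.
Qed.

Hypothesis hminJ : objective v theta h <= objective v theta (restr h).

(** Removing the false positives from h changes the objective by at least the slack in
    vB times their l1-norm, so at a minimiser there are none. *)
Lemma second_step_support : supported J h.
Proof.
have m1 := second_step_norm1; have Cr := cross_term hA.
pose slack k := (v k - `|score k| - B * norm1 (restr h)) * `|h k|.
have slack_coef k : k \in A :\: J -> 0 < v k - `|score k| - B * norm1 (restr h).
  by move=> kA; have := ler_wpM2l B_ge0 m1; have := vB kA; lra.
have slack_ge0 k : k \in A :\: J -> 0 <= slack k.
  by move=> kA; rewrite mulr_ge0// ltW// slack_coef.
pose F m := \sum_(k in ~: J) h k * Z k m.
have D : 0 <= 2 * (\sum_m F m * e m - \sum_m fit Z (restr h) m * F m
     - \sum_(k in A :\: J) v k * `|h k|).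
  have : 0 <= \sum_m F m ^+ 2 by apply: sumr_ge0 => m _; apply: sqr_ge0.
  move: hminJ; rewrite /objective -subr_ge0.
  have -> : \sum_l v l * `|theta l + h l| = \sum_(l in J) v l * `|theta l + h l| +
      \sum_(k in A :\: J) v k * `|h k|.
    rewrite (sum_setC J) -(sum_offJ v hA); congr (_ + _); apply: eq_bigr => l.
    by rewrite inE => lJ; rewrite theta0// add0r.
  have -> : \sum_l v l * `|theta l + restr h l| = \sum_(l in J) v l * `|theta l + h l|.
    rewrite (sum_setC J) [X in _ + X]big1 ?addr0.
      by apply: eq_bigr => l lJ; rewrite /restr lJ.
    by move=> l; rewrite inE => lJ; rewrite theta0// /restr (negbTE lJ) addr0 normr0 mulr0.
  have -> : \sum_m (e m - fit Z h m) ^+ 2 = \sum_m (e m - fit Z (restr h) m) ^+ 2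
      + \sum_m F m ^+ 2 - 2 * \sum_m F m * e m + 2 * \sum_m fit Z (restr h) m * F m.
    rewrite !mulr_sumr -sumrN -!big_split; apply: eq_bigr => m _ /=.
    by rewrite fit_restr -/(F m); ring.
  lra.
have Fe : \sum_m F m * e m <= \sum_(k in A :\: J) `|score k| * `|h k|.
  rewrite /F; under eq_bigr do rewrite mulr_suml.
  rewrite exchange_big /= -(sum_offJ (fun k => `|score k|) hA); apply: ler_sum => k _.
  rewrite -normrM; apply: le_trans (ler_norm _); rewrite le_eqVlt; apply/orP; left.
  by rewrite /score mulr_suml; apply/eqP; apply: eq_bigr => m _; ring.
have tot : \sum_(k in A :\: J) slack k <= 0.
  have -> : \sum_(k in A :\: J) slack k = \sum_(k in A :\: J) v k * `|h k|
    - \sum_(k in A :\: J) `|score k| * `|h k|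
    - B * norm1 (restr h) * \sum_(k in A :\: J) `|h k|.
    rewrite mulr_sumr -!sumrB; apply: eq_bigr => k _; rewrite /slack; ring.
  move: Cr; rewrite -/(F _); lra.
have tot0 : \sum_(k in A :\: J) slack k = 0.
  by apply/eqP; rewrite eq_le tot sumr_ge0.
move=> l lJ; have [lA|] := boolP (l \in A); last exact: hA.
have lAJ : l \in A :\: J by rewrite !inE lJ.
have /eqP := tot0; rewrite psumr_eq0// => /allP /(_ l (mem_index_enum _)).
rewrite lAJ /= mulf_eq0 (gt_eqF (slack_coef _ lAJ)) /= normr_eq0.
by move/eqP.
Qed.

Lemma second_step_error l : `|h l| < 2 * Num.sqrt s * Q / phi.
Proof.
have s0 : 0 < Num.sqrt s by rewrite sqrtr_gt0 (lt_le_trans ltr01) ?cardJ_ge1.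
have E : restr h = h.
  by apply/funext => k; rewrite /restr; case: ifPn => // /second_step_support ->.
have := second_step_short hA hmin second_step_norm1; rewrite E => H.
apply: (le_lt_trans (abs_le_norm2 h l)); apply: (le_lt_trans H).
have : 0 < Num.sqrt s * Q / phi by rewrite divr_gt0// mulr_gt0.
have -> : 4 / 3 * Num.sqrt s * Q / phi = 4 / 3 * (Num.sqrt s * Q / phi) by ring.
have -> : 2 * Num.sqrt s * Q / phi = 2 * (Num.sqrt s * Q / phi) by ring.
lra.
Qed.

End DualFeasibility.
End SecondStep.
End Lasso.

(** * The panel model in scaled coordinates *)

Lemma subm11E (R : zmodType) (A B : 'M[R]_1) : (A - B) 0 0 = A 0 0 - B 0 0.
Proof. by rewrite !mxE. Qed.

Section Scaling.
Context {R : realType}.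
Variables N T p : nat.
Hypotheses (hN : (0 < N)%N) (hT : (0 < T)%N).
Implicit Types (b bh : 'cV[R]_p) (c ch : 'cV[R]_N) (lam mu : R).

Definition byblock {U : Type} (u v : U) (l : 'I_(p + N)) : U :=
  match fintype.split l with inl _ => u | inr _ => v end.

Lemma byblockl U (u v : U) k : byblock u v (lshift N k) = u.
Proof. by rewrite /byblock (unsplitK (inl k)). Qed.
Lemma byblockr U (u v : U) i : byblock u v (rshift p i) = v.
Proof. by rewrite /byblock (unsplitK (inr i)). Qed.

Definition rate : 'I_(p + N) -> R := byblock (Num.sqrt (N * T)%:R) (Num.sqrt T%:R).

Definition design (x : 'I_N -> 'I_T -> 'I_p -> R) (l : 'I_(p + N))
    (m : ('I_N * 'I_T)%type) : R :=
  match fintype.split l with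
  | inl k => x m.1 m.2 k / Num.sqrt (N * T)%:R
  | inr i => (m.1 == i)%:R / Num.sqrt T%:R
  end.

Definition penalty (lam mu : R) (l : 'I_(p + N)) : R := byblock lam mu l / rate l.

Definition stack_param (b : 'cV[R]_p) (c : 'cV[R]_N) (l : 'I_(p + N)) : R :=
  col_mx b c l 0.

Lemma stack_paraml b c k : stack_param b c (lshift N k) = b k 0.
Proof. by rewrite /stack_param col_mxEu. Qed.
Lemma stack_paramr b c i : stack_param b c (rshift p i) = c i 0.
Proof. by rewrite /stack_param col_mxEd. Qed.

Lemma rate_gt0 l : 0 < rate l.
Proof.
rewrite /rate /byblock; case: fintype.split => _; rewrite sqrtr_gt0 ltr0n//.
by rewrite muln_gt0 hN.
Qed.

Lemma in_joint_supp b c l : (l \in joint_supp b c) = (stack_param b c l != 0).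
Proof.
rewrite /joint_supp inE; case: (split_ordP l) => [k|i] ->.
  rewrite stack_paraml (finset.mem_imset _ _ (@lshift_inj _ _)) inE.
  by rewrite orbC; case: imsetP => // -[j _ /eqP]; rewrite eq_lrshift.
rewrite stack_paramr (finset.mem_imset _ _ (@rshift_inj _ _)) inE.
by case: imsetP => // -[j _ /eqP]; rewrite eq_rlshift.
Qed.

Lemma card_joint_supp (b : 'cV[R]_p) (c : 'cV[R]_N) : #|joint_supp b c| = (#|supp b| + #|supp c|)%N.
Proof.
rewrite /joint_supp cardsU !card_imset; [|exact: rshift_inj|exact: lshift_inj].
rewrite (_ : (_ :&: _)%SET = finset.set0) ?cards0 ?subn0//.
apply/eqP; rewrite -finset.subset0; apply/fintype.subsetP => l; rewrite inE => /andP[].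
by move=> /imsetP[k _ ->] /imsetP[i _ /eqP]; rewrite eq_lrshift.
Qed.

Lemma sum_joint_supp (b : 'cV[R]_p) (c : 'cV[R]_N) (f : 'I_(p + N) -> R) :
  \sum_(l in joint_supp b c) f l =
  \sum_(k in supp b) f (lshift N k) + \sum_(i in supp c) f (rshift p i).
Proof.
rewrite big_mkcond big_split_ord /= [in RHS]big_mkcond [X in _ = _ + X]big_mkcond.
congr (_ + _); apply: eq_bigr => k _; rewrite in_joint_supp ?stack_paraml ?stack_paramr.
  by rewrite inE.
by rewrite inE.
Qed.

Section Objectives.
Variables (x : 'I_N -> 'I_T -> 'I_p -> R) (e : 'I_N -> 'I_T -> R).
Variables (bs : 'cV[R]_p) (cs : 'cV[R]_N).

Definition scaled_error b c (l : 'I_(p + N)) : R :=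
  rate l * (stack_param b c l - stack_param bs cs l).
Definition scaled_truth (l : 'I_(p + N)) : R := rate l * stack_param bs cs l.
Definition err (m : ('I_N * 'I_T)%type) : R := e m.1 m.2.
Let y i t : R := ((\col_k x i t k)^T *m bs) 0 0 + cs i 0 + e i t.

Definition rss b c : R :=
  \sum_i \sum_t (y i t - ((\col_k x i t k)^T *m b) 0 0 - c i 0) ^+ 2.

Lemma rate_l k : rate (lshift N k) = Num.sqrt (N * T)%:R.
Proof. exact: byblockl. Qed.
Lemma rate_r i : rate (rshift p i) = Num.sqrt T%:R.
Proof. exact: byblockr. Qed.

Lemma design_l k m : design x (lshift N k) m = x m.1 m.2 k / Num.sqrt (N * T)%:R.
Proof. by rewrite /design (unsplitK (inl k)). Qed.
Lemma design_r i m : design x (rshift p i) m = (m.1 == i)%:R / Num.sqrt T%:R.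
Proof. by rewrite /design (unsplitK (inr i)). Qed.

Lemma fit_scaled_error b c i t :
  fit (design x) (scaled_error b c) (i, t) =
  ((\col_k x i t k)^T *m (b - bs)) 0 0 + (c i 0 - cs i 0).
Proof.
rewrite /fit big_split_ord /= /scaled_error; congr (_ + _).
  rewrite mxE; apply: eq_bigr => k _; rewrite !mxE rate_l design_l /= !stack_paraml.
  rewrite mulrACA; have := rate_gt0 (lshift N k); rewrite rate_l => r0.
  by field; rewrite gt_eqF.
rewrite (bigD1 i)//= big1 ?addr0.
  rewrite rate_r design_r eqxx mulr1n !stack_paramr; have := rate_gt0 (rshift p i).
  by rewrite rate_r => r0; field; rewrite gt_eqF.
by move=> j ji; rewrite design_r /= eq_sym (negbTE ji) mul0r mulr0.
Qed.

Lemma rssE b c :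
  rss b c = \sum_m (err m - fit (design x) (scaled_error b c) m) ^+ 2.
Proof.
rewrite /rss pair_big /=; apply: eq_bigr => -[i t] _ /=.
rewrite fit_scaled_error /err /y /= mulmxBr subm11E; ring.
Qed.

Lemma scaled_truthD b c l : scaled_truth l + scaled_error b c l = rate l * stack_param b c l.
Proof. by rewrite /scaled_truth /scaled_error; ring. Qed.

Lemma lasso_objectiveE lam mu b c :
  rss b c + 2 * lam * (\sum_k `|b k 0|) + 2 * mu * (\sum_i `|c i 0|) =
  objective (design x) err (penalty lam mu) scaled_truth (scaled_error b c).
Proof.
rewrite rssE /objective -addrA -!mulrA -mulrDr; congr (_ + 2 * _).
rewrite big_split_ord /= !mulr_sumr; congr (_ + _); apply: eq_bigr => k _;
  rewrite scaled_truthD normrM (gtr0_norm (rate_gt0 _)) /penalty mulrA divfK ?gt_eqF ?rate_gt0//.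
  by rewrite byblockl stack_paraml.
by rewrite byblockr stack_paramr.
Qed.

Definition adaptive_penalty lam mu (bh : 'cV[R]_p) (ch : 'cV[R]_N) (l : 'I_(p + N)) : R :=
  byblock lam mu l / `|stack_param bh ch l| / rate l.

Lemma adaptive_objectiveE lam mu bh ch b c :
  adaptive_objective y (fun i t => \col_k x i t k) lam mu bh ch b c =
  objective (design x) err (adaptive_penalty lam mu bh ch) scaled_truth (scaled_error b c).
Proof.
rewrite /adaptive_objective -/(rss b c) rssE /objective -addrA -!mulrA -mulrDr; congr (_ + 2 * _).
rewrite big_split_ord /= !mulr_sumr; congr (_ + _).
  rewrite big_mkcond; apply: eq_bigr => k _.
  rewrite scaled_truthD normrM (gtr0_norm (rate_gt0 _)) /adaptive_penalty [RHS]mulrA divfK ?gt_eqF ?rate_gt0//.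
  rewrite byblockl !stack_paraml inE; case: eqP => [->|_] /=; first by rewrite normr0 invr0 mulr0 mul0r.
  by rewrite mulrAC mulrA.
rewrite big_mkcond; apply: eq_bigr => k _.
rewrite scaled_truthD normrM (gtr0_norm (rate_gt0 _)) /adaptive_penalty [RHS]mulrA divfK ?gt_eqF ?rate_gt0//.
rewrite byblockr !stack_paramr inE; case: eqP => [->|_] /=; first by rewrite normr0 invr0 mulr0 mul0r.
by rewrite mulrAC mulrA.
Qed.

(** Every scaled error comes from a parameter, so minimality over parameters is
    minimality over all h. *)
Lemma scaled_error_onto (h : 'I_(p + N) -> R) : exists b c, scaled_error b c = h.
Proof.
exists (\col_k (bs k 0 + h (lshift N k) / Num.sqrt (N * T)%:R)),
       (\col_i (cs i 0 + h (rshift p i) / Num.sqrt T%:R)).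
apply/funext => l; have := rate_gt0 l; rewrite /scaled_error; case: (split_ordP l) => k -> r0.
  by move: r0; rewrite !stack_paraml mxE rate_l => r0; field; rewrite gt_eqF.
by move: r0; rewrite !stack_paramr mxE rate_r => r0; field; rewrite gt_eqF.
Qed.

Lemma scaled_error_eq0 b c l : (scaled_error b c l == 0) = (stack_param b c l == stack_param bs cs l).
Proof. by rewrite mulf_eq0 (gt_eqF (rate_gt0 l)) /= subr_eq0. Qed.

(** When the first step has found all active coefficients, the constraint of the second
    step says that the error, and not only the parameter, is supported on the selected set. *)
Lemma feasible_scaled_error bh ch b c :
  joint_supp bs cs \subset joint_supp bh ch ->
  adaptive_feasible bh ch b c <-> supported (joint_supp bh ch) (scaled_error b c).
Proof.
move=> /fintype.subsetP JA; split=> [[fb fc] l lA|H].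
  apply/eqP; rewrite scaled_error_eq0.
  have -> : stack_param bs cs l = 0.
    by apply/eqP; apply: contraNT lA => ?; apply: JA; rewrite in_joint_supp.
  move: lA; rewrite in_joint_supp negbK; case: (split_ordP l) => k ->.
    by rewrite !stack_paraml => bk; rewrite fb// inE bk.
  by rewrite !stack_paramr => bk; rewrite fc// inE bk.
have K l : stack_param bh ch l == 0 -> stack_param b c l = 0.
  move=> bl; have lA : l \notin joint_supp bh ch by rewrite in_joint_supp negbK.
  have /eqP := H l lA; rewrite scaled_error_eq0 => /eqP ->.
  by apply/eqP; apply: contraNT lA => ?; apply: JA; rewrite in_joint_supp.
split=> k; rewrite inE negbK => bk.
  by rewrite -(stack_paraml b c) K// stack_paraml.
by rewrite -(stack_paramr b c) K// stack_paramr.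
Qed.

End Objectives.
End Scaling.

(** * Signs of the adaptive Lasso at one outcome *)

Lemma sgr_near (R : realDomainType) (a b : R) : `|a - b| < `|b| -> Num.sg a = Num.sg b.
Proof.
have [b0|b0|->] := ltgtP b 0; last by rewrite normr0 normr_lt0.
  rewrite (ltr0_norm b0) ltr_norml => /andP[_ h].
  by rewrite !ltr0_sg//; lra.
rewrite (gtr0_norm b0) ltr_norml => /andP[h _].
by rewrite !gtr0_sg//; lra.
Qed.

Lemma l2norm_norm2 (R : realType) n (v : 'cV[R]_n) : l2norm v = norm2 (fun i => v i 0).
Proof. by []. Qed.

Section Outcome.
Context {R : realType}.
Variables N T p : nat.
Hypotheses (hN : (0 < N)%N) (hT : (0 < T)%N).
Variables (x : 'I_N -> 'I_T -> 'I_p -> R) (e : 'I_N -> 'I_T -> R).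
Variables (bs bh bt : 'cV[R]_p) (cs ch ct : 'cV[R]_N) (lam mu : R).
Hypotheses (lam_gt0 : 0 < lam) (mu_gt0 : 0 < mu).
Let y i t : R := ((\col_k x i t k)^T *m bs) 0 0 + cs i 0 + e i t.
Hypothesis lassoP : forall b c,
  rss x e bs cs bh ch + 2 * lam * (\sum_k `|bh k 0|) + 2 * mu * (\sum_i `|ch i 0|) <=
  rss x e bs cs b c + 2 * lam * (\sum_k `|b k 0|) + 2 * mu * (\sum_i `|c i 0|).
Hypothesis feasibleP : adaptive_feasible bh ch bt ct.
Hypothesis adaptiveP : forall b c, adaptive_feasible bh ch b c ->
  adaptive_objective y (fun i t => \col_k x i t k) lam mu bh ch bt ct <=
  adaptive_objective y (fun i t => \col_k x i t k) lam mu bh ch b c.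

Local Notation I := 'I_(p + N).
Local Notation Z := (design x).
Local Notation J := (joint_supp bs cs).
Local Notation A := (joint_supp bh ch).
Local Notation s := (#|J|%:R : R).
Local Notation L := (lam / Num.sqrt (N * T)%:R).
Local Notation Mu := (mu / Num.sqrt T%:R).
Let om := penalty (N := N) T (p := p) lam mu.
Let theta := scaled_truth T bs cs.
Let hhat := scaled_error T bs cs bh ch.
Let htil := scaled_error T bs cs bt ct.
Let v := adaptive_penalty T lam mu bh ch.

Lemma om_l k : om (lshift N k) = L.
Proof. by rewrite /om /penalty byblockl rate_l. Qed.
Lemma om_r i : om (rshift p i) = Mu.
Proof. by rewrite /om /penalty byblockr rate_r. Qed.

Lemma sqNT_gt0 : 0 < Num.sqrt (N * T)%:R :> R.
Proof. by rewrite sqrtr_gt0 ltr0n muln_gt0 hN. Qed.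
Lemma sqT_gt0 : 0 < Num.sqrt T%:R :> R.
Proof. by rewrite sqrtr_gt0 ltr0n. Qed.

Lemma om_gt0 l : 0 < om l.
Proof.
rewrite /om /penalty divr_gt0 ?rate_gt0// /byblock.
by case: fintype.split => _.
Qed.

Lemma lasso_min h : objective Z (err e) om theta hhat <= objective Z (err e) om theta h.
Proof.
have [b [c <-]] := scaled_error_onto hN hT bs cs h.
by rewrite -!(lasso_objectiveE hN hT).
Qed.

Lemma theta_offJ l : l \notin J -> theta l = 0.
Proof. by rewrite in_joint_supp negbK /theta /scaled_truth => /eqP ->; rewrite mulr0. Qed.

Hypothesis score_small : forall l, `|score Z (err e) l| <= om l / 16.

(** Without active coefficients the basic inequality leaves no room for a nonzero
    first-step estimate, and the second step is constrained to the selected set. *)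
Lemma null_truth : J = finset.set0 -> bt = bs /\ ct = cs.
Proof.
move=> J0.
have S0 (f : I -> R) : \sum_(l in J) f l = 0 by rewrite J0 big1// => l; rewrite inE.
have B := basic_inequality theta_offJ (fun l => ltW (om_gt0 l)) (lasso_min (fun=> 0)).
have q0 := qform_gram_ge0 Z hhat.
have P : 0 <= \sum_(l in ~: J) om l * `|hhat l|.
  by apply: sumr_ge0 => l _; rewrite mulr_ge0// ltW// om_gt0.
have P2 : 15 / 16 * \sum_(l in ~: J) om l * `|hhat l| <=
    \sum_(l in ~: J) (om l - `|score Z (err e) l|) * `|hhat l|.
  rewrite mulr_sumr; apply: ler_sum => l _; rewrite [leLHS]mulrA ler_wpM2r//.
  have := score_small l; lra.
rewrite S0 in B.
have Z0 : \sum_(l in ~: J) om l * `|hhat l| = 0 by apply/eqP; rewrite eq_le P andbT; lra.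
have h0 l : hhat l = 0.
  have lJ : l \in ~: J by rewrite J0 !inE.
  have /eqP := Z0; rewrite psumr_eq0; last by move=> k _; rewrite mulr_ge0// ltW// om_gt0.
  move=> /allP/(_ l (mem_index_enum _)); rewrite lJ /= mulf_eq0 (gt_eqF (om_gt0 l)) /= normr_eq0.
  by move/eqP.
have zs l : stack_param bs cs l = 0.
  have : l \notin J by rewrite J0 inE.
  by rewrite in_joint_supp negbK => /eqP.
have zh l : stack_param bh ch l = 0.
  by have /eqP := h0 l; rewrite scaled_error_eq0// zs => /eqP.
case: feasibleP => fb fc; split; apply/colP => k.
  have := zs (lshift N k); rewrite stack_paraml => ->; apply: fb.
  by have := zh (lshift N k); rewrite stack_paraml inE negbK => ->.
have := zs (rshift p k); rewrite stack_paramr => ->; apply: fc.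
by have := zh (rshift p k); rewrite stack_paramr inE negbK => ->.
Qed.

Variables (Gam : I -> I -> R) (tau k2 rho : R).
Hypothesis k2_gt0 : 0 < k2.
Hypothesis tau_ge0 : 0 <= tau.
Hypothesis rho_gt0 : 0 < rho.
Hypothesis om_rho : forall k l, om k <= rho * om l.
Hypothesis J0 : J != finset.set0.
Hypothesis close : forall a b, `|gram Z a b - Gam a b| <= tau.
Hypothesis compat : forall h, cone om J h -> k2 * norm2 h ^+ 2 <= qform Gam h.
Hypothesis tau_small : tau * s * rho ^+ 2 <= k2 / 200.
Hypothesis Gam_r : forall i l, l != rshift p i -> Gam (rshift p i) l = 0.

Let xi := 8 * (L * Num.sqrt #|supp bs|%:R + Mu * Num.sqrt #|supp cs|%:R) / k2.
Hypothesis bmin : forall k, k \in supp bs -> 2 * xi <= Num.sqrt (N * T)%:R * `|bs k 0|.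
Hypothesis cmin : forall i, i \in supp cs -> 2 * xi <= Num.sqrt T%:R * `|cs i 0|.

Let rho_ge1' : 1 <= rho.
Proof. exact: (rho_ge1 om_gt0 om_rho J0). Qed.

Lemma L_gt0 : 0 < L. Proof. by rewrite divr_gt0// sqNT_gt0. Qed.
Lemma Mu_gt0 : 0 < Mu. Proof. by rewrite divr_gt0// sqT_gt0. Qed.

Lemma xi_gt0 : 0 < xi.
Proof.
rewrite divr_gt0// mulr_gt0//.
have L0 := L_gt0; have M0 := Mu_gt0.
have a0 : 0 <= L * Num.sqrt #|supp bs|%:R by rewrite mulr_ge0 ?sqrtr_ge0 ?ltW.
have b0 : 0 <= Mu * Num.sqrt #|supp cs|%:R by rewrite mulr_ge0 ?sqrtr_ge0 ?ltW.
rewrite lt_neqAle addr_ge0// andbT eq_sym paddr_eq0//; apply/negP => /andP[].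
rewrite (mulf_eq0 L (Num.sqrt _)) (mulf_eq0 Mu (Num.sqrt _)) (gt_eqF L0) (gt_eqF M0) /= !sqrtr_eq0 !lern0 => /eqP s1 /eqP s2.
by move: J0; rewrite -card_gt0 card_joint_supp s1 s2.
Qed.

Lemma sqrt_weights_le_xi :
  8 * Num.sqrt (\sum_(l in J) om l ^+ 2) <= k2 * xi.
Proof.
rewrite /xi mulrCA divff ?gt_eqF// mulr1 ler_pM2l//.
set X := _ + _; have X0 : 0 <= X.
  by rewrite addr_ge0// mulr_ge0 ?sqrtr_ge0// ltW ?L_gt0 ?Mu_gt0.
rewrite -[leRHS]ger0_norm// -sqrtr_sqr; apply: ler_wsqrtr.
rewrite sum_joint_supp; under eq_bigr do rewrite om_l.
under [X in _ + X]eq_bigr do rewrite om_r.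
rewrite 2!sumr_const -(mulr_natr (L ^+ 2)) -(mulr_natr (Mu ^+ 2)) /X.
have a0 : 0 <= (#|supp bs|%:R : R) by [].
have b0 : 0 <= (#|supp cs|%:R : R) by [].
rewrite -[X in L ^+ 2 * X]sqr_sqrtr// -[X in Mu ^+ 2 * X]sqr_sqrtr//.
rewrite -!exprMn sqrrD -addrA lerD2l lerDr.
by rewrite mulrn_wge0// !mulr_ge0 ?sqrtr_ge0// ?ltW// ?L_gt0 ?Mu_gt0.
Qed.

(** This uses that the l2-norm of the weights on J is at most L sqrt s1 + M sqrt s2. *)
Lemma hhat_l2 : norm2 hhat <= xi / 3.
Proof.
have H := first_step_l2 tau_ge0 rho_gt0 om_gt0 om_rho J0 close compat tau_small score_small
   theta_offJ (lasso_min (fun=> 0)).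
have H2 := sqrt_weights_le_xi; rewrite -(ler_pM2l k2_gt0).
have := mulr_gt0 k2_gt0 xi_gt0; lra.
Qed.

Lemma hhat_error_b : Num.sqrt (N * T)%:R * l2norm (bh - bs) <= norm2 hhat.
Proof.
rewrite l2norm_norm2 -[X in X * _]ger0_norm ?(ltW sqNT_gt0)// -sqrtr_sqr -sqrtrM ?sqr_ge0//.
apply: ler_wsqrtr; rewrite big_split_ord /= mulr_sumr -[leLHS]addr0; apply: lerD; last first.
  by apply: sumr_ge0 => i _; exact: sqr_ge0.
apply: ler_sum => k _; rewrite -exprMn /hhat /scaled_error rate_l !stack_paraml.
by rewrite !mxE.
Qed.

Lemma hhat_le l : l \in J -> `|hhat l| <= rate T l * `|stack_param bs cs l| / 6.
Proof.
rewrite in_joint_supp => lJ; have := hhat_l2; have := abs_le_norm2 hhat l.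
case: (split_ordP l) lJ => k ->; rewrite ?stack_paraml ?stack_paramr => lJ.
  have := @bmin k; rewrite inE => /(_ lJ); rewrite rate_l; lra.
have := @cmin k; rewrite inE => /(_ lJ); rewrite rate_r; lra.
Qed.

Lemma bh_le l : l \in J -> `|stack_param bh ch l - stack_param bs cs l| <= `|stack_param bs cs l| / 6.
Proof.
move=> /hhat_le; rewrite /hhat /scaled_error normrM (gtr0_norm (rate_gt0 hN hT l)) -mulrA.
by rewrite ler_pM2l ?rate_gt0.
Qed.

Lemma bh_ge l : l \in J -> 5 / 6 * `|stack_param bs cs l| <= `|stack_param bh ch l|.
Proof.
move=> /bh_le; have := ler_normD (stack_param bh ch l) (stack_param bs cs l - stack_param bh ch l).
by rewrite addrC subrK distrC; lra.
Qed.

Lemma J_sub_A : J \subset A.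
Proof.
apply/fintype.subsetP => l lJ; have := bh_ge lJ; move: lJ; rewrite !in_joint_supp.
by rewrite -!normr_gt0 => ?; lra.
Qed.

Lemma gram_rr i : gram Z (rshift p i) (rshift p i) = 1.
Proof.
rewrite /gram -(pair_bigA _ (fun i' t => Z (rshift p i) (i', t) * Z (rshift p i) (i', t))) /=.
rewrite (bigD1 i)//= [X in _ + X]big1 ?addr0; last first.
  by move=> j ji; rewrite big1// => t _; rewrite design_r /= (negbTE ji) mul0r mulr0.
under eq_bigr do rewrite design_r /= eqxx mul1r -invfM -expr2 sqr_sqrtr//.
by rewrite sumr_const card_ord -[LHS]mulr_natl divff// pnatr_eq0 -lt0n.
Qed.

Lemma gram_r_off i l : l != rshift p i -> `|gram Z (rshift p i) l| <= tau.
Proof. by move=> li; have := close (rshift p i) l; rewrite Gam_r// subr0. Qed.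

(** The dummy columns have unit norm and Gam couples them with nothing else. *)
Lemma hhat_r i : (rshift p i \notin J -> ch i 0 = 0) /\
  (rshift p i \in J -> Mu / 2 <= `|hhat (rshift p i)|).
Proof.
have := first_step_coordinate tau_ge0 rho_gt0 om_gt0 om_rho J0 close compat tau_small score_small
   theta_offJ (lasso_min (fun=> 0)) (gram_rr i) (@gram_r_off i) (fun d => lasso_min _).
rewrite om_r => -[H1 H2]; split=> [iJ|iJ].
  have /eqP := H1 iJ; rewrite scaled_error_eq0//; move: iJ; rewrite in_joint_supp negbK => /eqP ->.
  by rewrite stack_paramr => /eqP.
apply: H2; rewrite scaled_truthD mulf_eq0 (gt_eqF (rate_gt0 hN hT _)) /=.
by have := fintype.subsetP J_sub_A _ iJ; rewrite in_joint_supp.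
Qed.

Lemma A_off_J l : l \in A :\: J -> exists2 k, l = lshift N k & bh k 0 != 0.
Proof.
rewrite inE => /andP[lJ]; rewrite in_joint_supp; case: (split_ordP l) lJ => k -> lJ.
  by rewrite stack_paraml; exists k.
by rewrite stack_paramr; have [-> //] := hhat_r k; rewrite eqxx.
Qed.

Lemma htilA : supported A htil.
Proof. by apply/(feasible_scaled_error hN hT _ _ J_sub_A). Qed.

Lemma adaptive_min h : supported A h ->
  objective Z (err e) v theta htil <= objective Z (err e) v theta h.
Proof.
have [b [c <-]] := scaled_error_onto hN hT bs cs h.
move=> /(feasible_scaled_error hN hT _ _ J_sub_A) fe.
by rewrite -!(adaptive_objectiveE hN hT); apply: adaptiveP.
Qed.

Lemma adaptive_min0 : objective Z (err e) v theta htil <= objective Z (err e) v theta (fun=> 0).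
Proof. exact: adaptive_min. Qed.

Lemma v_ge0 l : 0 <= v l.
Proof.
rewrite /v /adaptive_penalty !divr_ge0//; last by rewrite ltW ?rate_gt0.
by rewrite /byblock; case: fintype.split => _; exact: ltW.
Qed.

Variables (q1 q2 phi : R).
Hypotheses (q1_ge0 : 0 <= q1) (q2_ge0 : 0 <= q2).
Hypothesis q1P : forall k, k \in supp bs -> `|bs k 0|^-1 <= q1.
Hypothesis q2P : forall i, i \in supp cs -> `|cs i 0|^-1 <= q2.
Hypothesis q1_attained : q1 = 0 \/ exists2 k, k \in supp bs & q1 = `|bs k 0|^-1.
Hypothesis q2_attained : q2 = 0 \/ exists2 i, i \in supp cs & q2 = `|cs i 0|^-1.
Let Q := Num.max (L / 2) (Mu / 2) + Num.max (2 * L * q1) (2 * Mu * q2).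
Hypothesis phi_gt0 : 0 < phi.
Hypothesis phiP : forall h', supported J h' -> phi * norm2 h' ^+ 2 <= qform Gam h'.
Hypothesis k2_phi : k2 <= phi.

Lemma Q_gt0 : 0 < Q.
Proof.
rewrite ltr_pwDl//; first by rewrite lt_max divr_gt0 ?L_gt0.
by rewrite le_max !mulr_ge0// ltW// L_gt0.
Qed.

Lemma LQ : L / 2 + 2 * L * q1 <= Q.
Proof. by apply: lerD; rewrite le_max lexx. Qed.
Lemma MQ : Mu / 2 + 2 * Mu * q2 <= Q.
Proof. by apply: lerD; rewrite le_max lexx orbT. Qed.

Definition inv_min : I -> R := byblock q1 q2.

(** An active coefficient is estimated with relative error at most 1/6, so its inverse is at most
    6/5 of the inverse of the smallest active coefficient of its block. *)
Lemma v_on_J l : l \in J -> v l <= 6 / 5 * om l * inv_min l.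
Proof.
move=> lJ; have H := bh_ge lJ; have lJ' := lJ; rewrite in_joint_supp in lJ'.
have E : v l = om l * `|stack_param bh ch l|^-1.
  by rewrite /v /adaptive_penalty /om /penalty mulrAC.
rewrite E [leRHS]mulrAC [leRHS]mulrC ler_pM2l ?om_gt0//.
have bp : 0 < `|stack_param bs cs l| by rewrite normr_gt0.
have hp : 0 < `|stack_param bh ch l| by lra.
have H2 : `|stack_param bh ch l|^-1 <= 6 / 5 * `|stack_param bs cs l|^-1.
  rewrite -[X in X * _]invrK -invfM lef_pV2 ?posrE//; last by rewrite mulr_gt0.
  have -> : (6 / 5 : R)^-1 = 5 / 6 by field.
  exact: H.
apply: (le_trans H2); rewrite ler_pM2l//.
move: lJ'; case: (split_ordP l) => k ->.
  by rewrite /inv_min byblockl stack_paraml => ?; apply: q1P; rewrite inE.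
by rewrite /inv_min byblockr stack_paramr => ?; apply: q2P; rewrite inE.
Qed.

Lemma om_inv_min_Q l : om l / 2 + 2 * om l * inv_min l <= Q.
Proof.
case: (split_ordP l) => k ->.
  by rewrite om_l /inv_min byblockl LQ.
by rewrite om_r /inv_min byblockr MQ.
Qed.

Lemma score_v_Q l : l \in J -> `|score Z (err e) l| + v l <= 3 / 5 * Q.
Proof.
move=> lJ; have := v_on_J lJ; have := om_inv_min_Q l; have := score_small l.
have := om_gt0 l; lra.
Qed.

(** A false positive is a covariate, and its first-step estimate is itself a part of the
    first-step error. *)
Lemma v_off_J l : l \in A :\: J ->
  [/\ 0 < l2norm (bh - bs), L / l2norm (bh - bs) <= v l & exists k, l = lshift N k].
Proof.
move=> /[dup] lAJ /A_off_J[k lk bk]; move: lAJ; rewrite lk finset.in_setD => /andP[kJ _].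
have bs0 : bs k 0 = 0.
  by move: kJ; rewrite in_joint_supp negbK stack_paraml => /eqP.
have be : `|bh k 0| <= l2norm (bh - bs).
  by rewrite l2norm_norm2; apply: le_trans (abs_le_norm2 _ k); rewrite !mxE bs0 subr0.
have b0 : 0 < `|bh k 0| by rewrite normr_gt0.
have e0 := lt_le_trans b0 be; split=> //; last by exists k.
rewrite /v /adaptive_penalty byblockl stack_paraml rate_l.
have -> : lam / `|bh k 0| / Num.sqrt (N * T)%:R = L / `|bh k 0| by rewrite mulrAC.
by rewrite ler_pM2l ?L_gt0// lef_pV2 ?posrE.
Qed.

(** The first-step error is at most 1/6 of the smallest active coefficient. *)
Lemma inv_error_q1 : 0 < l2norm (bh - bs) -> 6 * q1 <= (l2norm (bh - bs))^-1.
Proof.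
move=> e0; have [->|[k kJ ->]] := q1_attained; first by rewrite mulr0 invr_ge0 ltW.
have k0 : 0 < `|bs k 0| by rewrite normr_gt0; move: kJ; rewrite inE.
rewrite -[X in X * _]invrK -invfM lef_pV2 ?posrE//; last by rewrite mulr_gt0.
have := bmin kJ; have := hhat_error_b; have := hhat_l2 => H1 H2 H3.
by rewrite -(ler_pM2l sqNT_gt0); lra.
Qed.

(** As for q1; the block c has the smaller rate sqrt T, which is at most sqrt(NT). *)
Lemma inv_error_q2 : 0 < l2norm (bh - bs) -> 6 * q2 <= (l2norm (bh - bs))^-1.
Proof.
move=> e0; have [->|[i iJ ->]] := q2_attained; first by rewrite mulr0 invr_ge0 ltW.
have k0 : 0 < `|cs i 0| by rewrite normr_gt0; move: iJ; rewrite inE.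
rewrite -[X in X * _]invrK -invfM lef_pV2 ?posrE//; last by rewrite mulr_gt0.
have := cmin iJ; have := hhat_error_b; have := hhat_l2 => H1 H2 H3.
have TNT : Num.sqrt T%:R <= Num.sqrt (N * T)%:R :> R.
  by rewrite ler_wsqrtr// ler_nat leq_pmull.
have TNTe := ler_wpM2r (ltW e0) TNT.
by rewrite -(ler_pM2l sqT_gt0); lra.
Qed.

Lemma tau_phi : tau * s <= phi / 200.
Proof.
have s0 : 0 <= tau * s by rewrite mulr_ge0.
have r1 : 1 <= rho ^+ 2 by rewrite exprn_ege1.
have := ler_wpM2l s0 r1; have := tau_small; have := k2_phi; lra.
Qed.

Section BetaPart.
Variable K1 : R.
Hypothesis K1_ge0 : 0 <= K1.
Hypothesis signal_b : forall k, k \in supp bs ->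
  2 * Num.sqrt s * Q / phi <= Num.sqrt (N * T)%:R * `|bs k 0|.
Hypothesis corr_b : 0 < l2norm (bh - bs) ->
  2 * s * K1 / phi * Q + lam / 2 <= lam / l2norm (bh - bs).
Hypothesis K1_large : supp bs != finset.set0 -> (~: supp bs)%SET != finset.set0 ->
  forall a b, `|Gam a b| + tau <= K1 / Num.sqrt (N * T)%:R.

(** The bound B on the correlations between false positives and J is K1 / sqrt(NT) if
    some covariate is active.  If only dummies are active, the correlations are at most
    tau, since Gam decouples the dummies, and the correlation inequality
    serves only to make the first-step error at most 2. *)
Lemma sign_beta : sgnv bt = sgnv bs.
Proof.
pose B := if supp bs == finset.set0 then tau else K1 / Num.sqrt (N * T)%:R.
have B0 : 0 <= B by rewrite /B; case: ifP => // _; rewrite divr_ge0 ?sqrtr_ge0.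
have gB k l : k \in A :\: J -> l \in J -> `|gram Z k l| <= B.
  move=> kA lJ; rewrite /B; have [b0|bn0] := eqVneq (supp bs) finset.set0.
    have [j kj bj] := A_off_J kA; move: lJ; case: (split_ordP l) => i ->.
      have : i \notin supp bs by rewrite b0 inE.
      by rewrite in_joint_supp stack_paraml inE negbK => ->.
    rewrite kj => _; have := @gram_r_off i (lshift N j); rewrite eq_lrshift => /(_ isT).
    by rewrite /gram; under eq_bigr do rewrite mulrC.
  have cn0 : (~: supp bs)%SET != finset.set0.
    have [j kj bj] := A_off_J kA; apply/set0Pn; exists j; rewrite !inE negbK.
    by move: kA; rewrite kj inE => /andP[]; rewrite in_joint_supp negbK stack_paraml.
  apply: le_trans (K1_large bn0 cn0 k l); have := close k l.
  have := ler_normD (gram Z k l - Gam k l) (Gam k l); rewrite subrK; lra.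
have vB k : k \in A :\: J -> B * (2 * s * Q / phi) + `|score Z (err e) k| < v k.
  move=> kA; have [e0 ve [j kj]] := v_off_J kA; apply: lt_le_trans ve.
  have S := score_small k; rewrite kj om_l in S; rewrite kj.
  have L0 := L_gt0; have C := corr_b e0.
  set e1 := l2norm _ in e0 C *.
  have C' : 2 * s * K1 / phi * Q / Num.sqrt (N * T)%:R + L / 2 <= L / e1.
    have -> : L / e1 = lam / e1 / Num.sqrt (N * T)%:R by rewrite mulrAC.
    have -> : 2 * s * K1 / phi * Q / Num.sqrt (N * T)%:R + L / 2 =
      (2 * s * K1 / phi * Q + lam / 2) / Num.sqrt (N * T)%:R by ring.
    by rewrite ler_wpM2r// invr_ge0 ltW// sqNT_gt0.
  rewrite /B; have [b0|bn0] := eqVneq (supp bs) finset.set0; last first.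
    have -> : K1 / Num.sqrt (N * T)%:R * (2 * s * Q / phi) = 2 * s * K1 / phi * Q / Num.sqrt (N * T)%:R by ring.
    lra.
  (* Only dummies are active, so B = tau; tau * s * rho^2 <= k2 / 200 and the
     comparison of weights through rho replace the bound on the correlations. *)
  have e_half : 2^-1 <= e1^-1.
    have P : 0 <= 2 * s * K1 / phi * Q / Num.sqrt (N * T)%:R.
      by have Q0 := ltW Q_gt0; have p0 := ltW phi_gt0; rewrite !mulr_ge0 ?invr_ge0 ?sqrtr_ge0.
    by rewrite -(ler_pM2l L0); lra.
  have e_q2 := inv_error_q2 e0; rewrite -/e1 in e_q2.
  have q10 : q1 = 0 by case: q1_attained => // -[j']; rewrite b0 inE.
  have rL : L <= rho * L by rewrite ler_peMl// ltW.
  have rM : Mu <= rho * L.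
    by have := om_rho (rshift p (Ordinal hN)) (lshift N j); rewrite om_l om_r.
  have QL : Q <= rho * L * (1 / 2 + 2 * q2).
    rewrite /Q q10 mulr0 mulrDr; apply: lerD.
      by rewrite ge_max; apply/andP; split; lra.
    rewrite ge_max; apply/andP; split; first by rewrite !mulr_ge0// ltW.
    by have := ler_wpM2r q2_ge0 rM; lra.
  have ts : tau * s * rho <= phi / 200.
    have s0 : 0 <= tau * s * rho by rewrite !mulr_ge0// ltW.
    by have := ler_wpM2l s0 rho_ge1'; have := tau_small; have := k2_phi; rewrite expr2; lra.
  have B1 : tau * (2 * s * Q / phi) <= L * (1 / 2 + 2 * q2) / 100.
    have -> : tau * (2 * s * Q / phi) = 2 * (tau * s) * Q / phi by ring.
    rewrite ler_pdivrMr//.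
    have w0 : 0 <= 2 * (tau * s) by rewrite !mulr_ge0.
    apply: (le_trans (ler_wpM2l w0 QL)).
    have w1 : 0 <= L * (1 / 2 + 2 * q2) by rewrite mulr_ge0 ?ltW//; have := q2_ge0; lra.
    by have := ler_wpM2l w1 ts; lra.
  have B2 : L * (1 / 4 + 3 * q2) <= L / e1 by rewrite ler_pM2l//; lra.
  have := mulr_ge0 (ltW L0) q2_ge0; lra.
have hJ : supported A (restr J htil).
  move=> l lA; rewrite /restr; case: ifP => // lJ.
  by rewrite (fintype.subsetP J_sub_A _ lJ) in lA.
have args := second_step_support tau_ge0 J0 close theta_offJ htilA v_ge0 Q_gt0 score_v_Q
  adaptive_min0 phi_gt0 phiP tau_phi B0 gB vB (adaptive_min hJ).
have errs := second_step_error tau_ge0 J0 close theta_offJ htilA v_ge0 Q_gt0 score_v_Q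
  adaptive_min0 phi_gt0 phiP tau_phi B0 gB vB (adaptive_min hJ).
apply/colP => k; rewrite !mxE.
have [kJ|kJ] := boolP (k \in supp bs).
  apply: sgr_near; have := lt_le_trans (errs (lshift N k)) (signal_b kJ).
  rewrite /htil /scaled_error rate_l !stack_paraml normrM (gtr0_norm sqNT_gt0).
  by rewrite ltr_pM2l// sqNT_gt0.
have kJ' : lshift N k \notin J by move: kJ; rewrite in_joint_supp stack_paraml inE.
by have /eqP := args _ kJ'; rewrite scaled_error_eq0// !stack_paraml => /eqP ->.
Qed.

End BetaPart.

Section DummyPart.
Variable K2 : R.
Hypothesis K2_ge0 : 0 <= K2.
Hypothesis signal_c : forall i, i \in supp cs ->
  2 * Num.sqrt s * Q / phi <= Num.sqrt T%:R * `|cs i 0|.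
Hypothesis corr_c : 0 < l2norm (ch - cs) ->
  2 * s * K2 / phi * Q + mu / 2 <= mu / l2norm (ch - cs).
Hypothesis phi_le1 : supp cs != finset.set0 -> phi <= 1.
Hypothesis tau_N : 1 <= Num.sqrt N%:R * tau.

Lemma ctil_off i : i \notin supp cs -> ct i 0 = 0.
Proof.
move=> iJ; have [_ fc] := feasibleP; apply: fc; rewrite inE negbK.
have [->//] := hhat_r i; move: iJ; rewrite inE.
by rewrite in_joint_supp stack_paramr.
Qed.

(** The first step leaves an error of at least M / (2 sqrt T) at an active dummy, while
    the correlation inequality bounds that error by 2. *)
Lemma Mu_le i : i \in supp cs -> Mu <= 4 * Num.sqrt T%:R.
Proof.
move=> iJ; have iJ' : rshift p i \in J by rewrite in_joint_supp stack_paramr; move: iJ; rewrite inE.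
have [_ /(_ iJ')] := hhat_r i.
rewrite /hhat /scaled_error rate_r !stack_paramr normrM (gtr0_norm sqT_gt0) => H.
have He : `|ch i 0 - cs i 0| <= l2norm (ch - cs).
  by rewrite l2norm_norm2; apply: le_trans (abs_le_norm2 _ i); rewrite !mxE.
have M0 := Mu_gt0.
have e0 : 0 < l2norm (ch - cs).
  apply: lt_le_trans He; rewrite -(pmulr_rgt0 _ sqT_gt0); lra.
have P : 0 <= 2 * s * K2 / phi * Q by have Q0 := ltW Q_gt0; have p0 := ltW phi_gt0; rewrite !mulr_ge0 ?invr_ge0.
have C := corr_c e0; have : 2^-1 <= (l2norm (ch - cs))^-1.
  by rewrite -(ler_pM2l mu_gt0); lra.
rewrite lef_pV2 ?posrE// => e2; have := ler_wpM2l (ltW sqT_gt0) (le_trans He e2); lra.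
Qed.

(** The l2-bound of the first step, with M <= 4 sqrt T and with the factor sqrt N by which
    sqrt(NT) exceeds sqrt T; tau_N gives kappa^2 sqrt N >= 200 s rho. *)
Lemma error_b_le i : i \in supp cs -> l2norm (bh - bs) <= 1 / 20.
Proof.
move=> iJ; have M4 := Mu_le iJ.
have H := first_step_l2 tau_ge0 rho_gt0 om_gt0 om_rho J0 close compat tau_small score_small
   theta_offJ (lasso_min (fun=> 0)).
have S := sqrt_weights_le J rho_gt0 om_gt0 om_rho (rshift p i); rewrite om_r in S.
have E := hhat_error_b.
have sN : 0 < Num.sqrt N%:R :> R by rewrite sqrtr_gt0 ltr0n.
have s1 : 1 <= s by apply: cardJ_ge1.
have ss : Num.sqrt s <= s.
  rewrite -[X in _ <= X](sqr_sqrtr (ler0n _ _)) expr2 ler_peMr ?sqrtr_ge0//.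
  by rewrite -[X in X <= _]sqrtr1 ler_wsqrtr.
have sNT : Num.sqrt (N * T)%:R = Num.sqrt N%:R * Num.sqrt T%:R :> R.
  by rewrite natrM sqrtrM.
have r0 := rho_gt0; have r1 := rho_ge1'.
have K : 200 * (s * rho) <= k2 * Num.sqrt N%:R.
  have sr : 0 <= s * rho by rewrite mulr_ge0 // ltW.
  have a1 := ler_wpM2l sr r1.
  have a2 : 0 <= s * rho * rho by rewrite !mulr_ge0 // ltW.
  have a3 := ler_wpM2l a2 tau_N.
  have a4 := ler_wpM2l (ltW sN) tau_small.
  move: a4; rewrite expr2; lra.
have rs : rho * Num.sqrt s <= rho * s by rewrite ler_wpM2l// ltW.
have T0 := sqT_gt0.
have B1 : k2 * norm2 hhat <= 10 * (rho * s) * Num.sqrt T%:R.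
  apply: (le_trans H); apply: (@le_trans _ _ (5 / 2 * (rho * Mu * Num.sqrt s))).
    by rewrite ler_pM2l//; lra.
  have -> : 5 / 2 * (rho * Mu * Num.sqrt s) = 5 / 2 * ((rho * Num.sqrt s) * Mu) by ring.
  have r2 : 0 <= rho * Num.sqrt s by rewrite mulr_ge0 ?sqrtr_ge0// ltW.
  have := ler_wpM2l r2 M4; have := ler_wpM2r (ltW T0) rs; lra.
have B2 : k2 * (Num.sqrt (N * T)%:R * l2norm (bh - bs)) <= 10 * (rho * s) * Num.sqrt T%:R.
  by apply: le_trans B1; rewrite ler_pM2l.
have B3 : (k2 * Num.sqrt (N * T)%:R) * l2norm (bh - bs) <= (k2 * Num.sqrt (N * T)%:R) * (1 / 20).
  rewrite -mulrA; apply: (le_trans B2).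
  have := ler_wpM2r (ltW T0) K; rewrite sNT; lra.
by rewrite -(ler_pM2l (mulr_gt0 k2_gt0 sqNT_gt0)).
Qed.

(** False positives are excluded by the first step, and |h_i| < Q at an active dummy; Q is
    below the threshold of the signal inequality since phi <= 1 <= s. *)
Lemma sign_dummy : sgnv ct = sgnv cs.
Proof.
apply/colP => i; rewrite !mxE.
have [iJ|iJ] := boolP (i \in supp cs); last first.
  by rewrite ctil_off//; move: iJ; rewrite inE negbK => /eqP ->.
have cn0 : supp cs != finset.set0 by apply/set0Pn; exists i.
apply: sgr_near.
have iJ' : rshift p i \in J by rewrite in_joint_supp stack_paramr; move: iJ; rewrite inE.
have W0 : 0 < 1 / 16 + 6 / 5 * (q1 + q2) by have := q1_ge0; have := q2_ge0; lra.
have qm l : inv_min l <= q1 + q2.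
  by rewrite /inv_min /byblock; case: fintype.split => _; have := q1_ge0; have := q2_ge0; lra.
have vJ l : l \in J -> `|score Z (err e) l| + v l <= (1 / 16 + 6 / 5 * (q1 + q2)) * om l.
  move=> lJ; have := v_on_J lJ; have := score_small l.
  have := ler_wpM2l (ltW (om_gt0 l)) (qm l); lra.
have vA l : l \in A :\: J ->
    (1 / 16 + 6 / 5 * (q1 + q2)) * om l <= 3 * (v l - `|score Z (err e) l|).
  move=> lA; have [e0 ve [j kj]] := v_off_J lA.
  have S := score_small l; rewrite kj om_l in S ve *.
  have e1 := error_b_le iJ; have eq1 := inv_error_q1 e0; have eq2 := inv_error_q2 e0.
  have e20 : 20 <= (l2norm (bh - bs))^-1.
    rewrite -[X in X <= _]invrK lef_pV2 ?posrE ?invr_gt0//.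
    by apply: (le_trans e1); rewrite div1r.
  have L0 := L_gt0.
  have : L * (1 / 6 + 2 * q1 + 2 * q2) <= L / l2norm (bh - bs) by rewrite ler_pM2l//; lra.
  have := mulr_ge0 (ltW L0) q2_ge0; have := mulr_ge0 (ltW L0) q1_ge0; lra.
have supd d : supported A (shift_coord htil (rshift p i) d).
  move=> l lA; rewrite /shift_coord; case: eqP => [le|_]; last exact: htilA.
  by move: lA; rewrite le (fintype.subsetP J_sub_A _ iJ').
have := second_step_coordinate tau_ge0 rho_gt0 om_gt0 om_rho J0 close compat tau_small theta_offJ
  htilA v_ge0 Q_gt0 score_v_Q adaptive_min0 W0 vJ vA iJ' (gram_rr i) (@gram_r_off i)
  (fun d => adaptive_min (@supd d)).
rewrite /htil /scaled_error rate_r !stack_paramr normrM (gtr0_norm sqT_gt0) => H.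
have Q0 := Q_gt0.
have s1 : 1 <= Num.sqrt s.
  by rewrite -[X in X <= _]sqrtr1 ler_wsqrtr//; apply: cardJ_ge1.
have QQ : Q <= 2 * Num.sqrt s * Q / phi.
  rewrite ler_pdivlMr//; have := ler_wpM2l (ltW Q0) (phi_le1 cn0).
  have := ler_wpM2l (ltW Q0) s1; lra.
by rewrite -(ltr_pM2l sqT_gt0); apply: (lt_le_trans H); apply: (le_trans QQ); apply: signal_c.
Qed.

End DummyPart.
End Outcome.

(** * The smallest eigenvalue of a symmetric matrix *)

Section Rayleigh.
Context {R : realType}.

Lemma continuous_bigsum (T : topologicalType) (I : Type) (s : seq I) (F : I -> T -> R) :
  (forall i, continuous (F i)) -> continuous (fun u => \sum_(i <- s) F i u).
Proof.
move=> cF; elim: s => [|i s IH].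
  have -> : (fun u => \sum_(i <- [::]) F i u) = cst 0.
    by apply/funext => u; rewrite big_nil.
  by move=> u; exact: cst_continuous.
have -> : (fun u => \sum_(j <- i :: s) F j u) = (fun u => F i u + \sum_(j <- s) F j u).
  by apply/funext => u; rewrite big_cons.
by move=> u; apply: cvgD; [exact: cF|exact: IH].
Qed.

Variable n : nat.
Implicit Types (M : 'M[R]_n) (u v c : 'rV[R]_n).

Local Notation qf M u := (qform M (fun i => u 0 i)).
Local Notation sq u := (\sum_i u 0 i ^+ 2).

Lemma qform_continuous M : continuous (fun u : 'rV[R]_n => qf M u).
Proof.
apply: continuous_bigsum => a; apply: continuous_bigsum => b u.
have cc (j : 'I_n) : (fun v : 'rV[R]_n => v 0 j) @ u --> u 0 j by exact: coord_continuous.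
exact: (cvgM (cvg_cst (M a b)) (cvgM (cc a) (cc b))).
Qed.

Lemma sq_continuous : continuous (fun u : 'rV[R]_n => sq u).
Proof.
apply: continuous_bigsum => a.
have -> : (fun u : 'rV[R]_n => u 0 a ^+ 2) = (fun u => u 0 a * u 0 a).
  by apply/funext => u; rewrite expr2.
move=> u; have cc : (fun v : 'rV[R]_n => v 0 a) @ u --> u 0 a by exact: coord_continuous.
exact: (cvgM cc cc).
Qed.

Lemma sphere_compact : compact [set u : 'rV[R]_n | sq u = 1].
Proof.
have K : compact [set v : 'rV[R]_n | forall i, v ord0 i \in `[(-1 : R), 1]].
  apply: (@rV_compact _  _ (fun=> `[(-1 : R), 1]%classic)).
  by move=> _; apply: segment_compact.
apply: (subclosed_compact _ K).
  apply: (@preimage_closed _ _ (fun u : 'rV[R]_n => sq u) [set 1]).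
    by move=> u _; exact: sq_continuous.
  exact: closed_eq.
move=> u /= u1 i; rewrite in_itv /= -ler_norml -(@ler_pXn2r _ 2)// ?nnegrE//.
rewrite expr1n real_normK ?num_real// -u1 (bigD1 i)//= lerDl sumr_ge0// => j _.
exact: sqr_ge0.
Qed.

Lemma qform_row M u v : qform M (fun i => (u + v) 0 i) =
  qf M u + qf M v + \sum_a \sum_b (M a b + M b a) * (u 0 a * v 0 b).
Proof.
have -> : \sum_a \sum_b (M a b + M b a) * (u 0 a * v 0 b) =
   \sum_a \sum_b M a b * (u 0 a * v 0 b) + \sum_a \sum_b M a b * (v 0 a * u 0 b).
  rewrite [X in _ + X]exchange_big /= -big_split; apply: eq_bigr => a _.
  rewrite -big_split; apply: eq_bigr => b _ /=; ring.
rewrite /qform -!big_split; apply: eq_bigr => a _; rewrite -!big_split.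
by apply: eq_bigr => b _ /=; rewrite !mxE; ring.
Qed.

Lemma qform_scale M (t : R) u : qform M (fun i => (t *: u) 0 i) = t ^+ 2 * qf M u.
Proof.
rewrite /qform mulr_sumr; apply: eq_bigr => a _; rewrite mulr_sumr.
by apply: eq_bigr => b _; rewrite !mxE; ring.
Qed.

(** A null vector of a positive semidefinite form is in the kernel: perturb it in the
    direction c *m M. *)
Lemma psd_kernel M c : (forall a b, M a b = M b a) -> (forall u, 0 <= qf M u) ->
  qf M c = 0 -> c *m M = 0.
Proof.
move=> sM psd c0.
set w := c *m M.
have cross t : 0 <= 2 * t * sq w + t ^+ 2 * qf M w.
  have E : \sum_a \sum_b (M a b + M b a) * (c 0 a * (t *: w) 0 b) = 2 * t * sq w.
    rewrite exchange_big /= mulr_sumr; apply: eq_bigr => b _.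
    have -> : w 0 b ^+ 2 = (\sum_a c 0 a * M a b) * w 0 b by rewrite expr2 {1}/w mxE.
    rewrite mulr_suml mulr_sumr; apply: eq_bigr => a _; rewrite (sM b a) [(t *: w) 0 b]mxE; ring.
  by have := psd (c + t *: w); rewrite qform_row c0 add0r qform_scale E; lra.
have w0 : sq w = 0.
  apply/eqP; rewrite eq_le; apply/andP; split; last first.
    by apply: sumr_ge0 => i _; exact: sqr_ge0.
  rewrite leNgt; apply/negP => wp.
  pose B := qf M w + 1; have Bp : 0 < B by rewrite ltr_wpDl// psd.
  have := cross (- (sq w / B)).
  have -> : 2 * - (sq w / B) * sq w + (- (sq w / B)) ^+ 2 * qf M w =
     (sq w) ^+ 2 / B * (qf M w / B - 2) by field; rewrite gt_eqF.
  rewrite leNgt => /negP; apply; rewrite pmulr_rlt0 ?divr_gt0 ?exprn_gt0// subr_lt0.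
  rewrite ltr_pdivrMr// /B; have := psd w; lra.
apply/rowP => i; rewrite [RHS]mxE -/w; apply/eqP; rewrite -sqrf_eq0.
have /eqP := w0; rewrite psumr_eq0; last by move=> j _; exact: sqr_ge0.
by move=> /allP/(_ i (mem_index_enum _)).
Qed.

(** The form attains its minimum m on the compact unit sphere, and the minimiser is a
    null vector of the positive semidefinite matrix M - m. *)
Lemma min_eigenvalue M : (0 < n)%N -> (forall a b, M a b = M b a) ->
  exists m : R, [/\ exists2 v : 'rV[R]_n, v != 0 & v *m M = m *: v,
     forall u : 'rV[R]_n, m * sq u <= qf M u & exists2 v : 'rV[R]_n, sq v = 1 & qf M v = m].
Proof.
move=> n0 sM; have S0 : [set u : 'rV[R]_n | sq u = 1] !=set0.
  exists (delta_mx 0 (Ordinal n0)) => /=; rewrite (bigD1 (Ordinal n0))//= big1 => [|j jn].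
    by rewrite mxE !eqxx addr0 expr1n.
  by rewrite mxE (negbTE jn) andbF expr0n.
have [c cS Hc] := compact_EVT_min S0 sphere_compact
  (@continuous_subspaceT _ _ _ _ (@qform_continuous M)).
have c1 : sq c = 1 by move: cS; rewrite inE.
have low u : qf M c * sq u <= qf M u.
  have [u0|un0] := eqVneq (sq u) 0.
    have z i : u 0 i = 0.
      apply/eqP; rewrite -sqrf_eq0; have /eqP := u0.
      rewrite psumr_eq0; last by move=> j _; exact: sqr_ge0.
      by move=> /allP/(_ i (mem_index_enum _)).
    rewrite u0 mulr0 /qform big1// => a _; rewrite big1// => b _.
    by rewrite z mul0r mulr0.
  have up : 0 < sq u by rewrite lt_neqAle eq_sym un0 sumr_ge0// => i _; exact: sqr_ge0.
  have : \sum_i ((Num.sqrt (sq u))^-1 *: u) 0 i ^+ 2 = 1.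
    under eq_bigr do rewrite mxE exprMn; rewrite -mulr_sumr exprVn sqr_sqrtr ?ltW//.
    by rewrite mulVf.
  move=> E; have H : qf M c <= (sq u)^-1 * qf M u.
    have -> : (sq u)^-1 * qf M u = qf M ((Num.sqrt (sq u))^-1 *: u).
      by rewrite qform_scale exprVn sqr_sqrtr ?ltW.
    by apply: Hc; rewrite inE.
  by rewrite -(ler_pM2l up) mulrA mulfV// mul1r mulrC in H.
have qI (m : R) u : qf (m%:M) u = m * sq u.
  rewrite /qform mulr_sumr; apply: eq_bigr => a _.
  rewrite (bigD1 a)//= big1 ?addr0; first by rewrite !mxE eqxx expr2.
  by move=> b ba; rewrite !mxE eq_sym (negbTE ba) mulr0n mul0r.
have qB u : qf (M - (qf M c)%:M) u = qf M u - qf M c * sq u.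
  rewrite -qI /qform -sumrB; apply: eq_bigr => a _; rewrite -sumrB.
  by apply: eq_bigr => b _; rewrite -mulrBl; congr (_ * _); rewrite !mxE.
exists (qf M c); split => //; last by exists c.
exists c.
  apply/eqP => c0; move: c1; rewrite c0 big1 => [/eqP|i _]; last by rewrite mxE expr0n.
  by rewrite eq_sym oner_eq0.
apply/eqP; rewrite -subr_eq0 -mul_mx_scalar -mulmxBr; apply/eqP.
apply: psd_kernel => [a b|u|]; first by rewrite !mxE sM eq_sym.
  by rewrite qB subr_ge0.
by rewrite qB c1 mulr1 subrr.
Qed.

Lemma phi_minP M : (0 < n)%N -> (forall a b, M a b = M b a) ->
  exists m : R, [/\ phi_min M = m%:E, forall u : 'rV[R]_n, m * sq u <= qf M u &
    exists2 v : 'rV[R]_n, sq v = 1 & qf M v = m].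
Proof.
move=> n0 sM; have [m [[v v0 vM] low at_]] := min_eigenvalue n0 sM.
exists m; split => //; apply/eqP; rewrite eq_le; apply/andP; split.
  by apply: ereal_inf_lbound; exists m => //=; apply/eigenvalueP; exists v.
apply: le_ereal_inf_tmp => _ [z /eigenvalueP[u uM u0] <-]; rewrite lee_fin.
have un : sq u != 0.
  apply: contra u0 => /eqP u0; apply/eqP/rowP => i; rewrite mxE.
  apply/eqP; rewrite -sqrf_eq0; have /eqP := u0.
  rewrite psumr_eq0; last by move=> j _; exact: sqr_ge0.
  by move=> /allP/(_ i (mem_index_enum _)).
have up : 0 < sq u by rewrite lt_neqAle eq_sym un sumr_ge0// => i _; exact: sqr_ge0.
rewrite -(ler_pM2r up); apply: (le_trans (low u)); rewrite le_eqVlt; apply/orP; left; apply/eqP.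
rewrite /qform exchange_big mulr_sumr; apply: eq_bigr => b _ /=.
have := congr1 (fun w : 'rV[R]_n => w 0 b) uM; rewrite !mxE => E.
rewrite expr2 mulrA -E mulr_suml; apply: eq_bigr => a _; ring.
Qed.

End Rayleigh.

(** * Powers of sums of two numbers *)

Section Powers.
Context {R : realType}.
Implicit Types a b x y r s : R.

Lemma powR_young s a b : 1 <= s -> 0 <= a -> 0 <= b ->
  s * (a `^ (s - 1) * b) <= b `^ s + (s - 1) * a `^ s.
Proof.
move=> s1 a0 b0; have s0 : 0 < s by rewrite (lt_le_trans ltr01).
have [s_1|sn1] := eqVneq s 1.
  by rewrite s_1 subrr powRr0 mul0r !mul1r addr0 powRr1.
have s10 : 0 < s - 1 by rewrite subr_gt0 lt_neqAle eq_sym sn1.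
have := @conjugate_powR R b (a `^ (s - 1)) s (s / (s - 1)) b0 (powR_ge0 _ _) s0.
rewrite divr_gt0// -powRrM => /(_ isT).
have -> : (s - 1) * (s / (s - 1)) = s by field; rewrite gt_eqF.
have -> : s^-1 + (s / (s - 1))^-1 = 1 by field; rewrite !gt_eqF.
move=> /(_ erefl) H; have := ler_wpM2l (ltW s0) H.
have -> : s * (b `^ s / s + a `^ s / (s / (s - 1))) = b `^ s + (s - 1) * a `^ s.
  by field; rewrite !gt_eqF.
by rewrite (mulrC b).
Qed.

(** The derivative of |.|^r is r times this function. *)
Definition spow r x : R := Num.sg x * `|x| `^ (r - 1).

Lemma spowN r x : spow r (- x) = - spow r x.
Proof. by rewrite /spow sgrN normrN mulNr. Qed.

Lemma spow_ge0 r x : 0 <= x -> 1 < r -> spow r x = x `^ (r - 1).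
Proof.
move=> x0 r1; rewrite /spow; have [->|xn0] := eqVneq x 0.
  by rewrite sgr0 mul0r powR0// gt_eqF// subr_gt0.
by rewrite gtr0_sg ?lt_neqAle ?(eq_sym 0) ?xn0// mul1r ger0_norm.
Qed.

Lemma spow_mul r x : 0 < r -> spow r x * x = `|x| `^ r.
Proof.
move=> r0; rewrite /spow mulrAC -normrEsg.
by rewrite mulr_powRB1.
Qed.

Lemma powR_abs_tangent r x z : 1 <= r ->
  `|z| `^ r + r * spow r z * (x - z) <= `|x| `^ r.
Proof.
move=> r1; have r0 : 0 < r by rewrite (lt_le_trans ltr01).
rewrite mulrBr -(mulrA r _ z) spow_mul//.
have := powR_young r1 (normr_ge0 z) (normr_ge0 x).
have : spow r z * x <= `|z| `^ (r - 1) * `|x|.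
  apply: (le_trans (ler_norm _)); rewrite normrM ler_wpM2r// /spow normrM (ger0_norm (powR_ge0 _ _)).
  by rewrite ler_piMl ?powR_ge0// normr_sg; case: (z != 0).
move=> H; have := ler_wpM2l (ltW r0) H; lra.
Qed.

Lemma powR_incr q a b m : 1 <= q -> 0 <= a -> a <= b -> b <= m ->
  b `^ q - a `^ q <= q * m `^ (q - 1) * (b - a).
Proof.
move=> q1 a0 ab bm; have b0 := le_trans a0 ab.
have Y := powR_young q1 b0 a0.
have E : b `^ q = b `^ (q - 1) * b.
  by rewrite mulrC mulr_powRB1// (lt_le_trans ltr01).
rewrite E in Y *.
have H : b `^ (q - 1) <= m `^ (q - 1).
  by apply: ge0_ler_powR => //; rewrite ?subr_ge0// nnegrE// (le_trans b0).
have ba : 0 <= q * (b - a) by rewrite mulr_ge0 ?subr_ge0// (le_trans ler01).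
by have := ler_wpM2l ba H; lra.
Qed.

Lemma spow_incr r x z m : 2 <= r -> `|x| <= m -> `|z| <= m ->
  (spow r z - spow r x) * (z - x) <= (r - 1) * m `^ (r - 2) * (z - x) ^+ 2.
Proof.
move=> r2 xm zm; have r1 : 1 < r by lra.
have q1 : 1 <= r - 1 by lra.
have r_2 : r - 2 = (r - 1) - 1 by ring.
have m0 : 0 <= m by apply: le_trans xm.
wlog xz : x z xm zm / x <= z.
  move=> H; have [|/ltW] := leP x z; first exact: H.
  by move=> /(H _ _ zm xm); rewrite -(sqrrN (z - x)) opprB -mulrNN !opprB.
have mq0 := powR_ge0 m (r - 1 - 1).
have pw a : 0 <= a -> a <= m -> a `^ (r - 1) <= m `^ (r - 1 - 1) * a.
  move=> a0 am; rewrite -(@mulr_powRB1 _ a (r - 1))//; last by lra.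
  rewrite mulrC ler_wpM2r//; apply: ge0_ler_powR => //; rewrite ?nnegrE//; lra.
have [x0|x0] := leP 0 x.
  have z0 := le_trans x0 xz.
  rewrite !spow_ge0// expr2 [leRHS]mulrA ler_wpM2r ?subr_ge0// r_2.
  by apply: powR_incr => //; rewrite -(ger0_norm z0).
have [z0|z0] := leP z 0.
  rewrite -[X in (_ - X) * _]opprK -spowN -[X in (X - _) * _]opprK -spowN opprK addrC.
  have nx : 0 <= - x by rewrite oppr_ge0 ltW.
  have nz : 0 <= - z by rewrite oppr_ge0.
  rewrite !spow_ge0// expr2 [leRHS]mulrA ler_wpM2r ?subr_ge0// r_2.
  have -> : z - x = (- x) - (- z) by ring.
  by apply: powR_incr; rewrite // ?oppr_ge0 ?lerN2// -(ltr0_norm x0).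
have nx : 0 <= - x by rewrite oppr_ge0 ltW.
rewrite (spow_ge0 (ltW z0))// -[spow r x]opprK -spowN spow_ge0// opprK.
rewrite expr2 [leRHS]mulrA ler_wpM2r ?subr_ge0// r_2.
have H1 := pw z (ltW z0); have H2 := pw (- x).
rewrite oppr_ge0 (ltW x0) -(ltr0_norm x0) in H2; rewrite -(ltr0_norm x0).
have H1' := H1 (le_trans (ler_norm z) zm); have H2' := H2 isT xm.
rewrite (ltr0_norm x0) in H2' *.
apply: (@le_trans _ _ (m `^ (r - 1 - 1) * (z - x))); first by lra.
by rewrite ler_wpM2r ?subr_ge0// ler_peMl.
Qed.

(** Second-order Taylor bound for |.|^r, from convexity and the monotonicity of the
    derivative. *)
Lemma powR_abs_taylor r x y : 2 <= r ->
  `|x + y| `^ r <= `|x| `^ r + r * spow r x * y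
     + r * (r - 1) * (`|x| + `|y|) `^ (r - 2) * y ^+ 2.
Proof.
move=> r2; have r0 : 0 <= r by lra.
have T := @powR_abs_tangent r x (x + y); rewrite opprD addrA subrr sub0r in T.
have xm : `|x| <= `|x| + `|y| by rewrite lerDl.
have I := spow_incr r2 xm (ler_normD x y).
have yE : x + y - x = y by ring.
rewrite yE in I.
have I' := ler_wpM2l r0 I.
have : `|x + y| `^ r + r * spow r (x + y) * - y <= `|x| `^ r by apply: T; lra.
lra.
Qed.

(** The growth factor 1 + e r / n is chosen so that its n-th power is at most e^(e r). *)
Definition burk_lin (n r : R) : R := expR 1 * r / n.
Definition burk_pow (n r : R) : R := r ^+ 2 * (2 * Num.sqrt (r * n)) `^ (r - 2).

Lemma burk_lin_ge0 n r : 0 <= n -> 0 <= r -> 0 <= burk_lin n r.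
Proof. by move=> n0 r0; rewrite divr_ge0// mulr_ge0// expR_ge0. Qed.

Lemma burk_pow_ge0 n r : 0 <= burk_pow n r.
Proof. by rewrite mulr_ge0 ?powR_ge0 ?sqr_ge0. Qed.

(** In the Taylor remainder either sqrt(r n) |y| <= |x|, and then |x| + |y| is |x| up to
    a factor 1 + 1/sqrt(r n) whose (r-2)-nd power is at most e; or |x| is dominated by
    |y| and the remainder is a multiple of |y|^r. *)
Lemma powR_abs_step (n r x y : R) : 2 <= r -> r <= n ->
  `|x + y| `^ r <= (1 + burk_lin n r) * `|x| `^ r + burk_pow n r * `|y| `^ r + r * (spow r x * y).
Proof.
move=> r2 rn; have r0 : 0 < r by lra.
have n0 : 0 < n by lra.
apply: (le_trans (powR_abs_taylor x y r2)).
suff : r * (r - 1) * (`|x| + `|y|) `^ (r - 2) * y ^+ 2 <=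
   burk_lin n r * `|x| `^ r + burk_pow n r * `|y| `^ r by lra.
set X := `|x|; set Y := `|y|; have X0 : 0 <= X := normr_ge0 _; have Y0 : 0 <= Y := normr_ge0 _.
have -> : y ^+ 2 = Y ^+ 2 by rewrite /Y real_normK ?num_real.
have split2 a : 0 <= a -> a `^ r = a `^ (r - 2) * a ^+ 2.
  move=> a0; have h : (r - 2 + 2%:R == 0) ==> (a != 0) by rewrite subrK (gt_eqF r0).
  by rewrite -powR_mulrn// -(powRD h) subrK.
have lin0 : 0 <= burk_lin n r * X `^ r.
  by rewrite mulr_ge0 ?powR_ge0// burk_lin_ge0// ltW.
have pow0 : 0 <= burk_pow n r * Y `^ r.
  by rewrite mulr_ge0 ?powR_ge0// burk_pow_ge0.
have rr : r * (r - 1) <= r ^+ 2 by rewrite expr2 ler_pM2l//; lra.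
have XY0 : 0 <= (X + Y) `^ (r - 2) * Y ^+ 2 by rewrite mulr_ge0 ?powR_ge0 ?sqr_ge0.
rewrite -mulrA; apply: (le_trans (ler_wpM2r XY0 rr)).
have rn0 : 0 < r * n by rewrite mulr_gt0.
pose w := Num.sqrt (r * n); have w0 : 0 < w by rewrite sqrtr_gt0.
have w0' := ltW w0; have r0' := ltW r0; have r20 : 0 <= r - 2 by lra.
have w2 : w ^+ 2 = r * n by rewrite sqr_sqrtr// ltW.
have rw : r <= w.
  by rewrite -(@ler_pXn2r _ 2) ?nnegrE// w2 expr2 ler_pM2l.
have [XY|XY] := leP (w * Y) X.
- apply: le_trans (_ : burk_lin n r * X `^ r <= _); last by rewrite lerDl.
  have Yw : Y <= X / w by rewrite ler_pdivlMr// mulrC.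
  have sumle : X + Y <= (1 + w^-1) * X by rewrite mulrDl mul1r lerD2l mulrC.
  have w1 : 0 <= 1 + w^-1 by rewrite addr_ge0// invr_ge0.
  have P1 : (X + Y) `^ (r - 2) <= ((1 + w^-1) * X) `^ (r - 2).
    by apply: ge0_ler_powR => //; rewrite nnegrE ?addr_ge0// mulr_ge0.
  have E1 : (1 + w^-1) `^ (r - 2) <= expR 1.
    apply: (@le_trans _ _ (expR w^-1 `^ (r - 2))).
      apply: ge0_ler_powR; rewrite ?nnegrE ?expR_ge0 ?expR_ge1Dx//; lra.
    rewrite -expRM ler_expR mulrC ler_pdivrMr// mul1r; lra.
  rewrite powRM// in P1.
  have P2 : (X + Y) `^ (r - 2) <= expR 1 * X `^ (r - 2).
    by apply: (le_trans P1); rewrite ler_wpM2r ?powR_ge0.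
  have Y2 : Y ^+ 2 <= X ^+ 2 / (r * n).
    rewrite -w2 -exprVn -exprMn; apply: lerXn2r; rewrite ?nnegrE// divr_ge0// ltW.
  have P3 : (X + Y) `^ (r - 2) * Y ^+ 2 <= expR 1 * X `^ (r - 2) * (X ^+ 2 / (r * n)).
    by apply: ler_pM; rewrite ?powR_ge0 ?sqr_ge0.
  have := ler_wpM2l (sqr_ge0 r) P3 => /le_trans; apply.
  rewrite (split2 X)// /burk_lin le_eqVlt; apply/orP; left; apply/eqP.
  by field; rewrite !gt_eqF.
- apply: le_trans (_ : burk_pow n r * Y `^ r <= _); last by rewrite lerDr.
  have sumle : X + Y <= 2 * w * Y.
    have : 1 * Y <= w * Y by rewrite ler_wpM2r//; lra.
    lra.
  have P1 : (X + Y) `^ (r - 2) <= (2 * w * Y) `^ (r - 2).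
    by apply: ge0_ler_powR => //; rewrite nnegrE ?addr_ge0// !mulr_ge0.
  rewrite (powRM _ _ Y0) ?mulr_ge0// in P1.
  rewrite /burk_pow -mulrA ler_pM2l ?exprn_gt0// (split2 Y)// mulrA.
  by rewrite ler_wpM2r ?sqr_ge0.
Qed.

Definition burk_const : R := 4 * expR (expR 1).

Lemma burk_const_gt0 : 0 < burk_const.
Proof. by rewrite mulr_gt0 ?expR_gt0. Qed.

Lemma burk_const_ge2 : 2 <= burk_const.
Proof.
rewrite /burk_const; have := expR_ge1Dx (expR 1 : R); have := expR_ge0 (1 : R); lra.
Qed.

Lemma ln2_ge : 2^-1 <= ln 2 :> R.
Proof.
have := @le_ln1Dx R (- 2^-1); rewrite (_ : 1 + - 2^-1 = 2^-1); last by field.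
rewrite lnV ?posrE// => /(_ ltac:(lra)); lra.
Qed.

Lemma le_pow2 r : 0 <= r -> r <= 2 `^ r.
Proof.
move=> r0; have [->|rn0] := eqVneq r 0; first by rewrite powR_ge0.
have rp : 0 < r by rewrite lt_neqAle eq_sym rn0.
rewrite /powR pnatr_eq0 /=.
have ln2 := ln2_ge.
have h : 1 + r / 4 <= expR (r / 4) := expR_ge1Dx _.
have sq : (1 + r / 4) ^+ 2 <= expR (r / 2).
  have -> : r / 2 = 2%:R * (r / 4) by field.
  by rewrite expRM_natl; apply: lerXn2r; rewrite ?nnegrE ?expR_ge0//; lra.
apply: (@le_trans _ _ (expR (r / 2))).
  by apply: le_trans sq; have := sqr_ge0 (1 - r / 4); lra.
by rewrite ler_expR mulrC; have := ler_wpM2l r0 ln2; lra.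
Qed.

(** After n steps of the recursion suggested by [powR_abs_step] the moment has the size
    (C sqrt(r n))^r with an absolute constant C. *)
Lemma burk_bound (n : nat) r : 2 <= r -> r <= n%:R ->
  n%:R * burk_pow n%:R r * (1 + burk_lin n%:R r) ^+ n <=
  burk_const `^ r * (r * n%:R) `^ (r / 2).
Proof.
move=> r2 rn; have r0 : 0 < r by lra.
have n0 : 0 < n%:R :> R by lra.
have rn0 : 0 < r * n%:R by rewrite mulr_gt0.
have E : (1 + burk_lin n%:R r) ^+ n <= expR (expR 1) `^ r.
  have -> : expR (expR 1) `^ r = expR (burk_lin n%:R r) ^+ n.
    rewrite -expRM -expRM_natl /burk_lin; congr (expR _).
    by field; rewrite gt_eqF.
  apply: lerXn2r; rewrite ?nnegrE ?expR_ge0 ?expR_ge1Dx//.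
  by rewrite addr_ge0// burk_lin_ge0// ltW.
have P : n%:R * burk_pow n%:R r <= 4 `^ r * (r * n%:R) `^ (r / 2).
  have s0 : 0 <= Num.sqrt (r * n%:R) by exact: sqrtr_ge0.
  rewrite /burk_pow (powRM _ _ s0)//.
  have -> : Num.sqrt (r * n%:R) `^ (r - 2) = (r * n%:R) `^ (r / 2) / (r * n%:R).
    rewrite -(powR12_sqrt (ltW rn0)) -powRrM.
    have -> : 2^-1 * (r - 2) = r / 2 - 1 by field.
    by rewrite powRB ?(gt_eqF rn0) ?implybT// (powRr1 (ltW rn0)).
  set W := (r * n%:R) `^ (r / 2); have W0 : 0 <= W by exact: powR_ge0.
  have -> : n%:R * (r ^+ 2 * (2 `^ (r - 2) * (W / (r * n%:R)))) = r * 2 `^ (r - 2) * W.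
    by field; rewrite !gt_eqF.
  rewrite ler_wpM2r//.
  have -> : (4 : R) `^ r = 2 `^ r * 2 `^ r by rewrite -powRM//; congr (_ `^ _); ring.
  apply: ler_pM; rewrite ?powR_ge0 ?(ltW r0) ?le_pow2//; first exact: ltW.
  by apply: ler_powR; lra.
have n1 : 0 <= n%:R * burk_pow n%:R r.
  by rewrite mulr_ge0 ?burk_pow_ge0.
rewrite /burk_const powRM ?expR_ge0//.
rewrite [leRHS]mulrAC.
apply: ler_pM; [exact: n1| |exact: P|exact: E].
by rewrite exprn_ge0// addr_ge0// burk_lin_ge0// ltW.
Qed.

End Powers.

(** * A moment inequality for martingales *)

Section Integrals.
Context {d : measure_display} {Omega : measurableType d} {R : realType}.
Variable P : probability Omega R.
Implicit Types (U V : Omega -> R) (r : R).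

Lemma measurable_abs_powR U r : measurable_fun setT U ->
  measurable_fun setT (fun w => `|U w| `^ r).
Proof.
move=> mU; apply: (measurableT_comp (measurable_powR r)).
by apply: measurableT_comp.
Qed.

Lemma integrable_ge0_fun U : measurable_fun setT U -> (forall w, 0 <= U w) ->
  (\int[P]_w (U w)%:E < +oo)%E -> P.-integrable setT (EFin \o U).
Proof.
move=> mU U0 Ufin; apply/integrableP; split; first exact/measurable_EFinP.
by under eq_integral do rewrite /= ger0_norm//.
Qed.

Lemma integrable_abs_powR U r (A : R) : measurable_fun setT U ->
  (\int[P]_w (`|U w| `^ r)%:E <= A%:E)%E ->
  P.-integrable setT (fun w => (`|U w| `^ r)%:E).
Proof.
move=> mU H; apply: (@integrable_ge0_fun (fun w => `|U w| `^ r)).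
- exact: measurable_abs_powR.
- by move=> w; exact: powR_ge0.
- by apply: (le_lt_trans H); rewrite ltry.
Qed.

Lemma le_integral_real U V : measurable_fun setT U -> measurable_fun setT V ->
  (forall w, 0 <= U w) -> (forall w, U w <= V w) ->
  (\int[P]_w (U w)%:E <= \int[P]_w (V w)%:E)%E.
Proof.
move=> mU mV U0 UV; apply: ge0_le_integral => //.
- by move=> w _; rewrite lee_fin.
- exact/measurable_EFinP.
- exact/measurable_EFinP.
- by move=> w _; rewrite lee_fin.
Qed.

Lemma integrableZl_real U (k : R) : P.-integrable setT (EFin \o U) ->
  P.-integrable setT (fun w => (k * U w)%:E).
Proof.
move=> iU; have := @integrableZl _ _ _ P setT measurableT k _ iU.
by apply: eq_integrable => // w _; rewrite EFinM.
Qed.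

Lemma integralZl_real U (k : R) : P.-integrable setT (EFin \o U) ->
  (\int[P]_w (k * U w)%:E = k%:E * \int[P]_w (U w)%:E)%E.
Proof.
move=> iU; have := @integralZl _ _ _ P setT measurableT _ iU k.
by move=> <-; apply: eq_integral => w _; rewrite EFinM.
Qed.

Lemma spowE r (x : R) : 2 <= r -> spow r x = x * `|x| `^ (r - 2).
Proof.
move=> r2; rewrite /spow -(@mulr_powRB1 _ `|x| (r - 1))//; last by lra.
rewrite mulrA mulrC [RHS]mulrC -numEsg; congr (_ `^ _ * _); ring.
Qed.

Lemma measurable_spow U r : 2 <= r -> measurable_fun setT U ->
  measurable_fun setT (fun w => spow r (U w)).
Proof.
move=> r2 mU; under eq_fun do rewrite spowE//.
by apply: measurable_funM => //; exact: measurable_abs_powR.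
Qed.

Lemma powR_mixed r (a b : R) : 1 <= r -> 0 <= a -> 0 <= b ->
  a `^ (r - 1) * b <= a `^ r + b `^ r.
Proof.
move=> r1 a0 b0; have r0 : 0 < r by lra.
have [ab|ba] := leP a b.
  apply: (@le_trans _ _ (b `^ r)); last by rewrite lerDr powR_ge0.
  rewrite -(mulr_powRB1 b0 r0) mulrC ler_wpM2l//.
  by apply: ge0_ler_powR; rewrite ?nnegrE// subr_ge0.
apply: (@le_trans _ _ (a `^ r)); last by rewrite lerDl powR_ge0.
by rewrite -(mulr_powRB1 a0 r0) mulrC ler_wpM2r ?powR_ge0// ltW.
Qed.

Lemma integrable_spow_mul U V r (A B : R) : 2 <= r ->
  measurable_fun setT U -> measurable_fun setT V ->
  (\int[P]_w (`|U w| `^ r)%:E <= A%:E)%E ->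
  (\int[P]_w (`|V w| `^ r)%:E <= B%:E)%E ->
  P.-integrable setT (fun w => (spow r (U w) * V w)%:E).
Proof.
move=> r2 mU mV UA VB.
have := integrableD measurableT (integrable_abs_powR mU UA) (integrable_abs_powR mV VB).
apply: le_integrable => //.
  by apply/measurable_EFinP; apply: measurable_funM => //; exact: measurable_spow.
move=> w _; rewrite /= lee_fin normrM.
rewrite [leRHS]ger0_norm ?addr_ge0 ?powR_ge0//.
apply: le_trans (powR_mixed _ (normr_ge0 (U w)) (normr_ge0 (V w))); last by lra.
rewrite ler_wpM2r// /spow normrM (ger0_norm (powR_ge0 _ _)).
by rewrite ler_piMl ?powR_ge0// normr_sg; case: (_ != _).
Qed.

(** One step of the recursion for E|S_k|^r; the linear term of the Taylor bound has
    mean zero. *)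
Lemma moment_step (S D : Omega -> R) (n r A B : R) : 2 <= r -> r <= n ->
  measurable_fun setT S -> measurable_fun setT D ->
  (\int[P]_w (`|S w| `^ r)%:E <= A%:E)%E ->
  (\int[P]_w (`|D w| `^ r)%:E <= B%:E)%E ->
  (P.-integrable setT (fun w => (spow r (S w) * D w)%:E) ->
    \int[P]_w (spow r (S w) * D w)%:E = 0)%E ->
  (\int[P]_w (`|S w + D w| `^ r)%:E <= ((1 + burk_lin n r) * A + burk_pow n r * B)%:E)%E.
Proof.
move=> r2 rn mS mD SA DB orth.
have iSD := integrable_spow_mul r2 mS mD SA DB.
have iS := integrable_abs_powR mS SA; have iD := integrable_abs_powR mD DB.
have mSr : measurable_fun setT (fun w => `|S w| `^ r) by exact: measurable_abs_powR.
have mDr : measurable_fun setT (fun w => `|D w| `^ r) by exact: measurable_abs_powR.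
have mSDr : measurable_fun setT (fun w => spow r (S w) * D w).
  by apply: measurable_funM => //; exact: measurable_spow.
have i1 := integrableZl_real (1 + burk_lin n r) iS.
have i2 := integrableZl_real (burk_pow n r) iD.
have i3 := integrableZl_real r iSD.
apply: (@le_trans _ _ (\int[P]_w ((1 + burk_lin n r) * `|S w| `^ r +
    burk_pow n r * `|D w| `^ r + r * (spow r (S w) * D w))%:E)%E).
  apply: le_integral_real.
  - by apply: measurable_abs_powR; exact: measurable_funD.
  - apply: measurable_funD; first apply: measurable_funD; exact: measurable_funM.
  - by move=> w; exact: powR_ge0.
  - by move=> w; exact: powR_abs_step.
under eq_integral do rewrite EFinD.
rewrite integralD//; last first.
  by under eq_fun do rewrite EFinD; exact: integrableD.
under [X in (X + _)%E]eq_integral do rewrite EFinD.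
rewrite integralD// !integralZl_real// orth// mule0 adde0 [leRHS]EFinD.
apply: leeD; rewrite [leRHS]EFinM; apply: lee_wpmul2l => //; rewrite lee_fin.
  by rewrite addr_ge0// burk_lin_ge0//; lra.
exact: burk_pow_ge0.
Qed.

Lemma measurable_partial_sum (D : nat -> Omega -> R) k :
  (forall j, measurable_fun setT (D j)) ->
  measurable_fun setT (fun w => \sum_(0 <= j < k) D j w).
Proof. by move=> mD; apply: measurable_sum. Qed.

Lemma powR_mean (I : finType) (a : I -> R) q : 1 <= q -> (0 < #|I|)%N ->
  (forall i, 0 <= a i) ->
  ((\sum_i a i) / #|I|%:R) `^ q <= (\sum_i a i `^ q) / #|I|%:R.
Proof.
move=> q1 I0 a0; set n := #|I|%:R; set m := _ / n.
have n0 : 0 < n by rewrite ltr0n.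
have m0 : 0 <= m by apply: divr_ge0; [exact: sumr_ge0|exact: ltW].
have q0 : 0 < q by lra.
have H : \sum_i q * (m `^ (q - 1) * a i) <= \sum_i (a i `^ q + (q - 1) * m `^ q).
  by apply: ler_sum => i _; apply: powR_young.
rewrite big_split /= sumr_const -[_ *+ _]mulr_natl -!mulr_sumr in H.
have E : \sum_i a i = m * n by rewrite divfK ?gt_eqF.
have E2 : m `^ (q - 1) * (m * n) = m `^ q * n by rewrite mulrA (mulrC _ m) mulr_powRB1.
rewrite E E2 in H.
by rewrite ler_pdivlMr//; move: H; rewrite -/n; lra.
Qed.

Lemma powR_abs_sum (n : nat) (a : nat -> R) r : 1 <= r -> (0 < n)%N ->
  `|\sum_(0 <= j < n) a j| `^ r <= n%:R `^ r * ((\sum_(0 <= j < n) `|a j| `^ r) / n%:R).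
Proof.
move=> r1 n0; rewrite !big_mkord.
have := @powR_mean 'I_n (fun j => `|a j|) r r1; rewrite card_ord => /(_ n0 (fun=> normr_ge0 _)).
set m := (_ / _) `^ r => H.
apply: (@le_trans _ _ (n%:R `^ r * m)); last by rewrite ler_wpM2l ?powR_ge0.
rewrite /m -powRM ?divr_ge0 ?sumr_ge0//.
rewrite mulrC divfK ?pnatr_eq0 -?lt0n//.
apply: ge0_ler_powR; rewrite ?nnegrE ?sumr_ge0 ?ler_norm_sum//; lra.
Qed.

(** The bound by convexity, which is enough when n <= r. *)
Lemma moment_sum_crude (D : nat -> Omega -> R) (n : nat) r (B : R) : 1 <= r ->
  (forall j, measurable_fun setT (D j)) -> 0 <= B ->
  (forall j, \int[P]_w (`|D j w| `^ r)%:E <= B%:E)%E ->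
  (\int[P]_w (`|\sum_(0 <= j < n) D j w| `^ r)%:E <= (n%:R `^ r * B)%:E)%E.
Proof.
move=> r1 mD B0 DB; have [->|n0] := posnP n.
  have z : (0 : R) `^ r = 0 by rewrite powR0// gt_eqF//; lra.
  under eq_integral do rewrite big_nil normr0 z.
  by rewrite integral0 lee_fin mulr_ge0 ?powR_ge0.
have m1 j : measurable_fun setT (fun w => `|D j w| `^ r) by exact: measurable_abs_powR.
apply: (@le_trans _ _ (\int[P]_w (n%:R `^ r / n%:R * \sum_(0 <= j < n) `|D j w| `^ r)%:E)%E).
  apply: le_integral_real.
  - by apply: measurable_abs_powR; exact: measurable_partial_sum.
  - by apply: measurable_funM => //; exact: (@measurable_partial_sum (fun j w => `|D j w| `^ r)).
  - by move=> w; exact: powR_ge0.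
  - by move=> w; apply: (le_trans (powR_abs_sum (D^~ w) r1 n0)); rewrite mulrA mulrAC.
under eq_integral do rewrite EFinM.
rewrite ge0_integralZl//; last first.
all: try by move=> w _; rewrite lee_fin sumr_ge0// => j _; exact: powR_ge0.
all: try by apply/measurable_EFinP; exact: (@measurable_partial_sum (fun j w => `|D j w| `^ r)).
all: try by rewrite lee_fin divr_ge0// powR_ge0.
under eq_integral do rewrite -sumEFin.
rewrite ge0_integral_sum//; last first.
all: try by move=> j w _; rewrite lee_fin powR_ge0.
all: try by move=> j; apply/measurable_EFinP.
have -> : (n%:R `^ r * B)%:E = ((n%:R `^ r / n%:R)%:E * (\sum_(0 <= j < n) B)%:E)%E.
  rewrite -EFinM sumr_const_nat subn0 -[B *+ n]mulr_natl; congr (_%:E).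
  by rewrite mulrA divfK ?pnatr_eq0 -?lt0n.
apply: lee_wpmul2l; first by rewrite lee_fin divr_ge0// powR_ge0.
by rewrite -sumEFin; apply: lee_sum.
Qed.

(** Burkholder's inequality with explicit dependence on r.  The martingale property enters as
    the orthogonality of each increment to the derivative of |.|^r at the preceding sum. *)
Lemma martingale_moment (D : nat -> Omega -> R) (n : nat) r (B : R) : 2 <= r ->
  (forall j, measurable_fun setT (D j)) -> 0 <= B ->
  (forall j, \int[P]_w (`|D j w| `^ r)%:E <= B%:E)%E ->
  (forall k, (k < n)%N ->
    P.-integrable setT (fun w => (spow r (\sum_(0 <= j < k) D j w) * D k w)%:E) ->
    \int[P]_w (spow r (\sum_(0 <= j < k) D j w) * D k w)%:E = 0)%E ->
  (\int[P]_w (`|\sum_(0 <= j < n) D j w| `^ r)%:E <=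
     (burk_const `^ r * (r * n%:R) `^ (r / 2) * B)%:E)%E.
Proof.
move=> r2 mD B0 DB orth; have r0 : 0 < r by lra.
have [rn|nr] := leP r n%:R; last first.
  apply: (le_trans (moment_sum_crude n _ mD B0 DB)); first by lra.
  rewrite lee_fin ler_wpM2r//.
  apply: (@le_trans _ _ ((r * n%:R) `^ (r / 2))).
    have -> : n%:R `^ r = (n%:R * n%:R) `^ (r / 2) :> R.
      by rewrite -expr2 -powR_mulrn// -powRrM; congr (_ `^ _); field.
    by have r0' := ltW r0; apply: ge0_ler_powR; rewrite ?nnegrE ?mulr_ge0 ?divr_ge0// ler_wpM2r// ltW.
  rewrite ler_peMl ?powR_ge0//.
  have c2 := @burk_const_ge2 R; rewrite -[X in X <= _](_ : 1 `^ r = 1); last by rewrite powR1.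
  by have r0' := ltW r0; apply: ge0_ler_powR; rewrite ?nnegrE//; lra.
have n0 : 0 < n%:R :> R by lra.
set al := burk_lin n%:R r; set be := burk_pow n%:R r.
have al0 : 0 <= al by apply: burk_lin_ge0; exact: ltW.
have be0 : 0 <= be by exact: burk_pow_ge0.
have main k : (k <= n)%N ->
  (\int[P]_w (`|\sum_(0 <= j < k) D j w| `^ r)%:E <= (k%:R * be * (1 + al) ^+ k * B)%:E)%E.
  elim: k => [_|k IH kn].
    have z : (0 : R) `^ r = 0 by rewrite powR0// gt_eqF.
    under eq_integral do rewrite big_nil normr0 z.
    by rewrite integral0 lee_fin !mul0r.
  under eq_integral do rewrite big_nat_recr//=.
  apply: (le_trans (moment_step r2 rn (measurable_partial_sum k mD) (mD k) (IH (ltnW kn)) (DB k)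
     (orth k kn))).
  rewrite lee_fin -/al -/be exprS.
  have : 1 <= (1 + al) ^+ k by rewrite exprn_ege1// lerDl.
  have b1 : 0 <= be * B by rewrite mulr_ge0.
  move=> /(ler_wpM2l b1); rewrite -natr1.
  have b2 : 0 <= al * (1 + al) ^+ k * (be * B) by apply: mulr_ge0 => //; apply: mulr_ge0 => //; apply: exprn_ge0; apply: addr_ge0.
  lra.
apply: (le_trans (main n (leqnn n))); rewrite lee_fin ler_wpM2r//.
exact: burk_bound.
Qed.

End Integrals.

(** * Orthogonality to a generated sigma-algebra *)

Section Orthogonality.
Context {d : measure_display} {Omega : measurableType d} {R : realType}.
Variable P : probability Omega R.
Variable G : set (set Omega).
Hypothesis Gm : G `<=` measurable.
Import HBNNSimple.

Local Notation GT := (g_sigma_algebraType G).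

Lemma sub_sigma_measurable (A : set Omega) : <<s G >> A -> measurable A.
Proof.
by apply: smallest_sub => //; exact: sigma_algebra_measurable.
Qed.

Lemma measurable_fun_sub d' (E : measurableType d') (h : Omega -> E) :
  measurable_fun (setT : set GT) (h : GT -> E) -> measurable_fun setT h.
Proof.
by move=> mh _ B mB; apply: sub_sigma_measurable; exact: mh.
Qed.

(** By monotone approximation of h by simple functions over the sub-sigma-algebra. *)
Lemma integral_sub_sigma (h d1 d2 : Omega -> R) :
  measurable_fun (setT : set GT) (h : GT -> R) -> (forall w, 0 <= h w) ->
  measurable_fun setT d1 -> measurable_fun setT d2 ->
  (forall w, 0 <= d1 w) -> (forall w, 0 <= d2 w) ->
  (forall A, <<s G >> A -> \int[P]_(w in A) (d1 w)%:E = \int[P]_(w in A) (d2 w)%:E)%E ->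
  (\int[P]_w (h w * d1 w)%:E = \int[P]_w (h w * d2 w)%:E)%E.
Proof.
move=> mh h0 md1 md2 d10 d20 H.
have mhE : measurable_fun (setT : set GT) (EFin \o h : GT -> \bar R).
  exact/measurable_EFinP.
pose f := nnsfun_approx (@measurableT _ GT) mhE.
have mf n : measurable_fun setT (f n : Omega -> R).
  by apply: measurable_fun_sub; exact: measurable_funP.
have lim_int (g : Omega -> R) : measurable_fun setT g -> (forall w, 0 <= g w) ->
  (\int[P]_w (h w * g w)%:E = limn (fun n => \int[P]_w (f n w * g w)%:E))%E.
  move=> mg g0.
  have fg w : (h w * g w)%:E = limn (fun n => (f n w * g w)%:E).
    apply/esym/cvg_lim => //; rewrite EFinM.
    under eq_fun do rewrite EFinM.
    apply: cvgeZr => //.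
    apply: (@cvg_nnsfun_approx _ GT R setT measurableT _ mhE) => //.
    by move=> v _; rewrite /= lee_fin.
  under eq_integral do rewrite fg.
  apply: monotone_convergence => //.
  - by move=> n; apply/measurable_EFinP; apply: measurable_funM.
  - by move=> n w _; rewrite lee_fin mulr_ge0.
  - move=> w _ a b ab; rewrite lee_fin ler_wpM2r//.
    by have /lefP/(_ w) := @nd_nnsfun_approx _ GT R setT measurableT _ mhE a b ab.
rewrite (lim_int d1)// (lim_int d2)//; congr (limn _); apply/funext => n.
have decomp (g : Omega -> R) : measurable_fun setT g -> (forall w, 0 <= g w) ->
  (\int[P]_w (f n w * g w)%:E =
   \sum_(y \in range (f n)) y%:E * \int[P]_(w in (f n @^-1` [set y] : set Omega)) (g w)%:E)%E.
  move=> mg g0.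
  have mpre y : measurable ((f n : Omega -> R) @^-1` [set y]).
    by rewrite -[X in measurable X]setTI; exact: mf.
  transitivity (\int[P]_w (\sum_(y \in range (f n))
      (y * \1_(f n @^-1` [set y]) w * g w)%:E))%E.
    apply: eq_integral => w _.
    rewrite fsumEFin//; congr (_%:E); rewrite [in LHS](fimfunE (f n) w).
    by rewrite !fsbig_finite// mulr_suml.
  rewrite ge0_integral_fsum//; last first.
  - by move=> y w _; rewrite lee_fin mulr_ge0//; exact: nnfun_muleindic_ge0.
  - move=> y; apply/measurable_EFinP; apply: measurable_funM => //.
    by apply: measurable_funM => //; exact: measurable_indic.
  apply: eq_fsbigr => y yr.
  have y0 : 0 <= y by move: yr; rewrite inE => -[t _ <-].
  under eq_integral do rewrite -mulrA EFinM.
  rewrite ge0_integralZl//; last first.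
  - by move=> w _; rewrite lee_fin mulr_ge0.
  - by apply/measurable_EFinP; apply: measurable_funM => //; exact: measurable_indic.
  congr (_ * _)%E; rewrite [RHS]integral_mkcond.
  apply: eq_integral => w _; rewrite patchE /= indicE.
  by case: ifP => wy; rewrite ?mul1r ?mul0r.
rewrite (decomp d1)// (decomp d2)//; apply: eq_fsbigr => y yr; congr (_ * _)%E.
apply: H; have mfn : measurable_fun (setT : set GT) (f n : GT -> R) by exact: measurable_funP.
by have := mfn measurableT [set y] (measurable_set1 y); rewrite setTI.
Qed.

Hypothesis GI : setI_closed G.
Hypothesis GsetT : G setT.
Variable D : Omega -> R.
Hypothesis iD : P.-integrable setT (EFin \o D).
Hypothesis orth : forall A, G A -> (\int[P]_(w in A) (D w)%:E = 0)%E.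

(** Pi-lambda: the events over which D integrates to zero are closed under complements and
    under countable disjoint unions. *)
Lemma integral_sigma0 A : <<s G >> A -> (\int[P]_(w in A) (D w)%:E = 0)%E.
Proof.
pose Q (A : set Omega) := (\int[P]_(w in A) (D w)%:E = 0)%E.
apply: (@dynkin_induction _ GT G Q) => //.
- exact: orth.
- move=> S mS QS; have mS' := sub_sigma_measurable mS.
  have := orth GsetT; rewrite -(setUv S).
  rewrite integral_setU_EFin//.
  + by rewrite QS add0e.
  + exact: measurableC.
  + by rewrite setUv; have /integrableP[/measurable_EFinP] := iD.
  + by apply/disj_setPS; rewrite setICr.
- move=> F mF tF QF; rewrite /Q integral_bigcup//.
  + by rewrite eseries0// => n _ _; exact: QF.
  + by move=> k; apply: sub_sigma_measurable; exact: mF.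
  + apply: integrableS iD => //; apply: bigcup_measurable => k _.
    by apply: sub_sigma_measurable; exact: mF.
Qed.

(** Apply [integral_sub_sigma] to the positive and negative parts of D as densities, and to
    those of h as test functions. *)
Lemma integral_mul_orth (h : Omega -> R) :
  measurable_fun (setT : set GT) (h : GT -> R) ->
  P.-integrable setT (fun w => (h w * D w)%:E) ->
  (\int[P]_w (h w * D w)%:E = 0)%E.
Proof.
move=> mh ihD.
have mD : measurable_fun setT D by have /integrableP[/measurable_EFinP] := iD.
have mh' : measurable_fun setT h by exact: measurable_fun_sub mh.
have pn (f : Omega -> R) w : f w = f^\+ w - f^\- w.
  by rewrite -[in LHS](funrposBneg f).
have pa (f : Omega -> R) w : f^\+ w <= `|f w| /\ f^\- w <= `|f w|.
  have := congr1 (fun u => u w) (funrposDneg f) => /= <-.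
  by split; [rewrite lerDl funrneg_ge0|rewrite lerDr funrpos_ge0].
have mpos (f : Omega -> R) : measurable_fun setT f -> measurable_fun setT f^\+.
  exact: measurable_funrpos.
have mneg (f : Omega -> R) : measurable_fun setT f -> measurable_fun setT f^\-.
  exact: measurable_funrneg.
have iDp : P.-integrable setT (EFin \o D^\+).
  apply: le_integrable iD => //; first by apply/measurable_EFinP; exact: mpos.
  by move=> w _; rewrite /= lee_fin ger0_norm ?funrpos_ge0//; have [] := pa D w.
have iDn : P.-integrable setT (EFin \o D^\-).
  apply: le_integrable iD => //; first by apply/measurable_EFinP; exact: mneg.
  by move=> w _; rewrite /= lee_fin ger0_norm ?funrneg_ge0//; have [] := pa D w.
have pos_neg A : <<s G >> A ->
  (\int[P]_(w in A) (D^\+ w)%:E = \int[P]_(w in A) (D^\- w)%:E)%E.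
  move=> GA; have := integral_sigma0 GA.
  have mA := sub_sigma_measurable GA.
  under eq_integral do rewrite pn EFinB.
  have iAp : P.-integrable A (EFin \o D^\+) by exact: integrableS iDp.
  have iAn : P.-integrable A (EFin \o D^\-) by exact: integrableS iDn.
  rewrite integralB_EFin// => /eqP; rewrite sube_eq ?add0e; first by move/eqP.
    exact: integral_fune_fin_num.
  by rewrite fin_num_adde_defl// integral_fune_fin_num.
have hp := integral_sub_sigma (measurable_funrpos mh) (funrpos_ge0 h)
   (mpos _ mD) (mneg _ mD) (funrpos_ge0 D) (funrneg_ge0 D) pos_neg.
have hn := integral_sub_sigma (measurable_funrneg mh) (funrneg_ge0 h)
   (mpos _ mD) (mneg _ mD) (funrpos_ge0 D) (funrneg_ge0 D) pos_neg.
have prod_int (u v : Omega -> R) : measurable_fun setT u -> measurable_fun setT v ->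
  (forall w, 0 <= u w <= `|h w|) -> (forall w, 0 <= v w <= `|D w|) ->
  P.-integrable setT (EFin \o (fun w => u w * v w)).
  move=> mu mv u0 v0; apply: le_integrable ihD => //.
    by apply/measurable_EFinP; apply: measurable_funM.
  move=> w _; rewrite /= lee_fin !normrM.
  have /andP[? ?] := u0 w; have /andP[? ?] := v0 w.
  by apply: ler_pM => //; rewrite ger0_norm.
have bp (f : Omega -> R) w : 0 <= f^\+ w <= `|f w|.
  by rewrite funrpos_ge0; have [] := pa f w.
have bn (f : Omega -> R) w : 0 <= f^\- w <= `|f w|.
  by rewrite funrneg_ge0; have [] := pa f w.
have i1 := prod_int _ _ (mpos _ mh') (mpos _ mD) (bp h) (bp D).
have i2 := prod_int _ _ (mpos _ mh') (mneg _ mD) (bp h) (bn D).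
have i3 := prod_int _ _ (mneg _ mh') (mpos _ mD) (bn h) (bp D).
have i4 := prod_int _ _ (mneg _ mh') (mneg _ mD) (bn h) (bn D).
have E w : h w * D w = (h^\+ w * D^\+ w - h^\+ w * D^\- w) - (h^\- w * D^\+ w - h^\- w * D^\- w).
  by rewrite (pn h) (pn D); ring.
under eq_integral do rewrite E EFinB.
rewrite integralB_EFin//; last 2 first.
- exact: (integrableB measurableT i1 i2).
- exact: (integrableB measurableT i3 i4).
under eq_integral do rewrite EFinB.
under [X in (_ - X)%E]eq_integral do rewrite EFinB.
rewrite !integralB_EFin// hp hn !subee ?sube0//; exact: integral_fune_fin_num.
Qed.

End Orthogonality.

(** * Integrals and independence *)

Section Independence.
Context {d : measure_display} {Omega : measurableType d} {R : realType}.
Variable P : probability Omega R.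

Lemma moment_tail (U : Omega -> R) (r c A : R) : 0 < r -> 0 < c ->
  measurable_fun setT U -> (\int[P]_w (`|U w| `^ r)%:E <= A%:E)%E ->
  (P [set w | (c < `|U w|)%R] <= (A / c `^ r)%:E)%E.
Proof.
move=> r0 c0 mU UA; set S := [set w | c < `|U w|].
have cr0 : 0 < c `^ r by rewrite powR_gt0.
have mS : measurable S.
  have -> : S = (fun w => `|U w|) @^-1` `]c, +oo[.
    by apply/seteqP; split=> w /=; rewrite in_itv/= andbT.
  by rewrite -[X in measurable X]setTI; apply: measurableT_comp.
have H : ((c `^ r)%:E * P S <= A%:E)%E.
  have -> : ((c `^ r)%:E * P S = \int[P]_w (c `^ r * \1_S w)%:E)%E.
    under eq_integral do rewrite EFinM.
    rewrite ge0_integralZl//; first by rewrite integral_indic// setIT.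
    - by apply/measurable_EFinP; exact: measurable_indic.
    - by rewrite lee_fin ltW.
  apply: le_trans UA.
  apply: le_integral_real.
  - by apply: measurable_funM => //; exact: measurable_indic.
  - exact: measurable_abs_powR.
  - by move=> w; rewrite mulr_ge0// ltW.
  - move=> w; rewrite indicE; have [wS|_] := boolP (w \in S); last by rewrite mulr0 powR_ge0.
    rewrite mulr1; move: wS; rewrite inE => /ltW h.
    by apply: ge0_ler_powR => //; rewrite ?nnegrE//; exact: ltW.
by rewrite EFinM lee_pdivlMr// muleC.
Qed.

Section SigmaIndependent.
Variable G : set (set Omega).
Hypothesis Gm : G `<=` measurable.
Hypothesis GI : setI_closed G.
Hypothesis GsetT : G setT.
Variable E : set Omega.
Hypothesis mE : measurable E.
Hypothesis indep : forall A, G A -> P (E `&` A) = (P E * P A)%E.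
Local Notation GT := (g_sigma_algebraType G).

(** The variable 1_E - P(E) is orthogonal to G by independence, hence to the G-measurable
    variable 1_F D. *)
Lemma integral_indep_event (D : Omega -> R) (F : set Omega) :
  measurable_fun (setT : set GT) (D : GT -> R) ->
  P.-integrable setT (EFin \o D) -> <<s G >> F ->
  (\int[P]_(w in F) (D w)%:E = 0)%E ->
  (\int[P]_(w in E `&` F) (D w)%:E = 0)%E.
Proof.
move=> mD iD GF DF0.
have mF := sub_sigma_measurable Gm GF.
have PE : P E \is a fin_num by exact: fin_num_measure.
pose u w : R := \1_E w - fine (P E).
have mu : measurable_fun setT u by apply: measurable_funB => //; exact: measurable_indic.
have iu : P.-integrable setT (EFin \o u).
  apply: (@le_integrable _ _ _ P setT measurableT _ (EFin \o cst 2)).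
  - exact/measurable_EFinP.
  - move=> w _; rewrite /= lee_fin /u (@ger0_norm _ 2)//.
    apply: (le_trans (ler_normB _ _)).
    rewrite -[leRHS]/(1 + 1 : R); apply: lerD.
      by rewrite indicE; case: (_ \in _); rewrite ?normr1 ?normr0.
    by rewrite ger0_norm ?fine_ge0// -lee_fin fineK// probability_le1.
  - exact: finite_measure_integrable_cst.
have orth A : G A -> (\int[P]_(w in A) (u w)%:E = 0)%E.
  move=> GA; have mA := Gm GA.
  under eq_integral do rewrite EFinB.
  rewrite integralB_EFin//; last 2 first.
  - apply: (@le_integrable _ _ _ P A mA _ (EFin \o cst 1)).
    + by apply/measurable_EFinP; apply: measurable_funTS; exact: measurable_indic.
    + by move=> w _; rewrite /= lee_fin normr1 indicE; case: (_ \in _); rewrite ?normr1 ?normr0.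
    + exact: finite_measure_integrable_cst.
  - exact: finite_measure_integrable_cst.
  have PA : P A \is a fin_num by exact: fin_num_measure.
  have -> : (\int[P]_(w in A) (\1_E w)%:E = P E * P A)%E.
    by rewrite integral_indic//; exact: indep.
  by rewrite integral_cst// fineK// subee// fin_numM.
pose h w : R := \1_F w * D w.
have mh : measurable_fun (setT : set GT) (h : GT -> R).
  by apply: measurable_funM => //; exact: measurable_indic.
have mD' : measurable_fun setT D by exact: measurable_fun_sub mD.
have ih : P.-integrable setT (EFin \o h).
  apply: le_integrable iD => //.
    by apply/measurable_EFinP; apply: measurable_funM => //; exact: measurable_indic.
  move=> w _; rewrite /= lee_fin /h normrM ler_piMl// indicE.
  by case: (_ \in _); rewrite ?normr1 ?normr0.
have ihu : P.-integrable setT (fun w => (h w * u w)%:E).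
  have := integrableZl_real 2 ih; apply: le_integrable => //.
    apply/measurable_EFinP; apply: measurable_funM => //.
    by apply: measurable_funM => //; exact: measurable_indic.
  move=> w _; rewrite /= lee_fin !normrM (@ger0_norm _ 2)// mulrC ler_wpM2r//.
  apply: (le_trans (ler_normB _ _)); rewrite -[leRHS]/(1 + 1 : R); apply: lerD.
    by rewrite indicE; case: (_ \in _); rewrite ?normr1 ?normr0.
  by rewrite ger0_norm ?fine_ge0// -lee_fin fineK// probability_le1.
have := integral_mul_orth Gm GI GsetT iu orth mh ihu.
have hu w : h w * u w = \1_(E `&` F) w * D w - fine (P E) * (\1_F w * D w).
  rewrite /h /u !indicE in_setI; case: (_ \in E); case: (_ \in F) => /=; ring.
under eq_integral do rewrite hu EFinB.
have mEF : measurable (E `&` F) by exact: measurableI.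
have iEF : P.-integrable setT (EFin \o (fun w => \1_(E `&` F) w * D w)).
  apply: le_integrable iD => //.
    by apply/measurable_EFinP; apply: measurable_funM => //; exact: measurable_indic.
  move=> w _; rewrite /= lee_fin normrM ler_piMl// indicE.
  by case: (_ \in _); rewrite ?normr1 ?normr0.
have toset (S : set Omega) : (\int[P]_w (\1_S w * D w)%:E = \int[P]_(w in S) (D w)%:E)%E.
  rewrite [RHS]integral_mkcond; apply: eq_integral => w _; rewrite patchE /= indicE.
  by case: (_ \in _); rewrite ?mul1r ?mul0r.
rewrite integralB_EFin//; last exact: (integrableZl_real (fine (P E)) ih).
by rewrite integralZl_real// !toset DF0 mule0 sube0.
Qed.

End SigmaIndependent.

Lemma preimage_system_measurable d' (V' : measurableType d') (V : Omega -> V') :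
  measurable_fun setT V -> preimage_set_system setT V measurable `<=` measurable.
Proof. by move=> mV _ [B mB <-]; exact: mV. Qed.

Lemma preimage_systemI d' (V' : measurableType d') (V : Omega -> V') :
  setI_closed (preimage_set_system setT V measurable).
Proof.
move=> _ _ [B mB <-] [C mC <-]; exists (B `&` C); first exact: measurableI.
by rewrite !setTI preimage_setI.
Qed.

Lemma preimage_systemT d' (V' : measurableType d') (V : Omega -> V') :
  preimage_set_system setT V measurable setT.
Proof. by exists setT => //; rewrite preimage_setT setTI. Qed.

Lemma preimage_system_id d' (V' : measurableType d') (V : Omega -> V') :
  <<s preimage_set_system setT V measurable >> = preimage_set_system setT V measurable.
Proof.
apply: sigma_algebra_id; apply: sigma_algebra_preimage.
exact: sigma_algebra_measurable.
Qed.

Lemma measurable_preimage_system d' d'' (V' : measurableType d') (W : measurableType d'')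
    (V : Omega -> V') (f : V' -> W) : measurable_fun setT f ->
  measurable_fun (setT : set (g_sigma_algebraType (preimage_set_system setT V measurable)))
     (f \o V : g_sigma_algebraType (preimage_set_system setT V measurable) -> W).
Proof.
move=> mf _ B mB; apply: sub_sigma_algebra; exists (f @^-1` B).
  by rewrite -[X in measurable X]setTI; exact: mf.
by rewrite !setTI.
Qed.

(** On the sigma-algebra of U the densities g(V) and c have the same integrals, so they
    integrate f(U) alike ([integral_sub_sigma]); that they agree on an event of U is
    the same argument with the roles of U and V exchanged and an indicator density. *)
Lemma integral_indep_mul d1 d2 (E1 : measurableType d1) (E2 : measurableType d2)
    (U : Omega -> E1) (V : Omega -> E2) (f : E1 -> R) (g : E2 -> R) (c : R) :
  measurable_fun setT U -> measurable_fun setT V -> independent2 P U V ->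
  measurable_fun setT f -> measurable_fun setT g ->
  (forall u, 0 <= f u) -> (forall v, 0 <= g v) ->
  (\int[P]_w (g (V w))%:E = c%:E)%E ->
  (\int[P]_w (f (U w) * g (V w))%:E = c%:E * \int[P]_w (f (U w))%:E)%E.
Proof.
move=> mU mV indep mf mg f0 g0 gc.
have c0 : 0 <= c by rewrite -lee_fin -gc integral_ge0// => w _; rewrite lee_fin.
have Gm := preimage_system_measurable mU.
have mgV : measurable_fun setT (g \o V) by exact: measurableT_comp.
have gA A : <<s preimage_set_system setT U measurable >> A ->
  (\int[P]_(w in A) (g (V w))%:E = \int[P]_(w in A) c%:E)%E.
  rewrite preimage_system_id => -[B mB <-]; rewrite setTI.
  set A' := U @^-1` B.
  have mA : measurable A' by rewrite -[X in measurable X]setTI; exact: mU.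
  rewrite integral_cst//.
  have Gm2 := preimage_system_measurable mV.
  have PA : P A' \is a fin_num by exact: fin_num_measure.
  have E : (\int[P]_w (g (V w) * \1_A' w)%:E = \int[P]_w (g (V w) * fine (P A'))%:E)%E.
    apply: (integral_sub_sigma (h := g \o V) Gm2).
    - exact: measurable_preimage_system.
    - by move=> w; exact: g0.
    - exact: measurable_indic.
    - exact: measurable_cst.
    - by move=> w.
    - by move=> w; rewrite fine_ge0.
    - rewrite preimage_system_id => _ [C mC <-]; rewrite setTI.
      have mC' : measurable (V @^-1` C) by rewrite -[X in measurable X]setTI; exact: mV.
      by rewrite integral_indic// integral_cst// fineK//; exact: indep.
  transitivity (\int[P]_w (g (V w) * \1_A' w)%:E)%E.
    rewrite integral_mkcond; apply: eq_integral => w _; rewrite patchE /= indicE.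
    by case: (_ \in _); rewrite ?mulr1 ?mulr0.
  rewrite E; under eq_integral do rewrite mulrC EFinM.
  rewrite ge0_integralZl//.
  - by rewrite gc fineK// muleC.
  - exact/measurable_EFinP.
  - by move=> w _; rewrite lee_fin.
  - by rewrite lee_fin fine_ge0.
rewrite (integral_sub_sigma (h := f \o U) (d2 := cst c) Gm)//.
- under eq_integral do rewrite /= mulrC EFinM.
  rewrite ge0_integralZl//.
  + by apply/measurable_EFinP; exact: measurableT_comp.
  + by move=> w _; rewrite lee_fin.
- exact: measurable_preimage_system.
- by move=> w; exact: f0.
Qed.

Lemma integral_ident d' (E : measurableType d') (I : Type) (V : I -> Omega -> E) (f : E -> R) i j :
  identically_distributed P V -> (forall i, measurable_fun setT (V i)) ->
  measurable_fun setT f -> (forall u, 0 <= f u) ->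
  (\int[P]_w (f (V i w))%:E = \int[P]_w (f (V j w))%:E)%E.
Proof.
move=> Vid mV mf f0.
have H k : (\int[P]_w (f (V k w))%:E = \int[pushforward P (V k)]_y (f y)%:E)%E.
  rewrite (ge0_integral_pushforward (mV k))//.
  - exact/measurable_EFinP.
  - by move=> y _; rewrite lee_fin.
rewrite !H; apply: eq_measure_integral => A mA _.
by rewrite /= /pushforward; exact: Vid.
Qed.

End Independence.

(** * The history of a cell of the panel *)

Section PanelModel.
Context {d : measure_display} {Omega : measurableType d} {R : realType}.
Variable P : probability Omega R.
Variables N T p : nat.
Variables (x : 'I_N -> 'I_T -> 'I_p -> {RV P >-> R}) (eps : 'I_N -> 'I_T -> {RV P >-> R}).

Lemma measurable_covariates i : measurable_fun setT (covariates_unit x i).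
Proof.
apply/measurable_fun_tnthP => t.
apply/measurable_fun_tnthP => k.
have -> : ((@tnth p R)^~ k \o ((@tnth T (p.-tuple R))^~ t \o covariates_unit x i)) = x i t k.
  by apply/funext => w /=; rewrite !tnth_mktuple.
exact: measurable_funP.
Qed.

Lemma measurable_errors i : measurable_fun setT (errors_unit eps i).
Proof.
apply/measurable_fun_tnthP => t.
have -> : ((@tnth T R)^~ t \o errors_unit eps i) = eps i t.
  by apply/funext => w /=; rewrite !tnth_mktuple.
exact: measurable_funP.
Qed.

Lemma measurable_data i : measurable_fun setT (data_unit x eps i).
Proof.
by apply: measurable_fun_pair; [exact: measurable_covariates|exact: measurable_errors].
Qed.

Definition get_x (t : 'I_T) (k : 'I_p) (u : T.-tuple (p.-tuple R)) : R := tnth (tnth u t) k.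
Definition get_e (t : 'I_T) (u : T.-tuple R) : R := tnth u t.

Lemma measurable_get_x t k : measurable_fun setT (get_x t k).
Proof.
by apply: (measurableT_comp (@measurable_tnth _ _ _ k)); exact: measurable_tnth.
Qed.
Lemma measurable_get_e t : measurable_fun setT (get_e t).
Proof. exact: measurable_tnth. Qed.

Lemma get_xE i t k w : get_x t k (covariates_unit x i w) = x i t k w.
Proof. by rewrite /get_x !tnth_mktuple. Qed.
Lemma get_eE i t w : get_e t (errors_unit eps i w) = eps i t w.
Proof. by rewrite /get_e !tnth_mktuple. Qed.

Hypothesis indep_units : mutually_independent P (data_unit x eps).
Hypothesis indep_xe : forall i, independent2 P (covariates_unit x i) (errors_unit eps i).
Hypothesis mds : forall i, martingale_difference (eps i).

Definition past_event (i : 'I_N) (B : 'I_N -> set (T.-tuple (p.-tuple R) * T.-tuple R)) :=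
  \bigcap_(j in [set` [set j : 'I_N | (j < i)%N]%SET]) (data_unit x eps j @^-1` B j).

Lemma past_eventE i B w : past_event i B w <->
  forall j : 'I_N, (j < i)%N -> B j (data_unit x eps j w).
Proof.
split=> H j; first by move=> ji; apply: (H j); rewrite /= inE.
by rewrite /= inE => ji; exact: H.
Qed.

Lemma measurable_past i B : (forall j, measurable (B j)) -> measurable (past_event i B).
Proof.
move=> mB; rewrite /past_event; apply: fin_bigcap_measurable => //.
by move=> j _; rewrite -[X in measurable X]setTI; exact: measurable_data.
Qed.

Lemma past_indep i B : (forall j, measurable (B j)) ->
  forall A, preimage_set_system setT (data_unit x eps i) measurable A ->
  P (past_event i B `&` A) = (P (past_event i B) * P A)%E.
Proof.
move=> mB _ [C mC <-]; rewrite setTI.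
set S := [set j : 'I_N | (j < i)%N]%SET.
have iS : i \notin S by rewrite inE ltnn.
pose B' j := if j == i then C else B j.
have mB' j : measurable (B' j) by rewrite /B'; case: ifP.
have -> : past_event i B `&` data_unit x eps i @^-1` C =
    \bigcap_(j in [set` (i |: S)%SET]) (data_unit x eps j @^-1` B' j).
  apply/seteqP; split=> [w [/past_eventE H1 H2] j /=|w H].
    rewrite !inE => /orP[/eqP ->|ji]; first by rewrite /B' eqxx.
    by rewrite /B'; case: eqP ji => [->|_ /H1//]; rewrite ltnn.
  split; last by have := H i; rewrite /= !inE eqxx /B' eqxx; exact.
  apply/past_eventE => j ji; have := H j; rewrite /= !inE ji orbT /B'.
  by case: eqP ji => [->|_ _]; [rewrite ltnn|exact].
rewrite (indep_units _ mB') big_setU1//= /B' eqxx muleC; congr (_ * _)%E.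
rewrite /past_event (indep_units _ mB); apply: eq_bigr => j.
by rewrite inE; case: eqP => // ->; rewrite ltnn.
Qed.

(** What is known before the error of the cell (i, m): all data of the earlier units,
    the covariates of unit i, and the errors of unit i before m.  It is described by
    a pi-system, which generates the sigma-algebra. *)
Definition history (i : 'I_N) (m : nat) : set (set Omega) :=
  [set A | exists B C F, [/\ forall j, measurable (B j), measurable C,
     sigma_first (eps i) m F &
     A = past_event i B `&` (covariates_unit x i @^-1` C `&` F)]].

Lemma sigma_first_sub i m :
  sigma_first (eps i) m `<=` preimage_set_system setT (errors_unit eps i) measurable.
Proof.
rewrite -preimage_system_id; apply: smallest_sub; first exact: smallest_sigma_algebra.
apply: bigcup_sub => s _ _ [B mB <-]; apply: sub_sigma_algebra.
exists (get_e s @^-1` B).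
  by rewrite -[X in measurable X]setTI; exact: measurable_get_e.
by rewrite !setTI; apply/seteqP; split=> w /=; rewrite get_eE.
Qed.

Lemma sigma_first_measurable i m : sigma_first (eps i) m `<=` measurable.
Proof.
move=> A /sigma_first_sub; apply: preimage_system_measurable; exact: measurable_errors.
Qed.

Lemma sigma_firstI i m : setI_closed (sigma_first (eps i) m).
Proof.
move=> A B FA FB.
exact: (@measurableI _ (g_sigma_algebraType (\bigcup_(s in [set s : 'I_T | (s < m)%N])
        preimage_set_system setT (eps i s) measurable))).
Qed.

Lemma sigma_firstT i m : sigma_first (eps i) m setT.
Proof.
exact: (@measurableT _ (g_sigma_algebraType (\bigcup_(s in [set s : 'I_T | (s < m)%N])
        preimage_set_system setT (eps i s) measurable))).
Qed.

Lemma history_measurable i m : history i m `<=` measurable.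
Proof.
move=> _ [B [C [F [mB mC FF ->]]]].
apply: measurableI; first exact: measurable_past.
apply: measurableI; last exact: sigma_first_measurable FF.
by rewrite -[X in measurable X]setTI; exact: measurable_covariates.
Qed.

Lemma historyI i m : setI_closed (history i m).
Proof.
move=> _ _ [B [C [F [mB mC FF ->]]]] [B' [C' [F' [mB' mC' FF' ->]]]].
exists (fun j => B j `&` B' j), (C `&` C'), (F `&` F'); split.
- by move=> j; exact: measurableI.
- exact: measurableI.
- exact: sigma_firstI.
- have -> : past_event i (fun j => B j `&` B' j) = past_event i B `&` past_event i B'.
    apply/seteqP; split=> w.
      by move=> /past_eventE H; split; apply/past_eventE => j /H[].
    by move=> [/past_eventE H /past_eventE H']; apply/past_eventE => j ji; split; [exact: H|exact: H'].
  by rewrite preimage_setI setIACA; congr (_ `&` _); rewrite setIACA.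
Qed.

Lemma historyT i m : history i m setT.
Proof.
exists (fun=> setT), setT, setT; split=> //; first exact: sigma_firstT.
by rewrite preimage_setT !setTI; apply/seteqP; split=> // w _; apply/past_eventE.
Qed.

Lemma eps_integrable i t : P.-integrable setT (EFin \o eps i t).
Proof. by have [] := mds i t. Qed.

Lemma eps_sigma_first0 i (t : 'I_T) F : sigma_first (eps i) t F ->
  (\int[P]_(w in F) (eps i t w)%:E = 0)%E.
Proof.
have [_ [_ _ H]] := mds i t; move=> /H <-; rewrite integral0_eq//.
Qed.

(** The earlier units are independent of unit i, and within unit i the covariates are
    independent of the errors; what remains is the martingale property of the errors. *)
Lemma eps_history0 i (t : 'I_T) A : history i t A -> (\int[P]_(w in A) (eps i t w)%:E = 0)%E.
Proof.
move=> [B [C [F [mB mC FF ->]]]].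
have mcov : measurable (covariates_unit x i @^-1` C).
  by rewrite -[X in measurable X]setTI; exact: measurable_covariates.
have GE := sigma_first_sub FF.
apply: (integral_indep_event (preimage_system_measurable (@measurable_data i))
   (@preimage_systemI _ _ _ _ (data_unit x eps i)) (@preimage_systemT _ _ _ _ (data_unit x eps i))).
- exact: measurable_past.
- exact: past_indep.
- rewrite (_ : (eps i t : Omega -> R) = (get_e t \o snd) \o data_unit x eps i).
    apply: measurable_preimage_system; apply: measurableT_comp => //; exact: measurable_get_e.
  by apply/funext => w; rewrite /= get_eE.
- exact: eps_integrable.
- rewrite preimage_system_id; case: GE => E mE; rewrite setTI => <-.
  exists (C `*` E); first exact: measurableX.
  by rewrite setTI.
- apply: (integral_indep_event (preimage_system_measurable (@measurable_errors i))
   (@preimage_systemI _ _ _ _ (errors_unit eps i)) (@preimage_systemT _ _ _ _ (errors_unit eps i))).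
  + exact: mcov.
  + by move=> _ [E mE <-]; rewrite setTI; apply: indep_xe.
  + rewrite (_ : (eps i t : Omega -> R) = get_e t \o errors_unit eps i).
      by apply: measurable_preimage_system; exact: measurable_get_e.
    by apply/funext => w; rewrite /= get_eE.
  + exact: eps_integrable.
  + by rewrite preimage_system_id.
  + exact: eps_sigma_first0.
Qed.

Local Notation HT i m := (g_sigma_algebraType (history i m)).

Lemma history_x_past (i : 'I_N) m (j : 'I_N) t k : (j < i)%N ->
  measurable_fun (setT : set (HT i m)) (x j t k : HT i m -> R).
Proof.
move=> ji _ B mB; rewrite setTI; apply: sub_sigma_algebra.
exists (fun j' => if j' == j then (get_x t k \o fst) @^-1` B else setT), setT, setT; split=> //.
- move=> j'; case: ifP => // _; rewrite -[X in measurable X]setTI.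
  by apply: (measurableT_comp (measurable_get_x t k)) => //.
- exact: sigma_firstT.
rewrite preimage_setT !setIT; apply/seteqP; split=> w.
  by move=> Bw; apply/past_eventE => j' _; case: eqP => // ->; rewrite /= get_xE.
by move=> /past_eventE /(_ j ji); rewrite eqxx /= get_xE.
Qed.

Lemma history_eps_past (i : 'I_N) m (j : 'I_N) t : (j < i)%N ->
  measurable_fun (setT : set (HT i m)) (eps j t : HT i m -> R).
Proof.
move=> ji _ B mB; rewrite setTI; apply: sub_sigma_algebra.
exists (fun j' => if j' == j then (get_e t \o snd) @^-1` B else setT), setT, setT; split=> //.
- move=> j'; case: ifP => // _; rewrite -[X in measurable X]setTI.
  by apply: (measurableT_comp (measurable_get_e t)) => //.
- exact: sigma_firstT.
rewrite preimage_setT !setIT; apply/seteqP; split=> w.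
  by move=> Bw; apply/past_eventE => j' _; case: eqP => // ->; rewrite /= get_eE.
by move=> /past_eventE /(_ j ji); rewrite eqxx /= get_eE.
Qed.

Lemma past_eventT i : past_event i (fun=> setT) = setT.
Proof. by apply/seteqP; split=> // w _; apply/past_eventE. Qed.

Lemma history_x_own i m t k :
  measurable_fun (setT : set (HT i m)) (x i t k : HT i m -> R).
Proof.
move=> _ B mB; rewrite setTI; apply: sub_sigma_algebra.
exists (fun=> setT), (get_x t k @^-1` B), setT; split=> //.
- rewrite -[X in measurable X]setTI; exact: measurable_get_x.
- exact: sigma_firstT.
by rewrite past_eventT setTI setIT; apply/seteqP; split=> w /=; rewrite get_xE.
Qed.

Lemma history_eps_own i m (s : 'I_T) : (s < m)%N ->
  measurable_fun (setT : set (HT i m)) (eps i s : HT i m -> R).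
Proof.
move=> sm _ B mB; rewrite setTI; apply: sub_sigma_algebra.
exists (fun=> setT), setT, (eps i s @^-1` B); split=> //.
  by apply: sub_sigma_algebra; exists s => //; exists B => //; rewrite setTI.
by rewrite past_eventT preimage_setT !setTI.
Qed.

End PanelModel.

(** * Moments of the scores and of sums over units *)

Section Flatten.
Variables N T : nat.
Hypothesis hT : (0 < T)%N.

(** The m-th cell when the panel is read unit by unit, so that a sum over the panel
    becomes a sum over time of a single martingale. *)
Definition cell (m : nat) : option ('I_N * 'I_T) :=
  if insub (m %/ T)%N is Some i then
    if insub (m %% T)%N is Some t then Some (i, t) else None
  else None.

Lemma cellE (i : 'I_N) (t : 'I_T) : cell (t + i * T) = Some (i, t).
Proof.
rewrite /cell (addnC t) divnMDl// modnMDl.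
rewrite (divn_small (ltn_ord t)) addn0 (modn_small (ltn_ord t)).
by rewrite !valK.
Qed.

Lemma cellP m i t : cell m = Some (i, t) -> (m %/ T)%N = i /\ (m %% T)%N = t.
Proof.
rewrite /cell; case: insubP => // i' _ <-; case: insubP => // t' _ <-.
by case=> -> ->.
Qed.

Definition flat (V : nmodType) (a : 'I_N -> 'I_T -> V) (m : nat) : V :=
  if cell m is Some it then a it.1 it.2 else 0.

Lemma sum_flat (V : nmodType) (a : 'I_N -> 'I_T -> V) :
  \sum_(0 <= m < N * T) flat a m = \sum_i \sum_t a i t.
Proof.
rewrite big_nat_mul big_mkord; apply: eq_bigr => i _.
rewrite -{1}[(i * T)%N]add0n big_addn mulSn addnK big_mkord.
by apply: eq_bigr => t _; rewrite /flat cellE.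
Qed.

End Flatten.

Section PanelMoments.
Context {d : measure_display} {Omega : measurableType d} {R : realType}.
Variable P : probability Omega R.
Variables N T p : nat.
Hypothesis hT : (0 < T)%N.
Variables (x : 'I_N -> 'I_T -> 'I_p -> {RV P >-> R}) (eps : 'I_N -> 'I_T -> {RV P >-> R}).
Hypothesis indep_units : mutually_independent P (data_unit x eps).
Hypothesis indep_xe : forall i, independent2 P (covariates_unit x i) (errors_unit eps i).
Hypothesis mds : forall i, martingale_difference (eps i).

Lemma measurable_partial_sub d' (E : measurableType d') (D : nat -> E -> R) k :
  (forall j, (j < k)%N -> measurable_fun setT (D j)) ->
  measurable_fun setT (fun w => \sum_(0 <= j < k) D j w).
Proof.
move=> mD; pose D' j := if (j < k)%N then D j else cst 0.
have -> : (fun w => \sum_(0 <= j < k) D j w) = (fun w => \sum_(0 <= j < k) D' j w).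
  by apply/funext => w; apply: eq_big_nat => j /andP[_ jk]; rewrite /D' jk.
apply: measurable_sum => j; rewrite /D'; case: ifP => // jk; exact: mD.
Qed.

Let flatw (a : 'I_N -> 'I_T -> Omega -> R) (m : nat) (w : Omega) : R :=
  flat (fun i t => a i t w) m.

Lemma measurable_flatw a : (forall i t, measurable_fun setT (a i t)) ->
  forall m, measurable_fun setT (flatw a m).
Proof.
move=> ma m; rewrite /flatw /flat; case: (cell N T m) => [[i t]|] //=.
Qed.

(** The increments x eps are orthogonal to functions of the preceding increments: those,
    and x itself, belong to the history of the cell, to which eps is orthogonal. *)
Lemma score_x_moment (r B : R) k : 2 <= r -> 0 <= B ->
  (forall i t, \int[P]_w (`|x i t k w * eps i t w| `^ r)%:E <= B%:E)%E ->
  (\int[P]_w (`|\sum_i \sum_t x i t k w * eps i t w| `^ r)%:E <=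
    (burk_const `^ r * (r * (N * T)%:R) `^ (r / 2) * B)%:E)%E.
Proof.
move=> r2 B0 HB.
pose a i t w := x i t k w * eps i t w.
have Es w : \sum_i \sum_t x i t k w * eps i t w = \sum_(0 <= m < N * T) flatw a m w.
  by rewrite -(sum_flat hT (fun i t => x i t k w * eps i t w)).
under eq_integral do rewrite Es.
have r0 : 0 < r by lra.
apply: (@martingale_moment _ _ _ P (flatw a)) => //.
- by apply: measurable_flatw => i t; apply: measurable_funM.
- move=> m; rewrite /flatw /flat; case: (cell N T m) => [[i t]|] /=; first exact: HB.
  by under eq_integral do rewrite normr0 powR0 ?gt_eqF//; rewrite integral0 lee_fin.
- move=> m mNT; case E : (cell N T m) => [[i t]|]; last first.
    move=> _; apply: integral0_eq => w _.
    by rewrite [flatw a m w](_ : _ = 0) ?mulr0// /flatw /flat E.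
  have [Ei Et] := cellP E.
  have Ew w : flatw a m w = x i t k w * eps i t w by rewrite /flatw /flat E.
  rewrite (_ : (fun w => (spow r (\sum_(0 <= j < m) flatw a j w) * flatw a m w)%:E) =
    (fun w => (spow r (\sum_(0 <= j < m) flatw a j w) * x i t k w * eps i t w)%:E)); last first.
    by apply/funext => w; rewrite Ew mulrA.
  apply: (integral_mul_orth (@history_measurable _ _ _ _ _ _ _ x eps i t)
    (@historyI _ _ _ _ _ _ _ x eps i t) (@historyT _ _ _ _ _ _ _ x eps i t)).
  + by have [] := mds i t.
  + by move=> A; apply: eps_history0.
  + apply: measurable_funM; last exact: history_x_own.
    apply: measurable_spow => //.
    apply: (@measurable_partial_sub _ (g_sigma_algebraType (history x eps i t))
      (flatw a)) => j jm.
    rewrite /flatw /flat; case E' : (cell N T j) => [[i' t']|] //=.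
    have [Ei' Et'] := cellP E'.
    have [ii|ii] := ltnP i' i.
      by apply: measurable_funM; [exact: history_x_past|exact: history_eps_past].
    have ii' : i' = i.
      apply/val_inj/eqP; rewrite eqn_leq ii andbT /= -Ei -Ei'.
      by apply: leq_div2r; exact: ltnW.
    apply: measurable_funM; rewrite ii'; first exact: history_x_own.
    apply: history_eps_own.
    have := jm; rewrite (divn_eq j T) (divn_eq m T) Ei Et Ei' Et' ii'.
    by rewrite ltn_add2l.
Qed.

Lemma score_d_moment (r B : R) i : 2 <= r -> 0 <= B ->
  (forall t, \int[P]_w (`|eps i t w| `^ r)%:E <= B%:E)%E ->
  (\int[P]_w (`|\sum_t eps i t w| `^ r)%:E <=
    (burk_const `^ r * (r * T%:R) `^ (r / 2) * B)%:E)%E.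
Proof.
move=> r2 B0 HB; have r0 : 0 < r by lra.
pose D m w : R := if insub m is Some t then eps i t w else 0.
have E w : \sum_t eps i t w = \sum_(0 <= m < T) D m w.
  by rewrite big_mkord; apply: eq_bigr => t _; rewrite /D valK.
under eq_integral do rewrite E.
apply: (@martingale_moment _ _ _ P D) => //.
- by move=> m; rewrite /D; case: insub => //.
- move=> m; rewrite /D; case: insub => [i'|]; first exact: HB.
  by under eq_integral do rewrite normr0 powR0 ?gt_eqF//; rewrite integral0 lee_fin.
- move=> m mT.
  pose t := Ordinal mT.
  have Dm : D m = eps i t by apply/funext => w; rewrite /D insubT.
  rewrite Dm.
  apply: (integral_mul_orth (@sigma_first_measurable _ _ _ _ _ _ eps i t)
    (@sigma_firstI _ _ _ _ _ _ eps i t) (@sigma_firstT _ _ _ _ _ _ eps i t)).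
  + by have [] := mds i t.
  + by move=> A; apply: eps_sigma_first0.
  + apply: measurable_spow => //.
    apply: (@measurable_partial_sub _ (g_sigma_algebraType (sigma_first (eps i) t)) D) => j jm.
    rewrite /D; case: insubP => // s _ sj; rewrite -sj in jm.
    move=> _ B' mB; rewrite setTI; apply: sub_sigma_algebra.
    by apply: sub_sigma_algebra; exists s => //; exists B' => //; rewrite setTI.
Qed.

Definition past (i : 'I_N) : set (set Omega) :=
  [set A | exists2 B, forall j, measurable (B j) & A = past_event x eps i B].

Lemma past_measurable i : past i `<=` measurable.
Proof. by move=> _ [B mB ->]; exact: measurable_past. Qed.

Lemma pastI i : setI_closed (past i).
Proof.
move=> _ _ [B mB ->] [B' mB' ->]; exists (fun j => B j `&` B' j).
  by move=> j; exact: measurableI.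
apply/seteqP; split=> w.
  by move=> [/past_eventE H /past_eventE H']; apply/past_eventE => j ji; split; [exact: H|exact: H'].
by move=> /past_eventE H; split; apply/past_eventE => j /H[].
Qed.

Lemma pastT i : past i setT.
Proof. by exists (fun=> setT) => //; rewrite past_eventT. Qed.

(** Independent centred summands are martingale differences for the pasts of the units. *)
Lemma indep_sum_moment (r B : R)
  (f : T.-tuple (p.-tuple R) * T.-tuple R -> R) :
  2 <= r -> 0 <= B -> measurable_fun setT f ->
  (forall i, P.-integrable setT (fun w => (f (data_unit x eps i w))%:E)) ->
  (forall i, \int[P]_w (f (data_unit x eps i w))%:E = 0)%E ->
  (forall i, \int[P]_w (`|f (data_unit x eps i w)| `^ r)%:E <= B%:E)%E ->
  (\int[P]_w (`|\sum_i f (data_unit x eps i w)| `^ r)%:E <=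
    (burk_const `^ r * (r * N%:R) `^ (r / 2) * B)%:E)%E.
Proof.
move=> r2 B0 mf fi f0 HB; have r0 : 0 < r by lra.
pose D m w : R := if insub m is Some i then f (data_unit x eps i w) else 0.
have E w : \sum_i f (data_unit x eps i w) = \sum_(0 <= m < N) D m w.
  by rewrite big_mkord; apply: eq_bigr => t _; rewrite /D valK.
under eq_integral do rewrite E.
have mfd i : measurable_fun setT (f \o data_unit x eps i).
  by apply: measurableT_comp => //; exact: measurable_data.
apply: (@martingale_moment _ _ _ P D) => //.
- by move=> m; rewrite /D; case: insub => // i; exact: mfd.
- move=> m; rewrite /D; case: insub => [i'|]; first exact: HB.
  by under eq_integral do rewrite normr0 powR0 ?gt_eqF//; rewrite integral0 lee_fin.
- move=> m mT.
  pose i := Ordinal mT.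
  have Dm : D m = f \o data_unit x eps i by apply/funext => w; rewrite /D insubT.
  rewrite Dm.
  apply: (integral_mul_orth (@past_measurable i) (@pastI i) (@pastT i)); first exact: fi.
  + move=> _ [B' mB ->]; rewrite -[past_event _ _ _ _]setIT.
    apply: (integral_indep_event (preimage_system_measurable (@measurable_data _ _ _ _ _ _ _ x eps i))
     (@preimage_systemI _ _ _ _ (data_unit x eps i)) (@preimage_systemT _ _ _ _ (data_unit x eps i))).
    * exact: measurable_past.
    * exact: past_indep.
    * exact: measurable_preimage_system.
    * exact: fi.
    * by apply: sub_sigma_algebra; exact: preimage_systemT.
    * exact: f0.
  + apply: measurable_spow => //.
    apply: (@measurable_partial_sub _ (g_sigma_algebraType (past i)) D) => j jm.
    rewrite /D; case: insubP => // s _ sj; rewrite -sj in jm.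
    move=> _ B' mB; rewrite setTI; apply: sub_sigma_algebra.
    exists (fun j' => if j' == s then f @^-1` B' else setT).
      by move=> j'; case: ifP => // _; rewrite -[X in measurable X]setTI; exact: mf.
    apply/seteqP; split=> w.
      by move=> Bw; apply/past_eventE => j' _; case: eqP => // ->.
    by move=> /past_eventE /(_ s jm); rewrite eqxx.
Qed.

Lemma mean_moment (I : finType) (a : I -> Omega -> R) (q B : R) : 1 <= q -> (0 < #|I|)%N ->
  (forall i, measurable_fun setT (a i)) -> 0 <= B ->
  (forall i, \int[P]_w (`|a i w| `^ q)%:E <= B%:E)%E ->
  (\int[P]_w (`|(\sum_i a i w) / #|I|%:R| `^ q)%:E <= B%:E)%E.
Proof.
move=> q1 I0 ma B0 HB.
have n0 : 0 < #|I|%:R :> R by rewrite ltr0n.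
have maq i : measurable_fun setT (fun w => `|a i w| `^ q) by exact: measurable_abs_powR.
apply: (@le_trans _ _ (\int[P]_w (#|I|%:R^-1 * \sum_i `|a i w| `^ q)%:E)%E).
  apply: le_integral_real.
  - apply: measurable_abs_powR; apply: measurable_funM => //.
    by apply: measurable_sum.
  - by apply: measurable_funM => //; apply: measurable_sum.
  - by move=> w; exact: powR_ge0.
  - move=> w; rewrite [leRHS]mulrC; apply: le_trans (powR_mean q1 I0 (fun i => normr_ge0 (a i w))).
    apply: ge0_ler_powR; rewrite ?nnegrE//; first by lra.
      by rewrite divr_ge0// sumr_ge0.
    by rewrite normrM [X in _ * X]ger0_norm ?invr_ge0// ler_wpM2r ?invr_ge0// ler_norm_sum.
under eq_integral do rewrite EFinM.
have mS : measurable_fun setT (fun w => (\sum_i `|a i w| `^ q)%:E).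
  by apply/measurable_EFinP; apply: measurable_sum.
rewrite ge0_integralZl//; last first.
- by move=> w _; rewrite lee_fin sumr_ge0// => i _; exact: powR_ge0.
under eq_integral do rewrite -sumEFin.
rewrite ge0_integral_sum//; last first.
all: try by move=> i w _; rewrite lee_fin powR_ge0.
all: try by move=> i; apply/measurable_EFinP.
have -> : B%:E = ((#|I|%:R^-1)%:E * (\sum_(i : I) B)%:E)%E.
  by rewrite -EFinM sumr_const -[B *+ _]mulr_natl mulKf ?gt_eqF.
apply: lee_wpmul2l; first by rewrite lee_fin invr_ge0 ltW.
by rewrite -sumEFin; apply: lee_sum.
Qed.

End PanelMoments.

(** * Moments of sub-Gaussian variables *)

Section SubGaussian.
Context {d : measure_display} {Omega : measurableType d} {R : realType}.
Variable P : probability Omega R.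
Variables (U : Omega -> R) (C K : R).
Hypothesis mU : measurable_fun setT U.
Hypotheses (C0 : 0 < C) (K0 : 0 < K).
Hypothesis tail : forall u : R, 0 < u ->
  (P [set w | (u <= `|U w|)%R] <= (2^-1 * K * expR (- (C * u ^+ 2)))%R%:E)%E.

Let ln2_gt0 : 0 < ln 2 :> R.
Proof. by apply: ln_gt0; lra. Qed.

Let level w : R := C / 2 * U w ^+ 2 / ln 2.
Let A (n : nat) : set Omega := [set w | n%:R <= level w].

Let level_ge0 w : 0 <= level w.
Proof.
by rewrite divr_ge0 ?(ltW ln2_gt0)// mulr_ge0 ?sqr_ge0// divr_ge0// ltW.
Qed.

Let mlevel : measurable_fun setT level.
Proof.
apply: measurable_funM => //; apply: measurable_funM => //.
by under eq_fun do rewrite expr2; exact: measurable_funM.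
Qed.

Let mA n : measurable (A n).
Proof.
have -> : A n = level @^-1` `[n%:R, +oo[.
  by apply/seteqP; split=> w /=; rewrite in_itv/= andbT.
by rewrite -[X in measurable X]setTI; exact: mlevel.
Qed.

Let PA n : ((2 ^+ n.+1)%:E * P (A n) <= ((2 * (K + 2)) / (2 ^ n.+1)%:R)%:E)%E.
Proof.
have p0 : 0 < (2 : R) ^+ n.+1 by rewrite exprn_gt0.
rewrite natrX; case: n p0 => [|n] p0.
  rewrite expr1; apply: (@le_trans _ _ (2%:E * 1)%E).
    by apply: lee_wpmul2l; [rewrite lee_fin|exact: probability_le1].
  by rewrite mule1 lee_fin ler_pdivlMr//; have := K0; lra.
set u := Num.sqrt (2 * n.+1%:R * ln 2 / C).
have a0 : 0 < 2 * n.+1%:R * ln 2 / C by rewrite divr_gt0// mulr_gt0 ?ln2_gt0// mulr_gt0.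
have u0 : 0 < u by rewrite sqrtr_gt0.
have An : A n.+1 = [set w | u <= `|U w|].
  rewrite /A /level; apply/seteqP; split=> w /=.
    rewrite ler_pdivlMr ?ln2_gt0// => h.
    rewrite -sqrtr_sqr /u; apply: ler_wsqrtr.
    by rewrite ler_pdivrMr//; lra.
  rewrite -(@ler_pXn2r _ 2) ?nnegrE ?(ltW u0)// sqr_sqrtr ?(ltW a0)// real_normK ?num_real//.
  rewrite ler_pdivrMr// => h; rewrite ler_pdivlMr ?ln2_gt0//; lra.
have := tail u0; rewrite -An sqr_sqrtr ?(ltW a0)//.
have -> : - (C * (2 * n.+1%:R * ln 2 / C)) = - (n.+1%:R * (2 * ln 2)).
  by field; rewrite gt_eqF.
rewrite expRN expRM_natl expRM_natl lnK ?posrE// => H.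
apply: (le_trans (lee_wpmul2l _ H)); first by rewrite lee_fin ltW.
rewrite -EFinM lee_fin.
pose q := (2 : R) ^+ n.+1; have q0 : 0 < q by rewrite exprn_gt0.
have -> : (2 : R) ^+ n.+2 = 2 * q by rewrite exprS.
have -> : ((2 : R) ^+ 2) ^+ n.+1 = q ^+ 2 by rewrite -!exprM mulnC.
have -> : 2 * q * (2^-1 * K * (q ^+ 2)^-1) = K / q by field; rewrite gt_eqF.
have -> : 2 * (K + 2) / (2 * q) = (K + 2) / q by field; rewrite gt_eqF.
by rewrite ler_pM2r ?invr_gt0//; lra.
Qed.

(** Compare exp(C U^2 / 2) with the sum of 2^(n+1) over the levels n below
    C U^2 / (2 ln 2): the tail bound makes the n-th level cost a multiple of 2^-n. *)
Lemma subgaussian_exp :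
  (\int[P]_w (expR (C / 2 * U w ^+ 2))%:E <= (2 * (K + 2))%:E)%E.
Proof.
have mexp : measurable_fun setT (fun w => expR (C / 2 * U w ^+ 2)).
  apply: measurableT_comp => //; apply: measurable_funM => //.
  by under eq_fun do rewrite expr2; exact: measurable_funM.
pose f (n : nat) w : \bar R := (2 ^+ n.+1 * \1_(A n) w)%:E.
have mf n : measurable_fun setT (f n).
  by apply/measurable_EFinP; apply: measurable_funM => //; exact: measurable_indic.
have f0 n w : (0 <= f n w)%E by rewrite lee_fin mulr_ge0// exprn_ge0.
apply: (@le_trans _ _ (\int[P]_w (\sum_(n <oo) f n w))%E).
  apply: ge0_le_integral => //.
  - exact/measurable_EFinP.
  - by apply: ge0_emeasurable_sum.
  move=> w _; set n := Num.trunc (level w).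
  have /andP[n1 n2] := truncn_itv (level_ge0 w).
  apply: (@le_trans _ _ (f n w)).
    rewrite /f indicE mem_set//= mulr1 lee_fin.
    have -> : C / 2 * U w ^+ 2 = level w * ln 2 by rewrite /level divfK ?gt_eqF ?ln2_gt0.
    apply: (@le_trans _ _ (expR (n.+1%:R * ln 2))).
      by rewrite ler_expR ler_pM2r ?ln2_gt0// ltW.
    by rewrite expRM_natl lnK ?posrE.
  apply: le_trans (@nneseries_lim_ge _ _ xpredT 0 n.+1 (fun k _ _ => f0 k w)).
  by rewrite big_nat_recr//= leeDr// sume_ge0.
rewrite integral_nneseries//.
apply: (@le_trans _ _ (\sum_(n <oo) ((2 * (K + 2)) / (2 ^ n.+1)%:R)%:E)%E); last first.
  by apply: (epsilon_trick0 xpredT); have := K0; lra.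
apply: lee_nneseries => [n _ _|n _].
  by apply: integral_ge0 => w _; exact: f0.
apply: le_trans (PA n); rewrite /f.
under eq_integral do rewrite EFinM.
rewrite ge0_integralZl//; first by rewrite integral_indic// setIT.
- by apply/measurable_EFinP; exact: measurable_indic.
Qed.

Lemma powR_le_expR (q c y : R) : 0 < q -> 0 < c -> 0 <= y ->
  y `^ q <= (q / c) `^ q * expR (c * y).
Proof.
move=> q0 c0 y0; have q0' := ltW q0; have c0' := ltW c0.
have -> : expR (c * y) = expR (c * y / q) `^ q.
  by rewrite -expRM divfK ?gt_eqF.
rewrite -powRM ?expR_ge0 ?divr_ge0 ?(ltW q0) ?(ltW c0)//.
apply: ge0_ler_powR; rewrite ?nnegrE ?mulr_ge0 ?expR_ge0 ?divr_ge0 ?invr_ge0//.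
have h := expR_ge1Dx (c * y / q).
have qc : 0 < q / c by rewrite divr_gt0.
have E : y = q / c * (c * y / q) by field; rewrite !gt_eqF.
by rewrite [leLHS]E ler_pM2l//; lra.
Qed.

(** y^q <= (q/c)^q e^(c y) with y = U^2 and c = C/2. *)
Lemma subgaussian_moment (q : R) : 0 < q ->
  (\int[P]_w (`|U w| `^ (2 * q))%:E <= ((2 * q / C) `^ q * (2 * (K + 2)))%:E)%E.
Proof.
move=> q0; have c0 : 0 < C / 2 by rewrite divr_gt0.
have mexp : measurable_fun setT (fun w => expR (C / 2 * U w ^+ 2)).
  apply: measurableT_comp => //; apply: measurable_funM => //.
  by under eq_fun do rewrite expr2; exact: measurable_funM.
apply: (@le_trans _ _ (\int[P]_w ((2 * q / C) `^ q * expR (C / 2 * U w ^+ 2))%:E)%E).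
  apply: le_integral_real.
  - exact: measurable_abs_powR.
  - exact: measurable_funM.
  - by move=> w; exact: powR_ge0.
  move=> w; rewrite powRrM powR_mulrn// real_normK ?num_real//.
  have := powR_le_expR q0 c0 (sqr_ge0 (U w)).
  by have -> : q / (C / 2) = 2 * q / C by field; rewrite gt_eqF.
under eq_integral do rewrite EFinM.
rewrite ge0_integralZl//.
- by rewrite EFinM; apply: lee_wpmul2l; [rewrite lee_fin powR_ge0|exact: subgaussian_exp].
all: first [exact/measurable_EFinP|by rewrite lee_fin powR_ge0].
Qed.

End SubGaussian.

(** * Entries of the Gram matrix and their means *)

Section DesignEntries.
Context {R : realType}.
Variables N T p : nat.
Hypotheses (hN : (0 < N)%N) (hT : (0 < T)%N).
Variables (X : 'I_N -> 'I_T -> 'I_p -> R) (e : 'I_N -> 'I_T -> R).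

Lemma sum_cells (f : 'I_N -> 'I_T -> R) :
  \sum_(m : 'I_N * 'I_T) f m.1 m.2 = \sum_i \sum_t f i t.
Proof. by rewrite pair_big. Qed.

Lemma sqrt_natM_sqr n : Num.sqrt n%:R * Num.sqrt n%:R = n%:R :> R.
Proof. by rewrite -expr2 sqr_sqrtr. Qed.

Lemma gram_ll j k : gram (design X) (lshift N j) (lshift N k) =
  (\sum_i \sum_t X i t j * X i t k) / (N * T)%:R.
Proof.
rewrite /gram -(sum_cells (fun i t => X i t j * X i t k)) mulr_suml.
apply: eq_bigr => m _; rewrite !design_l mulrACA -invfM sqrt_natM_sqr.
by [].
Qed.

Lemma gram_lr j i : gram (design X) (lshift N j) (rshift p i) =
  (\sum_t X i t j) / (Num.sqrt (N * T)%:R * Num.sqrt T%:R).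
Proof.
rewrite /gram mulr_suml.
under eq_bigr => m _ do rewrite design_l design_r.
rewrite (sum_cells (fun i' t => X i' t j / Num.sqrt (N * T)%:R * ((i' == i)%:R / Num.sqrt T%:R))).
rewrite (bigD1 i)//= [X in _ + X]big1 ?addr0.
  by apply: eq_bigr => t _; rewrite eqxx mul1r invfM mulrA.
by move=> i' ii; rewrite big1// => t _; rewrite (negbTE ii) mul0r mulr0.
Qed.

Lemma gram_sym a b : gram (design X) a b = gram (design X) b a.
Proof. by rewrite /gram; apply: eq_bigr => m _; rewrite mulrC. Qed.

Lemma gram_rr_delta i i' : gram (design X) (rshift p i) (rshift p i') = (i == i')%:R.
Proof.
rewrite /gram; under eq_bigr => m _ do rewrite !design_r.
rewrite (sum_cells (fun j t => (j == i)%:R / Num.sqrt T%:R * ((j == i')%:R / Num.sqrt T%:R))).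
rewrite (bigD1 i)//= [X in _ + X]big1 ?addr0; last first.
  by move=> j ji; rewrite big1// => t _; rewrite (negbTE ji) !mul0r.
rewrite eqxx sumr_const card_ord -[LHS]mulr_natl mul1r [X in _ * X]mulrCA -invfM sqrt_natM_sqr.
by rewrite mulrCA divff ?mulr1// pnatr_eq0 -lt0n.
Qed.

Lemma score_l k : score (design X) (err e) (lshift N k) =
  (\sum_i \sum_t X i t k * e i t) / Num.sqrt (N * T)%:R.
Proof.
rewrite /score -(sum_cells (fun i t => X i t k * e i t)) mulr_suml.
by apply: eq_bigr => m _; rewrite design_l mulrAC.
Qed.

Lemma score_r i : score (design X) (err e) (rshift p i) =
  (\sum_t e i t) / Num.sqrt T%:R.
Proof.
rewrite /score mulr_suml; under eq_bigr => m _ do rewrite design_r.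
rewrite (sum_cells (fun i' t => ((i' == i)%:R / Num.sqrt T%:R) * e i' t)).
rewrite (bigD1 i)//= [X in _ + X]big1 ?addr0.
  by apply: eq_bigr => t _; rewrite eqxx mul1r mulrC.
by move=> i' ii; rewrite big1// => t _; rewrite (negbTE ii) !mul0r.
Qed.

End DesignEntries.

Section GramDeviation.
Context {d : measure_display} {Omega : measurableType d} {R : realType}.
Variable P : probability Omega R.
Variables N T p : nat.
Hypotheses (hN : (0 < N)%N) (hT : (0 < T)%N).
Variables (x : 'I_N -> 'I_T -> 'I_p -> {RV P >-> R}) (eps : 'I_N -> 'I_T -> {RV P >-> R}).
Hypothesis indep_units : mutually_independent P (data_unit x eps).
Hypothesis ident_units : identically_distributed P (data_unit x eps).

Lemma XtXE w j k : ((Xstack x w)^T *m Xstack x w) j k = \sum_i \sum_t x i t j w * x i t k w.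
Proof.
rewrite /Xstack tr_mxcol mul_mxrow_mxcol summxE; apply: eq_bigr => i _.
by rewrite mxE; apply: eq_bigr => t _; rewrite !mxE.
Qed.

Variables (q m2 G0 : R).
Hypothesis q1 : 1 <= q.
Hypothesis xq : forall i t k, (\int[P]_w (`|x i t k w| `^ (2 * q))%:E <= m2%:E)%E.
Hypothesis x2 : forall i t k, (\int[P]_w (`|x i t k w| `^ 2)%:E <= G0%:E)%E.

Lemma m2_ge0 : (0 < p)%N -> 0 <= m2.
Proof.
move=> hp; rewrite -lee_fin; apply: le_trans (xq (Ordinal hN) (Ordinal hT) (Ordinal hp)).
by apply: integral_ge0 => w _; rewrite lee_fin powR_ge0.
Qed.

Lemma G0_ge0 : (0 < p)%N -> 0 <= G0.
Proof.
move=> hp; rewrite -lee_fin; apply: le_trans (x2 (Ordinal hN) (Ordinal hT) (Ordinal hp)).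
by apply: integral_ge0 => w _; rewrite lee_fin powR_ge0.
Qed.

Lemma mxx i t j k : measurable_fun setT (fun w => x i t j w * x i t k w).
Proof. exact: measurable_funM. Qed.

Lemma xx_moment i t j k : (\int[P]_w (`|x i t j w * x i t k w| `^ q)%:E <= (2 * m2)%:E)%E.
Proof.
have mj := @measurable_abs_powR _ _ R _ (2 * q) (measurable_funP (x i t j)).
have mk := @measurable_abs_powR _ _ R _ (2 * q) (measurable_funP (x i t k)).
apply: (@le_trans _ _ (\int[P]_w (`|x i t j w| `^ (2 * q) + `|x i t k w| `^ (2 * q))%:E)%E).
  apply: le_integral_real.
  - by apply: measurable_abs_powR; exact: mxx.
  - exact: measurable_funD.
  - by move=> w; exact: powR_ge0.
  move=> w; rewrite normrM powRM//.
  have sq (a : R) : 0 <= a -> a `^ (2 * q) = a `^ q * a `^ q.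
    by move=> a0; rewrite mulrC powRrM powR_mulrn ?powR_ge0// expr2.
  rewrite !sq//; set a := _ `^ q; set b := _ `^ q.
  have := sqr_ge0 (a - b); have := sqr_ge0 a; have := sqr_ge0 b; lra.
under eq_integral do rewrite EFinD.
rewrite ge0_integralD//.
- have -> : (2 * m2)%:E = (m2%:E + m2%:E)%E by rewrite -EFinD; congr (_%:E); ring.
  exact: leeD.
all: first [exact/measurable_EFinP|by move=> w _; rewrite lee_fin powR_ge0].
Qed.

Lemma abs_le_1powR (a : R) (s : R) : 1 <= s -> `|a| <= 1 + `|a| `^ s.
Proof.
move=> s1; have [a1|a1] := leP `|a| 1.
  by apply: (le_trans a1); rewrite lerDl powR_ge0.
apply: (@le_trans _ _ (`|a| `^ s)); last by rewrite lerDr.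
by apply: le1r_powR => //; exact: ltW.
Qed.

Lemma integrable_moment (U : Omega -> R) (s B : R) : 1 <= s -> measurable_fun setT U ->
  (\int[P]_w (`|U w| `^ s)%:E <= B%:E)%E -> P.-integrable setT (EFin \o U).
Proof.
move=> s1 mU UB.
have i1 := integrable_abs_powR mU UB.
have i2 : P.-integrable setT (EFin \o cst (1 : R)) by exact: finite_measure_integrable_cst.
have := integrableD measurableT i2 i1; apply: le_integrable => //.
  exact/measurable_EFinP.
move=> w _; rewrite /= lee_fin [leRHS]ger0_norm ?addr_ge0 ?powR_ge0//.
exact: abs_le_1powR.
Qed.

Lemma xx_integrable i t j k : P.-integrable setT (fun w => (x i t j w * x i t k w)%:E).
Proof. exact: (integrable_moment q1 (mxx i t j k) (xx_moment i t j k)). Qed.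

Definition xxmean i t j k : R := fine (\int[P]_w (x i t j w * x i t k w)%:E).

Lemma xxmeanE i t j k : (\int[P]_w (x i t j w * x i t k w)%:E = (xxmean i t j k)%:E)%E.
Proof. by rewrite fineK//; apply: integral_fune_fin_num => //; exact: xx_integrable. Qed.

Lemma abs_xxmean i t j k : `|xxmean i t j k| <= G0.
Proof.
rewrite -lee_fin; have -> : (`|xxmean i t j k|%:E = `|\int[P]_w (x i t j w * x i t k w)%:E|)%E.
  by rewrite xxmeanE.
apply: (le_trans (le_abse_integral _ _ _)) => //; first exact/measurable_EFinP/mxx.
have mj := @measurable_abs_powR _ _ R _ 2 (measurable_funP (x i t j)).
have mk := @measurable_abs_powR _ _ R _ 2 (measurable_funP (x i t k)).
apply: (@le_trans _ _ (\int[P]_w (2^-1 * (`|x i t j w| `^ 2 + `|x i t k w| `^ 2))%:E)%E).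
  apply: (@le_integral_real _ _ _ _ (fun w => `|x i t j w * x i t k w|)).
  - by apply: measurableT_comp => //; exact: mxx.
  - by apply: measurable_funM => //; exact: measurable_funD.
  - by [].
  move=> w; rewrite normrM !powR_mulrn//.
  have := sqr_ge0 (`|x i t j w| - `|x i t k w|); lra.
under eq_integral do rewrite EFinM.
rewrite ge0_integralZl//; last first.
all: try by move=> w _; rewrite lee_fin addr_ge0 ?powR_ge0.
all: try by apply/measurable_EFinP; exact: measurable_funD.
under eq_integral do rewrite EFinD.
rewrite ge0_integralD//; last first.
all: try by move=> w _; rewrite lee_fin powR_ge0.
all: try exact/measurable_EFinP.
have -> : G0%:E = ((2^-1)%:E * (G0 + G0)%:E)%E :> \bar R.
  by rewrite -EFinM; congr (_%:E); field.
by apply: lee_wpmul2l; rewrite ?lee_fin// EFinD; apply: leeD.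
Qed.

(** Means of a signed function are compared through the nonnegative functions f + |f|
    and |f|, for which equality in law gives equal integrals. *)
Lemma xxmean_ident i i' t j k : xxmean i t j k = xxmean i' t j k.
Proof.
pose f (u : T.-tuple (p.-tuple R) * T.-tuple R) : R := get_x t j u.1 * get_x t k u.1.
have mf : measurable_fun setT f.
  by apply: measurable_funM;
    [exact: (measurableT_comp (measurable_get_x t j))|exact: (measurableT_comp (measurable_get_x t k))].
have fx i0 w : f (data_unit x eps i0 w) = x i0 t j w * x i0 t k w by rewrite /f /= !get_xE.
pose g u : R := f u + `|f u|; pose h u : R := `|f u|.
have mh : measurable_fun setT h by exact: measurableT_comp.
have mg : measurable_fun setT g by exact: measurable_funD.
have H i0 : (\int[P]_w (x i0 t j w * x i0 t k w)%:E =
   \int[P]_w (g (data_unit x eps i0 w))%:E - \int[P]_w (h (data_unit x eps i0 w))%:E)%E.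
  have ixx := xx_integrable i0 t j k.
  have ih : P.-integrable setT (fun w => (h (data_unit x eps i0 w))%:E).
    rewrite (_ : (fun _ => _) = (fun w => `|x i0 t j w * x i0 t k w|%:E)).
      exact: (integrable_abse ixx).
    by apply/funext => w; rewrite /h fx.
  rewrite -integralB_EFin//.
    by apply: eq_integral => w _; rewrite /g /h fx -EFinB addrK.
  have := integrableD measurableT ixx ih; apply: eq_integrable => // w _.
  by rewrite /= /g /h fx EFinD.
rewrite /xxmean !H; congr (fine (_ - _)%E).
  apply: (@integral_ident _ _ _ P _ _ _ (data_unit x eps) g i i' ident_units) => //.
  - exact: measurable_data.
  - by move=> u; rewrite /g; have := ler_norm (- f u); rewrite normrN; lra.
apply: (@integral_ident _ _ _ P _ _ _ (data_unit x eps) h i i' ident_units) => //.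
  by move=> i0; exact: measurable_data.
by move=> u; rewrite /h.
Qed.

Lemma Gamma_ll j k : Gamma x (lshift N j) (lshift N k) =
  (\sum_t xxmean (Ordinal hN) t j k) / T%:R.
Proof.
rewrite /Gamma block_mxEul mxE unlock.
under eq_integral do rewrite XtXE mulrC EFinM.
have iS : P.-integrable setT (fun w => (\sum_i \sum_t x i t j w * x i t k w)%:E).
  under eq_fun do rewrite -sumEFin.
  apply: integrable_sum => // i _; under eq_fun do rewrite -sumEFin.
  by apply: integrable_sum => // t _; exact: xx_integrable.
rewrite integralZl//.
under eq_integral do rewrite -sumEFin.
rewrite integral_sum//; last first.
  move=> i; under eq_fun do rewrite -sumEFin.
  by apply: integrable_sum => // t _; exact: xx_integrable.
have E i : (\int[P]_w (\sum_t x i t j w * x i t k w)%:E = (\sum_t xxmean (Ordinal hN) t j k)%:E)%E.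
  under eq_integral do rewrite -sumEFin.
  rewrite integral_sum//; last by move=> t; exact: xx_integrable.
  rewrite -sumEFin; apply: eq_bigr => t _; rewrite xxmeanE; congr (_%:E).
  exact: xxmean_ident.
under eq_bigr do rewrite E.
rewrite sumEFin sumr_const card_ord -EFinM /= -[X in _ * X]mulr_natl natrM.
by field; rewrite !pnatr_eq0 -!lt0n hN hT.
Qed.

Lemma Gamma_lr j i : Gamma x (lshift N j) (rshift p i) = 0.
Proof. by rewrite /Gamma block_mxEur mxE. Qed.
Lemma Gamma_rl j i : Gamma x (rshift p i) (lshift N j) = 0.
Proof. by rewrite /Gamma block_mxEdl mxE. Qed.
Lemma Gamma_rr i i' : Gamma x (rshift p i) (rshift p i') = (i == i')%:R.
Proof. by rewrite /Gamma block_mxEdr mxE. Qed.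

Lemma abs_Gamma_ll j k : `|Gamma x (lshift N j) (lshift N k)| <= G0.
Proof.
have T0 : 0 < T%:R :> R by rewrite ltr0n.
rewrite Gamma_ll normrM [X in _ * X]ger0_norm ?invr_ge0// ler_pdivrMr//.
apply: (le_trans (ler_norm_sum _ _ _)).
apply: (@le_trans _ _ (\sum_(t < T) G0)); first by apply: ler_sum => t _; exact: abs_xxmean.
by rewrite sumr_const card_ord mulr_natr.
Qed.

Lemma Gamma_sym a b : Gamma x a b = Gamma x b a.
Proof.
case: (split_ordP a) => i ->; case: (split_ordP b) => j ->.
- rewrite /Gamma !block_mxEul !mxE; do 2 congr (_ _); apply/funext => w.
  rewrite !XtXE; congr (_ / _); apply: eq_bigr => m _; apply: eq_bigr => t _.
  exact: mulrC.
- by rewrite Gamma_lr Gamma_rl.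
- by rewrite Gamma_lr Gamma_rl.
- by rewrite !Gamma_rr eq_sym.
Qed.

End GramDeviation.

(** * Deviations of the Gram matrix *)

Lemma integral_cst_prob d (Omega : measurableType d) (R : realType) (P : probability Omega R) (c : R) :
  (\int[P]_w c%:E = c%:E)%E.
Proof.
rewrite integral_cst// [X in (_ * X)%E](_ : _ = 1%E) ?mule1//.
exact: probability_setT.
Qed.

Section UnionBound.
Context {d : measure_display} {Omega : measurableType d} {R : realType}.
Variable P : probability Omega R.
Variables (K : finType) (U : K -> Omega -> R) (c b : K -> R).
Hypothesis mU : forall k, measurable_fun setT (U k).

Let bad k := [set w | c k < `|U k w|].
Let good := [set w | forall k, `|U k w| <= c k].

Let mbad k : measurable (bad k).
Proof.
have -> : bad k = (fun w => `|U k w|) @^-1` `]c k, +oo[.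
  by apply/seteqP; split=> w /=; rewrite in_itv/= andbT.
by rewrite -[X in measurable X]setTI; apply: measurableT_comp.
Qed.

Lemma measurable_good : measurable good.
Proof.
have -> : good = \bigcap_(k in [set: K]) (~` bad k).
  apply/seteqP; split=> w H k; first by move=> _; rewrite /bad /= ltNge; apply/negP; rewrite negbK H.
  by have := H k I; rewrite /bad /= => /negP; rewrite -leNgt.
by apply: fin_bigcap_measurable => // k _; exact: measurableC.
Qed.

Lemma union_bound : (forall k, P (bad k) <= (b k)%:E)%E ->
  ((1 - \sum_k b k)%:E <= P good)%E.
Proof.
move=> Hb; have mg := measurable_good.
have mi (S : set Omega) : measurable S -> measurable_fun setT (\1_S : Omega -> R).
  by move=> mS; exact: measurable_indic.
have msum : measurable_fun setT (fun w => \sum_k (\1_(bad k) w : R)).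
  by apply: measurable_sum => k; exact: mi.
have : (1%:E <= P good + (\sum_k b k)%:E)%E.
  apply: (@le_trans _ _ (\int[P]_w (\1_good w + \sum_k \1_(bad k) w)%:E)%E).
    apply: (@le_trans _ _ (\int[P]_w (cst 1 w)%:E)%E).
      by rewrite /= integral_cst_prob.
    apply: le_integral_real => //.
    - by apply: measurable_funD => //; exact: mi.
    - move=> w /=; rewrite [\1_good w]indicE; have [wg|wg] := boolP (w \in good).
        by rewrite lerDl sumr_ge0.
      rewrite add0r; have [k bk] : exists k, bad k w.
        apply/not_existsP => H; move: wg; rewrite notin_setE; apply => k.
        by rewrite leNgt; apply/negP; exact: H.
      rewrite (bigD1 k)//= indicE mem_set// lerDl sumr_ge0//.
  under eq_integral do rewrite EFinD -sumEFin.
  rewrite ge0_integralD//; last first.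
  all: try by move=> w _; apply: sume_ge0 => k _; rewrite lee_fin.
  all: try by under eq_fun do rewrite sumEFin; exact/measurable_EFinP.
  all: try by apply/measurable_EFinP; exact: mi.
  rewrite integral_indic// setIT; apply: leeD => //.
  rewrite ge0_integral_sum//; last first.
  all: try by move=> k; apply/measurable_EFinP; exact: mi.
  rewrite -sumEFin; apply: lee_sum => k _.
  by rewrite integral_indic// setIT; exact: Hb.
by rewrite -leeBlDr//.
Qed.

End UnionBound.

Section Deviation.
Context {d : measure_display} {Omega : measurableType d} {R : realType}.
Variable P : probability Omega R.
Variables N T p : nat.
Hypotheses (hN : (0 < N)%N) (hT : (0 < T)%N).
Variables (x : 'I_N -> 'I_T -> 'I_p -> {RV P >-> R}) (eps : 'I_N -> 'I_T -> {RV P >-> R}).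
Hypothesis indep_units : mutually_independent P (data_unit x eps).
Hypothesis ident_units : identically_distributed P (data_unit x eps).
Variables (q m2 G0 : R).
Hypothesis q2 : 2 <= q.
Hypothesis xq : forall i t k, (\int[P]_w (`|x i t k w| `^ (2 * q))%:E <= m2%:E)%E.
Hypothesis x2 : forall i t k, (\int[P]_w (`|x i t k w| `^ 2)%:E <= G0%:E)%E.

Local Notation Z w := (design (fun i t k => x i t k w)).

Let q1 : 1 <= q. Proof. by have := q2; lra. Qed.
Let q0 : 0 < q. Proof. by have := q2; lra. Qed.

Lemma powR_abs_sub (a b : R) : `|a - b| `^ q <= 2 `^ q * (`|a| `^ q + `|b| `^ q).
Proof.
wlog ab : a b / `|a| <= `|b|.
  move=> H; have [|/ltW] := leP `|a| `|b|; first exact: H.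
  by move=> /H; rewrite (distrC b) (addrC (`|b| `^ q)).
apply: (@le_trans _ _ ((2 * `|b|) `^ q)).
  apply: ge0_ler_powR; rewrite ?nnegrE ?mulr_ge0// ?(ltW q0)//.
  by apply: (le_trans (ler_normB _ _)); lra.
by rewrite powRM// ler_wpM2l ?powR_ge0// lerDr powR_ge0.
Qed.

(** The tail bound of order q at deviation tau, with s = sqrt N * tau. *)
Definition dev_bound (s : R) : R :=
  (2 * burk_const) `^ q * q `^ (q / 2) * (2 * m2 + G0 `^ q + 1) / s `^ q.

(** For one period and one pair of covariates this is a centred sum over i.i.d. units. *)
Lemma unit_dev_moment t j k :
  (\int[P]_w (`|\sum_i (x i t j w * x i t k w - xxmean x (Ordinal hN) t j k)| `^ q)%:E <=
    (burk_const `^ q * (q * N%:R) `^ (q / 2) * (2 `^ q * (2 * m2 + G0 `^ q)))%:E)%E.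
Proof.
have hp : (0 < p)%N by case: (p) j => // -[].
have m20 := m2_ge0 hN hT xq hp.
have G00 := G0_ge0 hN hT x2 hp.
set g := xxmean _ _ _ _ _.
pose f (u : T.-tuple (p.-tuple R) * T.-tuple R) : R := get_x t j u.1 * get_x t k u.1 - g.
have mf : measurable_fun setT f.
  by apply: measurable_funB => //; apply: measurable_funM;
    [exact: (measurableT_comp (measurable_get_x t j))|exact: (measurableT_comp (measurable_get_x t k))].
have fx i w : f (data_unit x eps i w) = x i t j w * x i t k w - g by rewrite /f /= !get_xE.
have ixx i := xx_integrable q1 xq i t j k.
have ig : P.-integrable setT (EFin \o cst g) by exact: finite_measure_integrable_cst.
have gE i : xxmean x i t j k = g by apply: (xxmean_ident ident_units q1 xq) .
have B0 : 0 <= 2 `^ q * (2 * m2 + G0 `^ q).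
  by rewrite mulr_ge0 ?powR_ge0// addr_ge0 ?powR_ge0// mulr_ge0.
have := indep_sum_moment indep_units q2 B0 mf.
have -> : (fun w => (`|\sum_i f (data_unit x eps i w)| `^ q)%:E) =
  (fun w => (`|\sum_i (x i t j w * x i t k w - g)| `^ q)%:E).
  by apply/funext => w; under eq_bigr do rewrite fx.
apply => i.
- have := integrableB measurableT (ixx i) ig; apply: eq_integrable => // w _.
  by rewrite /= fx EFinB.
- under eq_integral do rewrite fx EFinB.
  have E1 := xxmeanE q1 xq i t j k; rewrite gE in E1.
  rewrite integralB_EFin//=; last exact: ixx.
  rewrite [X in (X - _)%E](_ : _ = g%:E); last exact: E1.
  by rewrite integral_cst_prob subee.
- under eq_integral do rewrite fx.
  apply: (@le_trans _ _ (\int[P]_w (2 `^ q * (`|x i t j w * x i t k w| `^ q + G0 `^ q))%:E)%E).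
    have mm := @measurable_abs_powR _ _ R _ q (mxx x i t j k).
    apply: le_integral_real.
    + by apply: measurable_abs_powR; apply: measurable_funB => //; exact: mxx.
    + by apply: measurable_funM => //; exact: measurable_funD.
    + by move=> w; exact: powR_ge0.
    + move=> w; apply: (le_trans (powR_abs_sub _ _)); rewrite ler_wpM2l ?powR_ge0// lerD2l.
      apply: ge0_ler_powR; rewrite ?nnegrE ?(ltW q0)//.
      exact: (abs_xxmean q1 xq x2).
  have mm := @measurable_abs_powR _ _ R _ q (mxx x i t j k).
  under eq_integral do rewrite EFinM.
  rewrite ge0_integralZl//; last first.
  all: try by move=> w _; rewrite lee_fin addr_ge0 ?powR_ge0.
  all: try by apply/measurable_EFinP; exact: measurable_funD.
  all: try by rewrite lee_fin powR_ge0.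
  rewrite EFinM; apply: lee_wpmul2l; first by rewrite lee_fin powR_ge0.
  under eq_integral do rewrite EFinD.
  rewrite ge0_integralD//; last first.
  all: try by move=> w _; rewrite lee_fin powR_ge0.
  all: try exact/measurable_EFinP.
  rewrite EFinD integral_cst_prob; apply: leeD => //.
  exact: xx_moment.
Qed.

(** The deviation is the average over t of centred averages over units, so the
    moment of one period bounds the moment of the deviation. *)
Lemma gram_ll_tail j k (tau : R) : 0 < tau ->
  (P [set w | (tau < `|gram (Z w) (lshift N j) (lshift N k) - Gamma x (lshift N j) (lshift N k)|)%R]
    <= (dev_bound (Num.sqrt N%:R * tau))%:E)%E.
Proof.
move=> tau0.
have hp : (0 < p)%N by case: (p) j => // -[].
have m20 := m2_ge0 hN hT xq hp.
have G00 := G0_ge0 hN hT x2 hp.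
have N0 : 0 < N%:R :> R by rewrite ltr0n.
have T0 : 0 < T%:R :> R by rewrite ltr0n.
pose a t w : R := (\sum_i (x i t j w * x i t k w - xxmean x (Ordinal hN) t j k)) / N%:R.
have E w : gram (Z w) (lshift N j) (lshift N k) - Gamma x (lshift N j) (lshift N k) =
   (\sum_t a t w) / #|'I_T|%:R.
  rewrite gram_ll (Gamma_ll hN hT ident_units q1 xq) card_ord.
  rewrite exchange_big /= /a -mulr_suml.
  under [X in _ = X / _ / _]eq_bigr do rewrite sumrB sumr_const card_ord.
  rewrite sumrB sumrMnl -[X in _ = (_ - X) / _ / _]mulr_natl natrM.
  by field; rewrite !gt_eqF.
rewrite (_ : [set w | _] = [set w | tau < `|(\sum_t a t w) / #|'I_T|%:R|]); last first.
  by apply/seteqP; split=> w /=; rewrite E.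
set B := (burk_const `^ q * (q * N%:R) `^ (q / 2) * (2 `^ q * (2 * m2 + G0 `^ q))) / N%:R `^ q.
have B0 : 0 <= B.
  rewrite divr_ge0 ?powR_ge0//; apply: mulr_ge0; first by rewrite mulr_ge0 ?powR_ge0.
  by rewrite mulr_ge0 ?powR_ge0// addr_ge0 ?powR_ge0// mulr_ge0.
have ms t : measurable_fun setT (fun w => \sum_i (x i t j w * x i t k w - xxmean x (Ordinal hN) t j k)).
  by apply: measurable_sum => i; apply: measurable_funB => //; exact: mxx.
have ma t : measurable_fun setT (a t) by apply: measurable_funM.
have aB t : (\int[P]_w (`|a t w| `^ q)%:E <= B%:E)%E.
  have := unit_dev_moment t j k; rewrite /B /a.
  have Nq : 0 < (N%:R : R) `^ q by exact: powR_gt0.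
  move=> H.
  have -> : (fun w => (`|(\sum_i (x i t j w * x i t k w - xxmean x (Ordinal hN) t j k)) / N%:R| `^ q)%:E)
   = (fun w => ((N%:R `^ q)^-1)%:E * (`|\sum_i (x i t j w * x i t k w - xxmean x (Ordinal hN) t j k)| `^ q)%:E)%E.
    apply/funext => w; rewrite normrM [X in _ * X]ger0_norm ?invr_ge0// powRM ?invr_ge0//.
    by rewrite -[X in X `^ q * _]/(_) -(powR_inv1 (ltW N0)) -powRrM mulN1r powRN mulrC EFinM.
  rewrite ge0_integralZl//; last first.
  all: try by move=> w _; rewrite lee_fin powR_ge0.
  all: try by apply/measurable_EFinP; exact: measurable_abs_powR.
  all: try by rewrite lee_fin invr_ge0 ltW.
  rewrite [X in (_ <= X%:E)%E]mulrC EFinM; apply: lee_wpmul2l; last exact: H.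
  by rewrite lee_fin invr_ge0 ltW.
have I0 : (0 < #|'I_T|)%N by rewrite card_ord.
have := mean_moment q1 I0 ma B0 aB.
move=> /(moment_tail q0 tau0) H.
apply: (le_trans (H _)); first by apply: measurable_funM => //; apply: measurable_sum.
rewrite lee_fin /dev_bound.
have s0 : 0 < Num.sqrt N%:R :> R by rewrite sqrtr_gt0.
have sq : (Num.sqrt N%:R : R) `^ q = N%:R `^ (q / 2).
  by rewrite -powR12_sqrt// -powRrM mulrC.
have NN : (N%:R : R) `^ q = N%:R `^ (q / 2) * N%:R `^ (q / 2).
  by rewrite -powRD ?(gt_eqF N0) ?implybT//; congr (_ `^ _); field.
rewrite (powRM _ (ltW s0) (ltW tau0)) sq /B NN (powRM _ (ltW q0) (ltW N0)).
rewrite (powRM _ (ler0n _ 2) (ltW burk_const_gt0)).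
have h1 : 0 < (N%:R : R) `^ (q / 2) by exact: powR_gt0.
have h2 : 0 < tau `^ q by exact: powR_gt0.
set n := N%:R `^ (q / 2) in h1 *; set tq := tau `^ q in h2 *.
set b := burk_const `^ q; set qq := q `^ (q / 2); set w2 := 2 `^ q.
have -> : b * (qq * n) * (w2 * (2 * m2 + G0 `^ q)) / (n * n) / tq =
   w2 * b * qq * (2 * m2 + G0 `^ q) / (n * tq) by field; rewrite !gt_eqF.
rewrite ler_wpM2r ?invr_ge0 ?mulr_ge0 ?(ltW h1) ?(ltW h2)//.
by rewrite ler_wpM2l ?mulr_ge0 ?powR_ge0// lerDl.
Qed.

(** The entry is 1/sqrt N times an average over t of the covariate of unit i alone; no
    cancellation is used. *)
Lemma gram_lr_tail j i (tau : R) : 0 < tau ->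
  (P [set w | (tau < `|gram (Z w) (lshift N j) (rshift p i)|)%R]
    <= (dev_bound (Num.sqrt N%:R * tau))%:E)%E.
Proof.
move=> tau0.
have hp : (0 < p)%N by case: (p) j => // -[].
have m20 := m2_ge0 hN hT xq hp.
have s0 : 0 < Num.sqrt N%:R :> R by rewrite sqrtr_gt0 ltr0n.
have T0 : 0 < T%:R :> R by rewrite ltr0n.
have E w : `|gram (Z w) (lshift N j) (rshift p i)| = `|(\sum_t x i t j w) / #|'I_T|%:R| / Num.sqrt N%:R.
  rewrite gram_lr card_ord natrM sqrtrM// -mulrA sqrt_natM_sqr invfM mulrCA mulrC normrM.
  by rewrite [X in _ * X]ger0_norm ?invr_ge0 ?(ltW s0).
rewrite (_ : [set w | _] = [set w | Num.sqrt N%:R * tau < `|(\sum_t x i t j w) / #|'I_T|%:R|]); last first.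
  by apply/seteqP; split=> w /=; rewrite E ltr_pdivlMr// mulrC.
have I0 : (0 < #|'I_T|)%N by rewrite card_ord.
have xm t : (\int[P]_w (`|x i t j w| `^ q)%:E <= (1 + m2)%:E)%E.
  apply: (@le_trans _ _ (\int[P]_w (1 + `|x i t j w| `^ (2 * q))%:E)%E).
    apply: le_integral_real.
    - exact: measurable_abs_powR.
    - by apply: measurable_funD => //; exact: measurable_abs_powR.
    - by move=> w; exact: powR_ge0.
    - move=> w; rewrite mulrC powRrM; apply: (le_trans (ler_norm _)).
      have := @abs_le_1powR R (`|x i t j w| `^ q) 2; rewrite (@ger0_norm _ (_ `^ q)) ?powR_ge0//.
      by apply; lra.
  under eq_integral do rewrite EFinD.
  rewrite ge0_integralD//; last first.
  all: try by move=> w _; rewrite lee_fin powR_ge0.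
  all: try by apply/measurable_EFinP; exact: measurable_abs_powR.
  by rewrite EFinD integral_cst_prob; apply: leeD.
have mx t : measurable_fun setT (x i t j : Omega -> R) by exact: measurable_funP.
have := mean_moment q1 I0 mx (addr_ge0 ler01 m20) xm.
move=> /(moment_tail q0 (mulr_gt0 s0 tau0)) H.
apply: (le_trans (H _)); first by apply: measurable_funM => //; apply: measurable_sum.
rewrite lee_fin /dev_bound ler_wpM2r ?invr_ge0 ?powR_ge0//.
have A1' : 1 <= (2 * burk_const) `^ q :> R.
  rewrite -[X in X <= _](powRr0 (2 * burk_const)); apply: ler_powR; last exact: ltW q0.
  by have := @burk_const_ge2 R; lra.
have A2' : 1 <= q `^ (q / 2).
  rewrite -[X in X <= _](powRr0 q); apply: ler_powR; first by have := q2; lra.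
  by rewrite divr_ge0// ltW.
have A3 : 1 + m2 <= 2 * m2 + G0 `^ q + 1 by have := powR_ge0 G0 q; lra.
apply: (le_trans A3); rewrite ler_peMl//; first by have := powR_ge0 G0 q; lra.
by rewrite -[X in X <= _]mulr1; apply: ler_pM.
Qed.

End Deviation.

(** * Extended-real quantities of the statement *)

Section AbsMin.
Context {R : realType}.

Lemma absmin_set0 n (v : 'cV[R]_n) : supp v = finset.set0 -> absmin v = +oo%E.
Proof. by move=> v0; rewrite /absmin v0 big_set0. Qed.

Lemma absmin_attained n (v : 'cV[R]_n) : supp v != finset.set0 ->
  exists2 k, k \in supp v & absmin v = (`|v k 0|)%:E /\
    forall j, j \in supp v -> `|v k 0| <= `|v j 0|.
Proof.
move=> /set0Pn[k0 k0v].
pose k := [arg min_(i < k0 in supp v) `|v i 0|]%O.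
have [kv kmin] : k \in supp v /\ forall j, j \in supp v -> `|v k 0| <= `|v j 0|.
  by rewrite /k; case: arg_minP.
exists k => //; split=> //; apply/eqP; rewrite eq_le; apply/andP; split.
  by apply: bigmin_le_cond.
apply/bigmin_geP; split; first exact: leey.
by move=> j jv; rewrite lee_fin kmin.
Qed.

(** 1 / beta_min, with 1 / (+oo) = 0 when there is no active coefficient. *)
Definition inv_absmin n (v : 'cV[R]_n) : R :=
  if absmin v is r%:E then r^-1 else 0.

Lemma inv_absmin_ge0 n (v : 'cV[R]_n) : 0 <= inv_absmin v.
Proof.
rewrite /inv_absmin; have [v0|v0] := eqVneq (supp v) finset.set0.
  by rewrite absmin_set0.
by have [k _ [-> _]] := absmin_attained v0; rewrite invr_ge0.
Qed.

Lemma inv_absmin_ge n (v : 'cV[R]_n) k : k \in supp v -> `|v k 0|^-1 <= inv_absmin v.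
Proof.
move=> kv; have v0 : supp v != finset.set0 by apply/set0Pn; exists k.
have [j jv [E jmin]] := absmin_attained v0; rewrite /inv_absmin E.
have pos i : i \in supp v -> 0 < `|v i 0| by rewrite inE normr_gt0.
by rewrite lef_pV2 ?posrE ?pos// jmin.
Qed.

Lemma inv_absmin_attained n (v : 'cV[R]_n) :
  inv_absmin v = 0 \/ exists2 k, k \in supp v & inv_absmin v = `|v k 0|^-1.
Proof.
have [v0|v0] := eqVneq (supp v) finset.set0.
  by left; rewrite /inv_absmin absmin_set0.
have [j jv [E jmin]] := absmin_attained v0; right; exists j => //.
by rewrite /inv_absmin E.
Qed.

Lemma efrac_absmin n (v : 'cV[R]_n) (a c : R) : 0 < c ->
  efrac a%:E (c%:E * absmin v) = (a / c * inv_absmin v)%:E.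
Proof.
move=> c0; have [v0|v0] := eqVneq (supp v) finset.set0.
  rewrite /inv_absmin absmin_set0// gt0_muley ?lte_fin// /efrac /=.
  by rewrite mulr0 invey mule0.
have [k kv [E _]] := absmin_attained v0; rewrite /inv_absmin E.
have k0 : 0 < `|v k 0| by move: kv; rewrite inE normr_gt0.
have ck : 0 < c * `|v k 0| by rewrite mulr_gt0.
rewrite -EFinM /efrac eqe gt_eqF// inver gt_eqF// -EFinM.
by congr (_%:E); field; rewrite !gt_eqF.
Qed.

Lemma efrac_fin (a c : R) : c != 0 -> efrac a%:E c%:E = (a / c)%:E.
Proof. by move=> c0; rewrite /efrac eqe (negbTE c0) inver (negbTE c0). Qed.

Lemma le_absmin n (v : 'cV[R]_n) (a : \bar R) k : (a <= absmin v)%E -> k \in supp v ->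
  (a <= (`|v k 0|)%:E)%E.
Proof. by move=> av kv; apply: (le_trans av); apply: bigmin_le_cond. Qed.

Lemma QtermE N T p (b : 'cV[R]_p) (c : 'cV[R]_N) (lam mu : R) : (0 < N)%N -> (0 < T)%N ->
  Qterm T lam mu b c =
  (Num.max (lam / Num.sqrt (N * T)%:R / 2) (mu / Num.sqrt T%:R / 2) +
   Num.max (2 * (lam / Num.sqrt (N * T)%:R) * inv_absmin b)
           (2 * (mu / Num.sqrt T%:R) * inv_absmin c))%:E.
Proof.
move=> hN hT; have T0 : 0 < Num.sqrt T%:R :> R by rewrite sqrtr_gt0 ltr0n.
have NT0 : 0 < Num.sqrt (N * T)%:R :> R by rewrite sqrtr_gt0 ltr0n muln_gt0 hN.
rewrite /Qterm !efrac_absmin// EFinD !EFin_max; congr (maxe _ _ + maxe _ _)%E; congr (_%:E);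
  by field; rewrite gt_eqF.
Qed.

End AbsMin.

Section Quadratic.
Context {R : realType}.

Lemma l1norm_onE n (A : {set 'I_n}) (v : 'cV[R]_n) : l1norm_on A v = \sum_(i in A) `|v i 0|.
Proof. by []. Qed.

Lemma l1normE n (v : 'cV[R]_n) : l1norm v = \sum_i `|v i 0|.
Proof. by rewrite /l1norm /l1norm_on; apply: eq_bigl => i; rewrite inE. Qed.

Lemma sqr_l2norm n (v : 'cV[R]_n) : l2norm v ^+ 2 = \sum_i v i 0 ^+ 2.
Proof. by rewrite l2norm_norm2 sqr_norm2. Qed.

Lemma qform_mx n (M : 'M[R]_n) (v : 'cV[R]_n) :
  (v^T *m M *m v) 0 0 = qform M (fun i => v i 0).
Proof.
rewrite mxE /qform exchange_big; apply: eq_bigr => b _ /=.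
rewrite mxE mulr_suml; apply: eq_bigr => a _; rewrite mxE; ring.
Qed.

Lemma sqr_l2norm_mxcol N T (V : 'I_N -> 'cV[R]_T) :
  l2norm (\mxcol_(i < N) V i) ^+ 2 = \sum_i \sum_t V i t 0 ^+ 2.
Proof.
have E n (v : 'cV[R]_n) : \sum_i v i 0 ^+ 2 = (v^T *m v) 0 0.
  by rewrite mxE; apply: eq_bigr => i _; rewrite mxE expr2.
rewrite sqr_l2norm E tr_mxcol mul_mxrow_mxcol summxE.
by apply: eq_bigr => i _; rewrite E.
Qed.

Lemma submx_entry m n (A B : 'M[R]_(m, n)) i j : (A - B) i j = A i j - B i j.
Proof. by rewrite !mxE. Qed.

Lemma lasso_objective_rss N T p (x : 'I_N -> 'I_T -> 'I_p -> R) (e : 'I_N -> 'I_T -> R)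
    (bs b : 'cV[R]_p) (cs c : 'cV[R]_N) lam mu :
  let y i t : R := ((\col_k x i t k)^T *m bs) 0 0 + cs i 0 + e i t in
  lasso_objective (\mxcol_(i < N) \col_t y i t) (\mxcol_(i < N) \matrix_(t, k) x i t k) lam mu b c =
  rss x e bs cs b c + 2 * lam * (\sum_k `|b k 0|) + 2 * mu * (\sum_i `|c i 0|).
Proof.
move=> y; rewrite /lasso_objective !l1normE; congr (_ + _ + _).
rewrite /dummies !mxcol_mul -!mxcolB sqr_l2norm_mxcol; apply: eq_bigr => i _.
apply: eq_bigr => t _; congr (_ ^+ 2).
rewrite !submx_entry mxE; congr (_ - _ - _).
  by rewrite !mxE; apply: eq_bigr => k _; rewrite !mxE.
by rewrite -mulmxA -rowE mxE big_ord1 !mxE mul1r.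
Qed.

End Quadratic.

(** * Restricted eigenvalues of Gamma *)

Section RestrictedEigenvalues.
Context {R : realType}.

Section Principal.
Variables (n : nat) (M : 'M[R]_n) (J : {set 'I_n}).
Hypothesis symM : forall a b, M a b = M b a.
Hypothesis J0 : J != finset.set0.

Lemma sum_supported (f : 'I_n -> R) : (forall l, l \notin J -> f l = 0) ->
  \sum_l f l = \sum_(i < #|J|) f (enum_val i).
Proof.
move=> f0; rewrite (bigID (mem J)) /= [X in _ + X]big1 ?addr0; last by move=> l; exact: f0.
by rewrite big_enum_val.
Qed.

Lemma qform_supported h : supported J h ->
  qform M h = qform (principal_submx M J) (fun i => h (enum_val i)).
Proof.
move=> hJ; rewrite /qform sum_supported; last first.
  by move=> a aJ; rewrite big1// => b _; rewrite hJ// mul0r mulr0.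
apply: eq_bigr => i _; rewrite sum_supported; last first.
  by move=> b bJ; rewrite (hJ b)// !mulr0.
by apply: eq_bigr => j _; rewrite mxE.
Qed.

Lemma phi_min_principal : exists phi, [/\ phi_min (principal_submx M J) = phi%:E,
  forall h, supported J h -> phi * norm2 h ^+ 2 <= qform M h &
  exists h, [/\ supported J h, norm2 h ^+ 2 = 1 & qform M h = phi]].
Proof.
have J0' : (0 < #|J|)%N by rewrite card_gt0.
have sym : forall a b, principal_submx M J a b = principal_submx M J b a.
  by move=> a b; rewrite !mxE symM.
have [phi [E low [v v1 vphi]]] := phi_minP J0' sym.
exists phi; split => // [h hJ|].
  rewrite sqr_norm2 sum_supported; last by move=> l lJ; rewrite hJ// expr0n.
  rewrite qform_supported//; have := low (\row_i h (enum_val i)).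
  under eq_bigr do rewrite mxE.
  congr (_ <= _); rewrite /qform; apply: eq_bigr => a _; apply: eq_bigr => b _.
  by rewrite [(\row__ _) 0 a]mxE [(\row__ _) 0 b]mxE.
pose h l := \sum_(i < #|J|) v 0 i * (enum_val i == l)%:R.
have hE i : h (enum_val i) = v 0 i.
  rewrite /h (bigD1 i)//= eqxx mulr1 big1 ?addr0// => j ji.
  by rewrite (inj_eq enum_val_inj) (negbTE ji) mulr0.
have hJ : supported J h.
  move=> l lJ; rewrite /h big1// => i _; case: eqP => [il|_]; last by rewrite mulr0.
  by move: lJ; rewrite -il enum_valP.
exists h; split=> //.
  rewrite sqr_norm2 sum_supported; last by move=> l lJ; rewrite hJ// expr0n.
  by rewrite -v1; apply: eq_bigr => i _; rewrite hE.
rewrite qform_supported// -vphi; congr (qform _ _); apply/funext => i.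
exact: hE.
Qed.

End Principal.

Section Compatibility.
Variables N T p : nat.
Hypotheses (hN : (0 < N)%N) (hT : (0 < T)%N).
Variables (lam mu : R) (b : 'cV[R]_p) (c : 'cV[R]_N).
Hypotheses (lam_gt0 : 0 < lam) (mu_gt0 : 0 < mu).
Local Notation J := (joint_supp b c).
Local Notation om := (penalty (N := N) T (p := p) lam mu).

Lemma sum_joint_suppC (f : 'I_(p + N) -> R) :
  \sum_(l in ~: J) f l =
  \sum_(k in ~: supp b) f (lshift N k) + \sum_(i in ~: supp c) f (rshift p i).
Proof.
rewrite big_mkcond big_split_ord /= [in RHS]big_mkcond [X in _ = _ + X]big_mkcond.
by congr (_ + _); apply: eq_bigr => k _;
  rewrite inE in_joint_supp ?stack_paraml ?stack_paramr inE inE.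
Qed.

(** The cone of the proof is the one that defines kappa, with the true supports as R1 and
    R2. *)
Lemma kappa_coneE (delta : 'cV[R]_(p + N)) :
  cone om J (fun l => delta l 0) -> kappa_cone T lam mu (supp b) (supp c) delta.
Proof.
rewrite /cone /kappa_cone !l1norm_onE sum_joint_suppC sum_joint_supp.
have El k : om (lshift N k) = lam / Num.sqrt (N * T)%:R by rewrite /penalty byblockl rate_l.
have Er i : om (rshift p i) = mu / Num.sqrt T%:R by rewrite /penalty byblockr rate_r.
have L (A : {set 'I_p}) : \sum_(k in A) om (lshift N k) * `|delta (lshift N k) 0| =
   lam / Num.sqrt (N * T)%:R * \sum_(k in A) `|usubmx delta k 0|.
  by rewrite mulr_sumr; apply: eq_bigr => k _; rewrite El mxE.
have Rr (A : {set 'I_N}) : \sum_(i in A) om (rshift p i) * `|delta (rshift p i) 0| =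
   mu / Num.sqrt T%:R * \sum_(i in A) `|dsubmx delta i 0|.
  by rewrite mulr_sumr; apply: eq_bigr => k _; rewrite Er mxE.
by rewrite !L !Rr mulrDr !mulrA.
Qed.

Lemma om_ge0 l : 0 <= om l.
Proof.
rewrite /penalty divr_ge0//; last by rewrite ltW ?rate_gt0.
by rewrite /byblock; case: fintype.split => _; exact: ltW.
Qed.

Lemma supported_cone h : supported J h -> cone om J h.
Proof.
move=> hJ; rewrite /cone big1; last by move=> l; rewrite inE => lJ; rewrite hJ// normr0 mulr0.
by rewrite mulr_ge0// sumr_ge0// => l _; rewrite mulr_ge0 ?om_ge0.
Qed.

End Compatibility.

Section Kappa.
Context {d : measure_display} {Omega : measurableType d}.
Variable P : probability Omega R.
Variables N T p : nat.
Hypotheses (hN : (0 < N)%N) (hT : (0 < T)%N).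
Variables (x : 'I_N -> 'I_T -> 'I_p -> {RV P >-> R}).
Variables (lam mu : R) (b : 'cV[R]_p) (c : 'cV[R]_N).
Hypotheses (lam_gt0 : 0 < lam) (mu_gt0 : 0 < mu).
Local Notation J := (joint_supp b c).
Local Notation om := (penalty (N := N) T (p := p) lam mu).
Hypothesis J0 : J != finset.set0.

(** A coordinate vector of J lies in the cone, so kappa^2 is finite. *)
Lemma kappa2_compat : (0 < kappa2 x lam mu #|supp b| #|supp c|)%E ->
  exists kap : R, [/\ kappa2 x lam mu #|supp b| #|supp c| = kap%:E, 0 < kap &
    forall h, cone om J h -> kap * norm2 h ^+ 2 <= qform (Gamma x) h].
Proof.
set k2 := kappa2 _ _ _ _ _ => k20.
have low h : cone om J h -> norm2 h != 0 ->
   (k2 <= (qform (Gamma x) h / norm2 h ^+ 2)%:E)%E.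
  move=> hc hn0; apply: ereal_inf_lbound.
  pose delta : 'cV[R]_(p + N) := \col_l h l.
  have dh : (fun l => delta l 0) = h by apply/funext => l; rewrite mxE.
  exists delta, (supp b), (supp c); split=> //.
  - apply: contra hn0 => /eqP d0; rewrite -sqrf_eq0 sqr_norm2 big1// => l _.
    by rewrite -dh d0 mxE expr0n.
  - by apply: kappa_coneE; rewrite dh.
  - by rewrite qform_mx l2norm_norm2 dh.
have [l0 l0J] : exists l, l \in J by apply/set0Pn.
pose h0 l : R := (l == l0)%:R.
have h0J : supported J h0.
  by move=> l lJ; rewrite /h0; case: eqP lJ => // ->; rewrite l0J.
have h0n : norm2 h0 != 0.
  apply/eqP => /norm2_eq0 /(_ l0); rewrite /h0 eqxx => /eqP.
  by rewrite oner_eq0.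
have h0c := supported_cone hN hT lam_gt0 mu_gt0 h0J.
have := low h0 h0c h0n.
case E : k2 k20 low => [k| |] //; rewrite ?lte_fin => k0 low _.
exists k; split=> // h hc.
have [n0|n0] := eqVneq (norm2 h) 0.
  rewrite n0 expr0n mulr0 /qform big1// => a _; rewrite big1// => a' _.
  by rewrite (norm2_eq0 n0) mul0r mulr0.
have := low h hc n0; rewrite lee_fin ler_pdivlMr//.
by rewrite lt_neqAle eq_sym sqrf_eq0 n0 sqr_ge0.
Qed.

End Kappa.
End RestrictedEigenvalues.

(** * Sign recovery at a good outcome *)

Section Outcomes.
Context {d : measure_display} {Omega : measurableType d} {R : realType}.
Variable P : probability Omega R.
Variables N T p : nat.
Hypotheses (hN : (0 < N)%N) (hT : (0 < T)%N).
Variables (x : 'I_N -> 'I_T -> 'I_p -> {RV P >-> R}) (eps : 'I_N -> 'I_T -> {RV P >-> R}).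
Variables (bs : 'cV[R]_p) (cs : 'cV[R]_N).
Variables (bhat btil : 'I_p -> {RV P >-> R}) (chat ctil : 'I_N -> {RV P >-> R}).
Variables (lam mu : R).
Hypotheses (lam_gt0 : 0 < lam) (mu_gt0 : 0 < mu).
Let y := response x eps bs cs.
Hypothesis lassoP : is_lasso y x lam mu bhat chat.
Hypothesis adaptiveP : is_adaptive_lasso y x lam mu bhat chat btil ctil.
Local Notation cov w := (fun i t k => x i t k w).
Local Notation noise w := (fun i t => eps i t w).
Local Notation J := (joint_supp bs cs).
Local Notation k2 := (kappa2 x lam mu #|supp bs| #|supp cs|).
Local Notation L := (lam / Num.sqrt (N * T)%:R).
Local Notation M := (mu / Num.sqrt T%:R).
Local Notation om := (penalty (N := N) T (p := p) lam mu).

Definition small_score w := forall l, `|score (design (cov w)) (err (noise w)) l| <= om l / 16.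
Definition close_gram tau w :=
  forall a b, `|gram (design (cov w)) a b - Gamma x a b| <= tau.

Lemma rss_lasso w b c :
  rss (cov w) (noise w) bs cs (rvec bhat w) (rvec chat w)
    + 2 * lam * (\sum_k `|rvec bhat w k 0|) + 2 * mu * (\sum_i `|rvec chat w i 0|) <=
  rss (cov w) (noise w) bs cs b c + 2 * lam * (\sum_k `|b k 0|) + 2 * mu * (\sum_i `|c i 0|).
Proof. by rewrite -!lasso_objective_rss; exact: (lassoP w b c). Qed.

Lemma outcome_null w : small_score w -> J = finset.set0 ->
  rvec btil w = bs /\ rvec ctil w = cs.
Proof.
move=> small J0; have [feas adm] := adaptiveP w.
exact: (@null_truth R N T p hN hT (cov w) (noise w) bs (rvec bhat w) (rvec btil w)
  cs (rvec chat w) (rvec ctil w) lam mu lam_gt0 mu_gt0 (@rss_lasso w) feas small J0).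
Qed.

Variables (tau rho : R).
Hypothesis tau_ge0 : 0 <= tau.
Hypothesis rho_gt0 : 0 < rho.
Hypothesis om_rho : forall k l, om k <= rho * om l.
Hypothesis J0 : J != finset.set0.
Hypothesis k2_gt0 : (0 < k2)%E.
Hypothesis tau_small : forall kap, k2 = kap%:E -> tau * #|J|%:R * rho ^+ 2 <= kap / 200.
Let W := 8 * (L * Num.sqrt #|supp bs|%:R + M * Num.sqrt #|supp cs|%:R).
Hypothesis bmin : (efrac (2%:E * efrac W%:E k2) (Num.sqrt (N * T)%:R)%:E <= absmin bs)%E.
Hypothesis cmin : (efrac (2%:E * efrac W%:E k2) (Num.sqrt T%:R)%:E <= absmin cs)%E.

Lemma le_absmin_scaled n (v : 'cV[R]_n) (c A : R) : 0 < c ->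
  (A%:E <= c%:E * absmin v)%E -> forall k, k \in supp v -> A <= c * `|v k 0|.
Proof.
move=> c0 H k kv; rewrite -lee_fin (le_trans H)// EFinM.
by apply: lee_wpmul2l; [rewrite lee_fin ltW|exact: le_absmin (lexx _) kv].
Qed.

(** The assumption beta_min >= 2 xi / sqrt(NT), or c_min >= 2 xi / sqrt T, without
    extended reals. *)
Lemma first_step_signal n (v : 'cV[R]_n) (c kap : R) : 0 < c -> k2 = kap%:E -> 0 < kap ->
  (efrac (2%:E * efrac W%:E k2) c%:E <= absmin v)%E ->
  forall k, k \in supp v -> 2 * (W / kap) <= c * `|v k 0|.
Proof.
move=> c0 -> kap0; rewrite efrac_fin ?gt_eqF// -EFinM efrac_fin ?gt_eqF// => H k kv.
by rewrite [leRHS]mulrC -ler_pdivrMr// -lee_fin (le_absmin H kv).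
Qed.

Lemma minimal_signal_real phi c n (v : 'cV[R]_n) : 0 < c -> 0 < phi -> phi_min_J x bs cs = phi%:E ->
  minimal_signal x lam mu bs cs c (absmin v) ->
  forall k, k \in supp v ->
  2 * Num.sqrt #|J|%:R *
   (Num.max (L / 2) (M / 2) + Num.max (2 * L * inv_absmin bs) (2 * M * inv_absmin cs)) / phi
   <= c * `|v k 0|.
Proof.
move=> c0 phi0 E; rewrite /minimal_signal E QtermE// efrac_fin ?gt_eqF// -EFinM => H k kv.
by rewrite mulrAC; exact: (le_absmin_scaled c0 H).
Qed.

Lemma correlation_bound_real phi K tuning er : 0 < phi -> phi_min_J x bs cs = phi%:E ->
  correlation_bound x lam mu bs cs K tuning er -> 0 < er ->
  2 * #|J|%:R * K / phi *
   (Num.max (L / 2) (M / 2) + Num.max (2 * L * inv_absmin bs) (2 * M * inv_absmin cs))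
   + tuning / 2 <= tuning / er.
Proof.
by move=> phi0 E + er0; rewrite /correlation_bound E QtermE// !efrac_fin ?gt_eqF.
Qed.

(** phi_min(Gamma_JJ) is attained by a vector that lies in the cone, whence kappa^2 <= phi,
    and it is at most every diagonal entry of Gamma_JJ. *)
Lemma restricted_phi kap : k2 = kap%:E ->
  (forall h, cone om J h -> kap * norm2 h ^+ 2 <= qform (Gamma x) h) ->
  exists phi, [/\ phi_min_J x bs cs = phi%:E, kap <= phi,
    forall h, supported J h -> phi * norm2 h ^+ 2 <= qform (Gamma x) h &
    forall l, l \in J -> phi <= Gamma x l l].
Proof.
move=> E compat.
have [phi [Ephi low [h [hJ h1 hphi]]]] := phi_min_principal (@Gamma_sym _ _ _ P N T p x) J0.
exists phi; split=> //.
  have := compat h (@supported_cone R N T p hN hT lam mu bs cs lam_gt0 mu_gt0 h hJ).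
  by rewrite h1 mulr1 hphi.
move=> l lJ; pose g k : R := (k == l)%:R.
have gJ : supported J g by move=> k kJ; rewrite /g; case: eqP kJ => // ->; rewrite lJ.
have := low g gJ; rewrite sqr_norm2 /qform.
rewrite (bigD1 l)//= big1 ?addr0; last by move=> k kl; rewrite /g (negbTE kl) expr0n.
rewrite (bigD1 l)//= [X in _ <= _ + X]big1 ?addr0; last first.
  by move=> k kl; rewrite big1// => k' _; rewrite /g (negbTE kl) ?(mul0r, mulr0).
rewrite (bigD1 l)//= [X in _ <= _ + X]big1 ?addr0; last first.
  by move=> k kl; rewrite /g (negbTE kl) ?(mul0r, mulr0).
by rewrite /g eqxx expr1n !mulr1.
Qed.

Lemma kappa_le_diag kap l : k2 = kap%:E -> l \in J -> kap <= Gamma x l l.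
Proof.
move=> E lJ; have [kap' [E' _ compat]] := kappa2_compat hN hT lam_gt0 mu_gt0 J0 k2_gt0.
move: E; rewrite E' => -[<-].
have [phi [_ kphi _ diag]] := restricted_phi E' compat.
exact: le_trans kphi (diag _ lJ).
Qed.

Lemma Gamma_r_off i l : l != rshift p i -> Gamma x (rshift p i) l = 0.
Proof.
case: (split_ordP l) => j ->; rewrite ?Gamma_rl// Gamma_rr.
by rewrite (inj_eq (@rshift_inj _ _)) eq_sym => /negbTE ->.
Qed.

Lemma outcome_beta K1 w : small_score w -> close_gram tau w -> 0 <= K1 ->
  (supp bs != finset.set0 -> (~: supp bs)%SET != finset.set0 ->
    forall a b, `|Gamma x a b| + tau <= K1 / Num.sqrt (N * T)%:R) ->
  minimal_signal x lam mu bs cs (Num.sqrt (N * T)%:R) (absmin bs) ->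
  correlation_bound x lam mu bs cs K1 lam (l2norm (rvec bhat w - bs)) ->
  sgnv (rvec btil w) = sgnv bs.
Proof.
move=> small close K10 K1l signal corr; have [feas adm] := adaptiveP w.
have NT0 := @sqNT_gt0 R N T hN hT.
have [kap [E kap0 compat]] := kappa2_compat hN hT lam_gt0 mu_gt0 J0 k2_gt0.
have [phi [Ephi kphi low diag]] := restricted_phi E compat.
have phi0 : 0 < phi by apply: lt_le_trans kap0 kphi.
apply: (@sign_beta R N T p hN hT (cov w) (noise w) bs (rvec bhat w) (rvec btil w)
  cs (rvec chat w) (rvec ctil w) lam mu lam_gt0 mu_gt0 (@rss_lasso w) feas adm small
  (Gamma x) tau kap rho kap0 tau_ge0 rho_gt0 om_rho J0 close compat (tau_small E) _ _ _
  (inv_absmin bs) (inv_absmin cs) phi _ _ _ _ _ _ phi0 low kphi K1 _ _ _ _) => //.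
all: try exact: inv_absmin_ge0.
all: try exact: inv_absmin_ge.
all: try exact: inv_absmin_attained.
- exact: Gamma_r_off.
- exact: (first_step_signal NT0 E kap0 bmin).
- exact: (first_step_signal (@sqT_gt0 R T hT) E kap0 cmin).
- exact: minimal_signal_real signal.
- exact: correlation_bound_real corr.
Qed.

Lemma outcome_dummy K2 w : small_score w -> close_gram tau w -> 0 <= K2 ->
  1 <= Num.sqrt N%:R * tau ->
  minimal_signal x lam mu bs cs (Num.sqrt T%:R) (absmin cs) ->
  correlation_bound x lam mu bs cs K2 mu (l2norm (rvec chat w - cs)) ->
  sgnv (rvec ctil w) = sgnv cs.
Proof.
move=> small close K20 tauN signal corr; have [feas adm] := adaptiveP w.
have T0 := @sqT_gt0 R T hT.
have [kap [E kap0 compat]] := kappa2_compat hN hT lam_gt0 mu_gt0 J0 k2_gt0.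
have [phi [Ephi kphi low diag]] := restricted_phi E compat.
have phi0 : 0 < phi by apply: lt_le_trans kap0 kphi.
apply: (@sign_dummy R N T p hN hT (cov w) (noise w) bs (rvec bhat w) (rvec btil w)
  cs (rvec chat w) (rvec ctil w) lam mu lam_gt0 mu_gt0 (@rss_lasso w) feas adm small
  (Gamma x) tau kap rho kap0 tau_ge0 rho_gt0 om_rho J0 close compat (tau_small E) _ _ _
  (inv_absmin bs) (inv_absmin cs) phi _ _ _ _ _ _ phi0 K2 _ _ _ _ _) => //.
all: try exact: inv_absmin_ge0.
all: try exact: inv_absmin_ge.
all: try exact: inv_absmin_attained.
- exact: Gamma_r_off.
- exact: (first_step_signal (@sqNT_gt0 R N T hN hT) E kap0 bmin).
- exact: (first_step_signal T0 E kap0 cmin).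
- exact: minimal_signal_real signal.
- exact: correlation_bound_real corr.
- move=> /set0Pn[i ic]; have := diag (rshift p i).
  rewrite in_joint_supp stack_paramr Gamma_rr eqxx; apply.
  by move: ic; rewrite inE.
Qed.

End Outcomes.

(** * Measurability of the recovery events *)

Section RecoveryEvent.
Context {d : measure_display} {Omega : measurableType d} {R : realType}.
Variable P : probability Omega R.

(** The event is the union of f = 0, where the fraction is +oo, and of c0 f <= tuning. *)
Lemma measurable_efrac_ge (c0 : \bar R) (tuning : R) (f : Omega -> R) :
  measurable_fun setT f -> (forall w, 0 <= f w) ->
  measurable [set w | (c0 <= efrac tuning%:E (f w)%:E)%E].
Proof.
move=> mf f0.
pose S (r : R) := (f @^-1` [set 0]) `|` ((fun w => r * f w) @^-1` `]-oo, tuning]).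
have mS r : measurable (S r).
  apply: measurableU; rewrite -[X in measurable X]setTI; first exact: mf.
  by apply: measurable_funM.
case: c0 => [r| |].
- suff -> : [set w | (r%:E <= efrac tuning%:E (f w)%:E)%E] = S r by [].
  apply/seteqP; split=> w /=; have := f0 w; rewrite le_eqVlt eq_sym /efrac eqe;
    have [fw0 _|fw0 /= fw] := eqVneq (f w) 0; rewrite ?leey ?inver ?(negbTE fw0).
  + by left.
  + by rewrite lee_fin ler_pdivlMr// => H; right; rewrite /= in_itv.
  + by [].
  + by rewrite lee_fin ler_pdivlMr// => -[/eqP|]; rewrite ?(negbTE fw0)//= in_itv.
- suff -> : [set w | (+oo <= efrac tuning%:E (f w)%:E)%E] = f @^-1` [set 0].
    by rewrite -[X in measurable X]setTI; exact: mf.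
  apply/seteqP; split=> w /=; rewrite /efrac eqe leye_eq;
    have [fw0|fw0] := eqVneq (f w) 0; rewrite ?inver ?(negbTE fw0)//.
  by move=> /eqP; rewrite (negbTE fw0).
- rewrite [X in measurable X](_ : _ = setT)//.
  by apply/seteqP; split=> w //= _; rewrite leNye.
Qed.

Lemma measurable_sg_eq (U : {RV P >-> R}) (s : R) : measurable [set w | Num.sg (U w) = s].
Proof.
have mU : measurable_fun setT (fun w => Num.sg (U w)).
  have -> : (fun w => Num.sg (U w)) =
     (fun w => if 0 < U w then 1 else if U w < 0 then -1 else 0).
    by apply/funext => w; case: sgrP.
  have mlt : measurable_fun setT (fun w => 0 < U w) by exact: measurable_fun_ltr.
  have mgt : measurable_fun setT (fun w => U w < 0) by exact: measurable_fun_ltr.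
  by apply: measurable_fun_ifT => //; apply: measurable_fun_ifT.
by rewrite -[X in measurable X]setTI; exact: (mU measurableT [set s] (measurable_set1 s)).
Qed.

Lemma measurable_sgnv_eq n (U : 'I_n -> {RV P >-> R}) (b : 'cV[R]_n) :
  measurable [set w | sgnv (rvec U w) = sgnv b].
Proof.
have -> : [set w | sgnv (rvec U w) = sgnv b] =
   \bigcap_(k in [set: 'I_n]) [set w | Num.sg (U k w) = Num.sg (b k 0)].
  apply/seteqP; split=> w /= => [E k _|E].
    by have := congr1 (fun v : 'cV[R]_n => v k 0) E; rewrite !mxE.
  by apply/matrixP => k j; rewrite !mxE ord1; exact: E.
by apply: fin_bigcap_measurable => // k _; exact: measurable_sg_eq.
Qed.

Lemma measurable_l2norm_error n (U : 'I_n -> {RV P >-> R}) (b : 'cV[R]_n) :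
  measurable_fun setT (fun w => l2norm (rvec U w - b)).
Proof.
have -> : (fun w => l2norm (rvec U w - b)) = (fun w => (\sum_i (rvec U w - b) i 0 ^+ 2) `^ 2^-1).
  by apply/funext => w; rewrite powR12_sqrt// sumr_ge0// => i _; exact: sqr_ge0.
apply: (measurableT_comp (measurable_powR _)).
apply: measurable_sum => k; under eq_fun do rewrite !mxE.
by apply: measurable_funX; apply: measurable_funB.
Qed.

End RecoveryEvent.

(** * Probability of the good event *)

Section GoodEvent.
Context {d : measure_display} {Omega : measurableType d} {R : realType}.
Variable P : probability Omega R.
Variables N T p : nat.
Hypotheses (hN : (0 < N)%N) (hT : (0 < T)%N).
Variables (x : 'I_N -> 'I_T -> 'I_p -> {RV P >-> R}) (eps : 'I_N -> 'I_T -> {RV P >-> R}).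
Variables (lam mu bx bd : R).
Hypothesis tail_x : forall k,
  (P [set w | (lam / 16 < `|\sum_i \sum_t x i t k w * eps i t w|)%R] <= bx%:E)%E.
Hypothesis tail_d : forall i, (P [set w | (mu / 16 < `|\sum_t eps i t w|)%R] <= bd%:E)%E.

Definition score_sum (l : 'I_p + 'I_N) (w : Omega) : R :=
  match l with
  | inl k => \sum_i \sum_t x i t k w * eps i t w
  | inr i => \sum_t eps i t w
  end.
Definition score_level (l : 'I_p + 'I_N) : R := if l is inl _ then lam / 16 else mu / 16.
Definition score_tail (l : 'I_p + 'I_N) : R := if l is inl _ then bx else bd.

Lemma measurable_score_sum l : measurable_fun setT (score_sum l).
Proof.
case: l => [k|i] /=.
  by apply: measurable_sum => i; apply: measurable_sum => t; exact: measurable_funM.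
by apply: measurable_sum.
Qed.

Lemma score_sum_tail l : (P [set w | (score_level l < `|score_sum l w|)%R] <= (score_tail l)%:E)%E.
Proof. by case: l => [k|i]; [exact: tail_x|exact: tail_d]. Qed.

Lemma score_sum_small w : (forall l, `|score_sum l w| <= score_level l) ->
  small_score x eps lam mu w.
Proof.
move=> H l; rewrite /penalty; case: (split_ordP l) => [k|i] ->.
  have NT0 := @sqNT_gt0 R N T hN hT.
  rewrite score_l byblockl rate_l normrM [X in _ * X]ger0_norm ?invr_ge0 ?(ltW NT0)//.
  rewrite mulrAC; apply: ler_wpM2r; first by rewrite invr_ge0 ltW.
  exact: (H (inl k)).
have T0 := @sqT_gt0 R T hT.
rewrite score_r// byblockr rate_r normrM [X in _ * X]ger0_norm ?invr_ge0 ?(ltW T0)//.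
rewrite mulrAC; apply: ler_wpM2r; first by rewrite invr_ge0 ltW.
exact: (H (inr i)).
Qed.

Lemma sum_score_tail : \sum_l score_tail l = p%:R * bx + N%:R * bd.
Proof. by rewrite big_sumType /= !sumr_const !card_ord !mulr_natl. Qed.

Lemma small_score_prob (E : set Omega) : measurable E ->
  (forall w, small_score x eps lam mu w -> E w) ->
  ((1 - (p%:R * bx + N%:R * bd))%:E <= P E)%E.
Proof.
move=> mE sE; rewrite -sum_score_tail.
apply: (le_trans (union_bound measurable_score_sum score_sum_tail)).
apply: le_measure; rewrite ?inE//; first exact: measurable_good measurable_score_sum.
by move=> w H; apply: sE; exact: score_sum_small.
Qed.

Variables (tau g : R).
Hypothesis tau_ge0 : 0 <= tau.
Local Notation Z w := (design (fun i t k => x i t k w)).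
Hypothesis tail_ll : forall j k, (P [set w | (tau < `|gram (Z w) (lshift N j) (lshift N k)
   - Gamma x (lshift N j) (lshift N k)|)%R] <= g%:E)%E.
Hypothesis tail_lr : forall j i,
  (P [set w | (tau < `|gram (Z w) (lshift N j) (rshift p i)|)%R] <= g%:E)%E.

Local Notation K := (('I_p + 'I_N) + ('I_p * 'I_p + 'I_p * 'I_N))%type.

Definition good_sum (l : K) (w : Omega) : R :=
  match l with
  | inl l => score_sum l w
  | inr (inl jk) => gram (Z w) (lshift N jk.1) (lshift N jk.2)
                    - Gamma x (lshift N jk.1) (lshift N jk.2)
  | inr (inr ji) => gram (Z w) (lshift N ji.1) (rshift p ji.2)
  end.
Definition good_level (l : K) : R := if l is inl l then score_level l else tau.
Definition good_tail (l : K) : R := if l is inl l then score_tail l else g.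

Lemma measurable_good_sum l : measurable_fun setT (good_sum l).
Proof.
case: l => [l|[[j k]|[j i]]]; first exact: measurable_score_sum.
  rewrite (_ : good_sum _ = fun w => (\sum_i \sum_t x i t j w * x i t k w) / (N * T)%:R
     - Gamma x (lshift N j) (lshift N k)); last by apply/funext => w; rewrite /= gram_ll.
  apply: measurable_funB => //; apply: measurable_funM => //.
  by apply: measurable_sum => i; apply: measurable_sum => t; exact: measurable_funM.
rewrite (_ : good_sum _ = fun w => (\sum_t x i t j w) / (Num.sqrt (N * T)%:R * Num.sqrt T%:R));
  last by apply/funext => w; rewrite /= gram_lr.
by apply: measurable_funM => //; apply: measurable_sum.
Qed.

Lemma sum_good_tail :
  \sum_l good_tail l = p%:R * bx + N%:R * bd + (p%:R ^+ 2 + N%:R * p%:R) * g.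
Proof.
rewrite big_sumType /= sum_score_tail; congr (_ + _).
rewrite sumr_const card_sum !card_prod !card_ord -[LHS]mulr_natl natrD !natrM; ring.
Qed.

(** The family of variables covers the scores and the Gram entries that involve a covariate;
    the entries between dummies are deterministic. *)
Lemma good_prob (E : set Omega) : measurable E ->
  (forall w, small_score x eps lam mu w -> close_gram x tau w -> E w) ->
  ((1 - (p%:R * bx + N%:R * bd + (p%:R ^+ 2 + N%:R * p%:R) * g))%:E <= P E)%E.
Proof.
move=> mE sE; rewrite -sum_good_tail.
have tails l : (P [set w | (good_level l < `|good_sum l w|)%R] <= (good_tail l)%:E)%E.
  case: l => [l|[[j k]|[j i]]]; first exact: score_sum_tail.
    exact: tail_ll.
  exact: tail_lr.
apply: (le_trans (union_bound measurable_good_sum tails)).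
apply: le_measure; rewrite ?inE//; first exact: measurable_good measurable_good_sum.
move=> w H; apply: sE; first by apply: score_sum_small => l; exact: (H (inl l)).
move=> a b; case: (split_ordP a) => j ->; case: (split_ordP b) => k ->.
- exact: (H (inr (inl (j, k)))).
- by rewrite Gamma_lr subr0; exact: (H (inr (inr (j, k)))).
- by rewrite gram_sym Gamma_rl subr0; exact: (H (inr (inr (k, j)))).
- by rewrite gram_rr_delta// Gamma_rr subrr normr0.
Qed.

End GoodEvent.

(** * Probability of sign recovery *)

Section Recovery.
Context {d : measure_display} {Omega : measurableType d} {R : realType}.
Variable P : probability Omega R.
Variables N T p : nat.
Hypotheses (hN : (0 < N)%N) (hT : (0 < T)%N).
Variables (x : 'I_N -> 'I_T -> 'I_p -> {RV P >-> R}) (eps : 'I_N -> 'I_T -> {RV P >-> R}).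
Variables (bs : 'cV[R]_p) (cs : 'cV[R]_N).
Variables (bhat btil : 'I_p -> {RV P >-> R}) (chat ctil : 'I_N -> {RV P >-> R}).
Variables (lam mu : R).
Hypotheses (lam_gt0 : 0 < lam) (mu_gt0 : 0 < mu).
Hypothesis lassoP : is_lasso (response x eps bs cs) x lam mu bhat chat.
Hypothesis adaptiveP :
  is_adaptive_lasso (response x eps bs cs) x lam mu bhat chat btil ctil.
Variables (bx bd : R).
Hypothesis tail_x : forall k,
  (P [set w | (lam / 16 < `|\sum_i \sum_t x i t k w * eps i t w|)%R] <= bx%:E)%E.
Hypothesis tail_d : forall i, (P [set w | (mu / 16 < `|\sum_t eps i t w|)%R] <= bd%:E)%E.
Variables (K1 K2 : R).
Local Notation J := (joint_supp bs cs).
Local Notation k2 := (kappa2 x lam mu #|supp bs| #|supp cs|).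

Definition beta_recovered : set Omega := [set w |
  correlation_bound x lam mu bs cs K1 lam (l2norm (rvec bhat w - bs)%R) ->
  sgnv (rvec btil w) = sgnv bs].
Definition dummy_recovered : set Omega := [set w |
  correlation_bound x lam mu bs cs K2 mu (l2norm (rvec chat w - cs)%R) ->
  sgnv (rvec ctil w) = sgnv cs].

Lemma measurable_imply_set (A B : set Omega) : measurable A -> measurable B ->
  measurable [set w | A w -> B w].
Proof.
move=> mA mB; rewrite (_ : [set _ | _] = ~` A `|` B).
  by apply: measurableU => //; exact: measurableC.
apply/seteqP; split=> w /= H; last by case: H.
by have [Aw|nAw] := pselect (A w); [right; exact: H|left].
Qed.

Lemma measurable_beta_recovered : measurable beta_recovered.
Proof.
apply: measurable_imply_set; last exact: measurable_sgnv_eq.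
apply: measurable_efrac_ge; first exact: measurable_l2norm_error.
by move=> w; exact: sqrtr_ge0.
Qed.

Lemma measurable_dummy_recovered : measurable dummy_recovered.
Proof.
apply: measurable_imply_set; last exact: measurable_sgnv_eq.
apply: measurable_efrac_ge; first exact: measurable_l2norm_error.
by move=> w; exact: sqrtr_ge0.
Qed.

Lemma recovery_null : J = finset.set0 ->
  ((1 - (p%:R * bx + N%:R * bd))%:E <= P beta_recovered)%E /\
  ((1 - (p%:R * bx + N%:R * bd))%:E <= P dummy_recovered)%E.
Proof.
move=> J0; split; apply: (small_score_prob hN hT tail_x tail_d).
- exact: measurable_beta_recovered.
- by move=> w /(outcome_null hN hT lam_gt0 mu_gt0 lassoP adaptiveP)/(_ J0)[E _] _; rewrite E.
- exact: measurable_dummy_recovered.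
- by move=> w /(outcome_null hN hT lam_gt0 mu_gt0 lassoP adaptiveP)/(_ J0)[_ E] _; rewrite E.
Qed.

Variables (tau rho g : R).
Hypothesis tau_ge0 : 0 <= tau.
Hypothesis rho_gt0 : 0 < rho.
Local Notation L := (lam / Num.sqrt (N * T)%:R).
Local Notation M := (mu / Num.sqrt T%:R).
Hypotheses (rho_ge1 : 1 <= rho) (L_rho : L <= rho * M) (M_rho : M <= rho * L).
Hypothesis J0 : J != finset.set0.
Hypothesis k2_gt0 : (0 < k2)%E.
Hypothesis tau_small : forall kap, k2 = kap%:E -> tau * #|J|%:R * rho ^+ 2 <= kap / 200.
Let W := 8 * (L * Num.sqrt #|supp bs|%:R + M * Num.sqrt #|supp cs|%:R).
Hypothesis bmin : (efrac (2%:E * efrac W%:E k2) (Num.sqrt (N * T)%:R)%:E <= absmin bs)%E.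
Hypothesis cmin : (efrac (2%:E * efrac W%:E k2) (Num.sqrt T%:R)%:E <= absmin cs)%E.
Local Notation Z w := (design (fun i t k => x i t k w)).
Hypothesis tail_ll : forall j k, (P [set w | (tau < `|gram (Z w) (lshift N j) (lshift N k)
   - Gamma x (lshift N j) (lshift N k)|)%R] <= g%:E)%E.
Hypothesis tail_lr : forall j i,
  (P [set w | (tau < `|gram (Z w) (lshift N j) (rshift p i)|)%R] <= g%:E)%E.
Let prob := 1 - (p%:R * bx + N%:R * bd + (p%:R ^+ 2 + N%:R * p%:R) * g).

Let L_gt0 : 0 < L. Proof. by rewrite divr_gt0// sqrtr_gt0 ltr0n muln_gt0 hN. Qed.
Let M_gt0 : 0 < M. Proof. by rewrite divr_gt0// sqrtr_gt0 ltr0n. Qed.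

Lemma penalty_ratio k l :
  penalty (N := N) T (p := p) lam mu k <= rho * penalty (N := N) T (p := p) lam mu l.
Proof.
rewrite /penalty; case: (split_ordP k) => i ->; case: (split_ordP l) => j ->;
  rewrite ?byblockl ?byblockr ?rate_l ?rate_r//.
  by rewrite ler_peMl// ltW.
by rewrite ler_peMl// ltW.
Qed.

Lemma recovery_beta : 0 <= K1 ->
  (supp bs != finset.set0 -> (~: supp bs)%SET != finset.set0 ->
    forall a b, `|Gamma x a b| + tau <= K1 / Num.sqrt (N * T)%:R) ->
  minimal_signal x lam mu bs cs (Num.sqrt (N * T)%:R) (absmin bs) ->
  (prob%:E <= P beta_recovered)%E.
Proof.
move=> K10 K1l signal; rewrite /prob; apply: (good_prob hN hT tail_x tail_d tau_ge0 tail_ll tail_lr).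
  exact: measurable_beta_recovered.
move=> w small close.
exact: (outcome_beta hN hT lam_gt0 mu_gt0 lassoP adaptiveP tau_ge0 rho_gt0 penalty_ratio
  J0 k2_gt0 tau_small bmin cmin small close K10 K1l signal).
Qed.

Lemma recovery_dummy : 0 <= K2 -> 1 <= Num.sqrt N%:R * tau ->
  minimal_signal x lam mu bs cs (Num.sqrt T%:R) (absmin cs) ->
  (prob%:E <= P dummy_recovered)%E.
Proof.
move=> K20 tauN signal; rewrite /prob; apply: (good_prob hN hT tail_x tail_d tau_ge0 tail_ll tail_lr).
  exact: measurable_dummy_recovered.
move=> w small close.
exact: (outcome_dummy hN hT lam_gt0 mu_gt0 lassoP adaptiveP tau_ge0 rho_gt0 penalty_ratio
  J0 k2_gt0 tau_small bmin cmin small close K20 tauN signal).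
Qed.

End Recovery.

(** * Transfer of moments between units *)

Lemma ereal_between (R : realType) (z : \bar R) (B : R) : (0 <= z)%E -> (z <= B%:E)%E ->
  exists2 c, z = c%:E & 0 <= c /\ c <= B.
Proof. by case: z => [c| |]//=; rewrite !lee_fin => c0 cB; exists c. Qed.

Section Transfer.
Context {d : measure_display} {Omega : measurableType d} {R : realType}.
Variable P : probability Omega R.
Variables N T p : nat.
Hypotheses (hN : (0 < N)%N) (hT : (0 < T)%N).
Variables (x : 'I_N -> 'I_T -> 'I_p -> {RV P >-> R}) (eps : 'I_N -> 'I_T -> {RV P >-> R}).
Hypothesis ident_units : identically_distributed P (data_unit x eps).

Lemma covariate_moment_ident r i i' t k :
  (\int[P]_w (`|x i t k w| `^ r)%:E = \int[P]_w (`|x i' t k w| `^ r)%:E)%E.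
Proof.
pose f (u : T.-tuple (p.-tuple R) * T.-tuple R) : R := `|get_x t k u.1| `^ r.
have mf : measurable_fun setT f.
  apply: measurable_abs_powR; exact: (measurableT_comp (measurable_get_x t k)).
have fx i0 w : f (data_unit x eps i0 w) = `|x i0 t k w| `^ r by rewrite /f /= get_xE.
have := @integral_ident _ _ _ P _ _ _ (data_unit x eps) f i i' ident_units
  (@measurable_data _ _ _ P N T p x eps) mf.
by under eq_integral do rewrite fx; under [in RHS]eq_integral do rewrite fx;
  apply => u; exact: powR_ge0.
Qed.

Lemma error_moment_ident r i i' t :
  (\int[P]_w (`|eps i t w| `^ r)%:E = \int[P]_w (`|eps i' t w| `^ r)%:E)%E.
Proof.
pose f (u : T.-tuple (p.-tuple R) * T.-tuple R) : R := `|get_e t u.2| `^ r.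
have mf : measurable_fun setT f.
  apply: measurable_abs_powR; exact: (measurableT_comp (measurable_get_e t)).
have fx i0 w : f (data_unit x eps i0 w) = `|eps i0 t w| `^ r by rewrite /f /= get_eE.
have := @integral_ident _ _ _ P _ _ _ (data_unit x eps) f i i' ident_units
  (@measurable_data _ _ _ P N T p x eps) mf.
by under eq_integral do rewrite fx; under [in RHS]eq_integral do rewrite fx;
  apply => u; exact: powR_ge0.
Qed.

Hypothesis indep_xe : forall i, independent2 P (covariates_unit x i) (errors_unit eps i).

Lemma product_moment r (A B : R) i t k : 0 <= B ->
  (\int[P]_w (`|x i t k w| `^ r)%:E <= A%:E)%E ->
  (\int[P]_w (`|eps i t w| `^ r)%:E <= B%:E)%E ->
  (\int[P]_w (`|x i t k w * eps i t w| `^ r)%:E <= (A * B)%:E)%E.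
Proof.
move=> B0 xA eB.
have e0 : (0 <= \int[P]_w (`|eps i t w| `^ r)%:E)%E.
  by apply: integral_ge0 => w _; rewrite lee_fin powR_ge0.
have x0 : (0 <= \int[P]_w (`|x i t k w| `^ r)%:E)%E.
  by apply: integral_ge0 => w _; rewrite lee_fin powR_ge0.
have [c E [c0 cB]] := ereal_between e0 eB.
pose f (u : T.-tuple (p.-tuple R)) : R := `|get_x t k u| `^ r.
pose g (u : T.-tuple R) : R := `|get_e t u| `^ r.
have := @integral_indep_mul _ _ _ P _ _ _ _ (covariates_unit x i) (errors_unit eps i) f g c
  (measurable_covariates x i) (measurable_errors eps i) (@indep_xe i)
  (measurable_abs_powR r (measurable_get_x t k)) (measurable_abs_powR r (measurable_get_e t))
  (fun=> powR_ge0 _ _) (fun=> powR_ge0 _ _).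
have fx w : f (covariates_unit x i w) = `|x i t k w| `^ r by rewrite /f get_xE.
have gx w : g (errors_unit eps i w) = `|eps i t w| `^ r by rewrite /g get_eE.
under eq_integral do rewrite gx; move=> /(_ E).
under eq_integral do rewrite fx gx -powRM// -normrM.
under [in X in _ = X -> _]eq_integral do rewrite fx.
move=> ->; rewrite mulrC EFinM; apply: (@le_trans _ _ (B%:E * \int[P]_w (`|x i t k w| `^ r)%:E)%E).
  by apply: lee_wpmul2r.
by apply: lee_wpmul2l.
Qed.

End Transfer.

(** * Tails from moments *)

Section PowerAlgebra.
Context {R : realType}.

Lemma powR_inv (a r : R) : 0 <= a -> a^-1 `^ r = (a `^ r)^-1.
Proof. by move=> a0; rewrite -(powR_inv1 a0) powRAC powR_inv1// powR_ge0. Qed.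

Lemma powR_div (a b r : R) : 0 <= a -> 0 <= b -> (a / b) `^ r = a `^ r / b `^ r.
Proof. by move=> a0 b0; rewrite powRM ?invr_ge0// powR_inv. Qed.

Lemma powR_half (a r : R) : 0 <= a -> a `^ (r / 2) = Num.sqrt a `^ r.
Proof. by move=> a0; rewrite [r / 2]mulrC powRrM powR12_sqrt. Qed.

Lemma powR_invK (a r : R) : r != 0 -> 0 <= a -> (a `^ r^-1) `^ r = a.
Proof. by move=> r0 a0; rewrite -powRrM mulVf// powRr1. Qed.

Lemma powR_ge1 (a s : R) : 1 <= a -> 0 <= s -> 1 <= a `^ s.
Proof. by move=> a1 s0; rewrite -(powRr0 a) ler_powR. Qed.

Lemma powR_le1 (a s : R) : 0 <= a -> a <= 1 -> 0 <= s -> a `^ s <= 1.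
Proof.
move=> a0 a1 s0; have := @ge0_ler_powR R s s0 a 1; rewrite !nnegrE powR1.
by apply.
Qed.

End PowerAlgebra.

Section Tails.
Context {d : measure_display} {Omega : measurableType d} {R : realType}.
Variable P : probability Omega R.

Lemma prob_le1 (E : set Omega) : measurable E -> (P E <= 1)%E.
Proof. by move=> mE; exact: probability_le1. Qed.

(** Young's inequality: (r/2) u^2 <= u^r + r/2 - 1. *)
Lemma second_moment_le1 (r : R) (U : Omega -> R) : 2 <= r -> measurable_fun setT U ->
  (\int[P]_w (`|U w| `^ r)%:E <= 1)%E -> (\int[P]_w (`|U w| `^ 2)%:E <= 1)%E.
Proof.
move=> r2 mU Ur; pose s := r / 2; have s1 : 1 <= s by rewrite /s; lra.
have s0 : 0 < s by lra.
have mr := measurable_abs_powR r mU.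
have ir := integrable_abs_powR mU Ur.
apply: (@le_trans _ _ (\int[P]_w (s^-1 * `|U w| `^ r + (1 - s^-1))%:E)%E).
  apply: le_integral_real.
  - exact: measurable_abs_powR.
  - by apply: measurable_funD => //; apply: measurable_funM.
  - by move=> w; exact: powR_ge0.
  move=> w; have := powR_young s1 (ler01 : 0 <= 1 :> R) (powR_ge0 `|U w| 2).
  rewrite -powRrM (_ : 2 * s = r); last by rewrite /s; field.
  rewrite !powR1 mul1r mulr1 => H.
  rewrite -(ler_pM2l s0); apply: (le_trans H); rewrite mulrDr mulrA mulfV ?gt_eqF// mul1r.
  by rewrite mulrBr mulr1 mulfV ?gt_eqF.
under eq_integral do rewrite EFinD.
rewrite integralD//; last 2 first.
- exact: integrableZl_real.
- exact: finite_measure_integrable_cst.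
rewrite integralZl_real// integral_cst_prob.
apply: (@le_trans _ _ ((s^-1)%:E * 1 + (1 - s^-1)%:E)%E).
  by apply: leeD => //; apply: lee_wpmul2l => //; rewrite lee_fin invr_ge0 ltW.
by rewrite mule1 -EFinD lee_fin; lra.
Qed.

Variables N T p : nat.
Hypotheses (hN : (0 < N)%N) (hT : (0 < T)%N).
Variables (x : 'I_N -> 'I_T -> 'I_p -> {RV P >-> R}) (eps : 'I_N -> 'I_T -> {RV P >-> R}).

Lemma burkholder_quotient (r n A m c : R) : 0 <= r -> 0 <= n -> 0 <= A -> 0 <= m -> 0 < c ->
  burk_const `^ r * (r * n) `^ (r / 2) * (A * m `^ r) / c `^ r =
  A * (burk_const * Num.sqrt r * Num.sqrt n * m / c) `^ r.
Proof.
move=> r0 n0 A0 m0 c0; have b0 : 0 <= burk_const :> R by rewrite ltW ?burk_const_gt0.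
rewrite powR_half ?mulr_ge0// sqrtrM// powR_div ?mulr_ge0// ?sqrtr_ge0 ?ltW//.
rewrite !powRM ?mulr_ge0 ?sqrtr_ge0//; ring.
Qed.

Hypothesis mds : forall i, martingale_difference (eps i).

Lemma score_d_tail (r A m c : R) i : 2 <= r -> 0 <= A -> 0 <= m -> 0 < c ->
  (forall t, \int[P]_w (`|eps i t w| `^ r)%:E <= (A * m `^ r)%:E)%E ->
  (P [set w | (c < `|\sum_t eps i t w|)%R] <=
    (A * (burk_const * Num.sqrt r * Num.sqrt T%:R * m / c) `^ r)%:E)%E.
Proof.
move=> r2 A0 m0 c0 H; have r0 : 0 < r by lra.
rewrite -burkholder_quotient ?(ltW r0)//.
apply: moment_tail => //; first exact: measurable_sum.
by apply: score_d_moment => //; rewrite mulr_ge0 ?powR_ge0.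
Qed.

Hypothesis indep_units : mutually_independent P (data_unit x eps).
Hypothesis indep_xe : forall i, independent2 P (covariates_unit x i) (errors_unit eps i).

Lemma score_x_tail (r A m c : R) k : 2 <= r -> 0 <= A -> 0 <= m -> 0 < c ->
  (forall i t, \int[P]_w (`|x i t k w * eps i t w| `^ r)%:E <= (A * m `^ r)%:E)%E ->
  (P [set w | (c < `|\sum_i \sum_t x i t k w * eps i t w|)%R] <=
    (A * (burk_const * Num.sqrt r * Num.sqrt (N * T)%:R * m / c) `^ r)%:E)%E.
Proof.
move=> r2 A0 m0 c0 H; have r0 : 0 < r by lra.
rewrite -burkholder_quotient ?(ltW r0)//.
apply: moment_tail => //.
  by apply: measurable_sum => i; apply: measurable_sum => t; exact: measurable_funM.
by apply: score_x_moment => //; rewrite mulr_ge0 ?powR_ge0.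
Qed.

Lemma dev_boundE (q m2 G0 u : R) : 0 <= q -> 0 <= u ->
  dev_bound q m2 G0 u = (2 * m2 + G0 `^ q + 1) * (2 * burk_const * Num.sqrt q / u) `^ q.
Proof.
move=> q0 u0; have b0 : 0 <= 2 * burk_const :> R by rewrite mulr_ge0// ltW ?burk_const_gt0.
rewrite /dev_bound powR_half// powR_div ?mulr_ge0 ?sqrtr_ge0//.
by rewrite [X in _ = _ * (X / _)]powRM ?sqrtr_ge0//; ring.
Qed.

End Tails.

(** * Scores with finitely many moments *)

Section ExtendedBounds.
Context {R : realType}.

Lemma efrac_ge0 (u v : \bar R) : (0 <= u -> 0 <= v -> 0 <= efrac u v)%E.
Proof.
move=> u0 v0; rewrite /efrac; case: ifPn => // v0'.
by rewrite mule_ge0// inve_ge0.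
Qed.

Lemma leeB_nneg (u v : \bar R) : (0 <= v -> u - v <= u)%E.
Proof. by move=> v0; rewrite -[leRHS]sube0; apply: leeB. Qed.

End ExtendedBounds.

Section Moments.
Context {d : measure_display} {Omega : measurableType d} {R : realType}.
Variable P : probability Omega R.
Variables N T p : nat.
Hypotheses (hN : (0 < N)%N) (hT : (0 < T)%N) (hp : (0 < p)%N).
Variables (x : 'I_N -> 'I_T -> 'I_p -> {RV P >-> R}) (eps : 'I_N -> 'I_T -> {RV P >-> R}).
Variables (r : R).
Hypothesis r2 : 2 <= r.
Hypothesis a1 : A1 x eps.
Hypothesis a2 : A2a r x eps (Ordinal hN).
Local Notation sigma := (max_Lr_norm r (eps (Ordinal hN))).

Let r0 : 0 < r. Proof. by have := r2; lra. Qed.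

Lemma max_Lr_norm_ge0 : 0 <= sigma.
Proof. exact: bigmax_ge_id. Qed.

Lemma covariate_moment_le1 i t k : (\int[P]_w (`|x i t k w| `^ r)%:E <= 1)%E.
Proof.
have [_ idu _ _] := a1; have [_ _ xm] := a2.
by rewrite (covariate_moment_ident idu r i (Ordinal hN)); have := xm t k; rewrite unlock.
Qed.

Lemma covariate_second_moment_le1 i t k : (\int[P]_w (`|x i t k w| `^ 2)%:E <= 1)%E.
Proof. by apply: second_moment_le1 (covariate_moment_le1 i t k). Qed.

Lemma error_moment_le i t : (\int[P]_w (`|eps i t w| `^ r)%:E <= (1 * sigma `^ r)%:E)%E.
Proof.
have [_ idu _ _] := a1; have [_ em _] := a2.
rewrite mul1r (error_moment_ident idu r i (Ordinal hN)).
have := em t; rewrite unlock => fin.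
have e0 : (0 <= \int[P]_w (`|eps (Ordinal hN) t w| `^ r)%:E)%E.
  by apply: integral_ge0 => w _; rewrite lee_fin powR_ge0.
have E : (\int[P]_w (`|eps (Ordinal hN) t w| `^ r)%:E =
          (Lr_norm P r (eps (Ordinal hN) t) `^ r)%:E)%E.
  rewrite /Lr_norm -fine_poweR poweR_Lnorm ?gt_eqF// fineK//.
  by rewrite ge0_fin_numE.
rewrite E lee_fin ge0_ler_powR ?(ltW r0)//.
- by rewrite nnegrE fine_ge0// Lnorm_ge0.
- by rewrite nnegrE max_Lr_norm_ge0.
- by rewrite /max_Lr_norm; apply: (le_bigmax_cond _ (fun t => Lr_norm P r (eps (Ordinal hN) t))).
Qed.

Lemma product_moment_le i t k :
  (\int[P]_w (`|x i t k w * eps i t w| `^ r)%:E <= (1 * sigma `^ r)%:E)%E.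
Proof.
have [_ _ ixe _] := a1.
have := @product_moment _ _ _ _ _ _ _ x eps ixe r 1 (1 * sigma `^ r) i t k.
rewrite !mul1r; apply.
- exact: powR_ge0.
- exact: covariate_moment_le1.
- by have := error_moment_le i t; rewrite mul1r.
Qed.

Definition score_const (s : R) : R := 4 * burk_const * Num.sqrt s.

Variables (a lam mu : R).
Hypothesis a_gt0 : 0 < a.
Hypothesis lamE : lam = 4 * a * p%:R `^ r^-1 * Num.sqrt (N * T)%:R * sigma.
Hypothesis muE : mu = 4 * a * N%:R `^ r^-1 * Num.sqrt T%:R * sigma.
Hypotheses (lam_gt0 : 0 < lam) (mu_gt0 : 0 < mu).

Lemma max_Lr_norm_gt0 : 0 < sigma.
Proof.
rewrite lt_neqAle max_Lr_norm_ge0 andbT eq_sym; apply/negP => /eqP s0.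
by have := lam_gt0; rewrite lamE s0 mulr0 ltxx.
Qed.

(** The tuning parameters are chosen so that the r-th moment bound of one score at level
    1/16 of the tuning parameter is (C_r / a)^r over the number of scores. *)
Lemma score_ratio (m n : nat) : (0 < m)%N -> (0 < n)%N ->
  1 * (burk_const * Num.sqrt r * Num.sqrt m%:R * sigma /
    (4 * a * n%:R `^ r^-1 * Num.sqrt m%:R * sigma / 16)) `^ r =
  (score_const r / a) `^ r / n%:R.
Proof.
move=> m0 n0; have s0 := max_Lr_norm_gt0.
have sm : 0 < Num.sqrt m%:R :> R by rewrite sqrtr_gt0 ltr0n.
have n0' : 0 < n%:R `^ r^-1 :> R by rewrite powR_gt0// ltr0n.
have b0 := @burk_const_gt0 R.
rewrite mul1r (_ : _ / _ = score_const r / a / n%:R `^ r^-1); last first.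
  by rewrite /score_const; field; rewrite !gt_eqF.
rewrite powR_div ?(ltW n0')//; last first.
  by rewrite divr_ge0 ?(ltW a_gt0)// /score_const !mulr_ge0 ?sqrtr_ge0// ltW.
by rewrite powR_invK ?gt_eqF.
Qed.

Lemma moment_score_x_tail k :
  (P [set w | (lam / 16 < `|\sum_i \sum_t x i t k w * eps i t w|)%R] <=
    ((score_const r / a) `^ r / p%:R)%:E)%E.
Proof.
have [iu _ ixe mds] := a1.
have NT0 : (0 < N * T)%N by rewrite muln_gt0 hN.
rewrite -(@score_ratio (N * T) p)// -lamE.
apply: score_x_tail => //; [exact: max_Lr_norm_ge0|by rewrite divr_gt0|].
exact: (fun i t => product_moment_le i t k).
Qed.

Lemma moment_score_d_tail i :
  (P [set w | (mu / 16 < `|\sum_t eps i t w|)%R] <=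
    ((score_const r / a) `^ r / N%:R)%:E)%E.
Proof.
have [iu _ ixe mds] := a1.
rewrite -(@score_ratio T N)// -muE.
apply: score_d_tail => //; [exact: max_Lr_norm_ge0|by rewrite divr_gt0|].
exact: error_moment_le.
Qed.

Lemma score_tail_total :
  p%:R * ((score_const r / a) `^ r / p%:R) + N%:R * ((score_const r / a) `^ r / N%:R) =
  2 * (score_const r / a) `^ r.
Proof. by field; rewrite !pnatr_eq0 -!lt0n hp hN. Qed.

End Moments.

(** * Gram matrix with finitely many moments *)

Section PolynomialMoments.
Context {R : realType}.

Definition gram_const (q : R) : R := 4 * (2 * burk_const * Num.sqrt q) `^ q.
(** The factor 200^(r/2) undoes the 1/200 in the tolerance; the summand 1 makes the
    bound vacuous when the tolerance is too small. *)
Definition gram_factor (r : R) : R := (1 + gram_const (r / 2)) * 200 `^ (r / 2).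

Lemma gram_const_ge0 q : 0 <= gram_const q.
Proof. by rewrite mulr_ge0// powR_ge0. Qed.

Lemma gram_factor_gt0 r : 0 < gram_factor r.
Proof.
apply: mulr_gt0; first by rewrite ltr_pwDl// gram_const_ge0.
by apply: powR_gt0; rewrite ltr0n.
Qed.

Context {d : measure_display} {Omega : measurableType d}.
Variable P : probability Omega R.
Variables N T p : nat.
Hypotheses (hN : (0 < N)%N) (hT : (0 < T)%N) (hp : (0 < p)%N).
Variables (x : 'I_N -> 'I_T -> 'I_p -> {RV P >-> R}) (eps : 'I_N -> 'I_T -> {RV P >-> R}).
Variables (bs : 'cV[R]_p) (cs : 'cV[R]_N).
Variables (bhat btil : 'I_p -> {RV P >-> R}) (chat ctil : 'I_N -> {RV P >-> R}).
Variables (r a lam mu : R).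
Hypothesis r2 : 2 <= r.
Hypothesis a1 : A1 x eps.
Hypothesis a2 : A2a r x eps (Ordinal hN).
Local Notation sigma := (max_Lr_norm r (eps (Ordinal hN))).
Hypothesis a_gt0 : 0 < a.
Hypothesis lamE : lam = 4 * a * p%:R `^ r^-1 * Num.sqrt (N * T)%:R * sigma.
Hypothesis muE : mu = 4 * a * N%:R `^ r^-1 * Num.sqrt T%:R * sigma.
Hypotheses (lam_gt0 : 0 < lam) (mu_gt0 : 0 < mu).
Hypothesis lassoP : is_lasso (response x eps bs cs) x lam mu bhat chat.
Hypothesis adaptiveP :
  is_adaptive_lasso (response x eps bs cs) x lam mu bhat chat btil ctil.
Local Notation J := (joint_supp bs cs).
Local Notation s1 := #|supp bs|.
Local Notation s2 := #|supp cs|.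
Local Notation k2 := (kappa2 x lam mu s1 s2).
Hypothesis k2_gt0 : (0 < k2)%E.
Local Notation L := (lam / Num.sqrt (N * T)%:R).
Local Notation M := (mu / Num.sqrt T%:R).
Let W := 32 * a * sigma * (p%:R `^ r^-1 * Num.sqrt s1%:R + N%:R `^ r^-1 * Num.sqrt s2%:R).
Hypothesis bmin : (efrac (2%:E * efrac W%:E k2) (Num.sqrt (N * T)%:R)%:E <= absmin bs)%E.
Hypothesis cmin : (efrac (2%:E * efrac W%:E k2) (Num.sqrt T%:R)%:E <= absmin cs)%E.
Local Notation Cr := (score_const r).
Local Notation Dr := (gram_factor r).
Let mx : R := Num.max (p%:R / N%:R) (N%:R / p%:R).
Let rho := mx `^ r^-1.
Let q := r / 2.

Let r0 : 0 < r. Proof. by have := r2; lra. Qed.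
Let N0 : 0 < N%:R :> R. Proof. by rewrite ltr0n. Qed.
Let p0 : 0 < p%:R :> R. Proof. by rewrite ltr0n. Qed.

Lemma sqrt_rates : L = 4 * a * p%:R `^ r^-1 * sigma /\ M = 4 * a * N%:R `^ r^-1 * sigma.
Proof.
have NT0 := @sqNT_gt0 R N T hN hT; have T0 := @sqT_gt0 R T hT.
by rewrite lamE muE; split; field; rewrite gt_eqF.
Qed.

Lemma ratio_ge1 : 1 <= mx.
Proof.
rewrite /mx le_max !ler_pdivlMr// !mul1r; exact: le_total.
Qed.

Lemma moment_rho_ge1 : 1 <= rho.
Proof. by rewrite powR_ge1 ?ratio_ge1 ?invr_ge0 ?ltW. Qed.

Lemma rate_ratio (m n : R) : 0 < m -> 0 < n -> m / n <= mx -> m `^ r^-1 <= rho * n `^ r^-1.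
Proof.
move=> m0 n0 mn; rewrite /rho -powRM ?(ltW n0) ?(le_trans ler01 ratio_ge1)//.
rewrite ge0_ler_powR ?nnegrE ?invr_ge0 ?(ltW r0) ?(ltW m0)//.
  by rewrite mulr_ge0 ?(ltW n0)// (le_trans ler01 ratio_ge1).
by rewrite -ler_pdivrMr.
Qed.

Lemma penalty_rates : L <= rho * M /\ M <= rho * L.
Proof.
have [-> ->] := sqrt_rates.
have s0 := max_Lr_norm_gt0 lamE lam_gt0.
have c0 : 0 <= 4 * a * sigma by rewrite !mulr_ge0// ltW.
have H (m n : R) : 0 < m -> 0 < n -> m / n <= mx ->
   4 * a * m `^ r^-1 * sigma <= rho * (4 * a * n `^ r^-1 * sigma).
  move=> m0 n0 /(rate_ratio m0 n0) mn.
  rewrite (_ : 4 * a * m `^ r^-1 * sigma = (4 * a * sigma) * m `^ r^-1); last by ring.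
  rewrite (_ : rho * _ = (4 * a * sigma) * (rho * n `^ r^-1)); last by ring.
  exact: ler_wpM2l.
by split; apply: H => //; rewrite /mx le_max lexx ?orbT.
Qed.

Lemma first_step_const :
  W = 8 * (L * Num.sqrt s1%:R + M * Num.sqrt s2%:R).
Proof. by have [-> ->] := sqrt_rates; rewrite /W; ring. Qed.

Section Tolerance.
Variables (kap : R).
Hypothesis J0 : J != finset.set0.
Hypotheses (kapE : k2 = kap%:E) (kap0 : 0 < kap).
Let tau := kap / (200 * #|J|%:R * rho ^+ 2).
Let u := Num.sqrt N%:R * tau.
Let g := (1 + gram_const q) / u `^ q.

Let s0 : 1 <= #|J|%:R :> R. Proof. by rewrite ler1n card_gt0. Qed.

Lemma abs_Gamma_le1 b b' : `|Gamma x b b'| <= 1.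
Proof.
have [_ idu _ _] := a1.
case: (split_ordP b) => i ->; case: (split_ordP b') => j ->.
- apply: (@abs_Gamma_ll _ _ _ P N T p hN hT x eps idu 1 1 1) => // i' t k;
    rewrite ?mulr1; exact: covariate_second_moment_le1 r2 a1 a2 _ _ _.
- by rewrite Gamma_lr normr0.
- by rewrite Gamma_rl normr0.
- by rewrite Gamma_rr; case: (i == j); rewrite ?normr1 ?normr0.
Qed.

Lemma kap_le1 : kap <= 1.
Proof.
have /set0Pn[l lJ] := J0.
apply: (le_trans (kappa_le_diag hN hT lam_gt0 mu_gt0 J0 k2_gt0 kapE lJ)).
exact: (le_trans (ler_norm _) (abs_Gamma_le1 l l)).
Qed.

Lemma denominator_ge1 : 1 <= #|J|%:R * rho ^+ 2.
Proof. by rewrite -[leLHS]mulr1; apply: ler_pM => //; apply: exprn_ege1; exact: moment_rho_ge1. Qed.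

Lemma tau_gt0 : 0 < tau.
Proof.
have d1 := denominator_ge1.
apply: divr_gt0; first exact: kap0.
rewrite -mulrA; apply: mulr_gt0; first by rewrite ltr0n.
exact: lt_le_trans ltr01 d1.
Qed.

Lemma tau_le1 : tau <= 1.
Proof.
have d1 := denominator_ge1; have k1 := kap_le1.
rewrite /tau ler_pdivrMr; last by rewrite -mulrA; lra.
by rewrite -mulrA; lra.
Qed.

Lemma tau_tolerance : tau * #|J|%:R * rho ^+ 2 <= kap / 200.
Proof.
have s0' : 0 < #|J|%:R :> R by rewrite (lt_le_trans ltr01 s0).
have rho0 : 0 < rho by rewrite (lt_le_trans ltr01 moment_rho_ge1).
rewrite /tau le_eqVlt; apply/orP; left; apply/eqP; field.
by rewrite !gt_eqF// exprn_gt0.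
Qed.

Lemma u_gt0 : 0 < u.
Proof. by rewrite mulr_gt0 ?tau_gt0// sqrtr_gt0. Qed.

(** The Gram term of the stated probability is (p^2 + Np) / u^(r/2) up to a constant, where
    u = sqrt N * tau. *)
Lemma gram_term :
  Dr * ((p%:R ^+ 2 + N%:R * p%:R) * (s1 + s2)%:R `^ (r / 2) * mx
         / (Num.sqrt kap `^ r * N%:R `^ (r / 4))) =
  (p%:R ^+ 2 + N%:R * p%:R) * g.
Proof.
have s0' : 0 < #|J|%:R :> R by rewrite (lt_le_trans ltr01 s0).
have rho0 : 0 < rho by rewrite (lt_le_trans ltr01 moment_rho_ge1).
have mx0 : 0 < mx by rewrite (lt_le_trans ltr01 ratio_ge1).
have uq : u `^ q = N%:R `^ (r / 4) * Num.sqrt kap `^ r / (200 `^ q * #|J|%:R `^ q * mx).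
  have [v [vE v0 vq]] : exists v, [/\ rho ^+ 2 = v, 0 <= v & v `^ q = mx].
    exists (rho ^+ 2); split; rewrite ?sqr_ge0// -powR_mulrn ?(ltW rho0)// -!powRrM.
    rewrite (_ : _ * _ = 1) ?powRr1 ?(ltW mx0)//.
    by rewrite /q; field; rewrite gt_eqF.
  have c0 : 0 <= 200 :> R by exact: ler0n.
  rewrite /u /tau vE; move: c0; set c : R := 200 => c0.
  rewrite mulrA powR_div ?mulr_ge0 ?sqrtr_ge0 ?(ltW kap0)//.
  rewrite -[in LHS]mulrA !powRM ?mulr_ge0 ?sqrtr_ge0 ?(ltW kap0)// vq mulrA.
  congr (_ * _ / _); last by rewrite /q powR_half// ltW.
  by rewrite -powR_half//; congr (_ `^ _); rewrite /q; field.
rewrite /g uq /gram_factor -card_joint_supp -/q.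
have pk : 0 < Num.sqrt kap `^ r by rewrite powR_gt0 ?sqrtr_gt0.
have pN : 0 < N%:R `^ (r / 4) :> R by rewrite powR_gt0.
have ps : 0 < #|J|%:R `^ q :> R by rewrite powR_gt0.
have p2 : 0 < 200 `^ q :> R by apply: powR_gt0; rewrite ltr0n.
by field; rewrite !gt_eqF.
Qed.

Lemma cells_ge : N%:R <= p%:R ^+ 2 + N%:R * p%:R :> R.
Proof.
have p1 : 1 <= p%:R :> R by rewrite ler1n.
have := ler_wpM2l (ltW N0) p1; have := sqr_ge0 (p%:R : R); lra.
Qed.

Lemma g_ge : (u `^ q)^-1 <= g.
Proof.
rewrite /g ler_peMl ?invr_ge0 ?powR_ge0//.
by rewrite lerDl gram_const_ge0.
Qed.

(** The Gram term is at least N / u^q.  It is thus at least 1 if u < 1, and also if q < 2,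
    because u <= sqrt N; in these cases the stated bound is vacuous. *)
Lemma gram_term_small :
  (p%:R ^+ 2 + N%:R * p%:R) * g < 1 -> 1 <= u /\ 2 <= q.
Proof.
move=> small; have uq0 : 0 < u `^ q by rewrite powR_gt0 ?u_gt0.
have q0 : 0 <= q by rewrite /q; have := r2; lra.
have N1 : 1 <= N%:R :> R by rewrite ler1n.
have cl := cells_ge.
have uN : N%:R < u `^ q.
  rewrite ltNge; apply/negP => uq; suff : 1 < (1 : R) by rewrite ltxx.
  apply: (le_lt_trans _ small); apply: (@le_trans _ _ (N%:R * (u `^ q)^-1)).
    by rewrite -ler_pdivrMr ?invr_gt0// invrK mul1r.
  by apply: ler_pM; rewrite ?(ltW N0) ?invr_ge0 ?(ltW uq0)// g_ge.
have u1 : 1 <= u.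
  rewrite leNgt; apply/negP => u1; have : u `^ q <= 1.
    by apply: powR_le1 => //; apply: ltW; rewrite ?u_gt0.
  by lra.
split=> //; rewrite leNgt; apply/negP => q2; have : u `^ q <= N%:R.
  have us : u <= Num.sqrt N%:R by rewrite /u ler_piMr ?sqrtr_ge0 ?tau_le1.
  apply: (@le_trans _ _ (u `^ 2)); first by rewrite ler_powR// ltW.
  rewrite powR_mulrn ?(ltW u_gt0)// -[leRHS]sqr_sqrtr ?(ltW N0)//.
  by rewrite ler_sqr ?nnegrE ?sqrtr_ge0 ?(ltW u_gt0).
lra.
Qed.

Lemma dev_bound_g : dev_bound q 1 1 u <= g.
Proof.
have q0 : 0 <= q by rewrite /q; have := r2; lra.
have b0 := @burk_const_gt0 R.
rewrite dev_boundE ?(ltW u_gt0)// powR1 powR_div ?(ltW u_gt0)//; last first.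
  by rewrite !mulr_ge0 ?sqrtr_ge0// ltW.
rewrite mulrA /g ler_wpM2r ?invr_ge0 ?powR_ge0//.
rewrite /gram_const; have := powR_ge0 (2 * burk_const * Num.sqrt q) q; lra.
Qed.


Let prob := 1 - (2 * (Cr / a) `^ r + (p%:R ^+ 2 + N%:R * p%:R) * g).

Lemma tails_total :
  prob = 1 - (p%:R * ((Cr / a) `^ r / p%:R) + N%:R * ((Cr / a) `^ r / N%:R)
     + (p%:R ^+ 2 + N%:R * p%:R) * g).
Proof. by rewrite /prob score_tail_total. Qed.

Lemma score_const_ge2 : 2 <= Cr.
Proof.
rewrite /score_const; have b2 := @burk_const_ge2 R.
have s1 : 1 <= Num.sqrt r by rewrite -sqrtr1 ler_sqrt; have := r2; lra.
have : 8 * 1 <= 4 * burk_const * Num.sqrt r by apply: ler_pM => //; lra.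
by lra.
Qed.

(** What may be assumed as soon as the stated bound says anything; in particular a >= 2
    because C_r >= 2. *)
Lemma positive_prob : 0 < prob ->
  [/\ 2 <= a, 1 <= u & 2 <= q].
Proof.
rewrite /prob => pos.
have g0 : 0 <= g by rewrite divr_ge0 ?powR_ge0// addr_ge0 ?gram_const_ge0.
have c0 : 0 <= (p%:R ^+ 2 + N%:R * p%:R) * g.
  by rewrite mulr_ge0// addr_ge0 ?sqr_ge0// mulr_ge0 ltW.
have e0 : 0 <= (Cr / a) `^ r by exact: powR_ge0.
have [|u1 q2] := gram_term_small; first by lra.
split=> //; rewrite leNgt; apply/negP => a2'.
have : 1 <= (Cr / a) `^ r.
  apply: powR_ge1; last exact: ltW.
  by rewrite ler_pdivlMr// mul1r; have := score_const_ge2; lra.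
by lra.
Qed.

Section Signs.
Variables (K1 K2 : R).

Lemma gram_tails : 2 <= q ->
  (forall j k, (P [set w | (tau < `|gram (design (fun i t k => x i t k w)) (lshift N j) (lshift N k)
     - Gamma x (lshift N j) (lshift N k)|)%R] <= g%:E)%E) /\
  (forall j i, (P [set w |
     (tau < `|gram (design (fun i t k => x i t k w)) (lshift N j) (rshift p i)|)%R] <= g%:E)%E).
Proof.
move=> q2; have [iu idu _ _] := a1.
have xq i t k : (\int[P]_w (`|x i t k w| `^ (2 * q))%:E <= 1%:E)%E.
  rewrite (_ : 2 * q = r); last by rewrite /q; field.
  exact: covariate_moment_le1 a1 a2 _ _ _.
have x2 i t k : (\int[P]_w (`|x i t k w| `^ 2)%:E <= 1%:E)%E.
  exact: covariate_second_moment_le1 r2 a1 a2 _ _ _.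
have gb : ((dev_bound q 1 1 u)%:E <= g%:E)%E by rewrite lee_fin dev_bound_g.
split=> j k; apply: le_trans gb.
  exact: (gram_ll_tail hN hT iu idu q2 xq x2 j k tau_gt0).
exact: (gram_lr_tail hN hT 1 q2 xq j k tau_gt0).
Qed.

Lemma tau_tolerance_k2 kap' : k2 = kap'%:E -> tau * #|J|%:R * rho ^+ 2 <= kap' / 200.
Proof. by rewrite kapE => -[<-]; exact: tau_tolerance. Qed.

Lemma beta_prob : 0 <= K1 ->
  (supp bs != finset.set0 -> (~: supp bs)%SET != finset.set0 ->
    a <= K1 / Num.sqrt (N * T)%:R) ->
  minimal_signal x lam mu bs cs (Num.sqrt (N * T)%:R) (absmin bs) ->
  (prob%:E <= P (beta_recovered x bs cs bhat btil lam mu K1))%E.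
Proof.
move=> K10 K1l signal; have [pos|neg] := ltP 0 prob; last first.
  by apply: (@le_trans _ _ 0%E); rewrite ?lee_fin.
have [a2' u1 q2] := positive_prob pos; have [tll tlr] := gram_tails q2.
have [LM ML] := penalty_rates; rewrite tails_total.
apply: (recovery_beta hN hT lam_gt0 mu_gt0 lassoP adaptiveP
  (moment_score_x_tail hT hp r2 a1 a2 a_gt0 lamE lam_gt0)
  (moment_score_d_tail hT r2 a1 a2 a_gt0 lamE muE lam_gt0 mu_gt0)
  (ltW tau_gt0) (lt_le_trans ltr01 moment_rho_ge1) moment_rho_ge1 LM ML J0 k2_gt0 tau_tolerance_k2 _ _
  tll tlr K10 _ signal).
- by rewrite -first_step_const.
- by rewrite -first_step_const.
move=> b0 bc0 b b'; apply: (le_trans _ (K1l b0 bc0)).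
by have := abs_Gamma_le1 b b'; have := tau_le1; lra.
Qed.

Lemma dummy_prob : 0 <= K2 ->
  minimal_signal x lam mu bs cs (Num.sqrt T%:R) (absmin cs) ->
  (prob%:E <= P (dummy_recovered x bs cs chat ctil lam mu K2))%E.
Proof.
move=> K20 signal; have [pos|neg] := ltP 0 prob; last first.
  by apply: (@le_trans _ _ 0%E); rewrite ?lee_fin.
have [a2' u1 q2] := positive_prob pos; have [tll tlr] := gram_tails q2.
have [LM ML] := penalty_rates; rewrite tails_total.
apply: (recovery_dummy hN hT lam_gt0 mu_gt0 lassoP adaptiveP
  (moment_score_x_tail hT hp r2 a1 a2 a_gt0 lamE lam_gt0)
  (moment_score_d_tail hT r2 a1 a2 a_gt0 lamE muE lam_gt0 mu_gt0)
  (ltW tau_gt0) (lt_le_trans ltr01 moment_rho_ge1) moment_rho_ge1 LM ML J0 k2_gt0 tau_tolerance_k2 _ _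
  tll tlr K20 u1 signal).
- by rewrite -first_step_const.
- by rewrite -first_step_const.
Qed.

End Signs.
End Tolerance.


End PolynomialMoments.

(** * Scores with sub-Gaussian data *)

Section Constants.
Context {R : realType}.
Variables (C K : R).
Hypotheses (C0 : 0 < C) (K0 : 0 < K).

Definition sg_mass : R := 2 * (K + 2).
(** The three terms of the minimum keep the order at most ln p ln a, and make the bases of the
    two r-th powers in the score tails at most 1/e. *)
Definition score_rate : R :=
  Num.min 1 (Num.min (C / (8 * expR 1 * burk_const)) (Num.sqrt C / (8 * expR 1 * burk_const))).
Definition score_mass : R := expR 2 + sg_mass ^+ 2.
Definition sg_variance : R := 1 + 2 / C * sg_mass.
Definition gram_scale : R := 2 / C + sg_variance.
(** The first term keeps the order small against sqrt N * tau, the second makes the base of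
    the q-th power in the Gram tail at most 1/e. *)
Definition gram_rate : R := Num.min (200^-1) (400 * expR 1 * burk_const * gram_scale)^-1.
Definition gram_mass : R := expR 2 + (2 * sg_mass + 2).

Let e0 : 0 < expR 1 :> R. Proof. exact: expR_gt0. Qed.
Let b0 : 0 < burk_const :> R. Proof. exact: burk_const_gt0. Qed.
Let c8 : 0 < 8 * expR 1 * burk_const :> R. Proof. by rewrite !mulr_gt0. Qed.

Lemma sg_mass_ge1 : 1 <= sg_mass. Proof. by rewrite /sg_mass; have := K0; lra. Qed.

Lemma score_rate_gt0 : 0 < score_rate.
Proof. by rewrite !lt_min ltr01 !divr_gt0 ?sqrtr_gt0. Qed.

Lemma score_rate_le : [/\ score_rate <= 1,
  8 * burk_const * score_rate / C <= (expR 1)^-1 &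
  8 * burk_const * score_rate / Num.sqrt C <= (expR 1)^-1].
Proof.
have sC : 0 < Num.sqrt C by rewrite sqrtr_gt0.
have H (z : R) : 0 < z -> score_rate <= z / (8 * expR 1 * burk_const) ->
   8 * burk_const * score_rate / z <= (expR 1)^-1.
  move=> z0; rewrite ler_pdivlMr// => Hz.
  rewrite ler_pdivrMr// [leRHS]mulrC ler_pdivlMr//; apply: le_trans Hz.
  by rewrite le_eqVlt; apply/orP; left; apply/eqP; ring.
by split; [|apply: H|apply: H]; rewrite // /score_rate !ge_min lexx ?orbT.
Qed.

Lemma sg_variance_ge1 : 1 <= sg_variance.
Proof.
rewrite /sg_variance lerDl mulr_ge0 ?divr_ge0 ?(ltW C0)//.
by have := sg_mass_ge1; lra.
Qed.

Lemma gram_scale_ge : sg_variance <= gram_scale /\ 2 / C <= gram_scale.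
Proof.
have := sg_variance_ge1; have : 0 < 2 / C by rewrite divr_gt0.
by rewrite /gram_scale; split; lra.
Qed.

Lemma gram_scale_ge1 : 1 <= gram_scale.
Proof. by have [] := gram_scale_ge; have := sg_variance_ge1; lra. Qed.

Let c400 : 0 < 400 * expR 1 * burk_const * gram_scale.
Proof. by rewrite !mulr_gt0 ?ltr0n//; have := gram_scale_ge1; lra. Qed.

Lemma gram_rate_gt0 : 0 < gram_rate.
Proof. by rewrite lt_min !invr_gt0 c400 ltr0n. Qed.

Lemma gram_rate_le : gram_rate <= 200^-1 /\
  400 * burk_const * gram_scale * gram_rate <= (expR 1)^-1.
Proof.
split; first by rewrite /gram_rate ge_min lexx.
have H : gram_rate <= (400 * expR 1 * burk_const * gram_scale)^-1.
  by rewrite /gram_rate ge_min lexx orbT.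
have -> : 400 * burk_const * gram_scale * gram_rate =
   400 * expR 1 * burk_const * gram_scale * gram_rate / expR 1.
  by field; rewrite gt_eqF.
move: c400 H; set c := 400 * _ * _ * _ => cp H.
rewrite ler_pdivrMr// mulVf ?gt_eqF//.
by have := ler_wpM2l (ltW cp) H; rewrite mulfV ?gt_eqF.
Qed.

End Constants.

Lemma expR_pow (R : realType) (b r : R) : 0 <= r -> 0 <= b -> b <= (expR 1)^-1 ->
  b `^ r <= expR (- r).
Proof.
move=> r0 b0 be; rewrite -expRN in be.
apply: (@le_trans _ _ (expR (- 1) `^ r)).
  by apply: ge0_ler_powR => //; rewrite nnegrE expR_ge0.
by rewrite /powR gt_eqF ?expR_gt0// expRK mulrN1.
Qed.

Section SubGaussianTails.
Context {d : measure_display} {Omega : measurableType d} {R : realType}.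
Variable P : probability Omega R.
Variables N T p : nat.
Hypotheses (hN : (0 < N)%N) (hT : (0 < T)%N).
Variables (x : 'I_N -> 'I_T -> 'I_p -> {RV P >-> R}) (eps : 'I_N -> 'I_T -> {RV P >-> R}).
Variables (C K : R).
Hypotheses (C0 : 0 < C) (K0 : 0 < K).
Hypothesis a1 : A1 x eps.
Hypothesis a2 : A2b C K x eps (Ordinal hN).
Local Notation H := (sg_mass K).
Local Notation c0 := (score_rate C).

Lemma covariate_sg_moment (q : R) i t k : 0 < q ->
  (\int[P]_w (`|x i t k w| `^ (2 * q))%:E <= ((2 * q / C) `^ q * H)%:E)%E.
Proof.
move=> q0; have [_ idu _ _] := a1.
rewrite (covariate_moment_ident idu _ i (Ordinal hN)).
apply: subgaussian_moment => // u u0; exact: (a2 u0).1.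
Qed.

Lemma error_sg_moment (q : R) i t : 0 < q ->
  (\int[P]_w (`|eps i t w| `^ (2 * q))%:E <= ((2 * q / C) `^ q * H)%:E)%E.
Proof.
move=> q0; have [_ idu _ _] := a1.
rewrite (error_moment_ident idu _ i (Ordinal hN)).
apply: subgaussian_moment => // u u0; exact: (a2 u0).2.
Qed.

Let H1 : 1 <= H. Proof. exact: sg_mass_ge1. Qed.

Lemma half_moment r : 0 <= r -> (2 * (r / 2) / C) `^ (r / 2) * H = H * Num.sqrt (r / C) `^ r.
Proof.
move=> r0; rewrite mulrC; congr (_ * _).
rewrite (_ : 2 * (r / 2) = r); last by field.
by rewrite powR_half// divr_ge0// ltW.
Qed.

Lemma error_sg_moment_sqrt r i t : 0 < r ->
  (\int[P]_w (`|eps i t w| `^ r)%:E <= (H * Num.sqrt (r / C) `^ r)%:E)%E.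
Proof.
move=> r0; rewrite -half_moment ?(ltW r0)//.
have -> : (\int[P]_w (`|eps i t w| `^ r)%:E = \int[P]_w (`|eps i t w| `^ (2 * (r / 2)))%:E)%E.
  by congr (integral _ _ _); apply/funext => w; congr (_ `^ _)%:E; field.
by apply: error_sg_moment; rewrite divr_gt0.
Qed.

Lemma product_sg_moment r i t k : 0 < r ->
  (\int[P]_w (`|x i t k w * eps i t w| `^ r)%:E <= (H ^+ 2 * (r / C) `^ r)%:E)%E.
Proof.
move=> r0; have [_ _ ixe _] := a1.
have rC : 0 <= r / C by rewrite divr_ge0// ltW.
have -> : H ^+ 2 * (r / C) `^ r = (H * Num.sqrt (r / C) `^ r) * (H * Num.sqrt (r / C) `^ r).
  by rewrite mulrACA -powRM ?sqrtr_ge0// -!expr2 sqr_sqrtr.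
apply: product_moment => //.
- by rewrite mulr_ge0 ?powR_ge0//; have := H1; lra.
- rewrite -half_moment ?(ltW r0)//.
  have -> : (\int[P]_w (`|x i t k w| `^ r)%:E = \int[P]_w (`|x i t k w| `^ (2 * (r / 2)))%:E)%E.
    by congr (integral _ _ _); apply/funext => w; congr (_ `^ _)%:E; field.
  by apply: covariate_sg_moment; rewrite divr_gt0.
- exact: error_sg_moment_sqrt.
Qed.

(** The moment inequality requires order at least 2; below, the constant e^2 makes the exponential bound exceed 1. *)
Lemma trivial_exp_tail (E : set Omega) (A r : R) : measurable E -> 0 <= A -> r < 2 ->
  (P E <= ((expR 2 + A) * expR (- r))%:E)%E.
Proof.
move=> mE A0 r2; apply: (le_trans (prob_le1 P mE)).
rewrite lee_fin mulrDl -expRD; apply: (@le_trans _ _ (expR (2 - r))).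
  by apply: (le_trans _ (expR_ge1Dx _)); lra.
by rewrite lerDl mulr_ge0// expR_ge0.
Qed.

(** With r proportional to m = ln p ln a, Markov's inequality for the r-th moment of a
    score gives the rate exp(-c m). *)
Lemma score_exp_x_tail (m : R) k : 1 <= m ->
  (P [set w | (Num.sqrt (N * T)%:R * (m * Num.sqrt m) / 8 <
       `|\sum_i \sum_t x i t k w * eps i t w|)%R]
   <= (score_mass K * expR (- (c0 * m)))%:E)%E.
Proof.
move=> m1; have [c1 cC _] := score_rate_le C0; have cp := score_rate_gt0 C0.
have m0 : 0 < m by lra.
set r := c0 * m; have r0 : 0 < r by rewrite mulr_gt0.
have [r2|r2] := ltP r 2.
  apply: trivial_exp_tail => //; last exact: sqr_ge0.
  have mS : measurable_fun setT (fun w => `|\sum_i \sum_t x i t k w * eps i t w|).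
    apply: measurableT_comp => //; apply: measurable_sum => i; apply: measurable_sum => t.
    exact: measurable_funM.
  rewrite [X in measurable X](_ : _ = (fun w => `|\sum_i \sum_t x i t k w * eps i t w|) @^-1`
     `]Num.sqrt (N * T)%:R * (m * Num.sqrt m) / 8, +oo[).
    by rewrite -[X in measurable X]setTI; exact: mS.
  by apply/seteqP; split=> w /=; rewrite in_itv/= andbT.
have [iu _ ixe mds] := a1.
have sm : 0 < Num.sqrt m by rewrite sqrtr_gt0.
have sNT := @sqNT_gt0 R N T hN hT.
have b0 := @burk_const_gt0 R.
have thr : 0 < Num.sqrt (N * T)%:R * (m * Num.sqrt m) / 8 by rewrite !mulr_gt0.
have HT := (score_x_tail hT mds iu ixe r2 (sqr_ge0 H)
  (divr_ge0 (ltW r0) (ltW C0)) thr (fun i t => product_sg_moment i t k r0)).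
apply: (le_trans HT).
rewrite lee_fin /score_mass; apply: (@le_trans _ _ (H ^+ 2 * expR (- r))); last first.
  by rewrite ler_wpM2r ?expR_ge0// lerDr expR_ge0.
rewrite ler_wpM2l ?sqr_ge0//; apply: expR_pow; first exact: ltW.
  apply: divr_ge0; last exact: ltW.
  by rewrite !mulr_ge0 ?sqrtr_ge0 ?invr_ge0 ?(ltW b0) ?(ltW r0) ?(ltW C0) ?(ltW cp) ?(ltW m0).
apply: le_trans cC.
have sr : Num.sqrt r <= Num.sqrt m by rewrite ler_sqrt ?(ltW m0)// /r ler_piMl ?(ltW m0).
rewrite (_ : _ / _ = (8 * burk_const * c0 / C) * (Num.sqrt r / Num.sqrt m)); last first.
  by rewrite /r; field; rewrite !gt_eqF.
rewrite ler_piMr//; last by rewrite ler_pdivrMr// mul1r.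
by rewrite !mulr_ge0 ?invr_ge0 ?(ltW b0) ?(ltW cp) ?(ltW C0).
Qed.

Lemma score_exp_d_tail (m : R) i : 1 <= m ->
  (P [set w | (Num.sqrt T%:R * (m * Num.sqrt m) / 8 < `|\sum_t eps i t w|)%R]
   <= (score_mass K * expR (- (c0 * m)))%:E)%E.
Proof.
move=> m1; have [c1 _ cC] := score_rate_le C0; have cp := score_rate_gt0 C0.
have m0 : 0 < m by lra.
set r := c0 * m; have r0 : 0 < r by rewrite mulr_gt0.
have [r2|r2] := ltP r 2.
  apply: trivial_exp_tail => //; last exact: sqr_ge0.
  have mS : measurable_fun setT (fun w => `|\sum_t eps i t w|).
    by apply: measurableT_comp => //; apply: measurable_sum => t.
  rewrite [X in measurable X](_ : _ = (fun w => `|\sum_t eps i t w|) @^-1`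
     `]Num.sqrt T%:R * (m * Num.sqrt m) / 8, +oo[).
    by rewrite -[X in measurable X]setTI; exact: mS.
  by apply/seteqP; split=> w /=; rewrite in_itv/= andbT.
have [iu _ ixe mds] := a1.
have sm : 0 < Num.sqrt m by rewrite sqrtr_gt0.
have sT := @sqT_gt0 R T hT.
have sC : 0 < Num.sqrt C by rewrite sqrtr_gt0.
have b0 := @burk_const_gt0 R.
have H0 : 0 <= H by have := H1; lra.
have thr : 0 < Num.sqrt T%:R * (m * Num.sqrt m) / 8 by rewrite !mulr_gt0.
apply: (le_trans (score_d_tail mds r2 H0 (sqrtr_ge0 _) thr
  (fun t => error_sg_moment_sqrt i t r0))).
rewrite lee_fin /score_mass; apply: (@le_trans _ _ (H ^+ 2 * expR (- r))); last first.
  by rewrite ler_wpM2r ?expR_ge0// lerDr expR_ge0.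
apply: ler_pM; rewrite ?powR_ge0//.
  by rewrite expr2 ler_peMr.
apply: expR_pow; first exact: ltW.
  apply: divr_ge0; last exact: ltW.
  by rewrite !mulr_ge0 ?sqrtr_ge0 ?(ltW b0).
apply: le_trans cC.
have sm1 : 1 <= Num.sqrt m by rewrite -[leLHS]sqrtr1 ler_sqrt ?(ltW m0).
have rr : Num.sqrt r * Num.sqrt r = r by rewrite -expr2 sqr_sqrtr ?(ltW r0).
rewrite [Num.sqrt (_ / _)]sqrtrM ?(ltW r0)// sqrtrV ?(ltW C0)//.
rewrite (_ : _ / _ = (8 * burk_const * (Num.sqrt r * Num.sqrt r) / m / Num.sqrt C) / Num.sqrt m); last first.
  by field; rewrite !gt_eqF.
rewrite rr ler_pdivrMr// (_ : 8 * burk_const * r / m / Num.sqrt C = 8 * burk_const * c0 / Num.sqrt C); last first.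
  by rewrite /r; field; rewrite !gt_eqF.
rewrite ler_peMr//.
by rewrite !mulr_ge0 ?invr_ge0 ?(ltW b0) ?(ltW cp) ?(ltW sC).
Qed.

End SubGaussianTails.

(** * Gram matrix with sub-Gaussian data *)

Section SubGaussianGram.
Context {d : measure_display} {Omega : measurableType d} {R : realType}.
Variable P : probability Omega R.
Variables N T p : nat.
Hypotheses (hN : (0 < N)%N) (hT : (0 < T)%N).
Variables (x : 'I_N -> 'I_T -> 'I_p -> {RV P >-> R}) (eps : 'I_N -> 'I_T -> {RV P >-> R}).
Variables (C K : R).
Hypotheses (C0 : 0 < C) (K0 : 0 < K).
Hypothesis a1 : A1 x eps.
Hypothesis a2 : A2b C K x eps (Ordinal hN).
Local Notation H := (sg_mass K).
Local Notation G0 := (sg_variance C K).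
Local Notation c1 := (gram_rate C K).
Local Notation gam := (gram_scale C K).

Lemma covariate_sg_second_moment i t k : (\int[P]_w (`|x i t k w| `^ 2)%:E <= G0%:E)%E.
Proof.
have := covariate_sg_moment C0 K0 a1 a2 i t k (ltr01 : 0 < 1 :> R).
rewrite mulr1 powRr1 ?divr_ge0 ?(ltW C0)// => Hm; apply: (le_trans Hm).
by rewrite lee_fin /sg_variance lerDr.
Qed.

Lemma abs_Gamma_sg b b' : `|Gamma x b b'| <= G0.
Proof.
have [_ idu _ _] := a1; have G1 := sg_variance_ge1 C0 K0.
case: (split_ordP b) => i ->; case: (split_ordP b') => j ->.
- apply: (@abs_Gamma_ll _ _ _ P N T p hN hT x eps idu 1 G0 G0) => // i' t k;
    rewrite ?mulr1; exact: covariate_sg_second_moment.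
- by rewrite Gamma_lr normr0; lra.
- by rewrite Gamma_rl normr0; lra.
- by rewrite Gamma_rr; case: (i == j); rewrite ?normr1 ?normr0; lra.
Qed.

(** The 2q-th moment of a sub-Gaussian covariate grows like q^q, and the moment inequality adds
    q^(q/2); so the tail is (C q^(3/2) / u)^q, and q^(3/2) proportional to u is the
    optimal order. *)
Lemma dev_bound_exp (q u : R) : 2 <= q -> 0 < u -> q * Num.sqrt q <= 200 * c1 * u ->
  dev_bound q ((2 * q / C) `^ q * H) G0 u <= (2 * H + 2) * expR (- q).
Proof.
move=> q2 u0 qu; have q0 : 0 < q by lra.
have b0 := @burk_const_gt0 R; have G1 := sg_variance_ge1 C0 K0.
have [gG gC] := gram_scale_ge C0 K0; have g1 := gram_scale_ge1 C0 K0.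
have [_ c1e] := gram_rate_le C0 K0; have c1p := gram_rate_gt0 C0 K0.
have H1 := sg_mass_ge1 K0.
have g0 : 0 < gam by lra.
have gq : gam <= gam * q by rewrite ler_peMr ?(ltW g0)//; lra.
have mono (z : R) : 0 <= z -> z <= gam * q -> z `^ q <= (gam * q) `^ q.
  move=> z0 zq; apply: ge0_ler_powR; rewrite ?nnegrE ?(ltW q0)//.
  by rewrite mulr_ge0 ?(ltW g0) ?(ltW q0).
rewrite dev_boundE ?(ltW q0) ?(ltW u0)//.
apply: (@le_trans _ _ ((2 * H + 2) * (gam * q) `^ q * (2 * burk_const * Num.sqrt q / u) `^ q)).
  apply: ler_wpM2r; first exact: powR_ge0.
  have E1 : (2 * q / C) `^ q <= (gam * q) `^ q.
    apply: mono; first by apply: divr_ge0; rewrite ?mulr_ge0 ?(ltW q0) ?(ltW C0).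
    by rewrite mulrAC ler_wpM2r ?(ltW q0).
  have E2 : G0 `^ q <= (gam * q) `^ q by apply: mono; lra.
  have E3 : 1 <= (gam * q) `^ q by apply: powR_ge1; lra.
  have := ler_wpM2r (_ : 0 <= H) E1 => /(_ ltac:(lra)); lra.
rewrite -mulrA -powRM; last 2 first.
- by rewrite mulr_ge0 ?(ltW g0) ?(ltW q0).
- by rewrite divr_ge0 ?mulr_ge0 ?sqrtr_ge0 ?(ltW b0) ?(ltW u0).
apply: ler_wpM2l; first by lra.
apply: expR_pow; first exact: ltW.
  by rewrite !mulr_ge0 ?invr_ge0 ?sqrtr_ge0 ?(ltW g0) ?(ltW q0) ?(ltW b0) ?(ltW u0).
apply: le_trans c1e.
rewrite (_ : _ * _ = 2 * burk_const * gam * (q * Num.sqrt q) / u); last first.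
  by field; rewrite gt_eqF.
rewrite ler_pdivrMr//.
have k0 : 0 <= 2 * burk_const * gam by rewrite !mulr_ge0 ?(ltW b0) ?(ltW g0).
have := ler_wpM2l k0 qu.
by congr (_ <= _); ring.
Qed.

Lemma gram_exp_tails (q tau : R) : 2 <= q -> 0 < tau ->
  q * Num.sqrt q <= 200 * c1 * (Num.sqrt N%:R * tau) ->
  (forall j k, (P [set w | (tau < `|gram (design (fun i t k => x i t k w)) (lshift N j) (lshift N k)
     - Gamma x (lshift N j) (lshift N k)|)%R] <= (gram_mass K * expR (- q))%:E)%E) /\
  (forall j i, (P [set w |
     (tau < `|gram (design (fun i t k => x i t k w)) (lshift N j) (rshift p i)|)%R]
       <= (gram_mass K * expR (- q))%:E)%E).
Proof.
move=> q2 t0 qu; have [iu idu _ _] := a1.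
have q0 : 0 < q by lra.
have xq i t k := covariate_sg_moment C0 K0 a1 a2 i t k q0.
have u0 : 0 < Num.sqrt N%:R * tau by rewrite mulr_gt0// sqrtr_gt0 ltr0n.
have gb : ((dev_bound q ((2 * q / C) `^ q * H) G0 (Num.sqrt N%:R * tau))%:E <=
     (gram_mass K * expR (- q))%:E)%E.
  rewrite lee_fin; apply: (le_trans (dev_bound_exp q2 u0 qu)).
  by rewrite /gram_mass ler_wpM2r ?expR_ge0// lerDr expR_ge0.
split=> j k; apply: le_trans gb.
  exact: (gram_ll_tail hN hT iu idu q2 xq covariate_sg_second_moment j k t0).
exact: (gram_lr_tail hN hT G0 q2 xq j k t0).
Qed.

End SubGaussianGram.

(** * Sub-Gaussian rates *)

Section ThreeHalves.
Context {R : realType}.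

(** z^(3/2), written so that it is multiplicative and monotone by inspection. *)
Definition pow32 (z : R) : R := z * Num.sqrt z.

Lemma pow32_ge0 z : 0 <= z -> 0 <= pow32 z.
Proof. by move=> z0; rewrite mulr_ge0 ?sqrtr_ge0. Qed.

Lemma pow32M y z : 0 <= y -> pow32 (y * z) = pow32 y * pow32 z.
Proof. by move=> y0; rewrite /pow32 sqrtrM// mulrACA. Qed.

Lemma ler_pow32 y z : 0 <= y -> y <= z -> pow32 y <= pow32 z.
Proof.
move=> y0 yz; apply: ler_pM; rewrite ?sqrtr_ge0// ler_sqrt//.
exact: le_trans y0 yz.
Qed.

Lemma sqr_pow32 z : 0 <= z -> pow32 z ^+ 2 = z ^+ 3.
Proof. by move=> z0; rewrite /pow32 exprMn sqr_sqrtr// -exprSr. Qed.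

Lemma powR32 z : 0 <= z -> z `^ (3 / 2) = pow32 z.
Proof.
move=> z0; rewrite /pow32 -powR12_sqrt// -{2}(powRr1 z0) -powRD; first by congr (_ `^ _); field.
by apply/implyP => /eqP; lra.
Qed.

Lemma sqrt_pow32 y z : 0 <= y -> 0 <= z -> Num.sqrt (4 * y * z ^+ 3) = 2 * Num.sqrt y * pow32 z.
Proof.
move=> y0 z0; have p0 := pow32_ge0 z0.
rewrite -sqr_pow32// -[X in 4 * X](sqr_sqrtr y0).
rewrite (_ : 4 * _ * _ = (2 * Num.sqrt y * pow32 z) ^+ 2); last by ring.
by rewrite sqrtr_sqr ger0_norm// !mulr_ge0 ?sqrtr_ge0.
Qed.

End ThreeHalves.

Section SubGaussianRecovery.
Context {R : realType} {d : measure_display} {Omega : measurableType d}.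
Variable P : probability Omega R.
Variables N T p : nat.
Hypotheses (hN : (0 < N)%N) (hT : (0 < T)%N).
Variables (x : 'I_N -> 'I_T -> 'I_p -> {RV P >-> R}) (eps : 'I_N -> 'I_T -> {RV P >-> R}).
Variables (bs : 'cV[R]_p) (cs : 'cV[R]_N).
Variables (bhat btil : 'I_p -> {RV P >-> R}) (chat ctil : 'I_N -> {RV P >-> R}).
Variables (C K a lam mu : R).
Hypotheses (C0 : 0 < C) (K0 : 0 < K).
Hypotheses (pe : expR 1 <= p%:R :> R) (Ne : expR 1 <= N%:R :> R) (ae : expR 1 <= a).
Hypothesis a1 : A1 x eps.
Hypothesis a2 : A2b C K x eps (Ordinal hN).
Local Notation lp := (ln (p%:R : R)).
Local Notation lN := (ln (N%:R : R)).
Local Notation la := (ln a).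
Hypothesis lamE : lam = Num.sqrt (4 * (N * T)%:R * lp ^+ 3 * la ^+ 3).
Hypothesis muE : mu = Num.sqrt (4 * T%:R * lN ^+ 3 * la ^+ 3).
Hypothesis lassoP : is_lasso (response x eps bs cs) x lam mu bhat chat.
Hypothesis adaptiveP :
  is_adaptive_lasso (response x eps bs cs) x lam mu bhat chat btil ctil.
Local Notation J := (joint_supp bs cs).
Local Notation s1 := #|supp bs|.
Local Notation s2 := #|supp cs|.
Local Notation k2 := (kappa2 x lam mu s1 s2).
Hypothesis k2_gt0 : (0 < k2)%E.
Local Notation L := (lam / Num.sqrt (N * T)%:R).
Local Notation M := (mu / Num.sqrt T%:R).
Let W := 16 * la `^ (3 / 2) * (lp `^ (3 / 2) * Num.sqrt s1%:R + lN `^ (3 / 2) * Num.sqrt s2%:R).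
Hypothesis bmin : (efrac (2%:E * efrac W%:E k2) (Num.sqrt (N * T)%:R)%:E <= absmin bs)%E.
Hypothesis cmin : (efrac (2%:E * efrac W%:E k2) (Num.sqrt T%:R)%:E <= absmin cs)%E.
Let mx : R := Num.max (lp / lN) (lN / lp).
Let rho := pow32 mx.
Local Notation c0 := (score_rate C).
Local Notation c1 := (gram_rate C K).
Local Notation G0 := (sg_variance C K).

Lemma ln_ge1 (z : R) : expR 1 <= z -> 1 <= ln z.
Proof.
move=> ze; rewrite -[leLHS]expRK ler_ln// posrE ?expR_gt0//.
exact: lt_le_trans (expR_gt0 1) ze.
Qed.

Let lp1 : 1 <= lp. Proof. exact: ln_ge1. Qed.
Let lN1 : 1 <= lN. Proof. exact: ln_ge1. Qed.
Let la1 : 1 <= la. Proof. exact: ln_ge1. Qed.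
Let lp0 : 0 <= lp. Proof. by have := lp1; lra. Qed.
Let lN0 : 0 <= lN. Proof. by have := lN1; lra. Qed.
Let la0 : 0 <= la. Proof. by have := la1; lra. Qed.

Lemma product_ge1 (y z : R) : 1 <= y -> 1 <= z -> 1 <= y * z.
Proof. by move=> y1 z1; rewrite -[leLHS]mulr1; apply: ler_pM. Qed.

Let mp1 : 1 <= lp * la. Proof. exact: product_ge1. Qed.
Let mN1 : 1 <= lN * la. Proof. exact: product_ge1. Qed.

(** lambda / 16 and mu / 16 are the levels of the sub-Gaussian score tails with
    m = ln p ln a and m = ln N ln a. *)
Lemma tuning_closed :
  lam = 2 * Num.sqrt (N * T)%:R * pow32 (lp * la) /\ mu = 2 * Num.sqrt T%:R * pow32 (lN * la).
Proof.
have E (y z : R) : 4 * y * z ^+ 3 * la ^+ 3 = 4 * y * (z * la) ^+ 3 by ring.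
by rewrite lamE muE !E; split; rewrite sqrt_pow32 ?mulr_ge0.
Qed.

Lemma pow32_gt0 (z : R) : 1 <= z -> 0 < pow32 z.
Proof. by move=> z1; rewrite mulr_gt0 ?sqrtr_gt0//; lra. Qed.

Lemma sg_lam_gt0 : 0 < lam.
Proof.
have [-> _] := tuning_closed.
by apply: mulr_gt0; [apply: mulr_gt0 => //; exact: (@sqNT_gt0 R N T hN hT)|exact: pow32_gt0 mp1].
Qed.

Lemma sg_mu_gt0 : 0 < mu.
Proof.
have [_ ->] := tuning_closed.
by apply: mulr_gt0; [apply: mulr_gt0 => //; exact: (@sqT_gt0 R T hT)|exact: pow32_gt0 mN1].
Qed.

Lemma sg_rates : L = 2 * pow32 (lp * la) /\ M = 2 * pow32 (lN * la).
Proof.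
have NT0 := @sqNT_gt0 R N T hN hT; have T0 := @sqT_gt0 R T hT.
by have [-> ->] := tuning_closed; split; field; rewrite gt_eqF.
Qed.

Lemma sg_first_step_const : W = 8 * (L * Num.sqrt s1%:R + M * Num.sqrt s2%:R).
Proof.
have [-> ->] := sg_rates.
by rewrite /W !powR32// !pow32M//; ring.
Qed.

Lemma sg_ratio_ge1 : 1 <= mx.
Proof.
have lp' : 0 < lp by have := lp1; lra.
have lN' : 0 < lN by have := lN1; lra.
by rewrite /mx le_max !ler_pdivlMr// !mul1r; exact: le_total.
Qed.

Let mx0 : 0 <= mx. Proof. by have := sg_ratio_ge1; lra. Qed.

Lemma sg_rho_ge1 : 1 <= rho.
Proof.
have m1 := sg_ratio_ge1.
apply: product_ge1 => //; rewrite -[leLHS]sqrtr1 ler_sqrt//.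
Qed.

Lemma sg_penalty_rates : L <= rho * M /\ M <= rho * L.
Proof.
have lp' : 0 < lp by have := lp1; lra.
have lN' : 0 < lN by have := lN1; lra.
have H (y z : R) : 0 < y -> 0 < z -> y / z <= mx ->
   2 * pow32 (y * la) <= rho * (2 * pow32 (z * la)).
  move=> y0 z0 yz; rewrite [leRHS]mulrCA ler_pM2l// /rho -pow32M//.
  apply: ler_pow32; first by rewrite mulr_ge0 ?(ltW y0).
  by rewrite mulrA ler_wpM2r// -ler_pdivrMr.
have [-> ->] := sg_rates.
by split; apply: H => //; rewrite /mx le_max lexx ?orbT.
Qed.

Lemma sg_score_x_tail k :
  (P [set w | (lam / 16 < `|\sum_i \sum_t x i t k w * eps i t w|)%R]
   <= (score_mass K * expR (- (c0 * (lp * la))))%:E)%E.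
Proof.
have := score_exp_x_tail hT C0 K0 a1 a2 k mp1.
have [-> _] := tuning_closed.
rewrite (_ : 2 * _ * _ / 16 = Num.sqrt (N * T)%:R * pow32 (lp * la) / 8)//.
by field.
Qed.

Lemma sg_score_d_tail i :
  (P [set w | (mu / 16 < `|\sum_t eps i t w|)%R]
   <= (score_mass K * expR (- (c0 * (lN * la))))%:E)%E.
Proof.
have := score_exp_d_tail hT C0 K0 a1 a2 i mN1.
have [_ ->] := tuning_closed.
rewrite (_ : 2 * _ * _ / 16 = Num.sqrt T%:R * pow32 (lN * la) / 8)//.
by field.
Qed.


Definition sg_A : R := score_mass K + gram_mass K + 4 * G0.
Definition sg_B : R := Num.min c0 c1.

Lemma sg_A_ge : [/\ score_mass K <= sg_A, gram_mass K <= sg_A, 4 * G0 <= sg_A & expR 2 <= sg_A].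
Proof.
have G1 := sg_variance_ge1 C0 K0; have H1 := sg_mass_ge1 K0.
have e2 := expR_gt0 (2 : R); have := sqr_ge0 (sg_mass K).
by rewrite /sg_A /score_mass /gram_mass; split; lra.
Qed.

(** n e^(-c ln n ln a) = n^(1 - c ln a). *)
Lemma power_tail (n : nat) : expR 1 <= n%:R :> R ->
  n%:R * (score_mass K * expR (- (c0 * (ln n%:R * la)))) <= sg_A * n%:R `^ (1 - sg_B * la).
Proof.
move=> ne; have n0 : 0 < n%:R :> R by rewrite (lt_le_trans (expR_gt0 1)).
have l1 := ln_ge1 ne.
have [Ax _ _ _] := sg_A_ge.
have e2 := expR_gt0 (2 : R); have sm0 : 0 <= score_mass K by rewrite /score_mass; have := sqr_ge0 (sg_mass K); lra.
rewrite mulrCA; apply: ler_pM => //.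
rewrite powRD; last by apply/implyP => _; rewrite gt_eqF.
rewrite powRr1 ?(ltW n0)// ler_wpM2l ?(ltW n0)//.
rewrite /powR gt_eqF// ler_expR mulNr lerN2.
rewrite (_ : sg_B * la * _ = sg_B * (ln n%:R * la)); last by ring.
apply: ler_wpM2r; last by rewrite /sg_B ge_min lexx.
by rewrite mulr_ge0// (le_trans ler01).
Qed.

Lemma sg_score_tails :
  p%:R * (score_mass K * expR (- (c0 * (lp * la)))) + N%:R * (score_mass K * expR (- (c0 * (lN * la))))
  <= sg_A * p%:R `^ (1 - sg_B * la) + sg_A * N%:R `^ (1 - sg_B * la).
Proof. by apply: lerD; exact: power_tail. Qed.

Section Tolerance.
Variables (kap : R).
Hypothesis J0 : J != finset.set0.
Hypotheses (kapE : k2 = kap%:E) (kap0 : 0 < kap).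
Let t := kap / (#|J|%:R * mx ^+ 3).
Let tau := t / 200.
Let v := (t ^+ 2 * N%:R) `^ 3^-1.
Let q := c1 * v.

Let s0 : 1 <= #|J|%:R :> R. Proof. by rewrite ler1n card_gt0. Qed.

Lemma sg_kap_le : kap <= G0.
Proof.
have /set0Pn[l lJ] := J0.
apply: (le_trans (kappa_le_diag hN hT sg_lam_gt0 sg_mu_gt0 J0 k2_gt0 kapE lJ)).
exact: (le_trans (ler_norm _) (abs_Gamma_sg hT C0 K0 a1 a2 l l)).
Qed.

Lemma sg_denominator_ge1 : 1 <= #|J|%:R * mx ^+ 3.
Proof. by apply: product_ge1 => //; apply: exprn_ege1; exact: sg_ratio_ge1. Qed.

Lemma t_gt0 : 0 < t.
Proof. by rewrite divr_gt0// (lt_le_trans ltr01 sg_denominator_ge1). Qed.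

Let big_pos : 0 < 200 :> R. Proof. by rewrite ltr0n. Qed.

Lemma sg_tau_gt0 : 0 < tau.
Proof. by rewrite /tau divr_gt0 ?t_gt0 ?big_pos. Qed.

Lemma sg_tau_le : tau <= G0.
Proof.
have d1 := sg_denominator_ge1; have tk : t <= kap.
  by rewrite /t ler_pdivrMr ?(lt_le_trans ltr01 d1)// ler_peMr// ltW.
have := sg_kap_le; have := t_gt0; rewrite /tau; lra.
Qed.

Lemma sg_tau_tolerance kap' : k2 = kap'%:E -> tau * #|J|%:R * rho ^+ 2 <= kap' / 200.
Proof.
rewrite kapE => -[<-].
have s0' : 0 < #|J|%:R :> R by rewrite (lt_le_trans ltr01 s0).
have m0 : 0 < mx by rewrite (lt_le_trans ltr01 sg_ratio_ge1).
rewrite /rho sqr_pow32// /tau /t le_eqVlt; apply/orP; left; apply/eqP.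
by move: big_pos; set c : R := 200 => cp; field; rewrite !gt_eqF.
Qed.

Lemma sg_v_ge0 : 0 <= v. Proof. exact: powR_ge0. Qed.

Lemma v_cube : v ^+ 3 = t ^+ 2 * N%:R.
Proof. by rewrite /v -powR_mulrn ?powR_ge0// powR_invK// mulr_ge0 ?sqr_ge0. Qed.

(** q = c v with v^3 = t^2 N, so q^(3/2) <= c sqrt N t. *)
Lemma order_le : q * Num.sqrt q <= 200 * c1 * (Num.sqrt N%:R * tau).
Proof.
have c1p := gram_rate_gt0 C0 K0; have [c1s _] := gram_rate_le C0 K0.
have c1l : c1 <= 1 by lra.
have q0 : 0 <= q by rewrite mulr_ge0 ?sg_v_ge0 ?(ltW c1p).
rewrite (_ : 200 * _ * _ = c1 * (Num.sqrt N%:R * t)); last by rewrite /tau; field.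
have rhs0 : 0 <= c1 * (Num.sqrt N%:R * t).
  by apply: mulr_ge0; [exact: ltW|apply: mulr_ge0; [exact: sqrtr_ge0|exact: ltW t_gt0]].
rewrite -/(pow32 q) -ler_sqr ?nnegrE ?pow32_ge0// sqr_pow32// /q exprMn v_cube.
rewrite (_ : (c1 * (Num.sqrt N%:R * t)) ^+ 2 = c1 ^+ 2 * (t ^+ 2 * N%:R)); last first.
  by rewrite !exprMn sqr_sqrtr//; ring.
apply: ler_wpM2r; first by apply: mulr_ge0; rewrite ?sqr_ge0.
by rewrite exprSr ler_piMr ?sqr_ge0.
Qed.

Let g := gram_mass K * expR (- q).
Let prob := 1 - (p%:R * (score_mass K * expR (- (c0 * (lp * la))))
  + N%:R * (score_mass K * expR (- (c0 * (lN * la)))) + (p%:R ^+ 2 + N%:R * p%:R) * g).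
Let stated := 1 - sg_A * p%:R `^ (1 - sg_B * la) - sg_A * N%:R `^ (1 - sg_B * la)
  - sg_A * (p%:R ^+ 2 + N%:R * p%:R) * expR (- (sg_B * v)).

Let cells_ge1 : 1 <= p%:R ^+ 2 + N%:R * p%:R :> R.
Proof.
have e1 : 1 <= expR 1 :> R by have := expR_ge1Dx (1 : R); lra.
have p1 : 1 <= p%:R :> R by exact: le_trans e1 pe.
have N1 : 1 <= N%:R :> R by exact: le_trans e1 Ne.
have := product_ge1 N1 p1; have := sqr_ge0 (p%:R : R); lra.
Qed.

Let Bv_le : sg_B * v <= q.
Proof. by apply: ler_wpM2r; rewrite ?sg_v_ge0// /sg_B ge_min lexx orbT. Qed.

Lemma stated_le : stated <= prob.
Proof.
have [_ Ag _ _] := sg_A_ge; have := sg_score_tails.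
have gm0 : 0 <= gram_mass K.
  by rewrite /gram_mass; have := sg_mass_ge1 K0; have := expR_gt0 (2 : R); lra.
have : (p%:R ^+ 2 + N%:R * p%:R) * g <= sg_A * (p%:R ^+ 2 + N%:R * p%:R) * expR (- (sg_B * v)).
  rewrite [sg_A * _]mulrC -mulrA ler_wpM2l ?(le_trans ler01 cells_ge1)//.
  by apply: ler_pM; rewrite ?expR_ge0// ler_expR lerN2.
rewrite /stated /prob; lra.
Qed.

(** If the order q is below 2 the Gram term is at least 1 and the stated bound is vacuous. *)
Lemma stated_gt0 : 0 < stated -> 2 <= q.
Proof.
move=> pos; rewrite leNgt; apply/negP => q2.
have [_ _ _ Ae] := sg_A_ge.
have A0 : 0 <= sg_A by rewrite (le_trans _ Ae)// expR_ge0.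
have : 1 <= sg_A * (p%:R ^+ 2 + N%:R * p%:R) * expR (- (sg_B * v)).
  apply: (@le_trans _ _ (expR 2 * expR (- (sg_B * v)))).
    rewrite -expRD; apply: (le_trans _ (expR_ge1Dx _)); have := Bv_le; lra.
  by rewrite ler_wpM2r ?expR_ge0// (le_trans Ae)// ler_peMr ?cells_ge1.
have := powR_ge0 p%:R (1 - sg_B * la); have := powR_ge0 N%:R (1 - sg_B * la).
move=> /(mulr_ge0 A0) x1 /(mulr_ge0 A0) x2.
by move: pos; rewrite /stated; lra.
Qed.

Lemma order_tolerance : 2 <= q -> 1 <= Num.sqrt N%:R * tau.
Proof.
move=> q2; have := order_le; have [c1s _] := gram_rate_le C0 K0.
have c1p := gram_rate_gt0 C0 K0.
have u0 : 0 <= Num.sqrt N%:R * tau by rewrite mulr_ge0 ?sqrtr_ge0 ?(ltW sg_tau_gt0).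
have sq1 : 1 <= Num.sqrt q by rewrite -[leLHS]sqrtr1 ler_sqrt; lra.
have q1 : 1 <= q by lra.
have := product_ge1 q1 sq1.
have : 200 * c1 * (Num.sqrt N%:R * tau) <= 1 * (Num.sqrt N%:R * tau) by apply: ler_wpM2r => //; lra.
lra.
Qed.

Variables (K1 K2 : R).

Lemma sg_beta_prob : 0 <= K1 ->
  (supp bs != finset.set0 -> (~: supp bs)%SET != finset.set0 ->
    2 * G0 <= K1 / Num.sqrt (N * T)%:R) ->
  minimal_signal x lam mu bs cs (Num.sqrt (N * T)%:R) (absmin bs) ->
  (stated%:E <= P (beta_recovered x bs cs bhat btil lam mu K1))%E.
Proof.
move=> K10 K1l signal; have [pos|neg] := ltP 0 stated; last first.
  by apply: (@le_trans _ _ 0%E); rewrite ?lee_fin.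
have q2 := stated_gt0 pos.
have [tll tlr] := gram_exp_tails hT C0 K0 a1 a2 q2 sg_tau_gt0 order_le.
have [LM ML] := sg_penalty_rates.
apply: (@le_trans _ _ prob%:E); first by rewrite lee_fin stated_le.
have K1b : supp bs != finset.set0 -> (~: supp bs)%SET != finset.set0 ->
    forall b b', `|Gamma x b b'| + tau <= K1 / Num.sqrt (N * T)%:R.
  move=> b0 bc0 b b'; apply: (le_trans _ (K1l b0 bc0)).
  by have := abs_Gamma_sg hT C0 K0 a1 a2 b b'; have := sg_tau_le; lra.
apply: (recovery_beta hN hT sg_lam_gt0 sg_mu_gt0 lassoP adaptiveP sg_score_x_tail sg_score_d_tail
  (ltW sg_tau_gt0) (lt_le_trans ltr01 sg_rho_ge1) sg_rho_ge1 LM ML J0 k2_gt0 sg_tau_tolerance _ _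
  tll tlr K10 K1b signal).
- by rewrite -sg_first_step_const.
- by rewrite -sg_first_step_const.
Qed.

Lemma sg_dummy_prob : 0 <= K2 ->
  minimal_signal x lam mu bs cs (Num.sqrt T%:R) (absmin cs) ->
  (stated%:E <= P (dummy_recovered x bs cs chat ctil lam mu K2))%E.
Proof.
move=> K20 signal; have [pos|neg] := ltP 0 stated; last first.
  by apply: (@le_trans _ _ 0%E); rewrite ?lee_fin.
have q2 := stated_gt0 pos.
have [tll tlr] := gram_exp_tails hT C0 K0 a1 a2 q2 sg_tau_gt0 order_le.
have [LM ML] := sg_penalty_rates.
apply: (@le_trans _ _ prob%:E); first by rewrite lee_fin stated_le.
apply: (recovery_dummy hN hT sg_lam_gt0 sg_mu_gt0 lassoP adaptiveP sg_score_x_tail sg_score_d_tail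
  (ltW sg_tau_gt0) (lt_le_trans ltr01 sg_rho_ge1) sg_rho_ge1 LM ML J0 k2_gt0 sg_tau_tolerance _ _
  tll tlr K20 (order_tolerance q2) signal).
- by rewrite -sg_first_step_const.
- by rewrite -sg_first_step_const.
Qed.

End Tolerance.
End SubGaussianRecovery.

(** * Sign recovery *)

Theorem corollary1 (R : realType) :
  (* Part (1) *)
  (forall r : R, 2 <= r ->
   exists C_r D_r : R, [/\ 0 < C_r, 0 < D_r &
   forall (d : measure_display) (Omega : measurableType d)
     (P : probability Omega R) (N T p : nat)
     (hN : (0 < N)%N) (hT : (0 < T)%N) (hp : (0 < p)%N)
     (x : 'I_N -> 'I_T -> 'I_p -> {RV P >-> R})
     (eps : 'I_N -> 'I_T -> {RV P >-> R})
     (bstar : 'cV[R]_p) (cstar : 'cV[R]_N)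
     (bhat btil : 'I_p -> {RV P >-> R}) (chat ctil : 'I_N -> {RV P >-> R})
     (a lam mu : R) (k2 kappa xi : \bar R),
   let i1 := Ordinal hN in
   let J1 := supp bstar in
   let J2 := supp cstar in
   let s1 := #|J1| in
   let s2 := #|J2| in
   let y := response x eps bstar cstar in
   A1 x eps ->
   A2a r x eps i1 ->
   0 < a ->
   lam = 4 * a * p%:R `^ r^-1 * Num.sqrt (N * T)%:R
           * max_Lr_norm r (eps i1) ->
   mu = 4 * a * N%:R `^ r^-1 * Num.sqrt T%:R * max_Lr_norm r (eps i1) ->
   0 < lam -> 0 < mu ->
   is_lasso y x lam mu bhat chat ->
   is_adaptive_lasso y x lam mu bhat chat btil ctil ->
   k2 = kappa2 x lam mu s1 s2 ->
   (0 < k2)%E ->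
   kappa = sqrte k2 ->
   xi = efrac (32 * a * max_Lr_norm r (eps i1)
               * (p%:R `^ r^-1 * Num.sqrt s1%:R
                  + N%:R `^ r^-1 * Num.sqrt s2%:R))%:E k2 ->
   (efrac (2%:E * xi) (Num.sqrt (N * T)%:R)%:E <= absmin bstar)%E ->
   (efrac (2%:E * xi) (Num.sqrt T%:R)%:E <= absmin cstar)%E ->
   let K1 := #|~: J1|%:R `^ (2 / r) * #|J1|%:R `^ (2 / r)
             * Num.sqrt (N * T)%:R * a in
   let K2 := #|J1|%:R `^ r^-1 * #|~: J2|%:R `^ r^-1 * Num.sqrt T%:R * a in
   let common : \bar R :=
     (1 - (2 * (C_r / a) `^ r)%:E
      - D_r%:E * efrac ((p%:R ^+ 2 + N%:R * p%:R) * (s1 + s2)%:R `^ (r / 2)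
                        * Num.max (p%:R / N%:R) (N%:R / p%:R))%:E
                       (poweR kappa r * (N%:R `^ (r / 4))%:E))%E in
   (minimal_signal x lam mu bstar cstar (Num.sqrt (N * T)%:R) (absmin bstar) ->
    (common - (2 / a `^ (r / 2))%:E <=
     P [set w |
        correlation_bound x lam mu bstar cstar K1 lam
          (l2norm (rvec bhat w - bstar)%R) ->
        sgnv (rvec btil w) = sgnv bstar])%E) /\
   (minimal_signal x lam mu bstar cstar (Num.sqrt T%:R) (absmin cstar) ->
    (common - (1 / a `^ (r / 2))%:E <=
     P [set w |
        correlation_bound x lam mu bstar cstar K2 mu
          (l2norm (rvec chat w - cstar)%R) ->
        sgnv (rvec ctil w) = sgnv cstar])%E)]) /\
  (* Part (2) *)
  (forall C K : R, 0 < C -> 0 < K ->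
   exists A B : R, [/\ 0 < A, 0 < B &
   forall (d : measure_display) (Omega : measurableType d)
     (P : probability Omega R) (N T p : nat)
     (hN : (0 < N)%N) (hT : (0 < T)%N)
     (x : 'I_N -> 'I_T -> 'I_p -> {RV P >-> R})
     (eps : 'I_N -> 'I_T -> {RV P >-> R})
     (bstar : 'cV[R]_p) (cstar : 'cV[R]_N)
     (bhat btil : 'I_p -> {RV P >-> R}) (chat ctil : 'I_N -> {RV P >-> R})
     (a lam mu : R) (k2 xi t : \bar R),
   let i1 := Ordinal hN in
   let J1 := supp bstar in
   let J2 := supp cstar in
   let s1 := #|J1| in
   let s2 := #|J2| in
   let y := response x eps bstar cstar in
   expR 1 <= p%:R :> R -> expR 1 <= N%:R :> R ->
   A1 x eps ->
   A2b C K x eps i1 ->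
   expR 1 <= a ->
   lam = Num.sqrt (4 * (N * T)%:R * ln p%:R ^+ 3 * ln a ^+ 3) ->
   mu = Num.sqrt (4 * T%:R * ln N%:R ^+ 3 * ln a ^+ 3) ->
   is_lasso y x lam mu bhat chat ->
   is_adaptive_lasso y x lam mu bhat chat btil ctil ->
   k2 = kappa2 x lam mu s1 s2 ->
   (0 < k2)%E ->
   xi = efrac (16 * ln a `^ (3 / 2)
               * (ln p%:R `^ (3 / 2) * Num.sqrt s1%:R
                  + ln N%:R `^ (3 / 2) * Num.sqrt s2%:R))%:E k2 ->
   (efrac (2%:E * xi) (Num.sqrt (N * T)%:R)%:E <= absmin bstar)%E ->
   (efrac (2%:E * xi) (Num.sqrt T%:R)%:E <= absmin cstar)%E ->
   t = efrac k2 ((s1 + s2)%:R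
                 * Num.max (ln p%:R / ln N%:R) (ln N%:R / ln p%:R) ^+ 3)%:E ->
   (1 <= N%:R%:E * t ^+ 2)%E ->
   let K1 := A * ln (1 + #|~: J1|%:R) * ln (expR 1 + #|J1|%:R)
             * Num.sqrt (N * T)%:R * ln a in
   let K2 := A * ln (1 + #|J1|%:R) * ln (1 + #|~: J2|%:R)
             * Num.sqrt T%:R * ln a in
   let common : \bar R :=
     (1 - (A * p%:R `^ (1 - B * ln a))%:E - (A * N%:R `^ (1 - B * ln a))%:E
      - (A * (p%:R ^+ 2 + N%:R * p%:R))%:E
        * expeR (- (B%:E * poweR (t ^+ 2 * N%:R%:E) (3^-1)%R)))%E in
   (minimal_signal x lam mu bstar cstar (Num.sqrt (N * T)%:R) (absmin bstar) ->
    (common - (4 / a)%:E <=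
     P [set w |
        correlation_bound x lam mu bstar cstar K1 lam
          (l2norm (rvec bhat w - bstar)%R) ->
        sgnv (rvec btil w) = sgnv bstar])%E) /\
   (minimal_signal x lam mu bstar cstar (Num.sqrt T%:R) (absmin cstar) ->
    (common - (2 / a)%:E <=
     P [set w |
        correlation_bound x lam mu bstar cstar K2 mu
          (l2norm (rvec chat w - cstar)%R) ->
        sgnv (rvec ctil w) = sgnv cstar])%E)]).
Proof.
split.
{
move=> r r2; exists (score_const r), (gram_factor r).
have r0 : 0 < r by lra.
split.
- by have := @score_const_ge2 R r r2; lra.
- exact: gram_factor_gt0.
move=> d Omega P N T p hN hT hp x eps bs cs bhat btil chat ctil a lam mu k2 kappa xi
  i1 J1 J2 s1 s2 y hA1 hA2 a0 lamE muE lam0 mu0 lassoP adaptiveP k2E k20 kappaE xiE bmin cmin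
  K1 K2 common.
have K10 : 0 <= K1 by rewrite !mulr_ge0 ?powR_ge0 ?sqrtr_ge0// ltW.
have K20 : 0 <= K2 by rewrite !mulr_ge0 ?powR_ge0 ?sqrtr_ge0// ltW.
pose bound : R := 1 - 2 * (score_const r / a) `^ r.
pose frac : \bar R := efrac ((p%:R ^+ 2 + N%:R * p%:R) * (s1 + s2)%:R `^ (r / 2)
                        * Num.max (p%:R / N%:R) (N%:R / p%:R))%:E
                       (poweR kappa r * (N%:R `^ (r / 4))%:E)%E.
have frac0 : (0 <= (gram_factor r)%:E * frac)%E.
  apply: mule_ge0; first by rewrite lee_fin (ltW (gram_factor_gt0 r)).
  apply: efrac_ge0; last by apply: mule_ge0; rewrite ?poweR_ge0// lee_fin powR_ge0.
  rewrite lee_fin; apply: mulr_ge0; last by rewrite le_max divr_ge0.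
  by apply: mulr_ge0; rewrite ?powR_ge0// addr_ge0 ?sqr_ge0// mulr_ge0.
have commonE : (common = bound%:E - (gram_factor r)%:E * frac)%E by [].
have slack (c : R) : 0 <= c -> (0 <= (c / a `^ (r / 2))%:E)%E.
  by move=> c0; rewrite lee_fin divr_ge0 ?powR_ge0.
have sl2 : (common - (2 / a `^ (r / 2))%:E <= common)%E by apply/leeB_nneg/slack.
have sl1 : (common - (1 / a `^ (r / 2))%:E <= common)%E by apply/leeB_nneg/slack.
have [J0|J0] := eqVneq (joint_supp bs cs) finset.set0.
  have commonb : (common <= bound%:E)%E by rewrite commonE; exact: leeB_nneg.
  have [] := recovery_null hN hT lam0 mu0 lassoP adaptiveP
    (moment_score_x_tail hT hp r2 hA1 hA2 a0 lamE lam0)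
    (moment_score_d_tail hT r2 hA1 hA2 a0 lamE muE lam0 mu0) K1 K2 J0.
  rewrite score_tail_total// => Hb Hc; split=> _.
    exact: le_trans (le_trans sl2 commonb) Hb.
  exact: le_trans (le_trans sl1 commonb) Hc.
rewrite k2E in k20; rewrite xiE k2E in bmin cmin.
have [kap [kapE kap0 _]] := kappa2_compat hN hT lam0 mu0 J0 k20.
(* The Gram term of the stated bound, in terms of u = sqrt N * tau. *)
have fracE : ((gram_factor r)%:E * frac)%E = 
   ((p%:R ^+ 2 + N%:R * p%:R) * ((1 + gram_const (r / 2)) / (Num.sqrt N%:R * (kap / (200 * #|joint_supp bs cs|%:R * (Num.max (p%:R / N%:R) (N%:R / p%:R) `^ r^-1) ^+ 2))) `^ (r / 2)))%:E.
  rewrite -(gram_term hN hp r2 J0 kap0) /frac kappaE k2E kapE.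
  rewrite [sqrte _](_ : _ = (Num.sqrt kap)%:E)// poweR_EFin -EFinM efrac_fin//.
  by rewrite mulf_neq0// gt_eqF// powR_gt0 ?sqrtr_gt0// ltr0n.
have commonr := commonE; rewrite fracE -EFinD /bound -addrA -opprD in commonr.
split=> signal.
  apply: (le_trans sl2); rewrite commonr.
  have K1a : supp bs != finset.set0 -> (~: supp bs)%SET != finset.set0 ->
      a <= K1 / Num.sqrt (N * T)%:R.
    move=> b0 bc0; rewrite /K1 mulrAC mulfK ?gt_eqF ?sqNT_gt0//.
    rewrite ler_peMl ?(ltW a0)// -[leLHS]mulr1 ler_pM ?powR_ge1// ?ler1n ?card_gt0//;
      by rewrite divr_ge0 ?ltW.
  have := beta_prob hT hp r2 hA1 hA2 a0 lamE muE lam0 mu0 lassoP adaptiveP k20 bmin cmin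
    J0 kapE kap0 K10 K1a signal.
  by apply.
apply: (le_trans sl1); rewrite commonr.
have := (dummy_prob hT hp r2 hA1 hA2 a0 lamE muE lam0 mu0 lassoP adaptiveP k20 bmin cmin
    J0 kapE kap0 K20 signal).
by apply.
}
move=> C K C0 K0; exists (sg_A C K), (sg_B C K).
have [_ _ A4 Ae] := sg_A_ge C0 K0.
have A0 : 0 < sg_A C K by exact: lt_le_trans (expR_gt0 2) Ae.
have B0 : 0 < sg_B C K by rewrite lt_min score_rate_gt0// gram_rate_gt0.
split=> //.
move=> d Omega P N T p hN hT x eps bs cs bhat btil chat ctil a lam mu k2 xi t
  i1 J1 J2 s1 s2 y pe Ne hA1 hA2 ae lamE muE lassoP adaptiveP k2E k20 xiE bmin cmin
  tE _ K1 K2 common.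
have a0 : 0 < a by exact: lt_le_trans (expR_gt0 1) ae.
have la1 : 1 <= ln a by exact: ln_ge1.
have lam0 := sg_lam_gt0 hN hT pe Ne ae lamE muE.
have mu0 := sg_mu_gt0 hT pe Ne ae lamE muE.
have ln0 (z : R) : 1 <= z -> 0 <= ln z by exact: ln_ge0.
have e1 : 1 <= expR 1 :> R by have := expR_ge1Dx (1 : R); lra.
have n1 (n : nat) : 1 <= 1 + n%:R :> R by rewrite lerDl.
have ne1 (n : nat) : 1 <= expR 1 + n%:R :> R by rewrite (le_trans e1)// lerDl.
have K10 : 0 <= K1 by rewrite !mulr_ge0 ?ln0 ?sqrtr_ge0 ?(ltW A0) ?(le_trans e1 ae).
have K20 : 0 <= K2 by rewrite !mulr_ge0 ?ln0 ?sqrtr_ge0 ?(ltW A0) ?(le_trans e1 ae).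
pose bound : R := 1 - sg_A C K * p%:R `^ (1 - sg_B C K * ln a)
  - sg_A C K * N%:R `^ (1 - sg_B C K * ln a).
pose tail : \bar R := ((sg_A C K * (p%:R ^+ 2 + N%:R * p%:R))%:E
        * expeR (- ((sg_B C K)%:E * poweR (t ^+ 2 * N%:R%:E) (3^-1)%R)))%E.
have tail0 : (0 <= tail)%E.
  apply: mule_ge0; last exact: expeR_ge0.
  by rewrite lee_fin mulr_ge0 ?(ltW A0)// addr_ge0 ?sqr_ge0// mulr_ge0.
have commonE : (common = bound%:E - tail)%E by [].
have slack (c : R) : 0 <= c -> (0 <= (c / a)%:E)%E.
  by move=> c0; rewrite lee_fin divr_ge0// ltW.
have sl4 : (common - (4 / a)%:E <= common)%E by apply/leeB_nneg/slack.
have sl2 : (common - (2 / a)%:E <= common)%E by apply/leeB_nneg/slack.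
have [J0|J0] := eqVneq (joint_supp bs cs) finset.set0.
  have commonb : (common <= bound%:E)%E by rewrite commonE; exact: leeB_nneg.
  have [] := recovery_null hN hT lam0 mu0 lassoP adaptiveP
    (sg_score_x_tail hT C0 K0 pe Ne ae hA1 hA2 lamE muE)
    (sg_score_d_tail hT C0 K0 pe Ne ae hA1 hA2 lamE muE) K1 K2 J0.
  set b := 1 - _ => Hb Hc.
  have bb : (bound%:E <= b%:E)%E.
    by rewrite lee_fin /bound /b -addrA -opprD lerB// sg_score_tails.
  split=> _.
    exact: le_trans (le_trans (le_trans sl4 commonb) bb) Hb.
  exact: le_trans (le_trans (le_trans sl2 commonb) bb) Hc.
rewrite k2E in k20; rewrite xiE k2E in bmin cmin.
have [kap [kapE kap0 _]] := kappa2_compat hN hT lam0 mu0 J0 k20.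
have mx1 := sg_ratio_ge1 pe Ne.
set mx := Num.max _ _ in mx1 tE.
have den : #|joint_supp bs cs|%:R * mx ^+ 3 != 0 :> R.
  by rewrite mulf_neq0 ?pnatr_eq0 ?cards_eq0// expf_neq0// gt_eqF// (lt_le_trans ltr01 mx1).
have tr : t = (kap / (#|joint_supp bs cs|%:R * mx ^+ 3))%:E.
  by rewrite tE -card_joint_supp k2E kapE efrac_fin.
have commonr : common = (bound - sg_A C K * (p%:R ^+ 2 + N%:R * p%:R) *
   expR (- (sg_B C K * ((kap / (#|joint_supp bs cs|%:R * mx ^+ 3)) ^+ 2 * N%:R) `^ 3^-1)))%:E.
  by rewrite commonE /tail tr -EFin_expe.
split=> signal.
  apply: (le_trans sl4); rewrite commonr.
  have K1a : supp bs != finset.set0 -> (~: supp bs)%SET != finset.set0 ->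
      2 * sg_variance C K <= K1 / Num.sqrt (N * T)%:R.
    move=> b0 bc0; rewrite /K1 mulrAC mulfK ?gt_eqF ?sqNT_gt0//.
    have l1 : 2^-1 <= ln (1 + #|~: J1|%:R) :> R.
      apply: (le_trans ln2_ge); have n0 := lt_le_trans ltr01 (n1 #|~: J1|).
      rewrite ler_ln; [|by rewrite posrE|by rewrite posrE].
      by rewrite lerD2l ler1n card_gt0.
    have l2 : 1 <= ln (expR 1 + #|J1|%:R) :> R by apply: ln_ge1; rewrite lerDl.
    have l12 : 2^-1 * 1 <= ln (1 + #|~: J1|%:R) * (ln (expR 1 + #|J1|%:R) * ln a).
      by apply: ler_pM => //; exact: product_ge1.
    have := ler_wpM2l (ltW A0) l12; rewrite !mulrA; lra.
  have := sg_beta_prob hT C0 K0 pe Ne ae hA1 hA2 lamE muE lassoP adaptiveP k20 bmin cmin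
    J0 kapE kap0 K10 K1a signal.
  by apply.
apply: (le_trans sl2); rewrite commonr.
have := sg_dummy_prob hT C0 K0 pe Ne ae hA1 hA2 lamE muE lassoP adaptiveP k20 bmin cmin
  J0 kapE kap0 K20 signal.
by apply.
Qed.
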